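(* Every block subspace $Y$ of $\mathfrak{X}$ contains a seminormalized block sequence $\{x_n\}_n$ for which there exists an isomorphism $T:\mathfrak{X}\to\mathfrak{X}$ (necessarily onto) such that $T(x_{2n-1})=x_{2n}$ for all $n\in\mathbb{N}$.
   Context: Notation. $c_{00}$ is the space of finitely supported real sequences on $\mathbb{N}$ with unit vectors $e_n$; for $f,x\in c_{00}$, $f(x)=\sum_i f(i)x(i)$. $\operatorname{ran}x$ is the smallest interval of $\mathbb{N}$ containing $\operatorname{supp}x$; $Ef$ is the restriction of $f$ to the interval $E$; $x<y$ means $\max\operatorname{supp}x<\min\operatorname{supp}y$; $\|\cdot\|_0$ is the supremum norm. A block sequence is a sequence of nonzero finitely supported vectors $x_1<x_2<\cdots$; a block subspace is the closed linear span of an infinite block sequence. Schreier families: $\mathcal{S}_0=\{\{n\}:n\in\mathbb{N}\}$, $\mathcal{S}_1=\{F\subset\mathbb{N}:\#F\le\min F\}$, $\mathcal{S}_{n+1}=\{F=\bigcup_{j=1}^kF_j: F_1<\cdots<F_k\in\mathcal{S}_n,\ k\le\min F_1\}$. A finite sequence $f_1<\cdots<f_k$ in $c_{00}$ is $\mathcal{S}_n$-admissible if $\{\min\operatorname{supp}f_i\}_{i=1}^k\in\mathcal{S}_n$. Pełczyński basis: fix a norm dense sequence $\{s_k\}_k$ in the unit sphere of $C[0,1]$; $\{u_k\}_k$ is the unit vector basis of $c_{00}$ with norm $\|\sum_{k=1}^na_ku_k\|_u=\sup\{\|\sum_{k\in F}a_ks_k\|:F\subset\{1,\dots,n\}\}$;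 $\{u_k^*\}_k$ are its biorthogonals, with dual norm also denoted $\|\cdot\|_u$. Averages: for $G\subset c_{00}$, $f\in G$ is an average of size $s(f)=n$ in $G$ if $f=\frac1n(f_1+\cdots+f_d)$ with $f_i\in G$, $d\le n$. A sequence of averages $\{f_j\}_j$ is very fast growing if $f_1<f_2<\cdots$ and $s(f_j)>2^{\max\operatorname{supp}f_{j-1}}$, $s(f_j)>s(f_{j-1})$ for $j>1$. Coding: fix an infinite $L_0=\{\ell_k:k\in\mathbb{N}\}\subset\mathbb{N}$ with $\ell_1>9$, $\ell_{k+1}>2^{2\ell_k}$, $\sum_k2^{-\ell_k}<\frac1{1000}$, decomposed into infinite (disjoint) sets $L_1,L_2,L_3$. Let $\mathcal{Q}$ be the set of finite sequences $(f_1,\dots,f_m)$, $f_1<\cdots<f_m$ in $c_{00}$ with rational coordinates, and fix a one to one $\sigma:\mathcal{Q}\to L_2$ with $\sigma(f_1,\dots,f_m)>2^{1/\|f_m\|_0}\max\operatorname{supp}f_m$. Norming set: $W$ is the smallest subset of $c_{00}$ such that: 1. $\pm e_n\in W$ for all $n$ (type 0 functionals); $W$ is symmetric, closed under restrictions to intervals and under rational convex combinations. 2. $W$ contains every $f=\frac1{2^n}\sum_{q=1}^d\alpha_q$, $n\in\mathbb N$, with $\{\alpha_q\}_{q=1}^d$ an $\mathcal{S}_n$-admissible very fast growing sequence of $\alpha$-averages in $W$; $g=\pm Ef$ ($E$ interval) is called of type I$_\alpha$ with weight $w(g)=n$. 3. The same with $\beta$-averages $\{\beta_q\}_{q=1}^d$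 in $W$; $g=\pm Ef$ is called of type I$_\beta$ with weight $w(g)=n$. 4. For every special sequence $\{f_q,g_q\}_{q=1}^d$ in $W$ and $F\subset\{1,\dots,d\}$ with $2\#F\le\min\operatorname{supp}f_{\min F}$, $W$ contains $f=\frac12\sum_{q\in F}(f_q+g_q)$; $g=\pm Ef$ is called of type II$_+$, with weights $\widehat w(g)=\{w(f_q):q\in F,\operatorname{ran}(f_q+g_q)\cap E\ne\varnothing\}$. 5. For special sequences and $F$ as in 4 and $\{\lambda_q\}_{q\in F}\subset\mathbb{Q}$ with $\|\sum_{q\in F}\lambda_qu_q^*\|_u\le1$, $W$ contains $f=\frac12\sum_{q\in F}\lambda_q(f_q-g_q)$; $g=\pm Ef$ is called of type II$_-$, with weights $\widehat w(g)=\{w(f_q):q\in F,\operatorname{ran}(f_q-g_q)\cap E\neq\varnothing\}$. Functionals of type II$_+$ or II$_-$ are of type II. A sequence of pairs of type I$_\alpha$ functionals $\{f_q,g_q\}_{q=1}^d$ is special if $f_1<g_1<f_2<\cdots<f_d<g_d$, $w(f_q)=w(g_q)$ for all $q$, $w(f_1)\in L_1$ and $\sigma(f_1,g_1,\dots,f_{q-1},g_{q-1})=w(f_q)$ for $1<q\le d$. An $\alpha$-average is $\alpha=\frac1n\sum_{j=1}^df_j\in W$, $d\le n$, with $f_1<\cdots<f_d$ in $W$. A $\beta$-average is $\beta=\frac1n\sum_{j=1}^df_j\in W$, $d\le n$, with $f_j\in W$ of type II with pairwise disjoint weight sets $\widehat w(f_j)$. The space: $\|x\|=\sup\{f(x):f\in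 W\}$ for $x\in c_{00}$, and $\mathfrak{X}$ is the completion of $(c_{00},\|\cdot\|)$; $\{e_n\}_n$ is a bimonotone Schauder basis of it. *)

(* Defs.v *)
From HB Require Import structures.
From mathcomp Require Import all_boot all_order all_algebra.
From mathcomp Require Import all_classical all_reals all_analysis.
Set Implicit Arguments.
Unset Strict Implicit.
Unset Printing Implicit Defensive.
Import Order.TTheory GRing.Theory Num.Theory.
Import numFieldNormedType.Exports.
Local Open Scope classical_set_scope.
Local Open Scope ring_scope.

(* Conventions.  Coordinates of vectors are indexed by the positive integers:
   an element of c00 is a function nat -> R that vanishes at 0.  This matters
   because the Schreier families see the actual value of min supp.
   Enumerations (f_1, ..., f_d; the sequences s_k, u_k, l_k, x_k) start at 0. *)

Section NatSets.
Local Open Scope nat_scope.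

(* Both default to 0 when the minimum (resp. maximum) does not exist. *)
Definition least (A : set nat) : nat :=
  xget 0 [set m | A m /\ forall i, A i -> m <= i].
Definition greatest (A : set nat) : nat :=
  xget 0 [set m | A m /\ forall i, A i -> i <= m].

Definition nat_interval (E : set nat) : Prop :=
  forall i j k, E i -> E k -> i <= j <= k -> E j.

(* Members of the Schreier families are nonempty sets of positive integers. *)
Fixpoint schreier (n : nat) (F : set nat) : Prop :=
  match n with
  | 0 => exists2 m, 0 < m & F = [set m]
  | 1 => [/\ F !=set0, ~ F 0 & (F #<= `I_(least F))%card]
  | n'.+1 => exists k (G : nat -> set nat),
      [/\ 0 < k <= least (G 0),
          forall j, j < k -> schreier n' (G j),
          forall j, j.+1 < k -> greatest (G j) < least (G j.+1)
        & F = \bigcup_(j in `I_k) G j]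
  end.

End NatSets.

Definition sup_norm (R : realType) (T : Type) (D : set T) (h : T -> R) : R :=
  sup [set `|h t| | t in D].

Section FinitelySupported.
Variable R : realType.
Implicit Types f g x y : nat -> R.

Definition supp x : set nat := [set i | x i != 0].

Definition c00 : set (nat -> R) := [set x | x 0%N = 0 /\ finite_set (supp x)].

Definition unit_vec (n : nat) : nat -> R := fun i => (i == n)%:R.

Definition pairing f x : R := \sum_(i \in [set: nat]) f i * x i.

Definition minsupp x : nat := least (supp x).
Definition maxsupp x : nat := greatest (supp x).

(* The smallest interval containing the support (empty if x = 0). *)
Definition ran x : set nat :=
  [set i | exists j k, [/\ supp x j, supp x k & (j <= i <= k)%N]].

(* x < y; in particular both vectors are nonzero. *)
Definition succv x y : Prop :=
  [/\ supp x !=set0, supp y !=set0 & (maxsupp x < minsupp y)%N].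

(* f 0 < ... < f (d - 1) *)
Definition block_upto (d : nat) (f : nat -> nat -> R) : Prop :=
  forall q, (q.+1 < d)%N -> succv (f q) (f q.+1).

Definition block_seq (x : nat -> nat -> R) : Prop :=
  forall n, c00 (x n) /\ succv (x n) (x n.+1).

Definition admissible (n d : nat) (f : nat -> nat -> R) : Prop :=
  block_upto d f /\ schreier n [set minsupp (f q) | q in `I_d].

End FinitelySupported.

Section Pelczynski.
Variable R : realType.

(* A dense sequence in the unit sphere of C[0,1]. *)
Definition dense_in_sphere (s : nat -> R -> R) : Prop :=
  (forall k, {within `[0, 1], continuous (s k)} /\ sup_norm `[0, 1] (s k) = 1)
  /\ forall h : R -> R,
       {within `[0, 1], continuous h} -> sup_norm `[0, 1] h = 1 ->
       forall e : R, 0 < e -> exists k, sup_norm `[0, 1] (h \- s k) < e.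

(* The norm of \sum_(k < n) a_k u_k. *)
Definition u_norm (s : nat -> R -> R) (n : nat) (a : nat -> R) : R :=
  sup [set sup_norm `[0, 1] (fun t => \sum_(k in F) a k * s k t)
      | F in [set: {set 'I_n}]].

(* The dual norm of \sum_(q in F) b_q u_q^*, the supremum being taken over the
   vectors \sum_(k < n) a_k u_k, n arbitrary, in the unit ball of u_norm. *)
Definition u_dual_norm (s : nat -> R -> R) (d : nat) (F : {set 'I_d})
    (b : nat -> R) : R :=
  sup [set r | exists n (a : nat -> R),
    [/\ forall k, (n <= k)%N -> a k = 0, u_norm s n a <= 1
      & r = `|\sum_(q in F) b q * a q|]].

End Pelczynski.

Section Coding.
Variable R : realType.

Definition coding_weights (l : nat -> nat) (L1 L2 L3 : set nat) : Prop :=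
  [/\ (9 < l 0)%N /\ forall k, (2 ^ (2 * l k) < l k.+1)%N,
      (\sum_(0 <= k <oo) ((2 ^- l k : R)%:E) < (1000^-1)%:E)%E,
      range l = L1 `|` L2 `|` L3,
      [/\ L1 `&` L2 = set0, L1 `&` L3 = set0 & L2 `&` L3 = set0]
    & [/\ infinite_set L1, infinite_set L2 & infinite_set L3]].

Definition rational_vec (x : nat -> R) : Prop :=
  forall i, exists r : rat, x i = ratr r.

(* The set Q of nonempty finite sequences f_1 < ... < f_m of nonzero vectors
   of c00 with rational coordinates. *)
Definition rational_blocks (u : seq (nat -> R)) : Prop :=
  [/\ (0 < size u)%N,
      forall i, (i < size u)%N ->
        [/\ c00 (nth 0 u i), supp (nth 0 u i) !=set0
          & rational_vec (nth 0 u i)]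
    & block_upto (size u) (nth 0 u)].

Definition coding_function (L2 : set nat) (sigma : seq (nat -> R) -> nat) :
    Prop :=
  [/\ forall u, rational_blocks u -> L2 (sigma u),
      forall u v, rational_blocks u -> rational_blocks v ->
        sigma u = sigma v -> u = v
    & forall u, rational_blocks u ->
        2 `^ (sup_norm setT (last 0 u))^-1 * (maxsupp (last 0 u))%:R
          < (sigma u)%:R].

End Coding.

Section NormingSet.
Variables (R : realType) (s : nat -> R -> R) (L1 : set nat).
Variable sigma : seq (nat -> R) -> nat.

(* A functional may admit several representations, so sizes, weights and
   weight sets are relations: "has size n", "has weight n", "has weight set
   A".  All notions are relative to a set G, eventually the norming set. *)
Section Types.
Variable G : set (nat -> R).

(* g = +E f or g = -E f *)
Definition signed_restriction (E : set nat) (f g : nat -> R) : Prop :=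
  nat_interval E /\ (g = f \_ E \/ g = - (f \_ E)).

Definition alpha_average (a : nat -> R) (n : nat) : Prop :=
  G a /\ exists d (f : nat -> nat -> R),
    [/\ (0 < d <= n)%N, forall j, (j < d)%N -> G (f j), block_upto d f
      & a = n%:R^-1 *: \sum_(j < d) f j].

Definition very_fast_growing (d : nat) (a : nat -> nat -> R)
    (size_ : nat -> nat) : Prop :=
  block_upto d a /\
  forall q, (q.+1 < d)%N ->
    (2 ^ maxsupp (a q) < size_ q.+1)%N /\ (size_ q < size_ q.+1)%N.

(* The functionals 2^-n (a_1 + ... + a_d) that generate types I_alpha and
   I_beta, [average] being alpha_average or beta_average. *)
Definition weighted_average (average : (nat -> R) -> nat -> Prop)
    (f : nat -> R) (n : nat) : Prop :=
  (0 < n)%N /\ exists d (a : nat -> nat -> R) (size_ : nat -> nat),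
    [/\ (0 < d)%N, forall q, (q < d)%N -> average (a q) (size_ q),
        very_fast_growing d a size_, admissible n d a
      & f = 2 ^- n *: \sum_(q < d) a q].

Definition type_I (average : (nat -> R) -> nat -> Prop)
    (g : nat -> R) (n : nat) : Prop :=
  exists f E, weighted_average average f n /\ signed_restriction E f g.

Definition type_Ialpha : (nat -> R) -> nat -> Prop := type_I alpha_average.

(* w q is the common weight of f q and g q *)
Definition special (d : nat) (f g : nat -> nat -> R) (w : nat -> nat) : Prop :=
  [/\ forall q, (q < d)%N ->
        [/\ G (f q), G (g q), type_Ialpha (f q) (w q) & type_Ialpha (g q) (w q)],
      forall q, (q < d)%N -> succv (f q) (g q),
      forall q, (q.+1 < d)%N -> succv (g q) (f q.+1),
      L1 (w 0%N)
    & forall q, (0 < q < d)%N ->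
        sigma (flatten [seq [:: f i; g i] | i <- iota 0 q]) = w q].

Definition special_data (d : nat) (f g : nat -> nat -> R) (w : nat -> nat)
    (F : {set 'I_d}) : Prop :=
  special d f g w /\
  exists2 q0, q0 \in F & (forall q, q \in F -> (q0 <= q)%N) /\
                         (2 * #|F| <= minsupp (f q0))%N.

Definition IIplus_sum (d : nat) (F : {set 'I_d}) (f g : nat -> nat -> R) :
    nat -> R :=
  2^-1 *: \sum_(q in F) (f q + g q).

Definition IIminus_sum (d : nat) (F : {set 'I_d}) (lambda : nat -> rat)
    (f g : nat -> nat -> R) : nat -> R :=
  2^-1 *: \sum_(q in F) (ratr (lambda q) : R) *: (f q - g q).

Definition IIminus_coefs (d : nat) (F : {set 'I_d}) (lambda : nat -> rat) :
    Prop :=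
  u_dual_norm s F (fun q => ratr (lambda q)) <= 1.

(* h is of type II_+ (resp. II_-) and has weight set A. *)
Definition type_IIplus (h : nat -> R) (A : set nat) : Prop :=
  exists d f g w (F : {set 'I_d}) E,
    [/\ special_data f g w F, signed_restriction E (IIplus_sum F f g) h
      & A = [set w q | q in [set q : 'I_d |
               q \in F /\ ran (f q + g q) `&` E !=set0]]].

Definition type_IIminus (h : nat -> R) (A : set nat) : Prop :=
  exists d f g w (F : {set 'I_d}) lambda E,
    [/\ special_data f g w F, IIminus_coefs F lambda,
        signed_restriction E (IIminus_sum F lambda f g) h
      & A = [set w q | q in [set q : 'I_d |
               q \in F /\ ran (f q - g q) `&` E !=set0]]].

Definition type_II (h : nat -> R) (A : set nat) : Prop :=
  type_IIplus h A \/ type_IIminus h A.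

Definition beta_average (b : nat -> R) (n : nat) : Prop :=
  G b /\ exists d (f : nat -> nat -> R) (A : nat -> set nat),
    [/\ (0 < d <= n)%N,
        forall j, (j < d)%N -> G (f j) /\ type_II (f j) (A j),
        forall i j, (i < j < d)%N -> A i `&` A j = set0
      & b = n%:R^-1 *: \sum_(j < d) f j].

Record norming_closed : Prop := NormingClosed {
  norming_c00 : G `<=` @c00 R;
  norming_unit : forall n, (0 < n)%N -> G (unit_vec R n) /\ G (- unit_vec R n);
  norming_sym : forall f, G f -> G (- f);
  norming_restr : forall f E, nat_interval E -> G f -> G (f \_ E);
  norming_convex : forall d (c : nat -> rat) (f : nat -> nat -> R),
    (forall j, (j < d)%N -> 0 <= c j /\ G (f j)) -> \sum_(j < d) c j = 1 ->
    G (\sum_(j < d) (ratr (c j) : R) *: f j);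
  norming_Ialpha : forall f n, weighted_average alpha_average f n -> G f;
  norming_Ibeta : forall f n, weighted_average beta_average f n -> G f;
  norming_IIplus : forall d f g w (F : {set 'I_d}),
    special_data f g w F -> G (IIplus_sum F f g);
  norming_IIminus : forall d f g w (F : {set 'I_d}) lambda,
    special_data f g w F -> IIminus_coefs F lambda ->
    G (IIminus_sum F lambda f g)
}.

End Types.

(* The smallest such set: all the notions above are monotone in G. *)
Definition norming_set : set (nat -> R) :=
  [set f | forall G, norming_closed G -> G f].

Definition W_norm (x : nat -> R) : R :=
  sup [set pairing f x | f in norming_set].

(* X, with the embedding iota, is a completion of (c00, W_norm).  Only the
   values of iota on c00 are meaningful. *)
Record is_completion (X : completeNormedModType R) (iota : (nat -> R) -> X) :
    Prop := IsCompletion {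
  completion_linear : forall (a : R) x y, c00 x -> c00 y ->
    iota (a *: x + y) = a *: iota x + iota y;
  completion_norm : forall x, c00 x -> `|iota x| = W_norm x;
  completion_dense : closure (iota @` @c00 R) = [set: X]
}.

End NormingSet.

Section Subspaces.
Variables (R : realType) (X : completeNormedModType R).
Variable iota : (nat -> R) -> X.

(* Y is the closed linear span of a block sequence. *)
Definition block_subspace (Y : set X) : Prop :=
  exists2 y, block_seq y &
    Y = closure [set v | exists N (a : nat -> R),
                           v = \sum_(i < N) a i *: iota (y i)].

Definition seminormalized (x : nat -> X) : Prop :=
  exists c C : R, 0 < c /\ forall n, c <= `|x n| <= C.

(* Onto isomorphism: a continuous linear bijection with continuous inverse. *)
Definition isomorphism (T : {linear X -> X}) : Prop :=
  continuous T /\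
  exists T' : X -> X, [/\ cancel T T', cancel T' T & continuous T'].

End Subspaces.

(* Main.v *)
Require Import Defs.
From HB Require Import structures.
From mathcomp Require Import all_boot all_order all_algebra.
From mathcomp Require Import all_classical all_reals all_analysis.
From mathcomp Require Import ring lra zify.
Set Implicit Arguments.
Unset Strict Implicit.
Unset Printing Implicit Defensive.
Import Order.TTheory GRing.Theory Num.Theory.
Import numFieldNormedType.Exports.
Local Open Scope classical_set_scope.
Local Open Scope ring_scope.

(** The isomorphism is [I - S], where [S] is a bounded operator with [S^2 = 0]
    that maps [x_(2n-1)] to [x_(2n-1) - x_(2n)]; its inverse is [I + S].

    In a given block subspace one finds a special sequence of pairs of functionals
    [(f_q, g_q)], of common weight [n_q], together with vectors [x_q] and [y_q]
    such that [f_q (x_q) = g_q (y_q) = 1] ([special_exists]).  Each [x_q] is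
    an iterated average of long sums of vectors, normed by a functional of type
    I_alpha whose weight exceeds the depth of the average by one
    ([exact_exists]).  The dense sequence of the sphere of C[0,1] has a
    subsequence close to bumps with bounded sums, so along some [q = kap i] the
    Pelczynski basis behaves like the basis of c_0 ([c0_subsequence]).  With
    [phi_i = f_q + g_q] and [z_i = x_q - y_q] the operator is
    [S v = sum_i phi_i (v) z_i].  Since [phi_i (z_j) = 0] its square vanishes.

    Boundedness compares two estimates.  Functionals of type II_+ show that the
    sum of [|phi_i (v)|] over a set of indices that is small with respect to its
    minimum is at most four times the norm of [v] ([phi_abs_sum]); hence few
    coefficients are large, and the others decrease geometrically.  On the other
    side, a combination of [N] differences [z_i] starting late enough, with
    coefficients at most [1], is bounded independently of [N] ([z_comb]).  The
    reason is that a functional of type II either has weights different from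
    those of the sequence, and the differences are almost invisible to it, or
    shares an initial part with the special sequence.  In the latter case the
    functionals of type II_+ vanish on the [z_i], and those of type II_- are
    controlled by the dual of the norm of c_0 ([exceptional]).  Both situations
    enter the general estimate [comb_bound] for vectors living on successive
    windows of weights, proved by induction over the norming set.

    The vectors come from a block sequence on which averages of growing size are
    asymptotically negligible although the sums of consecutive vectors stay
    bounded ([nice_exists]).  It is obtained in at most three steps, each one
    passing to iterated averages or to normalized long sums; iterated averages
    are analysed by comparison with Tsirelson space ([tsirelson_ind],
    [tree_robust], [tree_items_sum], [tree_beta_sum]). *)

(** * Finitely supported vectors *)

Section Pairing.
Variable R : realType.
Implicit Types (f g x y : nat -> R).

Lemma pairing_trunc K f x : (forall i, (K <= i)%N -> x i = 0) ->
  pairing f x = \sum_(i < K) f i * x i.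
Proof.
move=> xK; rewrite /pairing -(fsbig_widen `I_K setT) //.
  by rewrite -(fsbig_ord _ _ (fun i => f i * x i)).
by move=> i [_] /=; rewrite ltnNge => /negP/negPn /xK ->; rewrite mulr0.
Qed.

Lemma pairingC f x : pairing f x = pairing x f.
Proof. by rewrite /pairing; apply: eq_fsbigr => i _; rewrite mulrC. Qed.

Lemma c00_trunc x : c00 x -> exists K, forall i, (K <= i)%N -> x i = 0.
Proof.
move=> [_ /finite_fsetP[A sA]].
exists (\max_(i <- finmap.enum_fset A) i).+1 => i iA; apply: contrapT => /eqP xi.
have : supp x i by [].
rewrite sA /= => iA'; move: iA; rewrite ltnNge => /negP; apply.
exact: (leq_bigmax_seq i).
Qed.

Lemma c00_of_trunc K x : x 0%N = 0 -> (forall i, (K <= i)%N -> x i = 0) -> c00 x.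
Proof.
move=> x0 xK; split => //; apply: (@sub_finite_set _ _ `I_K); last exact: finite_II.
by move=> i /= /eqP xi; rewrite ltnNge; apply/negP => /xK.
Qed.

Lemma vecD x y i : (x + y) i = x i + y i. Proof. by []. Qed.
Lemma vecN x i : (- x) i = - x i. Proof. by []. Qed.
Lemma vecZ (a : R) x i : (a *: x) i = a * x i. Proof. by []. Qed.
Lemma vec_sum (I : Type) (r : seq I) (P : pred I) (F : I -> nat -> R) j :
  (\sum_(i <- r | P i) F i) j = \sum_(i <- r | P i) F i j.
Proof. exact: (big_morph (fun f : nat -> R => f j)). Qed.

Lemma c00_0 : c00 (0 : nat -> R).
Proof. exact: (@c00_of_trunc 0). Qed.

Lemma c00D x y : c00 x -> c00 y -> c00 (x + y).
Proof.
move=> cx cy; have [K xK] := c00_trunc cx; have [M yM] := c00_trunc cy.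
apply: (@c00_of_trunc (K + M)); first by rewrite vecD cx.1 cy.1 addr0.
move=> i iKM; rewrite vecD xK ?yM ?addr0 //.
  exact: leq_trans (leq_addl _ _) iKM.
exact: leq_trans (leq_addr _ _) iKM.
Qed.

Lemma c00Z (a : R) x : c00 x -> c00 (a *: x).
Proof.
move=> cx; have [K xK] := c00_trunc cx.
apply: (@c00_of_trunc K); first by rewrite vecZ cx.1 mulr0.
by move=> i iK; rewrite vecZ xK // mulr0.
Qed.

Lemma c00N x : c00 x -> c00 (- x).
Proof. by move=> cx; rewrite -scaleN1r; exact: c00Z. Qed.

Lemma c00B x y : c00 x -> c00 y -> c00 (x - y).
Proof. by move=> cx cy; apply: c00D => //; exact: c00N. Qed.

Lemma c00_sum (I : Type) (r : seq I) (P : pred I) (F : I -> nat -> R) :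
  (forall i, P i -> c00 (F i)) -> c00 (\sum_(i <- r | P i) F i).
Proof. by move=> h; apply: big_ind => //; [exact: c00_0|exact: c00D]. Qed.

Lemma restrE x (E : set nat) i : (x \_ E) i = if `[< E i >] then x i else 0.
Proof. by rewrite /patch; case: asboolP => h; [rewrite mem_set|rewrite memNset]. Qed.

Lemma c00_patch x (E : set nat) : c00 x -> c00 (x \_ E).
Proof.
move=> cx; have [K xK] := c00_trunc cx.
apply: (@c00_of_trunc K); first by rewrite restrE cx.1 if_same.
by move=> i iK; rewrite restrE xK // if_same.
Qed.

Lemma c00_unit n : (0 < n)%N -> c00 (unit_vec R n).
Proof.
move=> n0; apply: (@c00_of_trunc n.+1); first by rewrite /unit_vec; case: n n0.
by move=> i ni; rewrite /unit_vec gtn_eqF.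
Qed.

Lemma pairingDl f g x : c00 x -> pairing (f + g) x = pairing f x + pairing g x.
Proof.
move=> /c00_trunc[K xK]; rewrite !(pairing_trunc _ xK) -big_split/=.
by apply: eq_bigr => i _; rewrite -mulrDl.
Qed.

Lemma pairingZl (a : R) f x : c00 x -> pairing (a *: f) x = a * pairing f x.
Proof.
move=> /c00_trunc[K xK]; rewrite !(pairing_trunc _ xK) mulr_sumr.
by apply: eq_bigr => i _; rewrite mulrA.
Qed.

Lemma pairingNl f x : c00 x -> pairing (- f) x = - pairing f x.
Proof. by move=> cx; rewrite -scaleN1r pairingZl // mulN1r. Qed.

Lemma pairing0l x : pairing 0 x = 0.
Proof. by rewrite /pairing; apply: fsbig1 => i _; rewrite mul0r. Qed.

Lemma pairing0r x : pairing x 0 = 0.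
Proof. by rewrite pairingC pairing0l. Qed.

Lemma pairing_suml (I : Type) (r : seq I) (P : pred I) (F : I -> nat -> R) x :
  c00 x -> pairing (\sum_(i <- r | P i) F i) x =
           \sum_(i <- r | P i) pairing (F i) x.
Proof.
move=> cx; apply: (big_morph (fun f => pairing f x)); last exact: pairing0l.
by move=> f g; exact: pairingDl.
Qed.

Lemma pairingDr f x y : c00 f -> pairing f (x + y) = pairing f x + pairing f y.
Proof. by move=> cf; rewrite pairingC pairingDl // !(pairingC f). Qed.

Lemma pairingZr (a : R) f x : c00 f -> pairing f (a *: x) = a * pairing f x.
Proof. by move=> cf; rewrite pairingC pairingZl // !(pairingC f). Qed.

Lemma pairingNr f x : c00 f -> pairing f (- x) = - pairing f x.
Proof. by move=> cf; rewrite pairingC pairingNl // !(pairingC f). Qed.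

Lemma pairingBr f x y : c00 f -> pairing f (x - y) = pairing f x - pairing f y.
Proof. by move=> cf; rewrite pairingDr // pairingNr. Qed.

Lemma pairing_sumr (I : Type) (r : seq I) (P : pred I) (F : I -> nat -> R) f :
  c00 f -> pairing f (\sum_(i <- r | P i) F i) =
           \sum_(i <- r | P i) pairing f (F i).
Proof.
move=> cf; rewrite pairingC pairing_suml //.
by apply: eq_bigr => i _; rewrite pairingC.
Qed.

Lemma pairing_patch f x (E : set nat) : pairing (f \_ E) x = pairing f (x \_ E).
Proof.
rewrite /pairing; apply: eq_fsbigr => i _; rewrite !restrE.
by case: ifP => _; rewrite ?mul0r ?mulr0.
Qed.

Lemma pairing_unit n x : pairing (unit_vec R n) x = x n.
Proof.
rewrite pairingC (@pairing_trunc n.+1); last first.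
  by move=> i ni; rewrite /unit_vec gtn_eqF.
rewrite (bigD1 ord_max) //= /unit_vec eqxx mulr1 big1 ?addr0 // => i ni.
by rewrite [_ == _]negbTE ?mulr0.
Qed.

Lemma pairing_eq0 f x : (forall i, f i = 0 \/ x i = 0) -> pairing f x = 0.
Proof.
move=> h; rewrite /pairing; apply: fsbig1 => i _.
by case: (h i) => ->; rewrite ?mul0r ?mulr0.
Qed.

Lemma leastP (A : set nat) n : A n ->
  A (least A) /\ forall i, A i -> (least A <= i)%N.
Proof.
move=> An; rewrite /least; case: xgetP => [m _ []//|] H; exfalso.
have ex : exists m, `[< A m >] by exists n; apply/asboolP.
have [m /asboolP Am mmin] := ex_minnP ex.
by apply: (H m); split=> // i Ai; apply: mmin; apply/asboolP.
Qed.

Lemma greatestP (A : set nat) n K : A n -> (forall i, A i -> (i <= K)%N) ->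
  A (greatest A) /\ forall i, A i -> (i <= greatest A)%N.
Proof.
move=> An AK; rewrite /greatest; case: xgetP => [m _ []//|] H; exfalso.
have ex : exists m, `[< A m >] by exists n; apply/asboolP.
have AK' i : `[< A i >] -> (i <= K)%N by move=> /asboolP /AK.
have [m /asboolP Am mmin] := ex_maxnP ex AK'.
by apply: (H m); split=> // i Ai; apply: mmin; apply/asboolP.
Qed.

Lemma supp_neq0 x : x != 0 -> exists i, x i != 0.
Proof.
move=> x0; apply: contrapT => h; move/negP: x0; apply; apply/eqP/funext => i.
by apply: contrapT => /eqP xi; apply: h; exists i.
Qed.

Lemma minsuppP x : x != 0 -> x (minsupp x) != 0.
Proof. by move=> /supp_neq0[i xi]; have [] := @leastP (supp x) i xi. Qed.

Lemma minsupp_le x i : x i != 0 -> (minsupp x <= i)%N.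
Proof. by move=> xi; have [_] := @leastP (supp x) i xi; apply. Qed.

Lemma maxsuppP x : c00 x -> x != 0 -> x (maxsupp x) != 0.
Proof.
move=> /c00_trunc[K xK] /supp_neq0[i xi].
have [|] // := @greatestP (supp x) i K xi.
by move=> j /= /eqP xj; rewrite leqNgt; apply/negP => /ltnW /xK.
Qed.

Lemma maxsupp_ge x i : c00 x -> x i != 0 -> (i <= maxsupp x)%N.
Proof.
move=> /c00_trunc[K xK] xi.
have [|_] := @greatestP (supp x) i K xi; last by apply.
by move=> j /= /eqP xj; rewrite leqNgt; apply/negP => /ltnW /xK.
Qed.

Lemma minsupp_gt0 x : c00 x -> x != 0 -> (0 < minsupp x)%N.
Proof.
by move=> cx x0; rewrite lt0n; apply/eqP => m0; move: (minsuppP x0); rewrite m0 cx.1 eqxx.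
Qed.

Lemma minsupp_maxsupp x : c00 x -> x != 0 -> (minsupp x <= maxsupp x)%N.
Proof. by move=> cx x0; apply: minsupp_le; exact: maxsuppP. Qed.

Lemma supp_nonempty x : supp x !=set0 -> x != 0.
Proof. by move=> [i xi]; apply/eqP => x0; move: xi; rewrite /supp/= x0 eqxx. Qed.

Lemma nonempty_supp x : x != 0 -> supp x !=set0.
Proof. by move=> /supp_neq0[i xi]; exists i. Qed.

Lemma succvP x y : succv x y <-> [/\ x != 0, y != 0 & (maxsupp x < minsupp y)%N].
Proof.
split=> [[]|[]].
  by move=> /supp_nonempty ? /supp_nonempty ? ?.
by move=> /nonempty_supp ? /nonempty_supp ? ?.
Qed.

End Pairing.

(** * Coefficients with respect to the Pelczynski basis *)

Section Pelczynski_coefs.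
Variables (R : realType) (s : nat -> R -> R) (hs : dense_in_sphere s).

Lemma sphere_le1 k t : `[0, 1]%classic t -> `|s k t| <= 1.
Proof.
move=> t01; have [+ _] := hs => /(_ k)[_ sk].
have hsup : has_sup [set `|s k t| | t in `[0, 1]%classic].
  apply: contrapT => /sup_out; move: sk; rewrite /sup_norm => -> /eqP.
  by rewrite oner_eq0.
by rewrite -sk; apply: ub_le_sup; [case: hsup|exists t].
Qed.

Lemma sup_norm_ub (D : set R) (h : R -> R) (M : R) t : D t ->
  (forall u, D u -> `|h u| <= M) -> `|h t| <= sup_norm D h.
Proof.
move=> Dt hM; apply: ub_le_sup; last by exists t.
by exists M => _ [u Du <-]; exact: hM.
Qed.

Lemma sup_norm_le (D : set R) (h : R -> R) (M : R) t : D t ->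
  (forall u, D u -> `|h u| <= M) -> sup_norm D h <= M.
Proof.
move=> Dt hM; apply: ge_sup; first by exists `|h t|, t.
by move=> _ [u Du <-]; exact: hM.
Qed.

Let in01 : `[0, 1]%classic (0 : R).
Proof. by rewrite /= in_itv /= lexx ler01. Qed.

Lemma comb_le n (a : nat -> R) (F : {set 'I_n}) t : `[0, 1]%classic t ->
  `|\sum_(k in F) a k * s k t| <= \sum_(k < n) `|a k|.
Proof.
move=> t01; apply: le_trans (ler_norm_sum _ _ _) _.
rewrite big_mkcond /=; apply: ler_sum => k _; case: ifP => // _.
by rewrite normrM ler_piMr // sphere_le1.
Qed.

Lemma u_norm_ub n (a : nat -> R) (F : {set 'I_n}) t : `[0, 1]%classic t ->
  `|\sum_(k in F) a k * s k t| <= u_norm s n a.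
Proof.
move=> t01; apply: (@le_trans _ _ (sup_norm `[0, 1]%classic
    (fun t => \sum_(k in F) a k * s k t))).
  by apply: (@sup_norm_ub _ (fun t => \sum_(k in F) a k * s k t)
     (\sum_(k < n) `|a k|)) => // u; exact: comb_le.
apply: ub_le_sup; last by exists F.
exists (\sum_(k < n) `|a k|) => _ [G _ <-].
by apply: (@sup_norm_le _ _ _ 0) => // u; exact: comb_le.
Qed.

Lemma u_norm_le n (a : nat -> R) M :
  (forall (F : {set 'I_n}) t, `[0, 1]%classic t ->
     `|\sum_(k in F) a k * s k t| <= M) -> u_norm s n a <= M.
Proof.
move=> h; apply: ge_sup.
  by exists (sup_norm `[0, 1]%classic (fun t => \sum_(k in (finset.set0 : {set 'I_n})) a k * s k t)), finset.set0.
by move=> _ [G _ <-]; apply: (@sup_norm_le _ _ _ 0) => // u; exact: h.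
Qed.

Lemma u_coef_le n (a : nat -> R) q : u_norm s n a <= 1 ->
  (q < n)%N -> `|a q| <= 1.
Proof.
move=> ua qn; rewrite leNgt; apply/negP => aq1.
have aq0 : 0 < `|a q| by apply: lt_trans aq1.
have h t : `[0, 1]%classic t -> `|s q t| <= `|a q|^-1.
  move=> t01; have := u_norm_ub a [set Ordinal qn]%SET t01.
  rewrite big_set1 /= normrM => /le_trans /(_ ua).
  by rewrite -ler_pdivlMl // mulr1.
have [+ _] := hs => /(_ q)[_ sq].
have := sup_norm_le in01 h; rewrite sq.
by rewrite leNgt invf_lt1 // aq1.
Qed.

Lemma u_dual_ub d (F : {set 'I_d}) (b : nat -> R) n (a : nat -> R) :
  (forall k, (n <= k)%N -> a k = 0) -> u_norm s n a <= 1 ->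
  `|\sum_(q in F) b q * a q| <= u_dual_norm s F b.
Proof.
move=> an ua; apply: ub_le_sup; last by exists n, a.
exists (\sum_(q in F) `|b q|) => _ [n' [a' [an' ua' ->]]].
apply: le_trans (ler_norm_sum _ _ _) _; apply: ler_sum => q _.
rewrite normrM ler_piMr //; have [qn|/an' ->] := ltnP q n'.
  exact: u_coef_le ua' qn.
by rewrite normr0.
Qed.

Lemma dual_coef_le1 d (F : {set 'I_d}) (b : nat -> R) (q : 'I_d) :
  u_dual_norm s F b <= 1 -> q \in F -> `|b q| <= 1.
Proof.
move=> ub qF; apply: le_trans ub.
pose a (k : nat) : R := (k == q :> nat)%:R.
have := @u_dual_ub d F b q.+1 a; rewrite (bigD1 q) //= /a eqxx mulr1.
rewrite big1 ?addr0; last first.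
  by move=> i /andP[_ iq]; rewrite [_ == _]negbTE ?mulr0.
apply; first by move=> k qk; rewrite gtn_eqF.
apply: u_norm_le => G t t01.
apply: le_trans (ler_norm_sum _ _ _) _.
apply: (@le_trans _ _ (\sum_(i < q.+1) (i == q :> nat)%:R)).
  rewrite big_mkcond /=; apply: ler_sum => k _; case: ifP => // _.
  rewrite normrM; case: eqP => _; last by rewrite normr0 mul0r.
  by rewrite normr1 mul1r sphere_le1.
rewrite (bigD1 ord_max) //= eqxx big1 ?addr0 // => i im.
by rewrite [_ == _]negbTE.
Qed.

(** Testing the dual norm on the signed sums of the [u_(kap n)], which are bounded
    by [C] in the Pelczynski norm, bounds the sum of the coefficients that sit at
    the places [kap n]. *)
Lemma dual_sum_le (kap : nat -> nat) (C : R) :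
  (forall n m, (n < m)%N -> (kap n < kap m)%N) -> 0 < C ->
  (forall (e : nat -> R) (B : seq nat) t, `[0, 1]%classic t -> uniq B ->
     (forall n, `|e n| <= 1) -> `|\sum_(n <- B) e n * s (kap n) t| <= C) ->
  forall d (F : {set 'I_d}) (b : nat -> R) (B : seq nat), uniq B ->
    u_dual_norm s F b <= 1 ->
    \sum_(q in F | has (fun n => kap n == q :> nat) B) `|b q| <= C.
Proof.
move=> kmono C0 kC d F b B uB ub.
pose a (k : nat) : R :=
  if has (fun n => kap n == k) B && (k < d)%N then Num.sg (b k) / C else 0.
have kinj : injective kap.
  move=> m n; case: (ltngtP m n) => // /kmono h e; by rewrite e ltnn in h.
have := @u_dual_ub d F b d a; rewrite (_ : \sum_(q in F) b q * a q =
    (\sum_(q in F | has (fun n => kap n == q :> nat) B) `|b q|) / C); last first.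
  rewrite big_mkcondr mulr_suml /=; apply: eq_bigr => q _.
  rewrite /a ltn_ord andbT; case: ifP => _; last by rewrite mulr0 mul0r.
  by rewrite mulrA [b q * _]mulrC -normrEsg.
rewrite ger0_norm; last by rewrite divr_ge0 ?sumr_ge0 // ltW.
move=> h; rewrite -[leRHS]mul1r -ler_pdivrMr //; apply: le_trans ub; apply: h.
  by move=> k dk; rewrite /a ltnNge dk andbF.
apply: u_norm_le => G t t01.
pose e n : R := if [exists k in G, kap n == k :> nat] then Num.sg (b (kap n)) else 0.
have e1 n : `|e n| <= 1.
  rewrite /e; case: ifP => _; last by rewrite normr0.
  by rewrite normr_sg; case: (b _ != 0).
rewrite (_ : \sum_(k in G) _ = C^-1 * \sum_(n <- B) e n * s (kap n) t).
  by rewrite normrM gtr0_norm ?invr_gt0 // mulrC ler_pdivrMr // mul1r; exact: kC.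
transitivity (\sum_(k in G) \sum_(n <- B | kap n == k :> nat)
   C^-1 * (Num.sg (b (kap n)) * s (kap n) t)).
  apply: eq_bigr => k kG; rewrite /a ltn_ord andbT.
  case: (boolP (has _ B)) => [/hasP[n nB /eqP nk]|/hasPn hB]; last first.
    by rewrite mul0r big_seq_cond big1 // => i /andP[/hB /negbTE ->].
  rewrite big_mkcond (bigD1_seq n) //= nk eqxx big1 ?addr0; last first.
    by move=> i /negP iin; case: eqP => // ik; case: iin; apply/eqP/kinj; rewrite ik nk.
  by rewrite [in RHS]mulrA [C^-1 * _]mulrC.
rewrite mulr_sumr (exchange_big_dep xpredT) //=; apply: eq_bigr => n _.
rewrite /e; case: (boolP [exists k in G, kap n == k :> nat]).
  move=> /existsP[k /andP[kG /eqP nk]].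
  rewrite (bigD1 k) /= ?kG ?nk ?eqxx // big1 ?addr0 // => i /andP[/andP[_ /eqP ik]].
  by rewrite (ord_inj ik) eqxx.
move=> /existsPn hG; rewrite mul0r mulr0 big1 // => k /andP[kG nk].
by have := hG k; rewrite kG nk.
Qed.

End Pelczynski_coefs.

(** * The norming set: closure properties and induction *)

Section Monotone.
Variables (R : realType) (s : nat -> R -> R) (L1 : set nat).
Variable sigma : seq (nat -> R) -> nat.
Implicit Types (G : set (nat -> R)).

(** The two kinds of averages, indexed by a boolean: [true] for alpha. *)
Definition kavg (k : bool) G : (nat -> R) -> nat -> Prop :=
  if k then alpha_average G else beta_average s L1 sigma G.

Lemma alpha_average_mono G G' a n : G `<=` G' ->
  alpha_average G a n -> alpha_average G' a n.
Proof.
move=> GG' [Ga [d [f [dn fG fb fE]]]]; split; first exact: GG'.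
by exists d, f; split=> // j jd; exact/GG'/fG.
Qed.

Lemma weighted_average_mono (A A' : (nat -> R) -> nat -> Prop) f n :
  (forall a m, A a m -> A' a m) -> weighted_average A f n -> weighted_average A' f n.
Proof.
move=> AA' [n0 [d [a [z [d0 aA vf ad fE]]]]]; split=> //.
by exists d, a, z; split=> // q qd; exact/AA'/aA.
Qed.

Lemma type_I_mono (A A' : (nat -> R) -> nat -> Prop) f n :
  (forall a m, A a m -> A' a m) -> type_I A f n -> type_I A' f n.
Proof.
move=> AA' [g [E [gw gE]]]; exists g, E; split=> //.
exact: weighted_average_mono gw.
Qed.

Lemma special_mono G G' d f g w : G `<=` G' ->
  special L1 sigma G d f g w -> special L1 sigma G' d f g w.
Proof.
move=> GG' [h1 h2 h3 h4 h5]; split=> // q qd; have [fG gG fI gI] := h1 q qd.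
by split; [exact: GG'|exact: GG'|
  apply: type_I_mono fI|apply: type_I_mono gI] => a m; exact: alpha_average_mono.
Qed.

Lemma special_data_mono G G' d f g w (F : {set 'I_d}) : G `<=` G' ->
  special_data L1 sigma G f g w F -> special_data L1 sigma G' f g w F.
Proof. by move=> GG' [h1 h2]; split=> //; exact: special_mono h1. Qed.

Lemma type_II_mono G G' h A : G `<=` G' ->
  type_II s L1 sigma G h A -> type_II s L1 sigma G' h A.
Proof.
move=> GG' [[d [f [g [w [F [E [h1 h2 h3]]]]]]]|
            [d [f [g [w [F [la [E [h1 h2 h3 h4]]]]]]]]]; [left|right].
  by exists d, f, g, w, F, E; split=> //; exact: special_data_mono h1.
by exists d, f, g, w, F, la, E; split=> //; exact: special_data_mono h1.
Qed.

Lemma beta_average_mono G G' a n : G `<=` G' ->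
  beta_average s L1 sigma G a n -> beta_average s L1 sigma G' a n.
Proof.
move=> GG' [Ga [d [f [A [dn fG fb fE]]]]]; split; first exact: GG'.
exists d, f, A; split=> // j jd; have [h1 h2] := fG j jd; split.
  exact: GG'.
exact: type_II_mono h2.
Qed.

Lemma kavg_mono k G G' a n : G `<=` G' -> kavg k G a n -> kavg k G' a n.
Proof.
by case: k => GG'; [exact: alpha_average_mono|exact: beta_average_mono].
Qed.

Lemma kavg_in k G a n : kavg k G a n -> G a.
Proof. by case: k => -[]. Qed.

(** The functionals of type II_+ are obtained for [lam = 1] and [e = 1], those of
    type II_- for [e = -1]; both types are treated together. *)
Definition II_sum d (F : {set 'I_d}) (lam : nat -> rat) (e : R)
    (f g : nat -> nat -> R) : nat -> R :=
  2^-1 *: \sum_(q in F) (ratr (lam q) : R) *: (f q + e *: g q).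

Definition II_ok d (F : {set 'I_d}) (lam : nat -> rat) (e : R) : Prop :=
  (lam = (fun=> 1) /\ e = 1) \/ (IIminus_coefs s F lam /\ e = -1).

Lemma IIplus_sumE d (F : {set 'I_d}) (f g : nat -> nat -> R) :
  IIplus_sum F f g = II_sum F (fun=> 1) 1 f g.
Proof.
congr (_ *: _); apply: eq_bigr => q _.
by rewrite rmorph1 !scale1r.
Qed.

Lemma IIminus_sumE d (F : {set 'I_d}) lam (f g : nat -> nat -> R) :
  IIminus_sum F lam f g = II_sum F lam (-1) f g.
Proof.
by congr (_ *: _); apply: eq_bigr => q _; rewrite scaleN1r.
Qed.

Local Notation W := (norming_set s L1 sigma).
Local Notation closed := (norming_closed s L1 sigma).

Lemma W_sub G : closed G -> W `<=` G.
Proof. by move=> cG f; apply. Qed.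

Lemma c00_closed : closed (@c00 R).
Proof.
split=> //.
- by move=> n n0; split; [exact: c00_unit|apply: c00N; exact: c00_unit].
- by move=> f; exact: c00N.
- by move=> f E _; exact: c00_patch.
- by move=> d c f h _; apply: c00_sum => j _; apply: c00Z; have [] := h j (ltn_ord j).
- move=> f n [n0 [d [a [z [d0 aA vf ad ->]]]]]; apply/c00Z/c00_sum => q _.
  by have [] := aA q (ltn_ord q).
- move=> f n [n0 [d [a [z [d0 aA vf ad ->]]]]]; apply/c00Z/c00_sum => q _.
  by have [] := aA q (ltn_ord q).
- move=> d f g w F [[h _ _ _ _] _]; apply/c00Z/c00_sum => q _.
  by have [? ? _ _] := h q (ltn_ord q); exact: c00D.
- move=> d f g w F lam [[h _ _ _ _] _] _; apply/c00Z/c00_sum => q _.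
  by have [? ? _ _] := h q (ltn_ord q); exact/c00Z/c00B.
Qed.

Lemma W_c00 f : W f -> c00 f.
Proof. by move=> Wf; exact: (W_sub c00_closed). Qed.

Lemma W_closed : closed W.
Proof.
split.
- by move=> f; exact: W_c00.
- by move=> n n0; split=> G cG; have [] := norming_unit cG n0.
- by move=> f Wf G cG; apply: (norming_sym cG); exact: Wf.
- by move=> f E nE Wf G cG; apply: (norming_restr cG) => //; exact: Wf.
- move=> d c f h c1 G cG; apply: (norming_convex cG) => // j jd.
  by have [? Wf] := h j jd; split=> //; exact: Wf.
- move=> f n h G cG; apply: (norming_Ialpha cG (n := n)).
  by apply: weighted_average_mono h => a m; apply: alpha_average_mono; exact: W_sub.
- move=> f n h G cG; apply: (norming_Ibeta cG (n := n)).
  by apply: weighted_average_mono h => a m; apply: beta_average_mono; exact: W_sub.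
- move=> d f g w F h G cG; apply: (norming_IIplus cG (w := w)).
  by apply: special_data_mono h; exact: W_sub.
- move=> d f g w F lam h hl G cG; apply: (norming_IIminus cG (w := w)) => //.
  by apply: special_data_mono h; exact: W_sub.
Qed.

Lemma W_unit n : (0 < n)%N -> W (unit_vec R n).
Proof. by move=> /(norming_unit W_closed)[]. Qed.

Lemma WN f : W f -> W (- f).
Proof. exact: (norming_sym W_closed). Qed.

Lemma W_restr f E : nat_interval E -> W f -> W (f \_ E).
Proof. exact: (norming_restr W_closed). Qed.

Lemma W_weighted k f n : weighted_average (kavg k W) f n -> W f.
Proof.
by case: k; [exact: (norming_Ialpha W_closed)|exact: (norming_Ibeta W_closed)].
Qed.

Lemma W_II d f g w (F : {set 'I_d}) lam e :
  special_data L1 sigma W f g w F -> II_ok F lam e -> W (II_sum F lam e f g).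
Proof.
move=> h [[-> ->]|[hl ->]].
  by rewrite -IIplus_sumE; exact: (norming_IIplus W_closed h).
by rewrite -IIminus_sumE; exact: (norming_IIminus W_closed h).
Qed.

Lemma W_convex2 (c : rat) f g : 0 <= c <= 1 -> W f -> W g ->
  W ((ratr c : R) *: f + (1 - ratr c : R) *: g).
Proof.
move=> /andP[c0 c1] Wf Wg.
have := @norming_convex _ _ _ _ _ W_closed 2 (fun j => if j == 0%N then c else 1 - c)
  (fun j => if j == 0%N then f else g).
rewrite !big_ord_recl !big_ord0 /= !addr0 rmorphB rmorph1; apply; last by rewrite addrC subrK.
by move=> [|[|]] //= _; split=> //; rewrite subr_ge0.
Qed.

Lemma W_scale (c : rat) f : `|c| <= 1 -> W f -> W ((ratr c : R) *: f).
Proof.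
move=> c1 Wf; have := @W_convex2 ((1 + c) / 2) f (- f) _ Wf (WN Wf).
rewrite (_ : _ + _ = (ratr c : R) *: f).
  by apply; move: c1; rewrite ler_norml => /andP[? ?]; lra.
rewrite scalerN -scalerBl; congr (_ *: _).
by rewrite !rmorphM rmorphD rmorph1 fmorphV rmorph_nat; field.
Qed.

Lemma W0 : W 0.
Proof.
have := @W_scale 0 (unit_vec R 1) _ (W_unit (ltn0Sn 0)).
by rewrite rmorph0 scale0r normr0 ler01; apply.
Qed.

Lemma W_mean N (f : nat -> nat -> R) : (0 < N)%N ->
  (forall i, (i < N)%N -> W (f i)) -> W (N%:R^-1 *: \sum_(i < N) f i).
Proof.
move=> N0 Wf; have := @norming_convex _ _ _ _ _ W_closed N (fun=> N%:R^-1) f.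
rewrite (_ : \sum_(j < N) _ *: f j = N%:R^-1 *: \sum_(i < N) f i); last first.
  rewrite scaler_sumr; apply: eq_bigr => i _; congr (_ *: _).
  by rewrite fmorphV; congr (_^-1); exact: ratr_nat.
apply.
  by move=> j jN; split; [rewrite invr_ge0 ler0n|exact: Wf].
by rewrite sumr_const card_ord -[_ *+ N]mulr_natl divff // pnatr_eq0 -lt0n.
Qed.

(** The elements of [W] that satisfy [P] form a norming set, so by minimality they
    exhaust [W].  In the last two cases the averages, respectively the functionals
    of the special sequence, satisfy [P] as well. *)
Lemma W_ind (P : (nat -> R) -> Prop) :
  (forall n, (0 < n)%N -> P (unit_vec R n)) ->
  (forall f, W f -> P f -> P (- f)) ->
  (forall f E, nat_interval E -> W f -> P f -> P (f \_ E)) ->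
  (forall d (c : nat -> rat) (f : nat -> nat -> R),
     (forall j, (j < d)%N -> [/\ 0 <= c j, W (f j) & P (f j)]) ->
     \sum_(j < d) c j = 1 -> P (\sum_(j < d) (ratr (c j) : R) *: f j)) ->
  (forall k f n, weighted_average (kavg k [set f | W f /\ P f]) f n -> P f) ->
  (forall d f g w (F : {set 'I_d}) lam e,
     special_data L1 sigma [set f | W f /\ P f] f g w F ->
     II_ok F lam e -> P (II_sum F lam e f g)) ->
  forall f, W f -> P f.
Proof.
move=> Pu Pn Pr Pc Pw PII f Wf; suff /Wf[] : closed [set f | W f /\ P f] by [].
have sW : [set f | W f /\ P f] `<=` W by move=> ? [].
split.
- by move=> g [/W_c00].
- move=> n n0; have Wu := W_unit n0; split; split=> //; first exact: Pu.
    exact: WN.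
  by apply: Pn => //; exact: Pu.
- by move=> g [Wg Pg]; split; [exact: WN|exact: Pn].
- by move=> g E nE [Wg Pg]; split; [exact: W_restr|exact: Pr].
- move=> d c g h c1; split.
    by apply: (norming_convex W_closed) => // j jd; have [? [? ?]] := h j jd.
  by apply: Pc => // j jd; have [? [? ?]] := h j jd.
- move=> g n h; split; last exact: (Pw true _ n).
  apply: (@W_weighted true _ n); apply: weighted_average_mono h => a m.
  exact: (@kavg_mono true).
- move=> g n h; split; last exact: (Pw false _ n).
  apply: (@W_weighted false _ n); apply: weighted_average_mono h => a m.
  exact: (@kavg_mono false).
- move=> d a b w F h; rewrite IIplus_sumE; have ok : II_ok F (fun=> 1) 1 by left.
  by split; [apply: W_II ok; exact: special_data_mono h|exact: PII h ok].
- move=> d a b w F lam h hl; rewrite IIminus_sumE.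
  have ok : II_ok F lam (-1) by right.
  by split; [apply: W_II ok; exact: special_data_mono h|exact: PII h ok].
Qed.

End Monotone.

(** * Restrictions of averages and functionals *)

Section Blocks.
Variable R : realType.
Implicit Types (f g x y : nat -> R).

Lemma sum_one_nonzero (I : finType) (P : pred I) (F : I -> R) (M : R) :
  0 <= M -> (forall i, P i -> `|F i| <= M) ->
  (forall i j, P i -> P j -> F i != 0 -> F j != 0 -> i = j) ->
  `|\sum_(i | P i) F i| <= M.
Proof.
move=> M0 FM F1; have [[i /andP[Pi Fi]]|h] := pselect (exists i, P i && (F i != 0)).
  rewrite (bigD1 i) //= big1 ?addr0; first exact: FM.
  move=> j /andP[Pj ji]; apply/eqP; apply: contraNT ji => Fj.
  by apply/eqP; exact: F1.
rewrite big1 ?normr0 // => i Pi; apply: contrapT => /eqP Fi; apply: h.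
by exists i; rewrite Pi.
Qed.

Lemma supp_opp f : supp (- f) = supp f.
Proof. by apply/funext => i; rewrite /supp /= vecN oppr_eq0. Qed.

Lemma minsuppN f : minsupp (- f) = minsupp f.
Proof. by rewrite /minsupp supp_opp. Qed.

Lemma maxsuppN f : maxsupp (- f) = maxsupp f.
Proof. by rewrite /maxsupp supp_opp. Qed.

Lemma succvN f g : succv f g -> succv (- f) (- g).
Proof. by rewrite /succv !supp_opp minsuppN maxsuppN. Qed.

Lemma block_lt d (f : nat -> nat -> R) : (forall q, (q < d)%N -> c00 (f q)) ->
  block_upto d f -> forall q r, (q < r < d)%N ->
  (maxsupp (f q) < minsupp (f r))%N.
Proof.
move=> cf bf q r /andP[qr rd]; elim: r qr rd => // r IH; rewrite ltnS leq_eqVlt.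
move=> /orP[/eqP ->|qr] rd; first by have /succvP[] := bf r rd.
have /succvP[f0 _ h] := bf r rd; apply: ltn_trans h.
apply: leq_trans (IH qr (ltnW rd)) _; apply: minsupp_maxsupp => //.
exact/cf/ltnW.
Qed.

Lemma block_disj d (f : nat -> nat -> R) : (forall q, (q < d)%N -> c00 (f q)) ->
  block_upto d f -> forall q r i, (q < d)%N -> (r < d)%N ->
  f q i != 0 -> f r i != 0 -> q = r.
Proof.
move=> cf bf; suff h q r i : (q < r < d)%N -> f q i != 0 -> f r i != 0 -> False.
  move=> q r i qd rd fq fr; case: (ltngtP q r) => // qr.
    by case: (h q r i) => //; rewrite qr.
  by case: (h r q i) => //; rewrite qr.
move=> /andP[qr rd] fq fr; have := @block_lt d f cf bf q r; rewrite qr rd => /(_ isT).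
have := maxsupp_ge (cf q (ltn_trans qr rd)) fq; have := minsupp_le fr.
lia.
Qed.

Lemma block_coord d (f : nat -> nat -> R) M i : 0 <= M ->
  (forall q, (q < d)%N -> c00 (f q)) -> block_upto d f ->
  (forall q, (q < d)%N -> `|f q i| <= M) -> `|(\sum_(q < d) f q) i| <= M.
Proof.
move=> M0 cf bf fM; rewrite vec_sum; apply: sum_one_nonzero => // [q _|q r _ _ fq fr].
  exact: fM.
by apply: ord_inj; exact: (block_disj cf bf _ _ fq fr).
Qed.

Lemma restr_restr f (E E' : set nat) : (f \_ E) \_ E' = f \_ (E `&` E').
Proof.
apply/funext => i; rewrite !restrE.
rewrite (_ : `[< (E `&` E') i >] = `[< E i >] && `[< E' i >]).
  by case: `[< E i >]; case: `[< E' i >].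
exact: asbool_and.
Qed.

Lemma restrN f (E : set nat) : (- f) \_ E = - (f \_ E).
Proof.
by apply/funext => i; rewrite vecN !restrE vecN; case: ifP; rewrite ?oppr0.
Qed.

Lemma restrZ (c : R) f (E : set nat) : (c *: f) \_ E = c *: (f \_ E).
Proof.
by apply/funext => i; rewrite vecZ !restrE vecZ; case: ifP; rewrite ?mulr0.
Qed.

Lemma restr_sum (I : Type) (r : seq I) (P : pred I) (F : I -> nat -> R) (E : set nat) :
  (\sum_(i <- r | P i) F i) \_ E = \sum_(i <- r | P i) (F i \_ E).
Proof.
apply/funext => j; rewrite vec_sum restrE vec_sum; case: ifP => h.
  by apply: eq_bigr => i _; rewrite restrE h.
by rewrite big1 // => i _; rewrite restrE h.
Qed.

Lemma restr_setT f : f \_ setT = f.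
Proof. by apply/funext => i; rewrite restrE; case: asboolP => //; case. Qed.

Lemma interval_setI (E E' : set nat) :
  nat_interval E -> nat_interval E' -> nat_interval (E `&` E').
Proof.
move=> nE nE' i j k [Ei E'i] [Ek E'k] ijk.
by split; [exact: (nE i j k)|exact: (nE' i j k)].
Qed.

Lemma interval_setT : nat_interval setT. Proof. by []. Qed.

Lemma signed_restr_patch (E E' : set nat) f g : nat_interval E' ->
  signed_restriction E f g -> signed_restriction (E `&` E') f (g \_ E').
Proof.
move=> nE' [nE h]; split; first exact: interval_setI.
by case: h => ->; rewrite ?restrN restr_restr; [left|right].
Qed.

Lemma signed_restrN (E : set nat) f g :
  signed_restriction E f g -> signed_restriction E f (- g).
Proof. by move=> [nE [->|->]]; split=> //; [right|left; rewrite opprK]. Qed.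

Lemma sum_filter_nth d (f : nat -> nat -> R) (p : pred nat) :
  (forall j, (j < d)%N -> ~~ p j -> f j = 0) ->
  let l := [seq j <- iota 0 d | p j] in
  \sum_(j < d) f j = \sum_(t < size l) f (nth 0%N l t).
Proof.
move=> f0 l; rewrite -(big_mkord xpredT f) -(big_mkord xpredT (fun t => f (nth 0%N l t))).
rewrite -(big_nth 0%N xpredT f) /l big_filter /index_iota subn0 [RHS]big_mkcond.
rewrite !big_seq; apply: eq_bigr => j; rewrite mem_iota /= add0n => jd.
by case: ifP => // /negbT /(f0 j jd).
Qed.

Lemma filter_iota_lt d (p : pred nat) q r :
  let l := [seq j <- iota 0 d | p j] in
  (q < r < size l)%N -> (nth 0%N l q < nth 0%N l r)%N.
Proof.
move=> l /andP[qr rl].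
have sl : sorted ltn l by apply: sorted_filter; [exact: ltn_trans|exact: iota_ltn_sorted].
by rewrite (sorted_ltn_nth ltn_trans 0%N sl) // inE // (ltn_trans qr).
Qed.

Lemma filter_iota_mem d (p : pred nat) q :
  let l := [seq j <- iota 0 d | p j] in
  (q < size l)%N -> (nth 0%N l q < d)%N /\ p (nth 0%N l q).
Proof.
by move=> l ql; have := mem_nth 0%N ql; rewrite mem_filter mem_iota => /andP[-> /andP[]].
Qed.

End Blocks.

Section NormingSetBasics.
Variables (R : realType) (s : nat -> R -> R) (hs : dense_in_sphere s).
Variables (L1 : set nat) (sigma : seq (nat -> R) -> nat).
Local Notation W := (norming_set s L1 sigma).
Local Notation kavg := (kavg s L1 sigma).
Implicit Types (f g x y : nat -> R).

Lemma type_IIN h A : type_II s L1 sigma W h A -> type_II s L1 sigma W (- h) A.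
Proof.
move=> [[d [f [g [w [F [E [h1 h2 h3]]]]]]]|
            [d [f [g [w [F [la [E [h1 h2 h3 h4]]]]]]]]]; [left|right].
  by exists d, f, g, w, F, E; split=> //; exact: signed_restrN.
by exists d, f, g, w, F, la, E; split=> //; exact: signed_restrN.
Qed.

Lemma type_II_restr h A E : nat_interval E -> type_II s L1 sigma W h A ->
  exists2 A', A' `<=` A & type_II s L1 sigma W (h \_ E) A'.
Proof.
move=> nE [[d [f [g [w [F [E0 [h1 h2 h3]]]]]]]|
            [d [f [g [w [F [la [E0 [h1 h2 h3 h4]]]]]]]]].
  exists [set w q | q in [set q : 'I_d |
               q \in F /\ ran (f q + g q) `&` (E0 `&` E) !=set0]].
    rewrite h3 => _ [q [qF [i [ri [Ei _]]]] <-]; exists q => //.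
    by split=> //; exists i; split.
  by left; exists d, f, g, w, F, (E0 `&` E); split=> //; exact: signed_restr_patch.
exists [set w q | q in [set q : 'I_d |
               q \in F /\ ran (f q - g q) `&` (E0 `&` E) !=set0]].
  rewrite h4 => _ [q [qF [i [ri [Ei _]]]] <-]; exists q => //.
  by split=> //; exists i; split.
by right; exists d, f, g, w, F, la, (E0 `&` E); split=> //; exact: signed_restr_patch.
Qed.

Lemma kavgN k a n : kavg k W a n -> kavg k W (- a) n.
Proof.
case: k => -[Wa]; last first.
  move=> [d [f [A [dn fG fb fE]]]]; split; first exact: WN.
  exists d, (fun j => - f j), A; split=> //.
    by move=> j jd; have [h1 h2] := fG j jd; split; [exact: WN|exact: type_IIN].
  by rewrite fE sumrN scalerN.
move=> [d [f [dn fG fb fE]]]; split; first exact: WN.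
exists d, (fun j => - f j); split=> //.
- by move=> j jd; apply: WN; apply: fG.
- by move=> q qd; exact/succvN/fb.
- by rewrite fE sumrN scalerN.
Qed.

Lemma kavg_restr k a n E : nat_interval E -> kavg k W a n -> kavg k W (a \_ E) n.
Proof.
move=> nE; case: k => -[Wa]; last first.
  move=> [d [f [A [dn fG fb fE]]]]; split; first exact: W_restr.
  have hA j : exists A', (j < d)%N -> A' `<=` A j /\ type_II s L1 sigma W (f j \_ E) A'.
    case: (ltnP j d) => jd; last by exists set0.
    by have [A' h1 h2] := type_II_restr nE (fG j jd).2; exists A'.
  have [A' hA'] := choice hA.
  exists d, (fun j => f j \_ E), A'; split=> //.
  - move=> j jd; split; last by have [] := hA' j jd.
    by apply: W_restr => //; have [] := fG j jd.
  - move=> i j /andP[ij jd]; rewrite -subset0.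
    have id := ltn_trans ij jd.
    have <- : A i `&` A j = set0 by apply: fb; rewrite ij jd.
    by apply: setISS; [have [] := hA' i id|have [] := hA' j jd].
  - by rewrite fE restrZ restr_sum.
move=> [d [f [/andP[d0 dn] fG fb fE]]]; split; first exact: W_restr.
have n0 : (0 < n)%N := leq_trans d0 dn.
pose p j := f j \_ E != 0; pose l := [seq j <- iota 0 d | p j].
have aE : a \_ E = n%:R^-1 *: \sum_(t < size l) (f (nth 0%N l t) \_ E).
  rewrite fE restrZ restr_sum; congr (_ *: _).
  rewrite (@sum_filter_nth _ d (fun j => f j \_ E) p) // => j jd.
  by rewrite negbK => /eqP.
have [l0|l0] := posnP (size l).
  exists 1%N, (fun=> 0); split=> //; first by move=> *; exact: W0.
  by rewrite big_ord_recl big_ord0 addr0 aE l0 big_ord0.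
exists (size l), (fun t => f (nth 0%N l t) \_ E); split=> //.
- rewrite l0 (leq_trans _ dn) //.
  by rewrite -[X in (_ <= X)%N](size_iota 0 d) size_filter count_size.
- move=> t tl; apply: W_restr => //; apply: fG.
  by have [] := @filter_iota_mem d p t tl.
- move=> t tl; have lt : (nth 0%N l t < nth 0%N l t.+1)%N.
    by apply: filter_iota_lt; rewrite ltnSn.
  have [ad pa] := @filter_iota_mem d p t (ltnW tl).
  have [bd pb] := @filter_iota_mem d p t.+1 tl.
  move: lt ad pa bd pb; rewrite -/l; move: (nth _ _ _) (nth _ _ _) => b a'.
  move=> lt ad pa bd pb; apply/succvP; split=> //.
  have cf q : (q < d)%N -> c00 (f q) by move=> /fG; exact: W_c00.
  have := @block_lt _ d f cf fb a' b; rewrite lt bd => /(_ isT).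
  have cb : c00 (f a') := cf a' ad.
  have := maxsuppP (c00_patch E cb) pa; rewrite restrE; case: asboolP => [_|_ /eqP//].
  have := minsuppP pb; rewrite restrE; case: asboolP => [_|_ /eqP//].
  by move=> /minsupp_le h1 /(maxsupp_ge cb) h2 h3; lia.
Qed.

Lemma special_lt G d (f g : nat -> nat -> R) w : G `<=` @c00 R -> special L1 sigma G d f g w ->
  forall q r, (q < r < d)%N -> (maxsupp (g q) < minsupp (f r))%N.
Proof.
move=> Gc [h1 h2 h3 _ _] q r /andP[qr rd]; elim: r qr rd => // r IH.
rewrite ltnS leq_eqVlt => /orP[/eqP<- rd|qr rd].
  by have /succvP[] := h3 _ rd.
have rd' := ltnW rd; have [/Gc cf /Gc cg _ _] := h1 _ rd'.
have /succvP[f0 g0 fg] := h2 _ rd'; have /succvP[_ _ gf] := h3 _ rd.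
have := IH qr rd'; have := minsupp_maxsupp cf f0.
by have := minsupp_maxsupp cg g0; lia.
Qed.

Lemma W_coord f : W f -> forall i, `|f i| <= 1.
Proof.
apply: (@W_ind _ _ _ _ (fun f => forall i, `|f i| <= 1)) => {f}.
- by move=> n n0 i; rewrite /unit_vec; case: (i == n); rewrite ?normr1 ?normr0.
- by move=> f _ h i; rewrite vecN normrN.
- by move=> f E _ _ h i; rewrite restrE; case: ifP => _; rewrite ?normr0.
- move=> d c f h c1 i; rewrite vec_sum; apply: le_trans (ler_norm_sum _ _ _) _.
  have <- : \sum_(j < d) (ratr (c j) : R) = 1 by rewrite -rmorph_sum c1 rmorph1.
  apply: ler_sum => j _; have [cj _ fj] := h j (ltn_ord j).
  by rewrite vecZ normrM ger0_norm ?ler0q // ler_piMr ?ler0q.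
- move=> k f n [n0 [d [a [z [d0 aA vf [ba _] ->]]]]] i.
  rewrite vecZ normrM ger0_norm ?exprn_ge0 ?invr_ge0 ?exprn_ge0 //.
  rewrite -[leRHS]mulr1; apply: ler_pM; first by rewrite invr_ge0 exprn_ge0.
  - exact: normr_ge0.
  - by rewrite invf_le1 ?exprn_gt0 // exprn_ege1 // ler1n.
  apply: block_coord => // q qd.
    by have [/W_c00] := kavg_in (aA q qd).
  by have [_ h] := kavg_in (aA q qd).
- move=> d f g w F lam e [h _] ok i; have [h1 h2 h3 _ _] := h.
  have la q : q \in F -> `|ratr (lam q) : R| <= 1.
    case: ok => [[-> _] _|[/dual_coef_le1 h' _]]; last exact: h'.
    by rewrite rmorph1 normr1.
  have e1 : `|e| <= 1 by case: ok => [[_ ->]|[_ ->]]; rewrite ?normrN normr1.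
  rewrite /II_sum vecZ normrM ger0_norm ?invr_ge0 // -[leRHS]mulr1; apply: ler_pM => //.
    by rewrite invf_le1 // ler1n.
  have cf q : (q < d)%N -> c00 (f q) by move=> /h1[[/W_c00]].
  have cg q : (q < d)%N -> c00 (g q) by move=> /h1[_ [/W_c00]].
  have fg q r j : (q < d)%N -> (r < d)%N -> (f q j != 0) || (g q j != 0) ->
      (f r j != 0) || (g r j != 0) -> q = r.
    suff H q' r' : (q' < r' < d)%N -> (f q' j != 0) || (g q' j != 0) ->
        (f r' j != 0) || (g r' j != 0) -> False.
      move=> qd rd; case: (ltngtP q r) => // qr a b; exfalso.
        by apply: (H q r) => //; rewrite qr.
      by apply: (H r q) => //; rewrite qr.
    move=> {q r} /andP[qr rd]; have qd := ltn_trans qr rd.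
    have lt : (maxsupp (g q') < minsupp (f r'))%N.
      by apply: (special_lt _ h) => [u [/W_c00]|]; rewrite // qr rd.
    have /succvP[f0 g0 fgq] := h2 _ qd; have /succvP[f0' g0' fgr] := h2 _ rd.
    have a1 : (f q' j != 0) || (g q' j != 0) -> (j <= maxsupp (g q'))%N.
      case/orP => [/(maxsupp_ge (cf _ qd))|/(maxsupp_ge (cg _ qd))//].
      by have := minsupp_maxsupp (cg _ qd) g0; lia.
    have a2 : (f r' j != 0) || (g r' j != 0) -> (minsupp (f r') <= j)%N.
      case/orP => [/minsupp_le//|/minsupp_le].
      by have := minsupp_maxsupp (cf _ rd) f0'; lia.
    by move=> /a1 b1 /a2 b2; lia.
  have fz (u v : R) : u + e * v != 0 -> (u != 0) || (v != 0).
    by apply: contraNT; rewrite negb_or !negbK => /andP[/eqP-> /eqP->]; rewrite mulr0 addr0.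
  rewrite vec_sum; apply: sum_one_nonzero => //.
    move=> q qF; rewrite vecZ normrM -[leRHS]mulr1; apply: ler_pM => //.
      exact: la.
    have [[_ Pf] [_ Pg] _ _] := h1 q (ltn_ord q).
    have qd := ltn_ord q; have /succvP[f0 g0 fgq] := h2 q qd.
    rewrite vecD vecZ; have [fq|fq] := eqVneq (f q i) 0.
      by rewrite fq add0r normrM -[leRHS]mulr1; apply: ler_pM.
    have [gq|gq] := eqVneq (g q i) 0; first by rewrite gq mulr0 addr0.
    have := maxsupp_ge (cf _ qd) fq; have := minsupp_le gq; lia.
  move=> q r _ _ /=; rewrite !vecZ !vecD !vecZ => a b; apply: ord_inj.
  apply: (fg q r i) => //; apply: fz.
    by move: a; rewrite mulf_eq0 negb_or => /andP[].
  by move: b; rewrite mulf_eq0 negb_or => /andP[].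
Qed.

End NormingSetBasics.

(** * Lists of averages and Schreier admissibility *)

Section SeqFacts.
Variable T : eqType.
Implicit Types (u : seq T) (v : seq (seq T)).

Lemma filter_flatten (p : pred T) v :
  [seq x <- flatten v | p x] = flatten [seq [seq x <- g | p x] | g <- v].
Proof. by elim: v => //= g v IH; rewrite filter_cat IH. Qed.

Lemma flatten_filter_nil v : flatten [seq g <- v | g != [::]] = flatten v.
Proof. by elim: v => //= -[|x g] v IH /=; rewrite IH. Qed.

Lemma pairwise_flatten_nth (r : rel T) v i j x y : pairwise r (flatten v) ->
  (i < j < size v)%N -> x \in nth [::] v i -> y \in nth [::] v j -> r x y.
Proof.
elim: v i j => [|g v IH] i j; first by rewrite ltn0 andbF.
rewrite /= pairwise_cat => /and3P[/allrelP gv _ pv].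
case: i j => [|i] [|j] //= ij xg yj; last exact: (IH i j).
apply: gv => //; apply/flattenP; exists (nth [::] v j) => //.
exact: mem_nth.
Qed.

Lemma pairwise_flatten_mem (r : rel T) v g : pairwise r (flatten v) ->
  g \in v -> pairwise r g.
Proof.
elim: v => //= h v IH; rewrite pairwise_cat => /and3P[_ ph pv].
by rewrite inE => /orP[/eqP->|/IH]; last exact.
Qed.

Lemma filter_split (r : rel T) (p : pred T) u : pairwise r u ->
  (forall x y, x \in u -> y \in u -> r x y -> p y -> p x) ->
  u = [seq x <- u | p x] ++ [seq x <- u | ~~ p x].
Proof.
elim: u => //= x u IH /andP[/allP xu pu] rp.
have rp' a b : a \in u -> b \in u -> r a b -> p b -> p a.
  by move=> au bu; apply: rp; rewrite inE ?au ?bu orbT.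
case: ifP => px /=; first by rewrite -IH.
have -> : [seq y <- u | p y] = [::].
  apply/eqP; rewrite -(negbK (_ == _)) -has_filter; apply/hasPn => y yu.
  apply/negP => py; move: px; rewrite (rp x y) // ?inE ?eqxx ?yu ?orbT //.
  exact: xu.
rewrite /=; congr (_ :: _); rewrite {1}(IH pu rp').
have -> : [seq y <- u | p y] = [::] => //.
apply/eqP; rewrite -(negbK (_ == _)) -has_filter; apply/hasPn => y yu.
apply/negP => py; move: px; rewrite (rp x y) // ?inE ?eqxx ?yu ?orbT //.
exact: xu.
Qed.

End SeqFacts.

Section Items.
Variables (R : realType) (s : nat -> R -> R) (hs : dense_in_sphere s).
Variables (L1 : set nat) (sigma : seq (nat -> R) -> nat).
Local Notation W := (norming_set s L1 sigma).
Local Notation kavg := (kavg s L1 sigma).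
Implicit Types (f x : nat -> R).

(** An average together with a size of it. *)
Definition item := ((nat -> R) * nat)%type.
Implicit Types (u : seq item) (v : seq (seq item)) (a b : item).

(** The relation between consecutive, hence between any two, averages of a very fast
    growing sequence. *)
Definition irel (a b : item) : bool :=
  [&& (maxsupp a.1 < minsupp b.1)%N, (2 ^ maxsupp a.1 < b.2)%N & (a.2 < b.2)%N].

(** A finite very fast growing sequence of nonzero averages of kind [k]. *)
Definition items_ok (k : bool) (G : set (nat -> R)) u : Prop :=
  (forall a, a \in u -> kavg k G a.1 a.2 /\ a.1 != 0) /\ pairwise irel u.

(** Schreier admissibility of a list of functionals, as a nesting of groups. *)
Fixpoint Adm (m : nat) u : Prop :=
  match m with
  | 0 => (size u <= 1)%N
  | m'.+1 => exists v : seq (seq item),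
      [/\ u = flatten v, forall a, a \in u -> (size v <= minsupp a.1)%N,
          [::] \notin v & forall g, g \in v -> Adm m' g]
  end.

Lemma Adm_nil m : Adm m [::].
Proof. by case: m => [|m] //=; exists [::]. Qed.

Lemma Adm_map_filter m u (F : item -> item) (p : pred item) :
  (forall a, a \in u -> p a -> (minsupp a.1 <= minsupp (F a).1)%N) ->
  Adm m u -> Adm m [seq F a | a <- u & p a].
Proof.
elim: m u => [|m IH] u uF /=.
  move=> u1; rewrite size_map; apply: leq_trans u1.
  by rewrite size_filter count_size.
move=> [v [uE vs vn vA]].
pose v' := [seq [seq F a | a <- g & p a] | g <- v].
exists [seq g <- v' | g != [::]]; split.
- rewrite flatten_filter_nil uE filter_flatten map_flatten; congr flatten.
  by rewrite -map_comp.
- move=> b /mapP[a]; rewrite mem_filter => /andP[pa au] ->.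
  apply: leq_trans (uF a au pa); apply: leq_trans (vs a au).
  by rewrite size_filter (leq_trans (count_size _ _)) // size_map.
- by rewrite mem_filter eqxx.
- move=> g; rewrite mem_filter => /andP[_ /mapP[h hv ->]].
  apply: IH; last exact: vA.
  by move=> a ah; apply: uF; rewrite uE; apply/flattenP; exists h.
Qed.

Lemma Adm_filter m u (p : pred item) : Adm m u -> Adm m [seq a <- u | p a].
Proof. by move=> /(@Adm_map_filter _ _ id p); rewrite map_id; apply. Qed.

Lemma Adm_up m u : (forall a, a \in u -> (0 < minsupp a.1)%N) ->
  Adm m u -> Adm m.+1 u.
Proof.
case: u => [|a u] u0 uA; first exact: Adm_nil.
exists [:: a :: u]; split=> //=; first by rewrite cats0.
by move=> g; rewrite inE => /eqP ->.
Qed.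

Lemma items_sub k G u u' : {subset u' <= u} -> pairwise irel u' ->
  items_ok k G u -> items_ok k G u'.
Proof. by move=> uu' pu' [h _]; split=> // a /uu' /h. Qed.

Lemma items_filter k G u (p : pred item) :
  items_ok k G u -> items_ok k G [seq a <- u | p a].
Proof.
move=> h; apply: items_sub (h).
  by move=> a; rewrite mem_filter => /andP[].
exact: pairwise_filter h.2.
Qed.

Lemma items_mono k G G' u : G `<=` G' -> items_ok k G u -> items_ok k G' u.
Proof.
move=> GG' [h pu]; split=> // a /h[ka a0]; split=> //; exact: kavg_mono ka.
Qed.

Lemma items_restr k u E : nat_interval E -> items_ok k W u ->
  let p a := a.1 \_ E != 0 in let F (a : item) : item := (a.1 \_ E, a.2) in
  items_ok k W [seq F a | a <- u & p a] /\
  (forall a, a \in u -> p a -> (minsupp a.1 <= minsupp (F a).1)%N).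
Proof.
move=> nE [h pu] p F.
have le a : a \in u -> p a -> (minsupp a.1 <= minsupp (F a).1)%N /\
    (maxsupp (F a).1 <= maxsupp a.1)%N.
  move=> /h[/kavg_in /W_c00 ca a0] pa; split.
    apply: minsupp_le; have := minsuppP pa; rewrite restrE.
    by case: asboolP => // _ /eqP.
  apply: maxsupp_ge => //; have := maxsuppP (c00_patch E ca) pa; rewrite restrE.
  by case: asboolP => // _ /eqP.
split; last by move=> a au /(le a au)[].
split.
  move=> b /mapP[a]; rewrite mem_filter => /andP[pa au] ->; split=> //.
  by apply: kavg_restr => //; have [] := h a au.
rewrite pairwise_map; apply: (@sub_in_pairwise _ (fun a => (a \in u) && p a) irel).
- move=> a b /andP[au pa] /andP[bu pb] /and3P[h1 h2 h3].
  have [_ le1] := le a au pa; have [le2 _] := le b bu pb.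
  apply/and3P; split=> //=.
    by apply: leq_ltn_trans le1 _; apply: leq_trans le2.
  by apply: leq_ltn_trans h2; rewrite leq_exp2l.
- by apply/allP => a; rewrite mem_filter andbC.
- exact: pairwise_filter.
Qed.

Lemma items_sign k u (e : item -> bool) : items_ok k W u ->
  let F (a : item) : item := (if e a then - a.1 else a.1, a.2) in
  items_ok k W [seq F a | a <- u] /\
  (forall a, a \in u -> minsupp (F a).1 = minsupp a.1).
Proof.
move=> [h pu] F; have mF a : minsupp (F a).1 = minsupp a.1.
  by rewrite /F /=; case: ifP => //; rewrite minsuppN.
have MF a : maxsupp (F a).1 = maxsupp a.1.
  by rewrite /F /=; case: ifP => //; rewrite maxsuppN.
split=> //; split.
  move=> b /mapP[a au ->]; have [ka a0] := h a au; rewrite /F /=.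
  by case: ifP => _; split=> //; [exact: kavgN|rewrite oppr_eq0].
rewrite pairwise_map; move: pu; apply: sub_pairwise => a b.
by rewrite /irel /= mF !MF.
Qed.

Lemma items_c00 k G u a : G `<=` @c00 R -> items_ok k G u -> a \in u -> c00 a.1.
Proof. by move=> Gc [h _] /h[/kavg_in /Gc]. Qed.

Lemma items_pos k G u a : G `<=` @c00 R -> items_ok k G u -> a \in u ->
  (0 < minsupp a.1)%N.
Proof.
move=> Gc h au; apply: minsupp_gt0; first exact: (items_c00 Gc h au).
by have [/(_ a au)[]] := h.
Qed.

Lemma schreier_Adm k G u m : G `<=` @c00 R -> items_ok k G u -> (0 < m)%N ->
  schreier m [set minsupp a.1 | a in [set` u]] -> Adm m u.
Proof.
move=> Gc; case: m => // m h _; elim: m u h => [|m IH] u h.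
  move=> [_ _ hF] /=; exists [seq [:: a] | a <- u]; split.
  - by elim: (u) => //= a l {1}->.
  - move=> a au; rewrite size_map.
    have lea : (least [set minsupp a.1 | a in [set` u]] <= minsupp a.1)%N.
      have ma : [set minsupp a.1 | a in [set` u]] (minsupp a.1) by exists a.
      by have [_] := leastP ma; apply.
    apply: leq_trans lea; rewrite -card_le_II; apply: card_le_trans hF.
    rewrite (_ : [set minsupp a.1 | a in [set` u]] =
      [set minsupp (nth a u i).1 | i in `I_(size u)]); last first.
      apply/seteqP; split=> [_ [b /= /(nthP a)[i iu <-] <-]|_ [i /= iu <-]].
        by exists i.
      by exists (nth a u i) => //=; exact: mem_nth.
    have e : ([set minsupp (nth a u i).1 | i in `I_(size u)] #= `I_(size u))%card.
      apply: inj_card_eq => i j; rewrite !inE /= => iu ju mij.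
      suff H i' j' : (i' < j' < size u)%N ->
        minsupp (nth a u i').1 = minsupp (nth a u j').1 -> False.
        case: (ltngtP i j) => // ij; exfalso.
          by apply: (H i j) => //; rewrite ij.
        by apply: (H j i) => //; rewrite ij.
      move=> /andP[ij' ju']; have iu' := ltn_trans ij' ju'.
      have : irel (nth a u i') (nth a u j') by move/(pairwiseP a): h.2; apply.
      move=> /and3P[lt1 _ _] e1; have mi := mem_nth a iu'.
      have le1 := minsupp_maxsupp (items_c00 Gc h mi) (h.1 _ mi).2.
      by have := leq_ltn_trans le1 lt1; rewrite e1 ltnn.
    by move: e; rewrite card_eq_sym card_eq_le => /andP[].
  - by apply/mapP => -[].
  - by move=> g /mapP[a _ ->].
move=> [n [Gs [/andP[n0 nG] GS Glt uG]]].
pose p j (a : item) := `[< Gs j (minsupp a.1) >].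
have Gu j i : (j < n)%N -> Gs j i -> exists2 a, a \in u & minsupp a.1 = i.
  move=> jn ji; have : [set minsupp a.1 | a in [set` u]] i by rewrite uG; exists j.
  by move=> [a /= au <-]; exists a.
have Gub j : (j < n)%N -> exists K, forall i, Gs j i -> (i <= K)%N.
  move=> jn; exists (\max_(a <- u) minsupp a.1) => i /(Gu _ _ jn)[a au <-].
  exact: (leq_bigmax_seq a).
have Gne j : (j < n)%N -> exists i, Gs j i.
  move=> jn; have := GS j jn; case: m {IH GS} => [[[i Gi] _ _]|m [k' [G' [/andP[k0 kl] _ _ ->]]]].
    by exists i.
  exists (least (G' 0%N)), 0%N => //=.
  have [i G0i] : exists i, G' 0%N i.
    apply: contrapT => hn; move: kl; rewrite leqNgt => /negP; apply.
    rewrite (_ : least _ = 0%N) // /least; case: xgetP => // i _ [G0i _].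
    by exfalso; apply: hn; exists i.
  by have [] := leastP G0i.
have Glt2 j j' i i' : (j < j' < n)%N -> Gs j i -> Gs j' i' -> (i < i')%N.
  move=> /andP[jj' jn']; elim: j' i' jj' jn' => // j' IHj i'.
  rewrite ltnS => jj' jn' Gi Gi'.
  have [_ lei'] := leastP Gi'; have lt := Glt j' jn'.
  have [K jK] := Gub j' (ltnW jn'); have [i0 Gi0] := Gne j' (ltnW jn').
  have [gi gmax] := greatestP Gi0 jK.
  apply: leq_trans (lei' _ Gi'); move: jj'; rewrite leq_eqVlt => /orP[/eqP jE|jj'].
    by apply: leq_ltn_trans lt; apply: gmax; rewrite -jE.
  by apply: ltn_trans lt; exact: (IHj _ jj' (ltnW jn')).
pose v := [seq [seq a <- u | p j a] | j <- iota 0 n].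
have uv : u = flatten v.
  suff H q : (q <= n)%N -> [seq a <- u | has (p^~ a) (iota 0 q)] =
      flatten [seq [seq a <- u | p j a] | j <- iota 0 q].
    rewrite /v -H //; apply/esym/all_filterP/allP => a au.
    have : [set minsupp a.1 | a in [set` u]] (minsupp a.1) by exists a.
    rewrite uG => -[j /= jn Gj]; apply/hasP; exists j; first by rewrite mem_iota.
    exact/asboolP.
  elim: q => [|q IHq] qn; first by rewrite /= filter_pred0.
  rewrite -(addn1 q) iotaD map_cat flatten_cat -IHq 1?ltnW //= add0n cats0.
  set w := [seq a <- u | has (p^~ a) (iota 0 q ++ [:: q])].
  have pw : pairwise irel w by apply: pairwise_filter h.2.
  have lt a b : irel a b -> a \in u -> b \in u -> (minsupp a.1 < minsupp b.1)%N.
    move=> /and3P[ab _ _] au bu; apply: leq_ltn_trans ab.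
    by apply: minsupp_maxsupp; [exact: (items_c00 Gc h au)|have [] := h.1 a au].
  rewrite (@filter_split _ irel (fun a => has (p^~ a) (iota 0 q)) w pw); last first.
    move=> a b; rewrite !mem_filter !has_cat => /andP[+ au] /andP[_ bu] ab.
    move=> /orP[//|/=]; rewrite orbF => /asboolP qa /hasP[j].
    rewrite mem_iota add0n => /andP[_ jq] /asboolP jb.
    have := lt _ _ ab au bu; have := @Glt2 j q _ _ _ jb qa; rewrite jq qn => /(_ isT).
    lia.
  congr (_ ++ _).
    rewrite -filter_predI; apply: eq_filter => a /=; rewrite has_cat.
    by case: (has _ (iota 0 q)).
  rewrite -filter_predI; apply: eq_filter => a /=; rewrite has_cat /= orbF.
  case: (boolP (p q a)) => [/asboolP qa|_]; last by rewrite orbF andNb.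
  rewrite orbT andbT; apply/negP => /hasP[j]; rewrite mem_iota add0n => /andP[_ jq].
  move=> /asboolP ja; have := @Glt2 j q _ _ _ ja qa; rewrite jq qn => /(_ isT).
  by rewrite ltnn.
exists v; split=> //.
- move=> a au; rewrite size_map size_iota.
  have [i0 G0i] := Gne 0%N n0; have [_ l0] := leastP G0i.
  have : [set minsupp a.1 | a in [set` u]] (minsupp a.1) by exists a.
  rewrite uG => -[j /= jn Gj]; apply: leq_trans nG _.
  case: (posnP j) => [j0|j0]; first by apply: l0; rewrite -j0.
  have [l1 _] := leastP G0i.
  by apply/ltnW/(@Glt2 0%N j) => //; rewrite j0.
- apply/mapP => -[j]; rewrite mem_iota add0n => /andP[_ jn] /esym/eqP.
  rewrite -(negbK (_ == _)) -has_filter => /hasPn hj.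
  have [i Gi] := Gne j jn; have [a au ai] := Gu j i jn Gi.
  by have := hj a au; rewrite /p ai; move/asboolP.
- move=> g /mapP[j]; rewrite mem_iota add0n => /andP[_ jn] ->.
  apply: IH; first exact: items_filter.
  suff -> : [set minsupp a.1 | a in [set` [seq a <- u | p j a]]] = Gs j by exact: GS.
  apply/seteqP; split=> [_ [a /= au <-]|i Gi].
    by move: au; rewrite mem_filter => /andP[/asboolP].
  have [a au ai] := Gu j i jn Gi; exists a => //=.
  by rewrite mem_filter au andbT; apply/asboolP; rewrite ai.
Qed.

Lemma Adm_schreier k G u m : G `<=` @c00 R -> items_ok k G u -> (0 < m)%N ->
  u != [::] -> Adm m u -> schreier m [set minsupp a.1 | a in [set` u]].
Proof.
move=> Gc; case: m => // m h _; elim: m u h => [|m IH] u h u0.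
  move=> [v [uE vs vn vA]] /=.
  have [a au] : exists a, a \in u by case: (u) u0 => // a l _; exists a; rewrite inE eqxx.
  have ma : [set minsupp a.1 | a in [set` u]] (minsupp a.1) by exists a.
  have [[b /= bu <-] lb] := leastP ma.
  split; first by exists (minsupp a.1).
    by move=> [c /= cu c0]; have := items_pos Gc h cu; rewrite c0.
  have us : size u = size v.
    rewrite uE; elim: (v) vn vA => //= g v' IHv; rewrite inE negb_or => /andP[g0 vn] vA.
    rewrite size_cat IHv //; last by move=> g' g'v; apply: vA; rewrite inE g'v orbT.
    have := vA g; rewrite inE eqxx => /(_ isT) /=.
    by case: g g0 {vA} => [|c [|c' g]].
  apply: (@card_le_trans _ _ _ `I_(size u)); last by rewrite card_le_II us; exact: vs.
  rewrite (_ : [set minsupp a.1 | a in [set` u]] =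
      [set minsupp (nth a u i).1 | i in `I_(size u)]); first exact: card_image_le.
  apply/seteqP; split=> [_ [c /= /(nthP a)[i iu <-] <-]|_ [i /= iu <-]].
    by exists i.
  by exists (nth a u i) => //=; exact: mem_nth.
move=> [v [uE vs vn vA]]; exists (size v), (fun j => [set minsupp a.1 | a in [set` nth [::] v j]]).
have vu j a : (j < size v)%N -> a \in nth [::] v j -> a \in u.
  by move=> jv aj; rewrite uE; apply/flattenP; exists (nth [::] v j) => //; exact: mem_nth.
have vne j : (j < size v)%N -> nth [::] v j != [::].
  by move=> jv; apply: contraNneq vn => <-; exact: mem_nth.
have vex j : (j < size v)%N -> exists a, a \in nth [::] v j.
  by move=> /vne; case: (nth _ _ _) => // a l _; exists a; rewrite inE eqxx.
have v0 : (0 < size v)%N by rewrite lt0n; apply: contraNneq u0 => /size0nil v0; rewrite uE v0.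
split.
- rewrite v0 /=; have [a a0] := vex 0%N v0.
  have ma : [set minsupp a.1 | a in [set` nth [::] v 0]] (minsupp a.1) by exists a.
  have [[b /= bu <-] lb] := leastP ma; apply: vs; exact: vu bu.
- move=> j jv; apply: IH; first apply: (items_sub _ _ h).
  + by move=> a; exact: vu.
  + by apply: (@pairwise_flatten_mem _ _ v); rewrite -?uE ?h.2 ?mem_nth.
  + exact: vne.
  + by apply: vA; exact: mem_nth.
- move=> j jv; have [a aj] := vex j (ltnW jv); have [b bj] := vex j.+1 jv.
  have ma : [set minsupp a.1 | a in [set` nth [::] v j]] (minsupp a.1) by exists a.
  have mb : [set minsupp a.1 | a in [set` nth [::] v j.+1]] (minsupp b.1) by exists b.
  have [[b' /= b'j <-] _] := leastP mb.
  have [|[a' /= a'j <-] _] := @greatestP _ _ (\max_(a <- u) minsupp a.1) ma.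
    by move=> _ [c /= cj <-]; apply: leq_bigmax_seq => //; apply: vu cj; exact: ltnW.
  have /and3P[ab _ _] : irel a' b'.
    by apply: (@pairwise_flatten_nth _ _ v j j.+1); rewrite -?uE ?h.2 ?ltnSn.
  apply: leq_ltn_trans ab; apply: minsupp_maxsupp.
    by apply: (items_c00 Gc h); apply: vu a'j; exact: ltnW.
  by have [] := h.1 a'; first by apply: vu a'j; exact: ltnW.
- apply/seteqP; split=> [_ [a /= au <-]|i [j /= jv [a /= aj <-]]].
    move: au; rewrite uE => /flattenP[g /(nthP [::])[j jv <-] ag].
    by exists j => //; exists a.
  by exists a => //=; exact: vu aj.
Qed.

Lemma items_weighted k G u n : G `<=` @c00 R -> items_ok k G u -> (0 < n)%N ->
  u != [::] -> Adm n u ->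
  weighted_average (kavg k G) (2 ^- n *: \sum_(a <- u) a.1) n.
Proof.
move=> Gc h n0 u0 uA; split=> //.
pose x0 : item := (0, 0%N).
have bu q : (q.+1 < size u)%N -> irel (nth x0 u q) (nth x0 u q.+1).
  by move=> qu; move/(pairwiseP x0): h.2; apply; rewrite ?inE // ltnW.
have bl : block_upto (size u) (fun q => (nth x0 u q).1).
  move=> q qu; apply/succvP; split.
  - by have [] := h.1 (nth x0 u q); first by apply: mem_nth; exact: ltnW.
  - by have [] := h.1 (nth x0 u q.+1); first by apply: mem_nth.
  - by have /and3P[] := bu q qu.
exists (size u), (fun q => (nth x0 u q).1), (fun q => (nth x0 u q).2); split.
- by rewrite lt0n size_eq0.
- by move=> q qu; have [] := h.1 (nth x0 u q); first exact: mem_nth.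
- by split=> // q qu; have /and3P[] := bu q qu.
- split=> //; suff -> : [set minsupp (nth x0 u q).1 | q in `I_(size u)] =
      [set minsupp a.1 | a in [set` u]] by exact: (Adm_schreier Gc h n0 u0 uA).
  apply/seteqP; split=> [_ [i /= iu <-]|_ [c /= /(nthP x0)[i iu <-] <-]].
    by exists (nth x0 u i) => //=; exact: mem_nth.
  by exists i.
- by rewrite (big_nth x0) big_mkord.
Qed.

Lemma weighted_items k G f n : G `<=` @c00 R -> weighted_average (kavg k G) f n ->
  exists u, [/\ items_ok k G u, Adm n u, u != [::], (0 < n)%N &
    f = 2 ^- n *: \sum_(a <- u) a.1].
Proof.
move=> Gc [n0 [d [a [z [d0 aA [ba vf] [_ ad] fE]]]]].
pose u : seq item := [seq (a q, z q) | q <- iota 0 d].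
have cf q : (q < d)%N -> c00 (a q) by move=> /aA /kavg_in /Gc.
have a0 q : (q < d)%N -> a q != 0.
  have pos : forall m i, schreier m.+1 i -> ~ i 0%N.
    elim=> [|m IH] i; first by move=> [].
    by move=> [k' [G' [_ hG _ ->]]] [j /= jk]; exact: IH (hG j jk).
  move=> qd; apply/eqP => aq0; case: n n0 ad {fE} => // m _ /pos; apply.
  exists q => //=; rewrite aq0 /minsupp /least; case: xgetP => // i _ [].
  by rewrite /supp /= eqxx.
have h : items_ok k G u.
  split=> [b /mapP[q]|].
    by rewrite mem_iota add0n => /andP[_ qd] ->; split; [exact: aA|exact: a0].
  rewrite pairwise_map; apply/(pairwiseP 0%N) => i j; rewrite !inE size_iota => id jd ij.
  rewrite !nth_iota // !add0n /irel /=.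
  have lt := @block_lt _ d a cf ba.
  rewrite lt ?ij //=; apply/andP; split.
    case: j jd ij => // j jd ij; have [h1 _] := vf j jd; apply: leq_ltn_trans h1.
    rewrite leq_exp2l //; move: ij; rewrite ltnS leq_eqVlt => /orP[/eqP->//|ij].
    have := lt i j; rewrite ij (ltnW jd) => /(_ isT) /ltnW /leq_trans; apply.
    by apply: minsupp_maxsupp; [apply: cf|apply: a0]; exact: ltnW.
  elim: j jd ij => // j IHj jd; rewrite ltnS leq_eqVlt => /orP[/eqP->|ij].
    by have [] := vf j jd.
  by apply: ltn_trans (IHj (ltnW jd) ij) _; have [] := vf j jd.
exists u; split=> //.
- apply: (schreier_Adm Gc h n0); suff -> : [set minsupp b.1 | b in [set` u]] =
    [set minsupp (a q) | q in `I_d] by [].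
  apply/seteqP; split=> [_ [b /= /mapP[q + bE] <-]|_ [q /= qd <-]].
    by rewrite mem_iota add0n bE => /andP[_ qd]; exists q.
  by exists (a q, z q) => //=; apply/mapP; exists q; rewrite ?mem_iota.
- by rewrite -size_eq0 size_map size_iota -lt0n.
- rewrite fE big_map; congr (_ *: _).
  by rewrite -(big_mkord xpredT a) /index_iota subn0.
Qed.

End Items.

(** * Functionals of type I and the Tsirelson induction *)

Section Norming.
Variables (R : realType) (s : nat -> R -> R) (hs : dense_in_sphere s).
Variables (L1 : set nat) (sigma : seq (nat -> R) -> nat).
Local Notation W := (norming_set s L1 sigma).
Local Notation kavg := (kavg s L1 sigma).
Local Notation items_ok := (items_ok s L1 sigma).
Local Notation item := (item R).
Implicit Types (f x : nat -> R) (u : seq item) (a b : item).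

Definition bnd x (C : R) : Prop := forall f, W f -> `|pairing f x| <= C.

Lemma Wc00 : W `<=` @c00 R.
Proof. by move=> f /W_c00. Qed.

Lemma pairing_l1 f x c C h : 0 <= c -> (forall i, `|f i| <= c) ->
  0 <= C -> (forall i, `|x i| <= C) ->
  (forall i, x i != 0 -> (0 < i <= h)%N) -> `|pairing f x| <= c * (C * h%:R).
Proof.
move=> c0 fc C0 xC xh; rewrite (@pairing_trunc _ h.+1); last first.
  by move=> i hi; apply: contraTeq hi => /xh; lia.
rewrite big_ord_recl; have -> : x (@ord0 h) = 0.
  by apply: contrapT => /eqP /xh.
rewrite mulr0 add0r; apply: le_trans (ler_norm_sum _ _ _) _.
have -> : c * (C * h%:R) = \sum_(i < h) c * C.
  by rewrite sumr_const card_ord -[RHS]mulr_natr mulrA.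
by apply: ler_sum => i _; rewrite normrM; apply: ler_pM.
Qed.

Lemma bnd_coord x C : c00 x -> bnd x C -> forall i, `|x i| <= C.
Proof.
move=> cx xC i; have [->|i0] := posnP i.
    by rewrite cx.1 normr0; exact: le_trans (normr_ge0 _) (xC _ (@W0 _ s L1 sigma)).
by have := xC _ (@W_unit _ s L1 sigma _ i0); rewrite pairing_unit.
Qed.

Lemma items_coord k u M i : 0 <= M -> items_ok k W u ->
  (forall a, a \in u -> `|a.1 i| <= M) -> `|(\sum_(a <- u) a.1) i| <= M.
Proof.
move=> M0 h uM; rewrite vec_sum; elim: u h uM => [|a u IH] h uM.
  by rewrite big_nil normr0.
rewrite big_cons; have [ai|ai] := eqVneq (a.1 i) 0.
  rewrite ai add0r; apply: IH.
    by apply: items_sub (h) => [b bu|]; [rewrite inE bu orbT|have /= /andP[] := h.2].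
  by move=> b bu; apply: uM; rewrite inE bu orbT.
rewrite big_seq big1 ?addr0; first by apply: uM; rewrite inE eqxx.
move=> b bu; apply/eqP/contraT => bi.
have /= /andP[/allP au _] := h.2; have /and3P[ab _ _] := au b bu.
have ca : c00 a.1 by apply: (items_c00 Wc00 h); rewrite inE eqxx.
by have := maxsupp_ge ca ai; have := minsupp_le bi; lia.
Qed.

Lemma weighted_W k u n : items_ok k W u -> (0 < n)%N -> Adm n u ->
  W (2 ^- n *: \sum_(a <- u) a.1).
Proof.
move=> h n0 uA; have [->|u0] := eqVneq u [::].
  by rewrite big_nil scaler0; exact: W0.
by apply: (@W_weighted _ _ _ _ k _ n); apply: items_weighted; rewrite //; exact: Wc00.
Qed.

Lemma type_I_items k f n : type_I (kavg k W) f n ->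
  exists u, [/\ items_ok k W u, Adm n u, (0 < n)%N & f = 2 ^- n *: \sum_(a <- u) a.1].
Proof.
move=> [g [E [/(weighted_items Wc00)[u [h uA u0 n0 gE]] [nE fE]]]].
have [h' le] := items_restr nE h.
pose p (a : item) := a.1 \_ E != 0; pose F (a : item) : item := (a.1 \_ E, a.2).
have uA' : Adm n [seq F a | a <- u & p a] by exact: Adm_map_filter.
have gr : g \_ E = 2 ^- n *: \sum_(a <- [seq F a | a <- u & p a]) a.1.
  rewrite gE restrZ restr_sum big_map big_filter; congr (_ *: _).
  rewrite [RHS]big_mkcond; apply: eq_bigr => a _.
  by case: ifP => // /negbT; rewrite negbK => /eqP.
case: fE => ->; first by exists [seq F a | a <- u & p a].
have [h2 m2] := items_sign (fun=> true) h'; move: h2 m2 => /= h2 m2.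
exists [seq ((- a.1, a.2) : item) | a <- [seq F a | a <- u & p a]]; split=> //.
  rewrite -[X in map _ X]filter_predT; apply: Adm_map_filter uA'.
  by move=> a _ _ /=; rewrite minsuppN.
by rewrite gr (big_map (fun a : item => (- a.1, a.2))) /= sumrN scalerN.
Qed.

Lemma type_I_W k f n : type_I (kavg k W) f n -> W f.
Proof. by move=> /type_I_items[u [h uA n0 ->]]; exact: weighted_W h _ _. Qed.

Lemma kavg_coord_le1 k u a i : items_ok k W u -> a \in u -> `|a.1 i| <= 1.
Proof. by move=> h au; have [/kavg_in /(W_coord hs) ] := h.1 a au. Qed.

Lemma type_I_coord k f n : type_I (kavg k W) f n -> forall i, `|f i| <= 2 ^- n.
Proof.
move=> /type_I_items[u [h uA n0 ->]] i.
rewrite vecZ normrM ger0_norm ?invr_ge0 ?exprn_ge0 //.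
rewrite -[leRHS]mulr1; apply: ler_wpM2l; first by rewrite invr_ge0 exprn_ge0.
by apply: (@items_coord k u 1 i ler01 h) => // a au; exact: (kavg_coord_le1 _ h au).
Qed.

Lemma alpha_coord (a : nat -> R) n : alpha_average W a n -> forall i, `|a i| <= n%:R^-1.
Proof.
move=> [Wa [d [f [/andP[d0 dn] fW fb ->]]]] i.
rewrite vecZ normrM ger0_norm ?invr_ge0 //.
rewrite -[leRHS]mulr1; apply: ler_wpM2l; first by rewrite invr_ge0.
apply: block_coord => // q qd; first by apply: (@Wc00); exact: fW.
exact: (W_coord hs (fW q qd)).
Qed.

Lemma kavg_size_gt0 k (a : nat -> R) n : kavg k W a n -> (0 < n)%N.
Proof.
by case: k => -[_ [d [f]]] => [[/andP[/leq_trans h /h]]|[A [/andP[/leq_trans h /h]]]].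
Qed.

Lemma items_sum_le k u m x C : items_ok k W u -> Adm m u -> bnd x C -> c00 x ->
  \sum_(a <- u) `|pairing a.1 x| <= 2 ^+ m * C.
Proof.
move=> h uA xC cx; have C0 : 0 <= C := le_trans (normr_ge0 _) (xC _ (@W0 _ s L1 sigma)).
case: m uA => [|m uA].
  case: u h => [|a [|b u]] //= h _; rewrite ?big_nil ?mulr_ge0 //.
  rewrite big_cons big_nil addr0 expr0 mul1r; apply: xC.
  by have [ka _] := h.1 a (mem_head _ _); exact: kavg_in ka.
pose e (a : item) := pairing a.1 x < 0.
pose F (a : item) : item := (if e a then - a.1 else a.1, a.2).
pose u' := [seq F a | a <- u]; have [h2 m2] := items_sign e h.
have {}h2 : items_ok k W u' := h2.
have : `|pairing (2 ^- m.+1 *: \sum_(a <- u') a.1) x| <= C.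
  apply: xC; apply: (weighted_W h2 (ltn0Sn m)).
  have := @Adm_map_filter _ m.+1 u F predT; rewrite filter_predT; apply; last exact: uA.
  by move=> a au _; rewrite [leqRHS](m2 a au).
rewrite pairingZl // pairing_suml // big_map normrM.
rewrite [X in X * _]ger0_norm ?invr_ge0 ?exprn_ge0 // mulrC ler_pdivrMr ?exprn_gt0 //.
rewrite mulrC; apply: le_trans; apply: le_trans (ler_norm _); apply: ler_sum => a _ /=.
rewrite /e; case: ltP => h0; first by rewrite ltr0_norm // pairingNl.
by rewrite ger0_norm.
Qed.

Definition isum u : R := \sum_(a <- u) a.2%:R^-1.

Lemma isum_ge0 u : 0 <= isum u.
Proof. by apply: sumr_ge0 => a _; rewrite invr_ge0. Qed.

Lemma isum_tail k u h : items_ok k W u ->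
  (forall a, a \in u -> (2 ^ h < a.2)%N && (h < maxsupp a.1)%N) ->
  isum u <= 2 * 2 ^- h.
Proof.
elim: u h => [|a u IH] h ok uh; first by rewrite /isum big_nil mulr_ge0 ?invr_ge0 ?exprn_ge0.
rewrite /isum big_cons; have /andP[ah mh] := uh a (mem_head _ _).
have ok' : items_ok k W u.
  by apply: items_sub (ok) => [b bu|]; [rewrite inE bu orbT|have /= /andP[] := ok.2].
have le2 : isum u <= 2 * 2 ^- h.+1.
  apply: IH => // b bu; have /= /andP[/allP au _] := ok.2.
  have /and3P[ab ab2 _] := au b bu.
  have bu' : b \in a :: u by rewrite inE bu orbT.
  have mb : (minsupp b.1 <= maxsupp b.1)%N.
    by apply: minsupp_maxsupp; [exact: (items_c00 Wc00 ok)|have [] := ok.1 b bu'].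
  apply/andP; split; last by lia.
  by apply: leq_ltn_trans ab2; rewrite leq_exp2l.
have le1 : a.2%:R^-1 <= 2 ^- h :> R.
  rewrite lef_pV2 ?posrE ?exprn_gt0 // ?ltr0n ?(leq_ltn_trans _ ah) //.
  by rewrite -natrX ler_nat ltnW.
apply: le_trans (lerD le1 le2) _.
have -> : 2 ^- h.+1 = 2^-1 * 2 ^- h :> R by rewrite exprS invfM.
by rewrite mulrA divff // mul1r [leRHS]mulrDl mul1r.
Qed.

(** Only the first average meeting a vector supported beyond [h] can have a
    size that is not large compared with [h]. *)
Lemma first_touch k u h : items_ok k W u ->
  exists o u', [/\ [seq a <- u | (h < maxsupp a.1)%N] = o ++ u', (size o <= 1)%N &
    isum u' <= 2 ^- h].
Proof.
move=> ok; have ok' := items_filter (fun a : item => (h < maxsupp a.1)%N) ok.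
case E : [seq a <- u | (h < maxsupp a.1)%N] ok' => [|a u'] ok'.
  by exists [::], [::]; split=> //; rewrite /isum big_nil invr_ge0 exprn_ge0.
exists [:: a], u'; split=> //.
have ok2 : items_ok k W u'.
  by apply: items_sub (ok') => [b bu|]; [rewrite inE bu orbT|have /= /andP[] := ok'.2].
have ha : (h < maxsupp a.1)%N.
  by have := mem_head a u'; rewrite -E mem_filter => /andP[].
apply: le_trans (@isum_tail k u' h.+1 ok2 _) _; last first.
  by rewrite exprS invfM mulrA divff // mul1r.
move=> b bu; have /= /andP[/allP au _] := ok'.2; have /and3P[ab ab2 _] := au b bu.
have bu' : b \in a :: u' by rewrite inE bu orbT.
have mb : (minsupp b.1 <= maxsupp b.1)%N.
  by apply: minsupp_maxsupp; [exact: (items_c00 Wc00 ok')|have [] := ok'.1 b bu'].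
apply/andP; split; last by lia.
by apply: leq_ltn_trans ab2; rewrite leq_exp2l.
Qed.

Lemma group_bounds k u a0 a : items_ok k W u -> a \in u ->
  (minsupp (head a0 u).1 <= minsupp a.1)%N /\ (maxsupp a.1 <= maxsupp (last a0 u).1)%N.
Proof.
move=> ok au; split.
  case: u ok au => // b u ok; rewrite inE => /orP[/eqP->//|au] /=.
  have /= /andP[/allP bu _] := ok.2; have /and3P[ba _ _] := bu a au.
  apply/ltnW/(leq_ltn_trans _ ba)/minsupp_maxsupp.
    by apply: (items_c00 Wc00 ok); exact: mem_head.
  by have [] := ok.1 b (mem_head _ _).
case/lastP: u ok au => // u b ok; rewrite mem_rcons inE last_rcons => /orP[/eqP->//|au].
have := ok.2; rewrite -cats1 pairwise_cat => /and3P[/allrelP h _ _].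
have /and3P[ab _ _] := h a b au (mem_head _ _).
apply/ltnW/(leq_trans ab)/minsupp_maxsupp.
  by apply: (items_c00 Wc00 ok); rewrite mem_rcons inE eqxx.
by have [] := ok.1 b; rewrite // mem_rcons inE eqxx.
Qed.

Lemma big_double (V : zmodType) k (G : nat -> V) :
  \sum_(t < k.*2) G t = \sum_(t < k) (G t.*2 + G t.*2.+1).
Proof.
elim: k => [|k IH]; first by rewrite !big_ord0.
by rewrite doubleS !big_ord_recr /= IH addrA.
Qed.

(** Finitely many successive functionals, the [i]-th one being supported in
    [[st i, en i]]. *)
Definition W_family k (g : nat -> nat -> R) (st en : nat -> nat) : Prop :=
  [/\ forall i, (i < k)%N -> W (g i),
      forall i j, (i < k)%N -> g i j != 0 -> (st i <= j <= en i)%N &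
      forall i j, (i < j < k)%N -> (en i < st j)%N].

Lemma II_coef_le1 d (F : {set 'I_d}) lam e (q : 'I_d) : II_ok s F lam e ->
  q \in F -> `|lam q| <= 1.
Proof.
move=> [[-> _]|[h _]] qF; first by rewrite normr1.
have := dual_coef_le1 hs h qF; rewrite -(ratr_norm R) -(rmorph1 (ratr : rat -> R)).
by rewrite ler_rat.
Qed.

(** A type I functional of weight [n + 1] is half the sum of a Schreier family
    of functionals of weight [n], and a type II functional is half the sum of a
    Schreier family as well; hence [W] is contained in the norming set of
    Tsirelson space. *)
Lemma tsirelson_ind (P : (nat -> R) -> Prop) :
  (forall n, (0 < n)%N -> P (unit_vec R n)) ->
  (forall f, W f -> P f -> P (- f)) ->
  (forall f E, nat_interval E -> W f -> P f -> P (f \_ E)) ->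
  (forall d (c : nat -> rat) (f : nat -> nat -> R),
     (forall j, (j < d)%N -> [/\ 0 <= c j, W (f j) & P (f j)]) ->
     \sum_(j < d) c j = 1 -> P (\sum_(j < d) (ratr (c j) : R) *: f j)) ->
  (forall k (g : nat -> nat -> R) (st en : nat -> nat),
     W_family k g st en -> (forall i, (i < k)%N -> (k <= st i)%N) ->
     W (2^-1 *: \sum_(i < k) g i) -> P (2^-1 *: \sum_(i < k) g i)) ->
  forall f, W f -> P f.
Proof.
move=> Pu Pn Pr Pc Ph; have sW : [set f | W f /\ P f] `<=` W by move=> ? [].
apply: W_ind => //.
- move=> k f n wf.
  have {}wf : weighted_average (kavg k W) f n.
    by apply: weighted_average_mono wf => a m; exact: kavg_mono.
  have [u [ok uA u0 n0 ->]] := weighted_items Wc00 wf.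
  case: n n0 uA {wf} => // m _ [v [uE vs vn vA]].
  pose a0 : item := (0, 0%N).
  have mv j : (j < size v)%N -> nth [::] v j \in v by exact: mem_nth.
  have okv j : (j < size v)%N -> items_ok k W (nth [::] v j).
    move=> jv; apply: items_sub (ok).
      by move=> a aj; rewrite uE; apply/flattenP; exists (nth [::] v j) => //; exact: mv.
    by apply: (@pairwise_flatten_mem _ _ v); rewrite -?uE ?ok.2 ?mv.
  have ne j : (j < size v)%N -> nth [::] v j != [::].
    by move=> jv; apply: contraNneq vn => <-; exact: mv.
  have hd j : (j < size v)%N -> head a0 (nth [::] v j) \in nth [::] v j.
    by move=> /ne; case: (nth _ _ _) => //= a l _; exact: mem_head.
  have la j : (j < size v)%N -> last a0 (nth [::] v j) \in nth [::] v j.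
    by move=> /ne; case: (nth _ _ _) => //= a l _; exact: mem_last.
  have inu j a : (j < size v)%N -> a \in nth [::] v j -> a \in u.
    by move=> jv aj; rewrite uE; apply/flattenP; exists (nth [::] v j) => //; exact: mv.
  pose g j := 2 ^- m *: \sum_(a <- nth [::] v j) a.1.
  have Wf : W (2 ^- m.+1 *: \sum_(a <- u) a.1).
    by apply: (weighted_W ok (ltn0Sn m)); exists v.
  move: Wf; have -> : 2 ^- m.+1 *: \sum_(a <- u) a.1 = 2^-1 *: \sum_(j < size v) g j.
    rewrite uE big_flatten (big_nth [::]) big_mkord exprS invfM -scalerA.
    by congr (_ *: _); rewrite scaler_sumr.
  apply: (Ph _ g (fun j => minsupp (head a0 (nth [::] v j)).1)
                 (fun j => maxsupp (last a0 (nth [::] v j)).1)).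
    split.
    + move=> j jv; rewrite /g; case: (posnP m) => m0; last first.
        by apply: (weighted_W (okv j jv)) => //; apply: vA; exact: mv.
      have := vA _ (mv j jv); have := ne j jv; have := (okv j jv).1; rewrite m0.
      case: (nth _ _ _) => [|a [|? ?]] //= h _ _.
      rewrite expr0 invr1 scale1r big_cons big_nil addr0.
      by have [/kavg_in] := h a (mem_head _ _).
    + move=> j i jv; rewrite /g vecZ mulf_eq0 negb_or => /andP[_].
      rewrite vec_sum; have [//|H] := pselect ((minsupp (head a0 (nth [::] v j)).1 <= i <= maxsupp (last a0 (nth [::] v j)).1)%N).
      rewrite big_seq big1 ?eqxx // => a aj; apply: contrapT => /eqP ai; apply: H.
      have [h1 h2] := group_bounds a0 (okv j jv) aj.
      have := minsupp_le ai; have := maxsupp_ge (items_c00 Wc00 (okv j jv) aj) ai; lia.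
    + move=> i j /andP[ij jv]; have iv := ltn_trans ij jv.
      have /and3P[] // : irel (last a0 (nth [::] v i)) (head a0 (nth [::] v j)).
      by apply: (@pairwise_flatten_nth _ _ v i j); rewrite -?uE ?ok.2 ?la ?hd ?ij.
  by move=> j jv; apply: vs; exact: (inu j _ jv (hd j jv)).
- move=> d f g w F lam e /(special_data_mono sW) sp0 ok.
  have [sp [q0 q0F [q0min Fq0]]] := sp0.
  have [h1 h2 h3 _ _] := sp.
  pose l := enum F; have sl : size l = #|F| by rewrite cardE.
  pose q t := nth q0 l t.
  have qF t : (t < size l)%N -> q t \in F.
    by move=> tl; have := mem_nth q0 tl; rewrite mem_enum.
  have qlt t t' : (t < t' < size l)%N -> (q t < q t')%N.
    move=> tt'; have sq : sorted (fun i j : 'I_d => (i < j)%N) l.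
      rewrite /l /enum_mem; apply: sorted_filter; first by move=> a b c; exact: ltn_trans.
      have := iota_ltn_sorted 0 d; rewrite -val_enum_ord sorted_map.
      by rewrite enumT.
    have tr : transitive (fun i j : 'I_d => (i < j)%N) by move=> a b c; exact: ltn_trans.
    have /andP[ab bl] := tt'.
    by apply: (sorted_ltn_nth tr q0 sq); rewrite ?inE //; exact: ltn_trans ab bl.
  have W1 t : (t < size l)%N -> W ((ratr (lam (q t)) : R) *: f (q t)).
    move=> tl; apply: W_scale; first by apply: II_coef_le1 ok _; exact: qF.
    by have [] := h1 (q t) (ltn_ord _).
  have W2 t : (t < size l)%N -> W ((ratr (lam (q t)) : R) *: (e *: g (q t))).
    move=> tl; have [_ Wg _ _] := h1 (q t) (ltn_ord (q t)).
    apply: W_scale; first by apply: II_coef_le1 ok _; exact: qF.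
    by case: ok => [[_ ->]|[_ ->]]; rewrite ?scale1r ?scaleN1r //; exact: WN.
  pose G i := if odd i then (ratr (lam (q i./2)) : R) *: (e *: g (q i./2))
              else (ratr (lam (q i./2)) : R) *: f (q i./2).
  pose st i := if odd i then minsupp (g (q i./2)) else minsupp (f (q i./2)).
  pose en i := if odd i then maxsupp (g (q i./2)) else maxsupp (f (q i./2)).
  have Wf := W_II sp0 ok; move: Wf.
  have -> : II_sum F lam e f g = 2^-1 *: \sum_(i < (size l).*2) G i.
    congr (_ *: _); rewrite big_double -big_enum /= (big_nth q0) big_mkord.
    apply: eq_bigr => t _.
    by rewrite /G /= odd_double /= uphalf_double doubleK -scalerDr.
  have lt2 i : (i < (size l).*2)%N -> (i./2 < size l)%N.
    by move=> h; rewrite ltn_half_double.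
  have cf t : (t < d)%N -> c00 (f t) by move=> /h1[/W_c00].
  have cg t : (t < d)%N -> c00 (g t) by move=> /h1[_ /W_c00].
  apply: (Ph _ G st en).
    split.
    + by move=> i /lt2 il; rewrite /G; case: ifP => _; [exact: W2|exact: W1].
    + move=> i j /lt2 il; rewrite /G /st /en; case: ifP => _; rewrite !vecZ mulf_eq0 negb_or => /andP[_].
        rewrite mulf_eq0 negb_or => /andP[_ gj].
        by rewrite minsupp_le // maxsupp_ge //; exact: cg.
      by move=> fj; rewrite minsupp_le // maxsupp_ge //; exact: cf.
    + move=> i j /andP[ij jl]; have jl' := lt2 j jl.
      have il' := lt2 i (ltn_trans ij jl).
      have /succvP[fi0 gi0 fgi] := h2 (q i./2) (ltn_ord _).
      have /succvP[fj0 gj0 fgj] := h2 (q j./2) (ltn_ord _).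
      have : (i./2 <= j./2)%N by rewrite half_leq // ltnW.
      rewrite leq_eqVlt => /orP[/eqP ijh|ijh].
        move: ij; rewrite -{1}(odd_double_half i) -{1}(odd_double_half j) ijh.
        by rewrite /en /st ijh; case: (odd i); case: (odd j) => /= lt; [lia|lia|exact: fgj|lia].
      have := special_lt Wc00 sp (q := q i./2) (r := q j./2).
      rewrite qlt ?ijh ?ltn_ord // => /(_ isT) lt.
      have a1 : (en i <= maxsupp (g (q i./2)))%N.
        rewrite /en; case: ifP => // _; apply/ltnW/(leq_trans fgi)/minsupp_maxsupp => //.
        exact: cg.
      have a2 : (minsupp (f (q j./2)) <= st j)%N.
        rewrite /st; case: ifP => // _; apply/ltnW/(leq_ltn_trans _ fgj)/minsupp_maxsupp => //.
        exact: cf.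
      by lia.
  move=> i /lt2 il; rewrite -mul2n sl; apply: leq_trans Fq0 _.
  have /succvP[fi0 gi0 fgi] := h2 (q i./2) (ltn_ord _).
  have a2 : (minsupp (f (q i./2)) <= st i)%N.
    rewrite /st; case: ifP => // _; apply/ltnW/(leq_ltn_trans _ fgi)/minsupp_maxsupp => //.
    exact: cf.
  apply: leq_trans a2.
  have := q0min _ (qF _ il); rewrite leq_eqVlt => /orP[/eqP <-//|lt].
  have /succvP[f00 g00 fg0] := h2 q0 (ltn_ord _).
  have := special_lt Wc00 sp (q := q0) (r := q i./2).
  rewrite lt ltn_ord => /(_ isT) lt'.
  have := minsupp_maxsupp (cf q0 (ltn_ord _)) f00.
  by have := minsupp_maxsupp (cg q0 (ltn_ord _)) g00; lia.
Qed.

End Norming.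

(** * Iterated averages *)

Section Trees.
Variables (R : realType) (s : nat -> R -> R) (hs : dense_in_sphere s).
Variables (L1 : set nat) (sigma : seq (nat -> R) -> nat).
Local Notation W := (norming_set s L1 sigma).
Local Notation kavg := (kavg s L1 sigma).
Local Notation items_ok := (items_ok s L1 sigma).
Local Notation bnd := (bnd s L1 sigma).
Local Notation W_family := (W_family s L1 sigma).
Local Notation item := (item R).
Implicit Types (f x : nat -> R) (u : seq item).

Lemma W_family_restr k g st en E : nat_interval E -> W_family k g st en ->
  W_family k (fun i => g i \_ E) st en.
Proof.
move=> nE [h1 h2 h3]; split=> // i; first by move=> ik; apply: W_restr => //; exact: h1.
move=> j ik; rewrite restrE; case: asboolP => [_|_ /eqP//]; exact: h2.
Qed.

(** A family of successive functionals tested on a vector supported in [(h, hi]]: one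
    of them may start before [h], the others have to start inside. *)
Lemma sum_cross l (st en : nat -> nat) (phi : nat -> R) (r K : R) h hi :
  0 <= r -> 0 <= K ->
  (forall t, (t < l)%N -> (en t <= h)%N || (hi < st t)%N -> phi t = 0) ->
  (forall t, (t < l)%N -> (st t <= h)%N -> phi t <= r) ->
  (forall t, (t < l)%N -> phi t <= K) ->
  (forall t t', (t < t' < l)%N -> (en t < st t')%N) ->
  \sum_(t < l) phi t <= r + \sum_(t < l) (if (h < st t <= hi)%N then K else 0).
Proof.
move=> r0 K0; elim: l => [|l IH] p0 pr pK ord; first by rewrite !big_ord0 addr0.
rewrite !big_ord_recr /=; have [sh|sh] := leqP (st l) h.
  rewrite addr0 big1 ?add0r; last first.
    move=> t _; apply: p0; first by apply: ltnW; rewrite ltnS ltn_ord.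
    apply/orP; left; have := ord t l; rewrite ltn_ord ltnSn => /(_ isT); lia.
  apply: le_trans (pr l _ sh) _ => //; rewrite lerDl; apply: sumr_ge0 => t _.
  by case: ifP.
rewrite addrA; apply: lerD.
  apply: IH => [t tl|t tl|t tl|t t' tl].
  - by apply: p0; exact: ltnW.
  - by apply: pr; exact: ltnW.
  - by apply: pK; exact: ltnW.
  - by apply: ord; lia.
have [sl|sl] := leqP (st l) hi; first exact: pK.
by rewrite p0 // sl orbT.
Qed.

(** The basic data of a node: [N] successive vectors [xs i], supported in
    [(Ls i, Hs i]], each living far beyond the previous one. *)
Definition node (L N : nat) (Ls Hs : nat -> nat) : Prop :=
  [/\ (2 ^ L <= N)%N, (N <= Ls 0)%N, forall i, (i < N)%N -> (Ls i < Hs i)%N &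
      forall i, (i.+1 < N)%N -> (2 ^ Hs i <= Ls i.+1)%N].

Definition prevH (Hs : nat -> nat) i := if i is j.+1 then Hs j else 0%N.

Lemma node_lt L N Ls Hs i j : node L N Ls Hs -> (i < j < N)%N -> (2 ^ Hs i <= Ls j)%N.
Proof.
move=> [_ _ h1 h2] /andP[ij jN]; elim: j ij jN => // j IH.
rewrite ltnS leq_eqVlt => /orP[/eqP->|ij] jN; first exact: h2.
apply: leq_trans (IH ij (ltnW jN)) _; apply: leq_trans (h2 j jN).
apply/ltnW/(leq_trans (h1 j (ltnW jN))).
by apply/ltnW/ltn_expl.
Qed.

Lemma node_base L N Ls Hs i : node L N Ls Hs -> (i < N)%N -> (N <= Ls i)%N.
Proof.
move=> nd; have [h0 h1 h2 h3] := nd; case: i => [|i] // iN.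
apply: (leq_trans h1); apply: leq_trans (node_lt (i := 0) nd _); last by rewrite iN.
apply/ltnW/(leq_trans (h2 0%N _)); first by lia.
by apply/ltnW/ltn_expl.
Qed.

Lemma node_L L N Ls Hs i : node L N Ls Hs -> (i < N)%N -> (2 ^ L <= Ls i)%N.
Proof. by move=> nd iN; apply: leq_trans (node_base nd iN); have [] := nd. Qed.

Lemma node_prev L N Ls Hs i : node L N Ls Hs -> (i < N)%N -> (prevH Hs i < Ls i)%N.
Proof.
move=> nd; case: i => [|i] iN /=; have [h0 h1 h2 h3] := nd.
  by apply: leq_trans h1.
by apply: leq_trans (h3 i iN); exact: ltn_expl.
Qed.

Lemma node_prev_mono L N Ls Hs i j : node L N Ls Hs -> (i < j < N)%N ->
  (Hs i <= prevH Hs j)%N.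
Proof.
move=> nd; case: j => [|j] /andP[ij jN] //=.
move: ij; rewrite ltnS leq_eqVlt => /orP[/eqP->//|ij].
have := node_lt (i := i) (j := j) nd; rewrite ij (ltnW jN) => /(_ isT) h.
have [_ _ h2 _] := nd; have := h2 j (ltnW jN); have := ltn_expl (Hs i) (ltnSn 1).
by lia.
Qed.

Lemma node_sum1 L N Ls Hs (K : R) st : node L N Ls Hs -> 0 <= K ->
  \sum_(i < N) (if (prevH Hs i < st <= Hs i)%N then K else 0) <= K.
Proof.
move=> nd K0; apply: le_trans (ler_norm _) _.
apply: sum_one_nonzero => // [i _|i j _ _].
  by case: ifP => _; rewrite ?normr0 // ger0_norm.
case: ifP => [/andP[a1 a2]|]; last by rewrite eqxx.
case: ifP => [/andP[b1 b2] _ _|]; last by rewrite eqxx.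
apply: ord_inj; case: (ltngtP i j) => // ij; exfalso.
  by have := node_prev_mono (i := i) (j := j) nd; rewrite ij ltn_ord => /(_ isT); lia.
by have := node_prev_mono (i := j) (j := i) nd; rewrite ij ltn_ord => /(_ isT); lia.
Qed.

(** Summing [sum_cross] over a node: each index contributes to one entry of the
    node beyond the common bound. *)
Lemma node_cross L N Ls Hs l (st en : nat -> nat) (phi : nat -> nat -> R) (r K : R) :
  node L N Ls Hs -> 0 <= r -> 0 <= K ->
  (forall i t, (i < N)%N -> (t < l)%N ->
     (en t <= prevH Hs i)%N || (Hs i < st t)%N -> phi i t = 0) ->
  (forall i t, (i < N)%N -> (t < l)%N -> (st t <= prevH Hs i)%N -> phi i t <= r) ->
  (forall i t, (i < N)%N -> (t < l)%N -> phi i t <= K) ->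
  (forall t t', (t < t' < l)%N -> (en t < st t')%N) ->
  \sum_(t < l) \sum_(i < N) phi i t <= N%:R * r + l%:R * K.
Proof.
move=> nd r0 K0 p0 pr pK ord; rewrite exchange_big /=.
apply: (@le_trans _ _ (\sum_(i < N) (r + \sum_(t < l)
   (if (prevH Hs i < st t <= Hs i)%N then K else 0)))).
  apply: ler_sum => i _; apply: (@sum_cross l st en (phi i)) => //.
  - by move=> t tl; apply: p0.
  - by move=> t tl; apply: pr.
  - by move=> t tl; apply: pK.
rewrite big_split /= sumr_const card_ord mulr_natl lerD2l exchange_big /=.
apply: (@le_trans _ _ (\sum_(t < l) K)).
  by apply: ler_sum => t _; exact: node_sum1 nd K0.
by rewrite sumr_const card_ord mulr_natl.
Qed.

Variable leaf : nat -> nat -> (nat -> R) -> seq item -> Prop.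

(** Iterated averages of leaves.  [tree P L H x u] says that [x] is an average
    of depth [P], supported beyond [L], whose leaves carry the lists of averages
    collected in [u]; the sizes of the successive averages grow fast enough for
    [x] to behave like a special convex combination of order [P]. *)
Fixpoint tree (P L H : nat) x u : Prop :=
  match P with
  | 0 => leaf L H x u
  | P'.+1 => exists N (Ls Hs : nat -> nat) (xs : nat -> nat -> R) (us : nat -> seq item),
      [/\ node L N Ls Hs,
          forall i, (i < N)%N -> tree P' (Ls i) (Hs i) (xs i) (us i),
          x = N%:R^-1 *: \sum_(i < N) xs i,
          u = flatten [seq us i | i <- iota 0 N] & H = Hs N.-1]
  end.

Lemma treeS P L H x u : tree P.+1 L H x u <->
  exists N (Ls Hs : nat -> nat) (xs : nat -> nat -> R) (us : nat -> seq item),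
      [/\ node L N Ls Hs,
          forall i, (i < N)%N -> tree P (Ls i) (Hs i) (xs i) (us i),
          x = N%:R^-1 *: \sum_(i < N) xs i,
          u = flatten [seq us i | i <- iota 0 N] & H = Hs N.-1].
Proof. by []. Qed.

Definition leaf_basic := forall L H y u, leaf L H y u ->
  [/\ (L < H)%N, forall i, y i != 0 -> (L < i)%N && (8 * i <= H)%N & bnd y 1].

Hypothesis leafP : leaf_basic.

Definition inside (L H : nat) x := forall i, x i != 0 -> (L < i)%N && (8 * i <= H)%N.

Lemma within_c00 L H x : inside L H x -> c00 x.
Proof.
move=> xw; apply: (@c00_of_trunc _ H.+1).
  by apply: contrapT => /eqP /xw.
by move=> i iH; apply: contrapT => /eqP /xw; lia.
Qed.

Lemma bnd_ge0 x C : bnd x C -> 0 <= C.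
Proof. by move=> h; exact: le_trans (normr_ge0 _) (h _ (@W0 _ s L1 sigma)). Qed.

Lemma bnd_mean N (xs : nat -> nat -> R) C : (0 < N)%N ->
  (forall i, (i < N)%N -> bnd (xs i) C) -> bnd (N%:R^-1 *: \sum_(i < N) xs i) C.
Proof.
move=> N0 h f Wf; have cf := W_c00 Wf; rewrite pairingZr // pairing_sumr //.
rewrite normrM gtr0_norm ?invr_gt0 ?ltr0n // mulrC ler_pdivrMr ?ltr0n //.
apply: le_trans (ler_norm_sum _ _ _) _.
apply: (@le_trans _ _ (\sum_(i < N) C)); first by apply: ler_sum => i _; exact: h.
by rewrite sumr_const card_ord mulr_natr.
Qed.

Lemma tree_basic P L H x u : tree P L H x u ->
  [/\ (L < H)%N, inside L H x & bnd x 1].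
Proof.
elim: P L H x u => [|P IH] L H x u; first exact: leafP.
move=> /treeS[N [Ls [Hs [xs [us [nd tr -> _ ->]]]]]].
have [h0 h1 h2 h3] := nd.
have N0 : (0 < N)%N by apply: leq_trans h0; rewrite expn_gt0.
have LL : (L < 2 ^ L)%N by exact: ltn_expl.
split.
- have : (N.-1 < N)%N by lia.
  move=> Nl; have := node_L nd Nl; have := h2 _ Nl; lia.
- move=> j; rewrite vecZ mulf_eq0 negb_or vec_sum => /andP[_ xj].
  have [[i xi]|H1] := pselect (exists i : 'I_N, xs i j != 0); last first.
    move: xj; rewrite big1 ?eqxx // => i _; apply: contrapT => /eqP xi.
    by apply: H1; exists i.
  have [_ w _] := IH _ _ _ _ (tr i (ltn_ord i)).
  have /andP[a1 a2] := w j xi; have := node_L nd (ltn_ord i).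
  have : (Hs i <= Hs N.-1)%N.
    have : (i <= N.-1)%N by have := ltn_ord i; lia.
    rewrite leq_eqVlt => /orP[/eqP->//|lt].
    have := node_prev_mono (i := i) (j := N.-1) nd; rewrite lt.
    have Nl : (N.-1 < N)%N by lia.
    rewrite Nl => /(_ isT); have := node_prev nd Nl; have := h2 _ Nl; lia.
  by move=> ? ?; apply/andP; split; lia.
- by apply: bnd_mean => // i iN; have [] := IH _ _ _ _ (tr i iN).
Qed.

Lemma node_N0 L N Ls Hs : node L N Ls Hs -> (0 < N)%N.
Proof. by move=> [h0 _ _ _]; apply: leq_trans h0; rewrite expn_gt0. Qed.

Lemma pairing_far f x L H st en : inside L H x ->
  (forall i, f i != 0 -> (st <= i <= en)%N) ->
  (en <= L)%N || (H < st)%N -> pairing f x = 0.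
Proof.
move=> xw fs h; apply: pairing_eq0 => i.
have [->|/fs fi] := eqVneq (f i) 0; first by left.
right; apply: contrapT => /eqP /xw; lia.
Qed.

Definition bigL (P L : nat) := (2 * P + 10 <= L)%N.

Lemma bigL_sub P L L' : bigL P.+1 L -> (2 ^ L <= L')%N -> bigL P L'.
Proof. by rewrite /bigL; have := ltn_expl L (ltnSn 1); lia. Qed.

(** A sequence of order [2^-P] with room to absorb, at each step of the recursion in
    [bP_step], the functionals crossing from one entry to the next. *)
Definition bP (P : nat) : R := 4 * 2 ^- P * (2 - 2 ^- P).

Lemma bP_ge0 P : 0 <= bP P.
Proof.
rewrite /bP mulr_ge0 ?mulr_ge0 ?invr_ge0 ?exprn_ge0 // subr_ge0.
apply: (@le_trans _ _ 1); last by rewrite ler1n.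
by rewrite invf_le1 ?exprn_gt0 // exprn_ege1 // ler1n.
Qed.

Lemma bP_le P : bP P <= 8 * 2 ^- P.
Proof.
rewrite /bP; have : 0 <= 2 ^- P :> R by rewrite invr_ge0 exprn_ge0.
by move: (2 ^- P) => a a0; nra.
Qed.

Lemma exp24 q : (8 <= q)%N -> (24 * q <= 2 ^ q)%N.
Proof.
elim: q => // q IH; rewrite leq_eqVlt => /orP[/eqP <-//|]; rewrite ltnS => q8.
by have := IH q8; rewrite expnS; lia.
Qed.

Lemma bP_step P L N l : bigL P L -> (2 ^ L <= N)%N -> (l <= L)%N ->
  N%:R^-1 * (l%:R * bP P + 2^-1 * bP P * (N%:R + l%:R)) <= bP P.+1.
Proof.
move=> bg LN lL; have N0 : (0 < N)%N by apply: leq_trans LN; rewrite expn_gt0.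
have N0' : 0 < N%:R :> R by rewrite ltr0n.
have e1 : 12 * (l%:R / N%:R) <= 2 ^- P :> R.
  rewrite mulrA ler_pdivrMr // [leRHS]mulrC ler_pdivlMr ?exprn_gt0 //.
  rewrite -natrX -!natrM ler_nat; apply: leq_trans LN.
  have q8 : (8 <= L - P)%N by move: bg; rewrite /bigL; lia.
  have -> : (2 ^ L = 2 ^ (L - P) * 2 ^ P)%N by rewrite -expnD subnK //; move: bg; rewrite /bigL; lia.
  rewrite leq_mul2r; apply/orP; right; apply: leq_trans (exp24 q8).
  by move: bg; rewrite /bigL; lia.
rewrite /bP; have -> : 2 ^- P.+1 = 2^-1 * 2 ^- P :> R by rewrite exprS invfM.
have a0 : 0 < 2 ^- P :> R by rewrite invr_gt0 exprn_gt0.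
have a1 : 2 ^- P <= 1 :> R by rewrite invf_le1 ?exprn_gt0 // exprn_ege1 // ler1n.
move: (2 ^- P) a0 a1 e1 => a a0 a1; set e := l%:R / N%:R => e1.
have e0 : 0 <= e by rewrite /e divr_ge0.
have -> : N%:R^-1 * (l%:R * (4 * a * (2 - a)) + 2^-1 * (4 * a * (2 - a)) * (N%:R + l%:R))
   = 2 * a * ((2 - a) * (1 + 3 * e)) by rewrite /e; field; rewrite lt0r_neq0.
have -> : 4 * (2^-1 * a) * (2 - 2^-1 * a) = 2 * a * (2 - 2^-1 * a) by field.
rewrite ler_wpM2l ?mulr_ge0 ?ltW //; nra.
Qed.

Section SingleFunctional.
Variables (L N : nat) (Ls Hs : nat -> nat) (xs : nat -> nat -> R) (b : R).
Hypothesis nd : node L N Ls Hs.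
Hypothesis xw : forall i, (i < N)%N -> inside (Ls i) (Hs i) (xs i).
Hypothesis xrob : forall i l g st en, (i < N)%N -> (l <= Ls i)%N ->
  W_family l g st en -> \sum_(t < l) `|pairing (g t) (xs i)| <= b.

Definition meets (E : set nat) i : bool :=
  `[< exists j, E j /\ (prevH Hs i < j <= Hs i)%N >].

Lemma xs_bnd i : (i < N)%N -> bnd (xs i) b.
Proof.
move=> iN f Wf; have l1 : (1 <= Ls i)%N by have := node_prev nd iN; lia.
have [K fK] := c00_trunc (W_c00 Wf).
have := xrob (g := fun=> f) (st := fun=> 0%N) (en := fun=> K) iN l1.
rewrite big_ord_recl big_ord0 addr0; apply; split=> //.
  by move=> _ j _ fj; apply/andP; split=> //; rewrite leqNgt; apply/negP => /ltnW /fK /eqP; rewrite (negbTE fj).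
by move=> i' j; lia.
Qed.

Lemma pairing_not_meets f E i : (i < N)%N -> ~~ meets E i ->
  pairing (f \_ E) (xs i) = 0.
Proof.
move=> iN /asboolPn nm; apply: pairing_eq0 => j; rewrite restrE.
case: asboolP => Ej; last by left.
right; apply: contrapT => /eqP /(xw iN) /andP[a1 a2]; apply: nm; exists j; split=> //.
by have := node_prev nd iN; lia.
Qed.

(** On the entries after the first one that it meets, the functional is half of a sum of
    successive functionals which are few compared with the entry. *)
Lemma node_single f : W f -> forall E, nat_interval E ->
  `|pairing (f \_ E) (\sum_(i < N) xs i)| <=
    b + 2^-1 * b * \sum_(i < N) (meets E i)%:R.
Proof.
have N0 := node_N0 nd.
have b0 : 0 <= b by have := xs_bnd N0; exact: bnd_ge0.
have m0 E : 0 <= 2^-1 * b * \sum_(i < N) (meets E i)%:R.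
  by rewrite mulr_ge0 ?mulr_ge0 ?sumr_ge0.
move: f; apply: (tsirelson_ind hs) => //.
- move=> n n0 E nE; have Wu := W_restr nE (@W_unit _ s L1 sigma n n0).
  have cu := W_c00 Wu; rewrite pairing_sumr //.
  apply: (@le_trans _ _ b); last by rewrite lerDl.
  apply: sum_one_nonzero => // [i _|i j _ _].
    exact: (xs_bnd (ltn_ord i) Wu).
  have nz i' : (i' < N)%N -> pairing (unit_vec R n \_ E) (xs i') != 0 ->
      (Ls i' < n)%N && (8 * n <= Hs i')%N.
    move=> iN; rewrite pairing_patch pairing_unit restrE.
    by case: asboolP => [_|_ /eqP//]; exact: xw.
  move=> /(nz i (ltn_ord i)) /andP[a1 a2] /(nz j (ltn_ord j)) /andP[c1 c2].
  apply: ord_inj; case: (ltngtP i j) => // ij; exfalso.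
    have := node_prev_mono (i := i) (j := j) nd; rewrite ij ltn_ord => /(_ isT).
    by have := node_prev nd (ltn_ord j); lia.
  have := node_prev_mono (i := j) (j := i) nd; rewrite ij ltn_ord => /(_ isT).
  by have := node_prev nd (ltn_ord i); lia.
- move=> f Wf IH E nE; rewrite restrN pairingNl ?normrN; first exact: IH.
  by apply: c00_sum => i _; exact: within_c00 (xw (ltn_ord i)).
- move=> f E' nE' Wf IH E nE; rewrite restr_restr.
  apply: le_trans (IH _ (interval_setI nE' nE)) _; rewrite lerD2l.
  rewrite ler_wpM2l ?mulr_ge0 //; apply: ler_sum => i _; rewrite ler_nat.
  suff : meets (E' `&` E) i -> meets E i by case: (meets _ i); case: (meets _ i) => // /(_ isT).
  by move=> /asboolP[j [[_ Ej] h]]; apply/asboolP; exists j.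
- move=> d c f h c1 E nE; rewrite restr_sum pairing_suml; last first.
    by apply: c00_sum => i _; exact: within_c00 (xw (ltn_ord i)).
  apply: le_trans (ler_norm_sum _ _ _) _.
  set M := (X in _ <= X).
  rewrite -[M]mul1r -(rmorph1 (ratr : rat -> R)) -c1 rmorph_sum mulr_suml.
  apply: ler_sum => j _; have [cj Wj Pj] := h j (ltn_ord j).
  rewrite restrZ pairingZl; last first.
    by apply: c00_sum => i _; exact: within_c00 (xw (ltn_ord i)).
  by rewrite normrM ger0_norm ?ler0q // ler_wpM2l ?ler0q //; exact: (Pj E nE).
move=> k g st en fam kst Wf E nE; set f := 2^-1 *: _ in Wf *.
have [fW fs ford] := fam.
have Wi : forall i, (i < N)%N -> `|pairing (f \_ E) (xs i)| <= 2^-1 *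
    \sum_(t < k) `|pairing (g t \_ E) (xs i)|.
  move=> i iN; have cx := within_c00 (xw iN).
  rewrite /f restrZ pairingZl // normrM ger0_norm ?invr_ge0 // ler_wpM2l ?invr_ge0 //.
  by rewrite restr_sum pairing_suml //; exact: ler_norm_sum.
have WE := W_restr nE Wf.
have cfE := W_c00 WE.
rewrite pairing_sumr //; apply: le_trans (ler_norm_sum _ _ _) _.
pose nz i := pairing (f \_ E) (xs i) != 0.
have [[i1 i1N i1nz]|nonz] := pselect (exists2 i, (i < N)%N & nz i); last first.
  rewrite big1 ?addr_ge0 // => i _; apply/eqP; rewrite normr_eq0.
  by apply: contrapT => /negP h; apply: nonz; exists (i : nat).
have exi : exists i, (i < N)%N && nz i by exists i1; rewrite i1N.
have [{i1 i1N i1nz} i1 /andP[i1N i1nz] imin] := ex_minnP exi.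
rewrite (bigD1 (Ordinal i1N)) //=; apply: lerD; first exact: (xs_bnd i1N WE).
rewrite mulr_sumr [leRHS](bigD1 (Ordinal i1N)) //=.
apply: ler_wpDl; first by rewrite mulr_ge0 ?mulr_ge0.
apply: ler_sum => i ii1.
have [mi|mi] := boolP (meets E i); last first.
  by rewrite (pairing_not_meets _ _ mi) // normr0 mulr0.
rewrite mulr1; case: (boolP (nz i)) => [inz|]; last first.
  by rewrite negbK => /eqP ->; rewrite normr0 mulr_ge0.
have i1i : (i1 < i)%N.
  rewrite ltn_neqAle imin ?ltn_ord // andbT; apply: contra ii1 => /eqP e.
  by apply/eqP/ord_inj; rewrite /= e.
apply: le_trans (Wi i (ltn_ord i)) _; rewrite ler_wpM2l ?invr_ge0 //.
apply: (xrob (ltn_ord i) _ (W_family_restr nE fam)).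
(* the functional starts before [xs i]: its length is at most [Hs i1] *)
have [t [tk gt0]] : exists t, (t < k)%N /\ pairing (g t \_ E) (xs i1) != 0.
  apply: contrapT => h; move/negP: i1nz; apply; apply/eqP.
  rewrite /f restrZ restr_sum pairingZl ?pairing_suml ?(within_c00 (xw i1N)) //;
    last 2 first.
  - exact: within_c00 (xw i1N).
  - exact: within_c00 (xw i1N).
  rewrite big1 ?mulr0 // => t _; apply: contrapT => /eqP gt; apply: h.
  by exists t; split.
have st1 : (st t <= Hs i1)%N.
  rewrite leqNgt; apply/negP => lt; move/eqP: gt0; apply.
  apply: (@pairing_far _ _ (Ls i1) (Hs i1) (st t) (en t)); first exact: xw.
    by move=> j; rewrite restrE; case: asboolP => [_|_ /eqP//]; exact: fs.
  by rewrite lt orbT.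
have := node_prev_mono (i := i1) (j := i) nd; rewrite i1i ltn_ord => /(_ isT).
by have := node_prev nd (ltn_ord i); have := kst t tk; lia.
Qed.

(** Beyond [n] the terms of the average are few compared with the entry, which gives
    [b / n]; before [n] the coordinates of the average are at most [n^-1] and the
    supports are short; at most one entry is neither before nor beyond [n]. *)
Lemma node_alpha a n : (forall i, (i < N)%N -> bnd (xs i) 1) -> alpha_average W a n ->
  `|pairing a (\sum_(i < N) xs i)| <= N%:R * b / n%:R + (b + 1).
Proof.
move=> x1 aa; have [Wa [d [f [/andP[d0 dn] fW fb aE]]]] := aa.
have n0 : (0 < n)%N := leq_trans d0 dn.
have n0' : 0 < n%:R :> R by rewrite ltr0n.
have N0 := node_N0 nd; have b0 : 0 <= b by exact: bnd_ge0 (xs_bnd N0).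
have ca := W_c00 Wa.
have cf q : (q < d)%N -> c00 (f q) by move=> /fW /W_c00.
have good i : (i < N)%N -> (n <= Ls i)%N -> `|pairing a (xs i)| <= b / n%:R.
  move=> iN nL; rewrite aE pairingZl ?pairing_suml; try exact: within_c00 (xw iN).
  rewrite normrM gtr0_norm ?invr_gt0 // mulrC ler_pM2r ?invr_gt0 //.
  apply: le_trans (ler_norm_sum _ _ _) _.
  apply: (xrob (st := fun q => minsupp (f q)) (en := fun q => maxsupp (f q)) iN).
    exact: leq_trans nL.
  split=> //; last exact: block_lt.
  by move=> q j qd fj; rewrite minsupp_le // maxsupp_ge //; exact: cf.
have exi : exists i, (N <= i)%N || (n <= Ls i)%N by exists N; rewrite leqnn.
have [j jP jmin] := ex_minnP exi.
have jN : (j <= N)%N by apply: jmin; rewrite leqnn.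
have geL i i' : (i <= i' < N)%N -> (n <= Ls i)%N -> (n <= Ls i')%N.
  move=> /andP[]; rewrite leq_eqVlt => /orP[/eqP->//|ii'] iN nL.
  apply: leq_trans nL _; have := node_lt (i := i) (j := i') nd; rewrite ii' iN => /(_ isT).
  have [_ _ h _] := nd; have := h i (ltn_trans ii' iN); have := ltn_expl (Hs i) (ltnSn 1).
  by lia.
rewrite pairing_sumr // -(big_mkord xpredT (fun i => pairing a (xs i))).
have tail q : (j <= q <= N)%N -> `|\sum_(q <= i < N) pairing a (xs i)| <= N%:R * b / n%:R.
  move=> jq; apply: le_trans (ler_norm_sum _ _ _) _.
  apply: (@le_trans _ _ (\sum_(q <= i < N) b / n%:R)).
    rewrite !big_nat; apply: ler_sum => i /andP[qi iN]; apply: good => //.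
    case/orP: jP => [Nj|nj]; first by lia.
    by apply: geL nj; rewrite iN andbT; lia.
  rewrite sumr_const_nat -[leLHS]mulr_natl mulrA ler_wpM2r ?invr_ge0 ?ler0n //.
  by rewrite ler_wpM2r // ler_nat leq_subr.
case: j jP jmin jN tail => [|j] jP jmin jN tail.
  by apply: le_trans (tail 0%N _) _; rewrite // lerDl addr_ge0.
have nj : (Ls j < n)%N.
  by rewrite ltnNge; apply/negP => h; have := jmin j; rewrite h orbT ltnn => /(_ isT).
rewrite (big_cat_nat (n := j.+1)) //= big_nat_recr //= -addrA [leRHS]addrC.
have := tail j.+1; rewrite leqnn jN => /(_ isT) tl.
have mid := xs_bnd jN Wa.
suff hd : `|\sum_(0 <= i < j) pairing a (xs i)| <= 1.
  apply: le_trans (ler_normD _ _) _; rewrite [b + 1]addrC -addrA; apply: lerD => //.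
  by apply: le_trans (ler_normD _ _) _; apply: lerD.
rewrite big_mkord -pairing_sumr //.
apply: (@le_trans _ _ (n%:R^-1 * (1 * (prevH Hs j)%:R))); last first.
  rewrite mul1r mulrC ler_pdivrMr // mul1r ler_nat.
  by have := node_prev nd jN; lia.
apply: pairing_l1 => //; first by move=> i; exact: (alpha_coord hs aa).
  move=> i; rewrite vec_sum; apply: sum_one_nonzero => // [q _|q r _ _ qi ri].
    have qN : (q < N)%N by apply: ltn_trans (ltn_ord q) jN.
    by apply: (bnd_coord _ (x1 q qN)); exact: within_c00 (xw qN).
  have qN : (q < N)%N by apply: ltn_trans (ltn_ord q) jN.
  have rN : (r < N)%N by apply: ltn_trans (ltn_ord r) jN.
  have := xw qN qi; have := xw rN ri; have := node_prev nd qN; have := node_prev nd rN.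
  move=> h1 h2 /andP[h3 h4] /andP[h5 h6]; apply: ord_inj.
  case: (ltngtP q r) => // qr; exfalso.
    by have := node_prev_mono (i := q) (j := r) nd; rewrite qr rN => /(_ isT); lia.
  by have := node_prev_mono (i := r) (j := q) nd; rewrite qr qN => /(_ isT); lia.
move=> i; rewrite vec_sum => xi.
have [[q qi]|H1] := pselect (exists q : 'I_j, xs q i != 0); last first.
  exfalso; move: xi; rewrite big1 ?eqxx // => q _; apply: contrapT => /eqP xi.
  by apply: H1; exists q.
have qN : (q < N)%N by apply: ltn_trans (ltn_ord q) jN.
have := xw qN qi; have := node_prev_mono (i := q) (j := j) nd.
by rewrite ltn_ord jN => /(_ isT); lia.
Qed.

End SingleFunctional.

(** A tree tested against few successive functionals behaves as against one:
    this is where the fast growth of the averages is used, and it gives the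
    Tsirelson type bound of order [2^-P] on [W]. *)
Lemma tree_robust P L H x u : tree P.+1 L H x u -> bigL P.+1 L ->
  forall l g st en, (l <= L)%N -> W_family l g st en ->
  \sum_(t < l) `|pairing (g t) x| <= bP P.+1.
Proof.
elim: P L H x u => [|P IH] L H x u.
  move=> /treeS[N [Ls [Hs [xs [us [nd tr -> _ _]]]]]] bg l g st en lL [gW gs gord].
  have N0 := node_N0 nd; have N0' : 0 < N%:R :> R by rewrite ltr0n.
  have lf i : (i < N)%N -> _ := fun iN => leafP (tr i iN).
  have e t : (t < l)%N -> `|pairing (g t) (N%:R^-1 *: \sum_(i < N) xs i)| <=
     N%:R^-1 * \sum_(i < N) `|pairing (g t) (xs i)|.
    move=> tl; have cg := W_c00 (gW t tl).
    rewrite pairingZr // pairing_sumr // normrM gtr0_norm ?invr_gt0 //.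
    by rewrite ler_wpM2l ?invr_ge0 ?ler0n // ler_norm_sum.
  apply: (@le_trans _ _ (\sum_(t < l) (N%:R^-1 * \sum_(i < N) `|pairing (g t) (xs i)|))).
    by apply: ler_sum => t _; exact: e.
  rewrite -mulr_sumr.
  have := node_cross (st := st) (en := en) (l := l)
    (phi := fun i t => `|pairing (g t) (xs i)|) nd ler01 ler01.
  move=> /(_ _ _ _ gord) h.
  apply: (@le_trans _ _ (N%:R^-1 * (N%:R * 1 + l%:R * 1))).
    rewrite ler_wpM2l ?invr_ge0 ?ler0n //; apply: h.
    - move=> i t iN tl far; have [lt w _] := lf i iN.
      rewrite (@pairing_far _ _ (Ls i) (Hs i) (st t) (en t)) ?normr0 //; first by move=> j; exact: gs.
      by have := node_prev nd iN; lia.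
    - by move=> i t iN tl _; have [_ _] := lf i iN; apply; exact: gW.
    - by move=> i t iN tl; have [_ _] := lf i iN; apply; exact: gW.
  rewrite !mulr1 mulrDr mulVf ?lt0r_neq0 //.
  have : l%:R / N%:R <= 1 :> R.
    rewrite ler_pdivrMr // mul1r ler_nat; apply: leq_trans lL _.
    by have [h0 _ _ _] := nd; apply: leq_trans h0; apply/ltnW/ltn_expl.
  have -> : bP 1 = 3 by rewrite /bP expr1; field.
  by rewrite [N%:R^-1 * _]mulrC; lra.
move=> /treeS[N [Ls [Hs [xs [us [nd tr -> _ _]]]]]] bg l g st en lL [gW gs gord].
have N0 := node_N0 nd; have N0' : 0 < N%:R :> R by rewrite ltr0n.
have xw i : (i < N)%N -> inside (Ls i) (Hs i) (xs i).
  by move=> iN; have [] := tree_basic (tr i iN).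
have rob i l' g' st' en' : (i < N)%N -> (l' <= Ls i)%N -> W_family l' g' st' en' ->
    \sum_(t < l') `|pairing (g' t) (xs i)| <= bP P.+1.
  move=> iN; apply: (IH _ _ _ _ (tr i iN)).
  by apply: bigL_sub bg (node_L nd iN).
pose E t := [set j | (st t <= j <= en t)%N].
have nE t : nat_interval (E t).
  by move=> i j k'; rewrite /E /= => h1 h2 h3; lia.
have gE t : (t < l)%N -> g t \_ (E t) = g t.
  move=> tl; apply/funext => j; rewrite restrE; case: asboolP => // nj.
  by apply/esym; apply: contrapT => /eqP /(gs t j tl).
have e t : (t < l)%N -> `|pairing (g t) (N%:R^-1 *: \sum_(i < N) xs i)| <=
   N%:R^-1 * (bP P.+1 + 2^-1 * bP P.+1 * \sum_(i < N) (meets Hs (E t) i)%:R).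
  move=> tl; have cg := W_c00 (gW t tl).
  rewrite pairingZr // normrM gtr0_norm ?invr_gt0 //.
  rewrite ler_wpM2l ?invr_ge0 ?ler0n // -{1}(gE t tl).
  by apply: (node_single nd xw rob) => //; exact: gW.
apply: le_trans (_ : _ <= \sum_(t < l) (N%:R^-1 * (bP P.+1 + 2^-1 * bP P.+1 * \sum_(i < N) (meets Hs (E t) i)%:R))) _.
  by apply: ler_sum => t _; exact: e.
rewrite -mulr_sumr big_split /= sumr_const card_ord -mulr_sumr.
have [h0 _ _ _] := nd; have bg' : bigL P.+1 L by move: bg; rewrite /bigL; lia.
apply: le_trans (bP_step bg' h0 lL); rewrite ler_wpM2l ?invr_ge0 ?ler0n //.
have w0 : 0 <= 2^-1 * bP P.+1 by apply: mulr_ge0 (bP_ge0 _); rewrite invr_ge0.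
rewrite mulr_natl lerD2l ler_wpM2l //.
have := node_cross (st := st) (en := en) (l := l)
    (phi := fun i t => (meets Hs (E t) i)%:R) nd ler01 ler01.
rewrite !mulr1; apply=> //.
- move=> i t iN tl far; rewrite (_ : meets _ _ _ = false) //.
  apply/negbTE/asboolPn => -[j []]; rewrite /E /= => h1 h2; lia.
- by move=> i t _ _ _; case: (meets _ _ _).
- by move=> i t _ _; case: (meets _ _ _).
Qed.

Lemma tree_bnd P L H x u : tree P.+1 L H x u -> bigL P.+1 L -> bnd x (8 * 2 ^- P.+1).
Proof.
move=> tr bg; have [LH xw x1] := tree_basic tr => f Wf.
have [K fK] := c00_trunc (W_c00 Wf).
apply: le_trans (bP_le P.+1).
have l1 : (1 <= L)%N by move: bg; rewrite /bigL; lia.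
have := tree_robust tr bg (g := fun=> f) (st := fun=> 0%N) (en := fun=> K) l1.
rewrite big_ord_recl big_ord0 addr0; apply; split=> //.
  by move=> _ j _ fj; apply/andP; split=> //; rewrite leqNgt; apply/negP => /ltnW /fK /eqP; rewrite (negbTE fj).
by move=> i' j; lia.
Qed.

Lemma tree_alpha P L H x u a n : tree P.+2 L H x u -> bigL P.+2 L ->
  alpha_average W a n ->
  `|pairing a x| <= 8 * 2 ^- P.+1 / n%:R + 16 * 2 ^- L.
Proof.
move=> /treeS[N [Ls [Hs [xs [us [nd tr -> _ _]]]]]] bg aa.
have N0 := node_N0 nd; have N0' : 0 < N%:R :> R by rewrite ltr0n.
have xw i : (i < N)%N -> inside (Ls i) (Hs i) (xs i).
  by move=> iN; have [] := tree_basic (tr i iN).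
have x1 i : (i < N)%N -> bnd (xs i) 1.
  by move=> iN; have [] := tree_basic (tr i iN).
have rob i l' g' st' en' : (i < N)%N -> (l' <= Ls i)%N -> W_family l' g' st' en' ->
    \sum_(t < l') `|pairing (g' t) (xs i)| <= bP P.+1.
  move=> iN; apply: (tree_robust (tr i iN)).
  by apply: bigL_sub bg (node_L nd iN).
have := node_alpha nd xw rob x1 aa.
have ca : c00 a by have [/W_c00] := aa.
rewrite pairingZr // normrM gtr0_norm ?invr_gt0 // => h.
have n0 : (0 < n)%N := kavg_size_gt0 (k := true) aa.
have n0' : 0 < n%:R :> R by rewrite ltr0n.
have NL : N%:R^-1 <= 2 ^- L :> R.
  have [h0 _ _ _] := nd; rewrite lef_pV2 ?posrE ?exprn_gt0 //.
  by rewrite -natrX ler_nat.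
have b8 := bP_le P.+1; have b0 := bP_ge0 P.+1.
have p1 : 8 * 2 ^- P.+1 <= 8 :> R.
  by rewrite -[leRHS]mulr1 ler_wpM2l // invf_le1 ?exprn_gt0 // exprn_ege1 // ler1n.
apply: (@le_trans _ _ (N%:R^-1 * (N%:R * bP P.+1 / n%:R + (bP P.+1 + 1)))).
  by rewrite ler_wpM2l ?invr_ge0 ?ler0n.
rewrite mulrDr; apply: lerD.
  rewrite !mulrA mulVf ?lt0r_neq0 // mul1r; apply: ler_wpM2r; last exact: b8.
  by rewrite invr_ge0 ler0n.
rewrite mulrC; apply: ler_pM; [exact: addr_ge0| by rewrite invr_ge0 ltW|lra|exact: NL].
Qed.

End Trees.

(** * Iterated averages against admissible families *)

Arguments tree : simpl never.

Section TreeSums.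
Variables (R : realType) (s : nat -> R -> R) (hs : dense_in_sphere s).
Variables (L1 : set nat) (sigma : seq (nat -> R) -> nat).
Local Notation W := (norming_set s L1 sigma).
Local Notation kavg := (kavg s L1 sigma).
Local Notation items_ok := (items_ok s L1 sigma).
Local Notation bnd := (bnd s L1 sigma).
Local Notation item := (item R).
Implicit Types (f x : nat -> R) (u : seq item).

Variable leaf : nat -> nat -> (nat -> R) -> seq item -> Prop.
Hypothesis leafP : leaf_basic s L1 sigma leaf.
Local Notation tree := (tree leaf).

(** The relative loss in a node, which has at least [2^L] entries, while at most [L]
    groups of averages start before it. *)
Definition rho (L : nat) : R := L%:R / 2 ^+ L.

Lemma rho_ge0 L : 0 <= rho L.
Proof. by rewrite /rho divr_ge0 ?exprn_ge0. Qed.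

Lemma rho_le L L' : (0 < L)%N -> (L <= L')%N -> rho L' <= rho L.
Proof.
move=> L0 /subnK <-; elim: (L' - L)%N => // d IH; apply: le_trans IH.
rewrite /rho addSn exprS invfM mulrA ler_wpM2r ?invr_ge0 ?exprn_ge0 //.
rewrite ler_pdivrMr // -natrM ler_nat; lia.
Qed.

Lemma isum_flatten_mem (v : seq (seq item)) g : g \in v -> isum g <= isum (flatten v).
Proof.
elim: v => // h v IH; rewrite inE /isum /= big_cat /= => /orP[/eqP->|/IH].
  by rewrite lerDl; exact: isum_ge0.
by move=> /le_trans; apply; rewrite lerDr; exact: isum_ge0.
Qed.

Section ItemsSum.
Variables (k : bool) (Pmin Pmax Lmin : nat) (K : R).
Hypothesis K0 : 0 <= K.
Hypothesis base : forall P L H x u0, (Pmin <= P <= Pmax)%N -> (Lmin <= L)%N ->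
  tree P.+2 L H x u0 -> forall a n, kavg k W a n ->
  `|pairing a x| <= K * 2 ^- P / n%:R + 16 * 2 ^- L.

(** Each level of nesting of the admissible family is paid for by one level of
    the tree. *)
Lemma tree_items_groups m P L H x u0 (v : seq (seq item)) :
  (Pmin <= P)%N -> (P + m <= Pmax)%N -> (Lmin <= L)%N -> (0 < L)%N ->
  tree (P + m).+2 L H x u0 -> items_ok k W (flatten v) -> [::] \notin v ->
  (size v <= L)%N -> (forall g, g \in v -> Adm m g) ->
  \sum_(a <- flatten v) `|pairing a.1 x| <=
    K * 2 ^- P * isum (flatten v) + 2 ^+ (2 * m + 6) * rho L.
Proof.
elim: m L H x u0 v => [|m IH] L H x u0 v Pm PM LL L0 tr ok vn vL vA.
  rewrite addn0 in tr PM.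
  have sz : (size (flatten v) <= L)%N.
    apply: leq_trans vL; elim: (v) vA => //= g w IHw vA; rewrite size_cat -add1n leq_add //.
      by apply: vA; exact: mem_head.
    by apply: IHw => h hw; apply: vA; rewrite inE hw orbT.
  apply: (@le_trans _ _ (\sum_(a <- flatten v) (K * 2 ^- P * a.2%:R^-1 + 16 * 2 ^- L))).
    rewrite !big_seq; apply: ler_sum => a au; apply: base tr _ _ _ => //.
      by rewrite Pm.
    by have [] := ok.1 a au.
  rewrite big_split /= -mulr_sumr lerD2l big_const_seq count_predT.
  have -> : forall (c : R) n, iter n (+%R c) 0 = n%:R * c.
    by move=> c; elim=> [|n IHn] /=; rewrite ?mul0r // IHn -natr1 mulrDl mul1r addrC.
  rewrite /rho muln0 add0n mulrA mulrA ler_wpM2r ?invr_ge0 ?exprn_ge0 //.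
  rewrite mulrC; apply: ler_pM => //; last by rewrite ler_nat.
  by rewrite -natrX ler_nat.
have [h0 h1] := (ok.1, ok.2).
have : tree (P + m).+3 L H x u0 by rewrite addnS in tr.
move=> /treeS[N [Ls [Hs [xs [us [nd trs xE _ _]]]]]].
have N0 := node_N0 nd; have N0' : 0 < N%:R :> R by rewrite ltr0n.
have tb i (iN : (i < N)%N) := tree_basic leafP (trs i iN).
pose a0 : item := (0, 0%N).
pose G t := nth [::] v t.
have Gv t : (t < size v)%N -> G t \in v by exact: mem_nth.
have Gu t a : (t < size v)%N -> a \in G t -> a \in flatten v.
  by move=> tv aG; apply/flattenP; exists (G t) => //; exact: Gv.
have okG t : (t < size v)%N -> items_ok k W (G t).
  move=> tv; apply: items_sub (ok); first by move=> a; exact: Gu.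
  by apply: pairwise_flatten_mem h1 _; exact: Gv.
have Gne t : (t < size v)%N -> G t != [::].
  by move=> tv; apply: contraNneq vn => <-; exact: Gv.
have hd t : (t < size v)%N -> head a0 (G t) \in G t.
  by move=> /Gne; case: (G t) => //= a l _; exact: mem_head.
have la t : (t < size v)%N -> last a0 (G t) \in G t.
  by move=> /Gne; case: (G t) => //= a l _; exact: mem_last.
pose st t := minsupp (head a0 (G t)).1; pose en t := maxsupp (last a0 (G t)).1.
pose phi i t := \sum_(a <- G t) `|pairing a.1 (xs i)|.
set r := K * 2 ^- P * isum (flatten v) + 2 ^+ (2 * m + 6) * rho L.
have K2 : 0 <= K * 2 ^- P by rewrite mulr_ge0 ?invr_ge0 ?exprn_ge0.
have r0 : 0 <= r by rewrite addr_ge0 ?mulr_ge0 ?isum_ge0 ?rho_ge0 ?exprn_ge0 ?invr_ge0.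
have cross : \sum_(t < size v) \sum_(i < N) phi i t <=
    N%:R * r + (size v)%:R * 2 ^+ m.+1.
  apply: (node_cross (st := st) (en := en) nd r0); first by rewrite exprn_ge0.
  - move=> i t iN tv far; rewrite /phi big_seq big1 // => a aG.
    have [_ w _] := tb i iN.
    rewrite (pairing_far w (st := st t) (en := en t)) ?normr0 //.
      have [le1 le2] := group_bounds a0 (okG t tv) aG => j aj.
      have := minsupp_le aj; have := maxsupp_ge (items_c00 (@Wc00 _ _ _ _) (okG t tv) aG) aj.
      by rewrite /st /en; lia.
    by have := node_prev nd iN; lia.
  - move=> i t iN tv stp; rewrite /phi.
    have [v' [gE vs' vn' vA']] := vA _ (Gv t tv).
    have LLs : (L <= Ls i)%N.
      by apply: leq_trans (node_L nd iN); apply/ltnW/ltn_expl.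
    have := IH (Ls i) (Hs i) (xs i) (us i) v' Pm _ _ _ (trs i iN) _ vn' _ vA'.
    rewrite -gE => /(_ _ _ _ (okG t tv) _) ih.
    apply: le_trans (ih _ _ _ _) _.
    + by lia.
    + exact: leq_trans LLs.
    + exact: leq_trans LLs.
    + have := vs' _ (hd t tv); have := node_prev nd iN; rewrite /st in stp; lia.
    rewrite /r; apply: lerD; first by rewrite ler_wpM2l // isum_flatten_mem // Gv.
    by rewrite ler_wpM2l ?exprn_ge0 // rho_le.
  - move=> i t iN tv; have [_ w x1] := tb i iN.
    rewrite -[leRHS]mulr1; apply: (items_sum_le (k := k)) => //; first exact: okG.
      by apply: vA; exact: Gv.
      exact: x1.
    exact: within_c00 w.
  - move=> t t' /andP[tt tv'].
    have tv := ltn_trans tt tv'.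
    have /and3P[] // : irel (last a0 (G t)) (head a0 (G t')).
    by apply: (@pairwise_flatten_nth _ _ v t t'); rewrite ?h1 ?la ?hd ?tt.
have -> : \sum_(a <- flatten v) `|pairing a.1 x| =
    \sum_(t < size v) \sum_(a <- G t) `|pairing a.1 x|.
  by rewrite big_flatten (big_nth [::]) big_mkord.
apply: (@le_trans _ _ (N%:R^-1 * \sum_(t < size v) \sum_(i < N) phi i t)).
  rewrite mulr_sumr; apply: ler_sum => t _; rewrite exchange_big /= mulr_sumr.
  rewrite !big_seq; apply: ler_sum => a aG.
  have ca : c00 a.1 := items_c00 (@Wc00 _ _ _ _) (okG t (ltn_ord t)) aG.
  rewrite xE pairingZr // pairing_sumr // normrM gtr0_norm ?invr_gt0 //.
  by rewrite ler_wpM2l ?invr_ge0 ?ler0n // ler_norm_sum.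
apply: le_trans (ler_wpM2l _ cross) _; first by rewrite invr_ge0 ler0n.
rewrite mulrDr mulrA mulVf ?lt0r_neq0 // mul1r /r -addrA lerD2l.
have e1 : N%:R^-1 * ((size v)%:R * 2 ^+ m.+1) <= 2 ^+ m.+1 * rho L.
  rewrite mulrA [X in X * _]mulrC [leLHS]mulrC ler_wpM2l ?exprn_ge0 // /rho.
  apply: ler_pM; rewrite ?invr_ge0 ?ler0n ?ler_nat //.
  by have [h _ _ _] := nd; rewrite lef_pV2 ?posrE ?exprn_gt0 // -natrX ler_nat.
apply: le_trans (lerD (lexx _) e1) _; rewrite -mulrDl ler_wpM2r ?rho_ge0 //.
rewrite -!natrX -natrD ler_nat.
have : (2 ^ m.+1 <= 2 ^ (2 * m + 6))%N by rewrite leq_exp2l //; clear; lia.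
have -> : (2 * m.+1 + 6 = (2 * m + 6).+2)%N by clear; lia.
by rewrite !expnS; lia.
Qed.

Lemma tree_items_sum m P L H x u0 u :
  (Pmin <= P)%N -> (P + m <= Pmax)%N -> (Lmin <= L)%N -> (0 < L)%N ->
  tree (P + m).+2 L H x u0 -> items_ok k W u -> Adm m u ->
  \sum_(a <- u) `|pairing a.1 x| <=
    K * 2 ^- P * isum u + 2 ^+ (2 * m + 6) * rho L.
Proof.
move=> h1 h2 h3 h4 h5 ok uA; have [->|u0'] := eqVneq u [::].
  by rewrite big_nil /isum big_nil mulr0 add0r mulr_ge0 ?exprn_ge0 ?rho_ge0.
have := tree_items_groups (v := [:: u]) h1 h2 h3 h4 h5.
rewrite /= cats0; apply=> //; first by rewrite inE eq_sym.
by move=> g; rewrite inE => /eqP->.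
Qed.

End ItemsSum.

Lemma node_H_le L N Ls Hs i : node L N Ls Hs -> (i < N)%N -> (Hs i <= Hs N.-1)%N.
Proof.
move=> nd iN; have Nl : (N.-1 < N)%N by lia.
have : (i <= N.-1)%N by lia.
rewrite leq_eqVlt => /orP[/eqP->//|lt].
have := node_prev_mono (i := i) (j := N.-1) nd; rewrite lt Nl => /(_ isT).
by have [_ _ h _] := nd; have := node_prev nd Nl; have := h _ Nl; lia.
Qed.

(** The averages attached to the leaves form, together, an admissible very fast
    growing sequence of order increased by the depth of the tree. *)
Lemma tree_items (k : bool) (m0 : nat) (eps : R) :
  let good (L H : nat) x u := [/\ items_ok k W u, u != [::],
     forall a, a \in u -> [&& (L < minsupp a.1)%N, (maxsupp a.1 <= H)%N,
        (L < a.2)%N & (a.2 <= 2 ^ H)%N] & eps <= \sum_(a <- u) pairing a.1 x] in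
  (forall L H y u, leaf L H y u -> Adm m0 u /\ good L H y u) ->
  forall P L H x u, tree P L H x u -> Adm (P + m0) u /\ good L H x u.
Proof.
move=> good lf; elim=> [|P IH] L H x u; first exact: lf.
move=> /treeS[N [Ls [Hs [xs [us [nd trs -> -> ->]]]]]].
have N0 := node_N0 nd; have N0' : 0 < N%:R :> R by rewrite ltr0n.
have ih i (iN : (i < N)%N) := IH _ _ _ _ (trs i iN).
have tb i (iN : (i < N)%N) := tree_basic leafP (trs i iN).
have mem a : a \in flatten [seq us i | i <- iota 0 N] -> exists2 i, (i < N)%N & a \in us i.
  move=> /flattenP[g /mapP[i]]; rewrite mem_iota add0n => /andP[_ iN] -> ai.
  by exists i.
have bds a i : (i < N)%N -> a \in us i -> [&& (Ls i < minsupp a.1)%N, (maxsupp a.1 <= Hs i)%N,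
        (Ls i < a.2)%N & (a.2 <= 2 ^ Hs i)%N].
  by move=> iN; have [_ [_ _ h _]] := ih i iN; exact: h.
have rel i j a b : (i < j < N)%N -> a \in us i -> b \in us j -> irel a b.
  move=> ij ai bj; have jN : (j < N)%N by case/andP: ij.
  have iN : (i < N)%N by case/andP: ij => h1 h2; exact: ltn_trans h1 h2.
  have /and4P[h1 h2 h3 h4] := bds a i iN ai; have /and4P[g1 g2 g3 g4] := bds b j jN bj.
  have lt := node_lt nd ij; have e := ltn_expl (Hs i) (ltnSn 1).
  apply/and3P; split.
  - exact: leq_ltn_trans h2 (ltn_trans e (leq_ltn_trans lt g1)).
  - by apply: leq_ltn_trans g3; apply: leq_trans lt; rewrite leq_exp2l.
  - exact: leq_ltn_trans h4 (leq_ltn_trans lt g3).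
have pw M : (M <= N)%N -> pairwise (@irel R) (flatten [seq us i | i <- iota 0 M]).
  elim: M => // M IHM MN; rewrite -(addn1 M) iotaD map_cat flatten_cat /= cats0 add0n.
  rewrite pairwise_cat IHM 1?ltnW //=; apply/andP; split; last first.
    by have [_ [[_ h] _ _ _]] := ih M MN.
  apply/allrelP => a b /flattenP[g /mapP[i]]; rewrite mem_iota add0n => /andP[_ iM] -> ai bM.
  by apply: (rel i M) => //; rewrite iM.
have ok : items_ok k W (flatten [seq us i | i <- iota 0 N]).
  split; last exact: pw.
  by move=> a /mem[i iN ai]; have [_ [[h _] _ _ _]] := ih i iN; exact: h.
split.
  exists [seq us i | i <- iota 0 N]; split=> //.
  - move=> a /mem[i iN ai]; rewrite size_map size_iota.
    have /and4P[h1 _ _ _] := bds a i iN ai; apply: ltnW; apply: leq_ltn_trans h1.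
    exact: node_base nd iN.
  - apply/negP => /mapP[i]; rewrite mem_iota add0n => /andP[_ iN] e.
    by have [_ [_]] := ih i iN; rewrite -e.
  - move=> g /mapP[i]; rewrite mem_iota add0n => /andP[_ iN] ->.
    by have [] := ih i iN.
split=> //.
- have [_ [_ + _ _]] := ih 0%N N0; case: (N) N0 => // N' _ /=.
  by case: (us 0%N).
- move=> a /mem[i iN ai]; have /and4P[h1 h2 h3 h4] := bds a i iN ai.
  have LL := node_L nd iN; have e := ltn_expl L (ltnSn 1).
  have HH := node_H_le nd iN; have LL' : (L <= Ls i)%N by lia.
  apply/and4P; split; [exact: leq_ltn_trans h1|exact: leq_trans HH|exact: leq_ltn_trans h3|].
  by apply: leq_trans h4 _; rewrite leq_exp2l.
- rewrite big_flatten /= big_map.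
  have -> : \sum_(i <- iota 0 N) \sum_(a <- us i) pairing a.1 (N%:R^-1 *: \sum_(j < N) xs j) =
     \sum_(i < N) \sum_(a <- us i) N%:R^-1 * pairing a.1 (xs i).
    have -> : iota 0 N = index_iota 0 N by rewrite /index_iota subn0.
    rewrite big_mkord; apply: eq_bigr => i _.
    rewrite big_seq [RHS]big_seq; apply: eq_bigr => a ai.
    have [_ [oki _ _ _]] := ih i (ltn_ord i).
    have ca : c00 a.1 := items_c00 (@Wc00 _ _ _ _) oki ai.
    rewrite pairingZr // pairing_sumr // (bigD1 i) //= big1 ?addr0 // => j ji.
    have /and4P[h1 h2 _ _] := bds a i (ltn_ord i) ai.
    have [_ w _] := tb j (ltn_ord j).
    apply: (pairing_far w (st := minsupp a.1) (en := maxsupp a.1)).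
      by move=> q aq; rewrite minsupp_le // maxsupp_ge.
    have : (i < j)%N || (j < i)%N.
      by rewrite -neq_ltn; apply: contra ji => /eqP e; apply/eqP/ord_inj.
    case/orP => ij.
      have := node_prev_mono (i := i) (j := j) nd; rewrite ij ltn_ord => /(_ isT).
      by have := node_prev nd (ltn_ord j); lia.
    have := node_prev_mono (i := j) (j := i) nd; rewrite ij ltn_ord => /(_ isT).
    by have := node_prev nd (ltn_ord i); lia.
  apply: (@le_trans _ _ (\sum_(i < N) N%:R^-1 * eps)).
    by rewrite sumr_const card_ord -mulrnAl -[N%:R^-1 *+ N]mulr_natl divff ?mul1r ?lt0r_neq0.
  apply: ler_sum => i _; rewrite -mulr_sumr ler_wpM2l ?invr_ge0 ?ler0n //.
  by have [_ []] := ih i (ltn_ord i).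
Qed.

Lemma tree_span (Sp : (nat -> R) -> Prop) :
  (forall (c : R) x y, Sp x -> Sp y -> Sp (c *: x + y)) ->
  (forall L H y u, leaf L H y u -> Sp y) ->
  forall P L H x u, tree P L H x u -> Sp x.
Proof.
move=> SpL lf; elim=> [|P IH] L H x u; first exact: lf.
move=> /treeS[N [Ls [Hs [xs [us [nd trs -> _ _]]]]]]; have N0 := node_N0 nd.
have ih i (iN : (i < N)%N) := IH _ _ _ _ (trs i iN).
have Sp0 : Sp 0 by have := SpL (-1) _ _ (ih 0%N N0) (ih 0%N N0); rewrite scaleN1r addNr.
rewrite -[_ *: _]addr0; apply: (SpL) => //.
apply: big_ind => // [x1 y1 h1 h2|i _]; last exact: ih.
by rewrite -[x1]scale1r; exact: SpL.
Qed.

Lemma tree_last P L H x u :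
  (forall L H y u, leaf L H y u -> exists2 a, a \in u & maxsupp a.1 = H) ->
  tree P L H x u -> exists2 a, a \in u & maxsupp a.1 = H.
Proof.
move=> lf; elim: P L H x u => [|P IH] L H x u; first exact: lf.
move=> /treeS[N [Ls [Hs [xs [us [nd trs _ -> ->]]]]]]; have N0 := node_N0 nd.
have Nl : (N.-1 < N)%N by lia.
have [a au e] := IH _ _ _ _ (trs _ Nl); exists a => //.
apply/flattenP; exists (us N.-1) => //; apply/mapP; exists N.-1 => //.
by rewrite mem_iota add0n.
Qed.

Lemma tree_exists : (forall L, exists H y u, leaf L H y u) ->
  forall P L, exists H x u, tree P L H x u.
Proof.
move=> lf; elim=> [|P IH] L; first exact: lf.
have [F FP] := choice (fun L => IH L).
have [G GP] := choice FP; have [E EP] := choice GP.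
pose Ls i := iter i (fun l => 2 ^ F l)%N (2 ^ L)%N.
exists (F (Ls (2 ^ L).-1)%N), ((2 ^ L)%:R^-1 *: \sum_(i < 2 ^ L) G (Ls i)).
exists (flatten [seq E (Ls i) | i <- iota 0 (2 ^ L)]).
apply/treeS; exists (2 ^ L)%N, Ls, (F \o Ls), (G \o Ls), (E \o Ls); split=> //.
split=> // i iN; first by have [] := tree_basic leafP (EP (Ls i)).
Qed.

Section RIS.
Variable C : R.
Hypothesis C0 : 0 <= C.
Hypothesis ris : forall L H y u, leaf L H y u -> forall f w, type_Ialpha W f w ->
  (w < L)%N -> `|pairing f y| <= C * 2 ^- w.

Lemma pairing_mean f N (xs : nat -> nat -> R) : c00 f ->
  `|pairing f (N%:R^-1 *: \sum_(i < N) xs i)| <= N%:R^-1 * \sum_(i < N) `|pairing f (xs i)|.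
Proof.
move=> cf; rewrite pairingZr // pairing_sumr // normrM ger0_norm ?invr_ge0 ?ler0n //.
by rewrite ler_wpM2l ?invr_ge0 ?ler0n // ler_norm_sum.
Qed.

Lemma tree_ris_small P L H x u : tree P L H x u -> forall f w, type_Ialpha W f w ->
  (w < L)%N -> `|pairing f x| <= C * 2 ^- w.
Proof.
elim: P L H x u => [|P IH] L H x u; first exact: ris.
move=> /treeS[N [Ls [Hs [xs [us [nd trs -> _ _]]]]]] f w fI wL; have N0 := node_N0 nd.
have Wf : W f := type_I_W (k := true) fI.
apply: le_trans (pairing_mean _ _ (W_c00 Wf)) _.
rewrite mulrC ler_pdivrMr ?ltr0n //.
apply: (@le_trans _ _ (\sum_(i < N) (C * 2 ^- w))); last first.
  by rewrite sumr_const card_ord mulr_natr.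
apply: ler_sum => i _; apply: (IH _ _ _ _ (trs i (ltn_ord i))) => //.
by have := node_L nd (ltn_ord i); have := ltn_expl L (ltnSn 1); lia.
Qed.

(** The entries beyond [w] are covered by the estimate on the leaves, and those
    before [w] by the size of the coordinates, since their supports are short; the
    entry that may remain has coefficient at most [2^-L]. *)
Lemma tree_ris P L H x u : tree P.+1 L H x u -> forall f w, type_Ialpha W f w ->
  `|pairing f x| <= (C + w%:R) * 2 ^- w + 2 ^- L.
Proof.
move=> /treeS[N [Ls [Hs [xs [us [nd trs -> _ _]]]]]] f w fI; have N0 := node_N0 nd.
have Wf : W f := type_I_W (k := true) fI.
have tb i (iN : (i < N)%N) := tree_basic leafP (trs i iN).
have w0 : 0 <= 2 ^- w :> R by rewrite invr_ge0 exprn_ge0.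
apply: le_trans (pairing_mean _ _ (W_c00 Wf)) _.
pose b i : bool := (Ls i <= w < Hs i)%N.
apply: (@le_trans _ _ (N%:R^-1 * \sum_(i < N) ((C + w%:R) * 2 ^- w + (b i)%:R))).
  rewrite ler_wpM2l ?invr_ge0 ?ler0n //; apply: ler_sum => i _.
  have [_ xw x1] := tb i (ltn_ord i).
  have [wL|Lw] := ltnP w (Ls i).
    apply: le_trans (tree_ris_small (trs i (ltn_ord i)) fI wL) _.
    by apply: ler_wpDr; rewrite ?ler0n // ler_wpM2r // lerDl.
  rewrite /b Lw /=; have [wH|Hw] := ltnP w (Hs i).
    by apply: le_trans (x1 f Wf) _; rewrite lerDr mulr_ge0 ?addr_ge0.
  rewrite addr0.
  apply: (@le_trans _ _ (2 ^- w * (1 * (Hs i)%:R))).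
    apply: pairing_l1 => //; first by move=> j; exact: (type_I_coord hs (k := true) fI).
      by move=> j; apply: (bnd_coord _ x1); exact: within_c00 xw.
    by move=> j /xw; lia.
  rewrite mul1r mulrC ler_wpM2r //; apply: ler_wpDl => //.
  by rewrite ler_nat.
rewrite big_split /= sumr_const card_ord -[(_ * 2 ^- w) *+ N]mulr_natl mulrDr mulrA.
rewrite mulVf ?pnatr_eq0 -?lt0n // mul1r lerD2l.
apply: (@le_trans _ _ (N%:R^-1 * 1)).
  rewrite ler_wpM2l ?invr_ge0 ?ler0n //; apply: le_trans (ler_norm _) _.
  apply: sum_one_nonzero => // [i _|i j _ _].
    by case: (b i); rewrite ?normr1 ?normr0.
  have bn (c : bool) : (c%:R != 0 :> R) -> c by case: c; rewrite ?eqxx.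
  move=> /bn /andP[h1 h2] /bn /andP[h3 h4]; apply: ord_inj.
  case: (ltngtP i j) => // ij; exfalso.
    have := node_prev_mono (i := i) (j := j) nd; rewrite ij ltn_ord => /(_ isT).
    by have := node_prev nd (ltn_ord j); lia.
  have := node_prev_mono (i := j) (j := i) nd; rewrite ij ltn_ord => /(_ isT).
  by have := node_prev nd (ltn_ord i); lia.
rewrite mulr1; have [h _ _ _] := nd.
by rewrite lef_pV2 ?posrE ?exprn_gt0 ?ltr0n // -natrX ler_nat.
Qed.

End RIS.

End TreeSums.

(** * Special sequences and functionals of type II *)

Section Geometric.
Variable R : realType.

Lemma uniq_sum_geo (S : seq nat) (r : R) a : uniq S -> 0 <= r -> r < 1 ->
  (forall w, w \in S -> (a <= w)%N) ->
  \sum_(w <- S) r ^+ w <= r ^+ a / (1 - r).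
Proof.
move=> uS r0 r1 aS; have r1' : 0 < 1 - r by rewrite subr_gt0.
pose M := (\max_(w <- S) w).+1.
have SM w : w \in S -> (w < M)%N by move=> wS; rewrite ltnS; apply: leq_bigmax_seq.
have pS : perm_eq S [seq w <- index_iota a M | w \in S].
  apply: uniq_perm => //; first by rewrite filter_uniq // iota_uniq.
  move=> w; rewrite mem_filter mem_index_iota.
  by case: (boolP (w \in S)) => //= wS; rewrite aS // SM.
rewrite (perm_big _ pS) /= big_filter.
apply: (@le_trans _ _ (\sum_(a <= w < M) r ^+ w)).
  by rewrite big_mkcond /=; apply: ler_sum => w _; case: ifP => // _; rewrite exprn_ge0.
rewrite ler_pdivlMr //; elim: M {SM pS} => [|M IH].
  by rewrite big_geq // mul0r exprn_ge0.
have [aM|Ma] := leqP a M; last by rewrite big_geq // mul0r exprn_ge0.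
rewrite big_nat_recr //= mulrDl.
suff H q : (a <= q)%N -> (\sum_(a <= w < q) r ^+ w) * (1 - r) = r ^+ a - r ^+ q.
  rewrite H // mulrBr mulr1 -exprSr addrA subrK.
  by rewrite lerBlDr lerDl exprn_ge0.
elim: q => [|q IHq]; first by rewrite leqn0 => /eqP->; rewrite big_geq // mul0r subrr.
rewrite leq_eqVlt => /orP[/eqP <-|]; first by rewrite big_geq // mul0r subrr.
rewrite ltnS => aq; rewrite big_nat_recr //= mulrDl IHq // mulrBr mulr1 -exprSr.
by rewrite addrA subrK.
Qed.

Lemma sqr_exp_le w : (w ^ 2 * 2 ^ w <= 4 * 3 ^ w)%N.
Proof.
have H q : ((q + 5) ^ 2 * 2 ^ (q + 5) <= 4 * 3 ^ (q + 5))%N.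
  elim: q => // q IH; rewrite addSn !expnS; nia.
case: w => [|[|[|[|[|w]]]]] //.
by have := H w; rewrite addnC.
Qed.

Lemma sqr_half_le w : (w%:R ^+ 2) * 2 ^- w <= 4 * (3 / 4) ^+ w :> R.
Proof.
rewrite ler_pdivrMr ?exprn_gt0 // expr_div_n.
have -> : 4 ^+ w = 2 ^+ w * 2 ^+ w :> R by rewrite -exprMn -natrM.
have e : 2 ^+ w != 0 :> R by rewrite expf_neq0.
have -> : 4 * (3 ^+ w / (2 ^+ w * 2 ^+ w)) * 2 ^+ w = 4 * 3 ^+ w / 2 ^+ w :> R.
  by field.
rewrite ler_pdivlMr ?exprn_gt0 // -!natrX -!natrM ler_nat; exact: sqr_exp_le.
Qed.

End Geometric.

Section CodingFacts.
Variables (R : realType) (s : nat -> R -> R) (hs : dense_in_sphere s).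
Variables (l : nat -> nat) (L1 L2 L3 : set nat) (hL : coding_weights R l L1 L2 L3).
Variables (sigma : seq (nat -> R) -> nat) (hsigma : coding_function L2 sigma).
Local Notation W := (norming_set s L1 sigma).
Local Notation special := (special L1 sigma).
Implicit Types (x : nat -> R).

Definition wt (w : nat) : Prop := range l w.

Lemma l_mono i j : (i < j)%N -> (2 ^ (2 * l i) < l j)%N.
Proof.
have [[_ h] _ _ _ _] := hL; elim: j => // j IH; rewrite ltnS leq_eqVlt => /orP[/eqP->//|ij].
apply: ltn_trans (IH ij) _; apply: leq_ltn_trans (h j).
by apply/ltnW/(leq_ltn_trans _ (ltn_expl _ (ltnSn 1))); lia.
Qed.

Lemma wt_gt9 w : wt w -> (9 < w)%N.
Proof.
move=> [i _ <-]; have [[h0 _] _ _ _ _] := hL; case: i => // i.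
have := @l_mono 0 i.+1 isT; have := ltn_expl (2 * l 0) (ltnSn 1); lia.
Qed.

Lemma wt_gap w w' : wt w -> wt w' -> (w < w')%N -> (2 ^ (2 * w) < w')%N.
Proof.
move=> [i _ <-] [j _ <-] ij; apply: l_mono; rewrite ltnNge; apply/negP.
rewrite leq_eqVlt => /orP[/eqP ji|/l_mono h]; first by rewrite ji ltnn in ij.
by have := ltn_expl (2 * l j) (ltnSn 1); lia.
Qed.

Lemma L1_wt w : L1 w -> wt w.
Proof. by have [_ _ e _ _] := hL => L1w; rewrite /wt e; left; left. Qed.

Lemma L2_wt w : L2 w -> wt w.
Proof. by have [_ _ e _ _] := hL => L2w; rewrite /wt e; left; right. Qed.

Lemma ratvec_comb (I : Type) (r : seq I) (P : pred I) (c : I -> rat) (f : I -> nat -> R) :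
  (forall i, P i -> rational_vec (f i)) ->
  rational_vec (\sum_(i <- r | P i) (ratr (c i) : R) *: f i).
Proof.
move=> h; apply: big_ind.
- by move=> i; exists 0; rewrite rmorph0.
- by move=> x y hx hy i; have [a ha] := hx i; have [b hb] := hy i; exists (a + b);
    rewrite rmorphD vecD ha hb.
- by move=> i Pi j; have [a ha] := h i Pi j; exists (c i * a); rewrite rmorphM vecZ ha.
Qed.

Lemma ratvecZ (c : rat) x : rational_vec x -> rational_vec ((ratr c : R) *: x).
Proof. by move=> h i; have [a ha] := h i; exists (c * a); rewrite rmorphM vecZ ha. Qed.

Lemma ratr_exp2V n : 2 ^- n = ratr (2 ^- n) :> R.
Proof. by rewrite fmorphV rmorphXn /= rmorph_nat. Qed.

Lemma W_rational f : W f -> rational_vec f.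
Proof.
apply: (@W_ind _ _ _ _ (@rational_vec R)) => {f}.
- by move=> n _ i; exists (i == n)%:R; rewrite /unit_vec ratr_nat.
- by move=> f _ h i; have [a ha] := h i; exists (- a); rewrite vecN ha rmorphN.
- move=> f E _ _ h i; rewrite restrE; case: ifP => _; first exact: h.
  by exists 0; rewrite rmorph0.
- by move=> d c f h _; apply: (@ratvec_comb 'I_d _ _ _ (fun j => f j)) => j _; have [] := h j (ltn_ord j).
- move=> k f n wf; have [n0 [d [a [z [_ aA _ _ ->]]]]] := wf.
  rewrite ratr_exp2V; apply: ratvecZ.
  have := @ratvec_comb 'I_d (index_enum _) xpredT (fun=> 1) (fun q => a q).
  rewrite (eq_bigr (fun q : 'I_d => a q)); first by apply=> q _; have [] := kavg_in (aA q (ltn_ord q)).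
  by move=> q _; rewrite rmorph1 scale1r.
- move=> d f g w F lam e [[h1 _ _ _ _] _] ok; rewrite /II_sum.
  have -> : 2^-1 = ratr 2^-1 :> R by rewrite fmorphV rmorph_nat.
  apply: ratvecZ; apply: (@ratvec_comb 'I_d _ _ _ (fun q => f q + e *: g q)) => q _ i.
  have [[_ hf] [_ hg] _ _] := h1 q (ltn_ord q).
  have [a ha] := hf i; have [b hb] := hg i.
  case: ok => [[_ ->]|[_ ->]].
    by exists (a + b); rewrite scale1r vecD ha hb rmorphD.
  by exists (a - b); rewrite scaleN1r vecD vecN ha hb rmorphB.
Qed.

Definition pairs (f g : nat -> nat -> R) q := flatten [seq [:: f i; g i] | i <- iota 0 q].

Lemma pairsS f g q : pairs f g q.+1 = pairs f g q ++ [:: f q; g q].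
Proof. by rewrite /pairs -(addn1 q) iotaD map_cat flatten_cat /= add0n. Qed.

Lemma size_pairs f g q : size (pairs f g q) = q.*2.
Proof. by elim: q => // q IH; rewrite pairsS size_cat IH /= doubleS addn2. Qed.

Lemma nth_pairs f g q i : (i < q)%N ->
  nth 0 (pairs f g q) i.*2 = f i /\ nth 0 (pairs f g q) i.*2.+1 = g i.
Proof.
elim: q => // q IH; rewrite ltnS leq_eqVlt => /orP[/eqP->|iq]; rewrite pairsS !nth_cat size_pairs.
  by rewrite ltnn subnn ltnNge leqnSn /= subSnn.
have [h1 h2] := IH iq; rewrite ltn_double iq h1 -h2.
by have -> : (i.*2.+1 < q.*2)%N by lia.
Qed.

Lemma special_rational d f g w q : special W d f g w -> (0 < q <= d)%N ->
  rational_blocks (pairs f g q).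
Proof.
move=> sp /andP[q0 qd]; have [h1 h2 h3 _ _] := sp.
have par i : (i < q.*2)%N -> (i./2 < q)%N /\
    nth 0 (pairs f g q) i = if odd i then g i./2 else f i./2.
  move=> iq; have iq' : (i./2 < q)%N by rewrite ltn_half_double.
  split=> //; have [e1 e2] := nth_pairs f g iq'.
  rewrite -{1}(odd_double_half i); case: (odd i); first by rewrite add1n.
  by rewrite add0n.
split.
- by rewrite size_pairs double_gt0.
- move=> i; rewrite size_pairs => /par[iq ->].
  have id := leq_trans iq qd; have [Wf Wg _ _] := h1 _ id.
  have /succvP[f0 g0 _] := h2 _ id.
  case: (odd i); split.
  + exact: W_c00 Wg. + exact: nonempty_supp. + exact: W_rational.
  + exact: W_c00 Wf. + exact: nonempty_supp. + exact: W_rational.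
- move=> i; rewrite size_pairs => iq; have [iq1 ->] := par i (ltnW iq).
  have [iq2 ->] := par i.+1 iq; move: iq1 iq2; rewrite /= uphalf_half.
  case: (odd i); rewrite ?add0n ?add1n => iq1 iq2.
    by apply: h3; exact: leq_trans qd.
  by apply: h2; exact: leq_trans qd.
Qed.

Lemma special_weight_wt d f g w : special W d f g w ->
  forall q, (q < d)%N -> wt (w q).
Proof.
move=> sp q qd; have [_ _ _ h4 h5] := sp; have [sL2 _ _] := hsigma.
case: (posnP q) => [->|q0]; first exact: L1_wt.
apply: L2_wt; rewrite -(h5 q) ?q0 //; apply: sL2.
by apply: (special_rational sp); rewrite q0 ltnW.
Qed.

(** The weights code the past: two special sequences with a common weight agree
    before it. *)
Lemma special_weight_eq d f g w d' f' g' w' q q' :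
  special W d f g w -> special W d' f' g' w' -> (q < d)%N -> (q' < d')%N ->
  w q = w' q' -> q = q' /\ forall i, (i < q)%N -> f i = f' i /\ g i = g' i.
Proof.
move=> sp sp' qd q'd ww; have [_ _ _ h4 h5] := sp; have [_ _ _ h4' h5'] := sp'.
have [sL2 sinj _] := hsigma; have [_ _ _ [L12 _ _] _] := hL.
have mix d1 f1 g1 w1 q1 v : special W d1 f1 g1 w1 -> (0 < q1 < d1)%N -> L1 v -> v = w1 q1 -> False.
  move=> sp1 /andP[q10 q1d] L1v e; have [_ _ _ _ h] := sp1.
  have : (L1 `&` L2) v.
    split=> //; rewrite e -(h q1) ?q10 //; apply: sL2.
    by apply: (special_rational sp1); rewrite q10 ltnW.
  by rewrite L12.
case: (posnP q) => q0; case: (posnP q') => q0'.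
- by rewrite q0 q0'; split.
- by exfalso; apply: (mix _ _ _ _ q' (w 0%N) sp') => //; rewrite ?q0' // -ww q0.
- by exfalso; apply: (mix _ _ _ _ q (w' 0%N) sp) => //; rewrite ?q0 // ww q0'.
have : pairs f g q = pairs f' g' q'.
  apply: sinj; [apply: (special_rational sp)|apply: (special_rational sp')|].
  - by rewrite q0 ltnW. - by rewrite q0' ltnW.
  - by rewrite /pairs h5 ?q0 // h5' ?q0'.
move=> e; have qq : q = q'.
  by have := congr1 size e; rewrite !size_pairs => /double_inj.
split=> // i iq; have [e1 e2] := nth_pairs f g iq.
have iq' : (i < q')%N by rewrite -qq.
have [e3 e4] := nth_pairs f' g' iq'.
by rewrite -e1 -e2 -e3 -e4 e.
Qed.

Lemma special_weight_inj d f g w q r : special W d f g w -> (q < d)%N -> (r < d)%N ->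
  w q = w r -> q = r.
Proof. by move=> sp qd rd /(special_weight_eq sp sp qd rd)[]. Qed.

End CodingFacts.

Section TypeII.
Variables (R : realType) (s : nat -> R -> R) (hs : dense_in_sphere s).
Variables (L1 : set nat) (sigma : seq (nat -> R) -> nat).
Local Notation W := (norming_set s L1 sigma).
Implicit Types (f g : nat -> nat -> R) (x h : nat -> R).

Lemma type_II_unif G h A : type_II s L1 sigma G h A ->
  exists d f g w (F : {set 'I_d}) lam e E,
    [/\ special_data L1 sigma G f g w F, II_ok s F lam e,
        signed_restriction E (II_sum F lam e f g) h
      & A = [set w q | q in [set q : 'I_d |
               q \in F /\ ran (f q + e *: g q) `&` E !=set0]]].
Proof.
move=> [[d [f [g [w [F [E [h1 h2 h3]]]]]]]|
            [d [f [g [w [F [la [E [h1 h2 h3 h4]]]]]]]]].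
  exists d, f, g, w, F, (fun=> 1), 1, E; rewrite -IIplus_sumE; split=> //.
    by left.
  rewrite h3; congr image; apply/funext => q; apply/propext.
  by split=> /=; rewrite scale1r.
exists d, f, g, w, F, la, (-1), E; rewrite -IIminus_sumE; split=> //.
  by right.
rewrite h4; congr image; apply/funext => q; apply/propext.
by split=> /=; rewrite scaleN1r.
Qed.

Lemma II_norm_e d (F : {set 'I_d}) lam (e : R) : II_ok s F lam e -> `|e| = 1.
Proof. by case=> [[_ ->]|[_ ->]]; rewrite ?normrN normr1. Qed.

Lemma II_sum_pairing d (F : {set 'I_d}) lam (e : R) f g x : c00 x ->
  pairing (II_sum F lam e f g) x =
  2^-1 * \sum_(q in F) ratr (lam q) * (pairing (f q) x + e * pairing (g q) x).
Proof.
move=> cx; rewrite /II_sum pairingZl // pairing_suml //; congr (_ * _).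
by apply: eq_bigr => q _; rewrite pairingZl // pairingDl // pairingZl.
Qed.

Lemma II_term_le d (F : {set 'I_d}) lam (e : R) (q : 'I_d) (u v B : R) :
  II_ok s F lam e -> q \in F -> `|u| <= B -> `|v| <= B ->
  `|ratr (lam q) * (u + e * v)| <= 2 * B.
Proof.
move=> ok qF uB vB; rewrite normrM.
have l1 : `|ratr (lam q) : R| <= 1.
  by rewrite -ratr_norm -(rmorph1 (ratr : rat -> R)) ler_rat; exact: (II_coef_le1 hs ok qF).
rewrite -[leRHS]mul1r; apply: ler_pM => //.
apply: le_trans (ler_normD _ _) _; rewrite normrM (II_norm_e ok) mul1r.
by rewrite mulr_natl mulr2n; exact: lerD.
Qed.

Lemma II_sum_le d (F : {set 'I_d}) lam (e : R) f g x (B : 'I_d -> R) : c00 x ->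
  II_ok s F lam e ->
  (forall q, q \in F -> `|pairing (f q) x| <= B q /\ `|pairing (g q) x| <= B q) ->
  `|pairing (II_sum F lam e f g) x| <= \sum_(q in F) B q.
Proof.
move=> cx ok h; rewrite II_sum_pairing // normrM ger0_norm ?invr_ge0 //.
rewrite mulrC ler_pdivrMr // mulr_suml.
apply: le_trans (ler_norm_sum _ _ _) _; apply: ler_sum => q qF.
by have [h1 h2] := h q qF; rewrite [leRHS]mulrC; exact: (II_term_le ok qF).
Qed.

Lemma II_start d (F : {set 'I_d}) lam (e : R) f g w (q0 : 'I_d) i :
  special L1 sigma W d f g w -> (forall q, q \in F -> (q0 <= q)%N) ->
  II_sum F lam e f g i != 0 -> (minsupp (f q0) <= i)%N.
Proof.
move=> sp q0m; have [h1 h2 _ _ _] := sp.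
rewrite /II_sum vecZ vec_sum mulf_eq0 negb_or => /andP[_ nz].
have [[q qF fq]|H] := pselect (exists2 q : 'I_d, q \in F & (f q i != 0) || (g q i != 0)); last first.
  exfalso; move: nz; rewrite big1 ?eqxx // => q qF; rewrite vecZ vecD vecZ.
  have : ~~ ((f q i != 0) || (g q i != 0)) by apply/negP => h; apply: H; exists q.
  by rewrite negb_or !negbK => /andP[/eqP-> /eqP->]; rewrite mulr0 addr0 mulr0.
have [Wf Wg _ _] := h1 q (ltn_ord q); have /succvP[f0 g0 fg] := h2 q (ltn_ord q).
have a1 : (minsupp (f q) <= i)%N.
  case/orP: fq => [/minsupp_le//|/minsupp_le gi].
  by have := minsupp_maxsupp (W_c00 Wf) f0; lia.
apply: leq_trans a1; have := q0m q qF; rewrite leq_eqVlt => /orP[/eqP->//|lt].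
have := special_lt (@Wc00 _ _ _ _) sp (q := q0) (r := q); rewrite lt ltn_ord => /(_ isT).
have [Wf0 Wg0 _ _] := h1 q0 (ltn_ord q0); have /succvP[f00 g00 fg0] := h2 q0 (ltn_ord q0).
have := minsupp_maxsupp (W_c00 Wf0) f00; have := minsupp_maxsupp (W_c00 Wg0) g00; lia.
Qed.

Lemma type_I_restr k (f : nat -> R) n E : nat_interval E ->
  type_I (kavg s L1 sigma k W) f n -> type_I (kavg s L1 sigma k W) (f \_ E) n.
Proof.
move=> nE [g [E' [gw gr]]]; exists g, (E' `&` E); split=> //.
exact: signed_restr_patch.
Qed.

End TypeII.

(** * Beta-averages on iterated averages *)

Section BetaTrees.
Variables (R : realType) (s : nat -> R -> R) (hs : dense_in_sphere s).
Variables (l : nat -> nat) (L1 L2 L3 : set nat) (hL : coding_weights R l L1 L2 L3).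
Variables (sigma : seq (nat -> R) -> nat) (hsigma : coding_function L2 sigma).
Local Notation W := (norming_set s L1 sigma).
Local Notation kavg := (kavg s L1 sigma).
Local Notation items_ok := (items_ok s L1 sigma).
Local Notation bnd := (bnd s L1 sigma).
Local Notation wt := (wt l).
Local Notation item := (item R).
Implicit Types (x h : nat -> R) (u : seq item).

(** Only one average of the functional can be of small size; it contributes at most
    the norm of [x]. *)
Lemma type_I_split k f n x (h : nat) B T : type_I (kavg k W) f n -> c00 x ->
  (forall i, x i != 0 -> (h < i)%N) -> bnd x B ->
  (forall u, items_ok k W u -> Adm n u -> isum u <= 2 ^- h ->
     \sum_(a <- u) `|pairing a.1 x| <= T) ->
  `|pairing f x| <= 2 ^- n * (B + T).
Proof.
move=> /(type_I_items)[u [ok uA n0 ->]] cx xh xB uT.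
rewrite pairingZl // pairing_suml // normrM ger0_norm ?invr_ge0 ?exprn_ge0 //.
rewrite ler_wpM2l ?invr_ge0 ?exprn_ge0 //.
have [u0 [u' [e o1 iu]]] := first_touch h ok.
apply: le_trans (ler_norm_sum _ _ _) _.
have -> : \sum_(a <- u) `|pairing a.1 x| = \sum_(a <- [seq a <- u | (h < maxsupp a.1)%N]) `|pairing a.1 x|.
  rewrite big_filter [RHS]big_mkcond big_seq [RHS]big_seq; apply: eq_bigr => a au.
  case: ltnP => // ha; rewrite pairing_eq0 ?normr0 // => i.
  have [->|xi] := eqVneq (x i) 0; first by right.
  left; apply: contrapT => /eqP ai.
  have := maxsupp_ge (items_c00 (@Wc00 _ _ _ _) ok au) ai; have := xh i xi; lia.
have ok' := items_filter (fun a : item => (h < maxsupp a.1)%N) ok.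
have uA' := Adm_filter (fun a : item => (h < maxsupp a.1)%N) uA.
rewrite e in ok' uA' *; rewrite big_cat /=; apply: lerD.
  case: u0 o1 e ok' uA' => [|a [|]] //= _ _ ok' _.
    by rewrite big_nil; exact: bnd_ge0 xB.
  by rewrite big_cons big_nil addr0; apply: xB; have [/kavg_in] := ok'.1 a (mem_head _ _).
have pu' : pairwise (@irel R) u' by have := ok'.2; rewrite pairwise_cat => /and3P[].
have okt : items_ok k W u'.
  by apply: items_sub ok' => // a au; rewrite mem_cat au orbT.
apply: uT => //.
suff -> : u' = [seq a <- u0 ++ u' | a \in u'] by exact: Adm_filter.
have irr : irreflexive (@irel R).
  move=> a; apply/negbTE/negP => /and3P[_ _]; by rewrite ltnn.
have uq : uniq (u0 ++ u').
  apply: (@pairwise_uniq _ (@irel R)) => //; exact: ok'.2.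
rewrite filter_cat (_ : [seq a <- u0 | a \in u'] = [::]) ?cat0s.
  by apply/esym/all_filterP/allP.
apply/eqP; rewrite -(negbK (_ == _)) -has_filter; apply/hasPn => a ao.
by move: uq; rewrite cat_uniq => /and3P[_ /hasPn H _]; apply/negP => /H /negP; apply.
Qed.

Section BetaNode.
Variables (L N : nat) (Ls Hs : nat -> nat) (xs : nat -> nat -> R) (gam : nat -> R).
Hypothesis nd : node L N Ls Hs.
Hypothesis L2le : (2 <= L)%N.
Hypothesis xw : forall i, (i < N)%N -> inside (Ls i) (Hs i) (xs i).
Hypothesis x1 : forall i, (i < N)%N -> bnd (xs i) 1.
Hypothesis gam0 : forall w, 0 <= gam w.
Hypothesis xgam : forall i, (i < N)%N -> forall f w, type_Ialpha W f w -> wt w ->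
  `|pairing f (xs i)| <= gam w + 2 ^- Ls i.

Lemma sqr_le_exp q : (4 <= q)%N -> (q * q <= 2 ^ q)%N.
Proof.
elim: q => // q IH; rewrite leq_eqVlt => /orP[/eqP<-//|]; rewrite ltnS => q4.
by have := IH q4; rewrite expnS; nia.
Qed.

(** A type II functional starts in some entry of the node; on the later entries
    it has few terms, each of which sees little besides what its weight
    allows. *)
Lemma type_II_node h A : type_II s L1 sigma W h A ->
  exists S, [/\ uniq S, forall w, w \in S -> A w /\ wt w &
    `|pairing h (\sum_(i < N) xs i)| <= 2 + N%:R * \sum_(w <- S) gam w].
Proof.
have N0 := node_N0 nd; have N0' : 0 < N%:R :> R by rewrite ltr0n.
move=> /type_II_unif[d [f [g [w [F [lam [e [E [sd ok [nE hE] ->]]]]]]]]].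
have [sp [q0 q0F [q0m Fq0]]] := sd; have [sp1 sp2 _ _ _] := sp.
pose F' := [set q in F | `[< ran (f q + e *: g q) `&` E !=set0 >]]%SET.
exists [seq w q | q : 'I_d <- enum F']; split.
- rewrite map_inj_in_uniq ?enum_uniq // => q r _ _ e1; apply: ord_inj.
  exact: (special_weight_inj hL hsigma sp (ltn_ord q) (ltn_ord r) e1).
- move=> v /mapP[q]; rewrite mem_enum inE => /andP[qF /asboolP qE] ->; split.
    by exists q.
  exact: (special_weight_wt hL hsigma sp (ltn_ord q)).
have Wh0 := W_II sd ok; have Wh : W h.
  have Wr := W_restr nE Wh0.
  by case: hE => ->; [exact: Wr|exact: WN].
have hP x : c00 x -> `|pairing h x| = `|pairing (II_sum F lam e f g) (x \_ E)|.
  by move=> cx; case: hE => ->; rewrite ?pairingNl ?normrN // pairing_patch.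
set Sg := \sum_(v <- [seq w q | q : 'I_d <- enum F']) gam v.
have Sg0 : 0 <= Sg by apply: sumr_ge0.
have SgE : Sg = \sum_(q in F') gam (w q) by rewrite /Sg big_map big_enum.
have e0 : e != 0 by rewrite -normr_gt0 (II_norm_e ok).
have inran q i : (f q i != 0) || (g q i != 0) -> (q < d)%N -> ran (f q + e *: g q) i.
  move=> fg qd; have [Wf Wg _ _] := sp1 q qd; have /succvP[f0 g0 lt] := sp2 q qd.
  have nz : (f q + e *: g q) i != 0.
    rewrite vecD vecZ; have [fi|fi] := eqVneq (f q i) 0.
      by move: fg; rewrite fi eqxx /= add0r mulf_eq0 negb_or => ->; rewrite e0.
    have [gi|gi] := eqVneq (g q i) 0; first by rewrite gi mulr0 addr0.
    by have := maxsupp_ge (W_c00 Wf) fi; have := minsupp_le gi; lia.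
  by exists i, i; split=> //; rewrite leqnn.
have small i : (i < N)%N -> (#|F| <= Ls i)%N -> `|pairing h (xs i)| <= Sg + rho R (Ls i).
  move=> iN FL; have cx := within_c00 (xw iN); rewrite hP //.
  pose B (q : 'I_d) : R := if q \in F' then gam (w q) + 2 ^- Ls i else 0.
  apply: (@le_trans _ _ (\sum_(q in F) B q)).
    apply: (II_sum_le hs _ ok); first exact: c00_patch.
    move=> q qF; rewrite -!pairing_patch /B; case: ifP => qF'.
      have [Wf Wg fI gI] := sp1 q (ltn_ord q).
      have wq := special_weight_wt hL hsigma sp (ltn_ord q).
      by split; apply: xgam => //; apply: (type_I_restr (k := true) nE).
    have z : forall y, (forall j, y j != 0 -> (f q j != 0) || (g q j != 0)) ->
        `|pairing (y \_ E) (xs i)| <= 0.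
      move=> y hy; rewrite pairing_eq0 ?normr0 // => j; left; rewrite restrE.
      case: asboolP => // Ej; apply: contrapT => /eqP /hy yj.
      move: qF'; rewrite inE qF /= => /asboolPn; apply.
      by exists j; split=> //; exact: inran yj (ltn_ord q).
    by split; apply: z => j ->; rewrite ?orbT.
  rewrite /B -big_mkcondr /= (eq_bigl (mem F')); last by move=> q; rewrite !inE; case: (q \in F).
  rewrite big_split /= -SgE lerD2l sumr_const -[leLHS]mulr_natl /rho.
  rewrite ler_wpM2r ?invr_ge0 ?exprn_ge0 // ler_nat; apply: leq_trans FL.
  by apply: subset_leq_card; apply/fintype.subsetP => q; rewrite inE => /andP[].
rewrite pairing_sumr; last exact: (W_c00 Wh).
apply: le_trans (ler_norm_sum _ _ _) _.
pose nz i := pairing h (xs i) != 0.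
have [[i1 i1N i1nz]|nonz] := pselect (exists2 i, (i < N)%N & nz i); last first.
  rewrite big1 ?addr_ge0 ?mulr_ge0 // => i _; apply/eqP; rewrite normr_eq0.
  by apply: contrapT => /negP hn; apply: nonz; exists (i : nat).
have exi : exists i, (i < N)%N && nz i by exists i1; rewrite i1N.
have [{i1 i1N i1nz} i1 /andP[i1N i1nz] imin] := ex_minnP exi.
have i1H : (minsupp (f q0) <= Hs i1)%N.
  rewrite leqNgt; apply/negP => lt; move/eqP: i1nz; apply; apply/eqP.
  rewrite -normr_eq0 hP; last exact: within_c00 (xw i1N).
  rewrite normr_eq0 pairing_eq0 // => j.
  have [->|nj] := eqVneq (II_sum F lam e f g j) 0; first by left.
  right; rewrite restrE; case: ifP => // _; apply: contrapT => /eqP /(xw i1N) jH.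
  by have := II_start sp q0m nj; lia.
apply: (@le_trans _ _ (\sum_(i < N) ((i == i1 :> nat)%:R + (Sg + rho R (Ls i))))).
  apply: ler_sum => i _.
  have [ii1|ii1] := eqVneq (i : nat) i1.
    apply: le_trans (x1 (ltn_ord i) Wh) _; rewrite lerDl addr_ge0 ?rho_ge0 //.
  rewrite add0r; case: (boolP (nz i)) => [inz|]; last first.
    by rewrite negbK => /eqP ->; rewrite normr0 addr_ge0 ?rho_ge0.
  have lt : (i1 < i)%N by rewrite ltn_neqAle eq_sym ii1 imin ?ltn_ord.
  apply: small => //; apply: leq_trans (_ : (minsupp (f q0) <= _)%N); first by lia.
  have := node_prev_mono (i := i1) (j := i) nd; rewrite lt ltn_ord => /(_ isT).
  by have := node_prev nd (ltn_ord i); lia.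
rewrite big_split /= big_split /= sumr_const card_ord -[Sg *+ N]mulr_natl.
have h1 : \sum_(i < N) (i == i1 :> nat)%:R <= 1 :> R.
  rewrite (bigD1 (Ordinal i1N)) //= eqxx big1 ?addr0 // => i ii1.
  by rewrite (_ : (i == i1 :> nat) = false) //; apply/negbTE; apply: contra ii1 => /eqP e1; apply/eqP/ord_inj.
have h2 : \sum_(i < N) rho R (Ls i) <= 1.
  apply: (@le_trans _ _ (\sum_(i < N) N%:R^-1)); last first.
    by rewrite sumr_const card_ord -[_ *+ N]mulr_natl divff ?lt0r_neq0.
  apply: ler_sum => i _; apply: le_trans (rho_le R N0 (node_base nd (ltn_ord i))) _.
  rewrite /rho ler_pdivrMr ?exprn_gt0 // ler_pdivlMl // -natrX -natrM ler_nat.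
  apply: sqr_le_exp; have [h' _ _ _] := nd; apply: leq_trans h'.
  by rewrite -[4%N]/(2 ^ 2)%N leq_exp2l.
by lra.
Qed.

(** Distinct terms of a beta-average have disjoint weight sets, so the losses of all
    its terms add up to at most one sum over distinct weights. *)
Lemma node_beta a n (Gam : R) : beta_average s L1 sigma W a n ->
  (forall S, uniq S -> (forall w, w \in S -> wt w) -> \sum_(w <- S) gam w <= Gam) ->
  `|pairing a (\sum_(i < N) xs i)| <= 2 + N%:R * (Gam / n%:R).
Proof.
move=> [Wa [d [f [A [/andP[d0 dn] fG disj aE]]]]] SG.
have n0 : 0 < n%:R :> R by rewrite ltr0n; exact: leq_trans d0 dn.
have hS j : exists S, (j < d)%N -> [/\ uniq S, forall w, w \in S -> A j w /\ wt w &
    `|pairing (f j) (\sum_(i < N) xs i)| <= 2 + N%:R * \sum_(w <- S) gam w].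
  case: (ltnP j d) => jd; last by exists [::].
  by have [S hSj] := type_II_node (fG j jd).2; exists S.
have [S SP] := choice hS.
have cx : c00 (\sum_(i < N) xs i) by apply: c00_sum => i _; exact: within_c00 (xw (ltn_ord i)).
have uS M : (M <= d)%N -> uniq (flatten [seq S j | j <- iota 0 M]).
  elim: M => // M IH MN; rewrite -(addn1 M) iotaD map_cat flatten_cat /= cats0 add0n.
  have [u1 u2 _] := SP M MN; rewrite cat_uniq u1 IH 1?ltnW //= andbT.
  apply/hasPn => w wM; apply/negP => /flattenP[t /mapP[j]].
  rewrite mem_iota add0n => /andP[_ jM] -> wj.
  have [_ u3 _] := SP j (ltn_trans jM MN).
  have : (A j `&` A M) w by split; [have [] := u3 w wj|have [] := u2 w wM].
  by rewrite disj ?jM.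
have tot : \sum_(j < d) \sum_(w <- S j) gam w <= Gam.
  have -> : \sum_(j < d) \sum_(w <- S j) gam w =
      \sum_(w <- flatten [seq S j | j <- iota 0 d]) gam w.
    rewrite big_flatten big_map; have -> : iota 0 d = index_iota 0 d by rewrite /index_iota subn0.
    by rewrite big_mkord.
  apply: SG; first exact: uS.
  move=> w /flattenP[t /mapP[j]]; rewrite mem_iota add0n => /andP[_ jd] -> wj.
  by have [_ h _] := SP j jd; have [] := h w wj.
rewrite aE pairingZl // pairing_suml // normrM gtr0_norm ?invr_gt0 //.
apply: (@le_trans _ _ (n%:R^-1 * (\sum_(j < d) (2 + N%:R * \sum_(w <- S j) gam w)))).
  rewrite ler_wpM2l ?invr_ge0 ?(ltW n0) //; apply: le_trans (ler_norm_sum _ _ _) _.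
  by apply: ler_sum => j _; have [] := SP j (ltn_ord j).
rewrite big_split /= sumr_const card_ord -mulr_sumr mulrDr; apply: lerD.
  rewrite mulrC ler_pdivrMr // -[leLHS]mulr_natl mulrC ler_wpM2l // ler_nat //.
rewrite mulrCA ler_wpM2l ?ler0n // mulrC ler_wpM2r ?invr_ge0 ?(ltW n0) //.
Qed.

End BetaNode.

Lemma exp_big Q L : (8 * Q + 40 <= L)%N -> (2 ^ (3 * Q + 6) * (L * L) <= 2 ^ L)%N.
Proof.
move=> QL; pose q := (L %/ 4)%N.
have Lq : (L <= 4 * q + 3)%N by rewrite /q; lia.
have q10 : (2 * Q + 10 <= q)%N by rewrite /q; lia.
have h1 : (4 * q + 3 <= 2 ^ q)%N.
  by have := exp24 (q := q); rewrite (_ : (8 <= q)%N); [move=> /(_ isT)|]; lia.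
have h2 : (L * L <= 2 ^ (q + q))%N.
  by rewrite expnD; apply: leq_mul; lia.
apply: (@leq_trans (2 ^ (3 * Q + 6) * 2 ^ (q + q))); first by rewrite leq_mul2l h2 orbT.
by rewrite -expnD leq_exp2l //; move: QL; rewrite /q; lia.
Qed.

Lemma exp_big1 Q L : (8 * Q + 40 <= L)%N -> 2 ^+ (3 * Q + 6) * rho R L <= L%:R^-1.
Proof.
move=> QL; have L0 : (0 < L)%N by lia.
rewrite /rho mulrA ler_pdivrMr ?exprn_gt0 // [leRHS]mulrC ler_pdivlMr ?ltr0n //.
rewrite -!natrX -!natrM ler_nat -mulnA; exact: exp_big.
Qed.

Variable leaf : nat -> nat -> (nat -> R) -> seq item -> Prop.
Hypothesis leafP : leaf_basic s L1 sigma leaf.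
Local Notation tree := (tree leaf).

(** The bound for alpha-averages, on arbitrary leaves. *)
Lemma tree_alpha_sum m Q L H x u0 u : (m + 2 <= Q)%N -> (8 * Q + 40 <= L)%N ->
  tree Q L H x u0 -> items_ok true W u -> Adm m u ->
  \sum_(a <- u) `|pairing a.1 x| <=
    8 * 2 ^- (Q - m - 2) * isum u + 2 ^+ (2 * m + 6) * rho R L.
Proof.
move=> mQ QL tr ok uA.
have eQ : (Q = (Q - m - 2 + m).+2)%N by lia.
apply: (@tree_items_sum _ _ _ _ _ leafP true 0%N Q (8 * Q + 40)%N 8 _ _ m (Q - m - 2)%N L H x u0) => //.
- move=> P L' H' x' u' /andP[_ PQ] LL tr' a n ka.
  have bg : bigL P.+2 L' by rewrite /bigL; lia.
  apply: le_trans (tree_alpha hs leafP tr' bg ka) _; rewrite lerD2r.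
  rewrite ler_wpM2r ?invr_ge0 ?ler0n // ler_wpM2l // exprS invfM.
  by rewrite ler_piMl ?invr_ge0 ?exprn_ge0 // invf_le1 // ler1n.
- lia.
- lia.
- by rewrite -eQ.
Qed.

Lemma pow34 n : 2 ^- n <= (3 / 4) ^+ n :> R.
Proof.
rewrite -exprVn; elim: n => [|n IH]; first by rewrite !expr0.
by rewrite !exprS; apply: ler_pM => //; rewrite ?exprn_ge0 ?invr_ge0 //; lra.
Qed.

Section RISLeaves.
Variable C : R.
Hypothesis C0 : 0 <= C.
Hypothesis ris : forall L H y u, leaf L H y u -> forall f w, type_Ialpha W f w ->
  (w < L)%N -> `|pairing f y| <= C * 2 ^- w.
Variable ws : nat.

(** The bound for a functional of weight [w] on an iterated average of depth [Q]; for the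
    exceptional weight [ws] nothing better than the norm is available. *)
Definition gam (Q w : nat) : R :=
  2 ^- Q * ((4 * C + 14) * (3 / 4) ^+ w + (if w == ws then 8 else 0)).

Lemma gam_ge0 Q w : 0 <= gam Q w.
Proof.
rewrite /gam mulr_ge0 ?invr_ge0 ?exprn_ge0 // addr_ge0 //; last by case: ifP.
by rewrite mulr_ge0 ?exprn_ge0 ?divr_ge0 // addr_ge0 // mulr_ge0.
Qed.

Lemma gam_sum Q S : uniq S -> \sum_(w <- S) gam Q w <= 2 ^- Q * (16 * C + 64).
Proof.
move=> uS; rewrite /gam -mulr_sumr ler_wpM2l ?invr_ge0 ?exprn_ge0 //.
rewrite big_split /= -mulr_sumr.
have h1 : \sum_(w <- S) (3 / 4) ^+ w <= 4 :> R.
  have r0 : 0 <= 3 / 4 :> R by lra.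
  have r1 : 3 / 4 < 1 :> R by lra.
  have := @uniq_sum_geo R S (3 / 4) 0 uS r0 r1; rewrite expr0 => /(_ (fun _ _ => isT)).
  have -> : 1 / (1 - 3 / 4) = 4 :> R by field.
  by [].
have h2 : \sum_(w <- S) (if w == ws then 8 else 0) <= 8 :> R.
  rewrite -big_mkcond /= big_const_seq.
  have : (count (fun w => w == ws) S <= 1)%N by rewrite count_uniq_mem //; case: (_ \in _).
  by case: (count _ _) => [|[|]] //=; rewrite addr0.
have : (4 * C + 14) * \sum_(w <- S) (3 / 4) ^+ w <= (4 * C + 14) * 4.
  by rewrite ler_wpM2l // addr_ge0 // mulr_ge0.
lra.
Qed.

(** A weight below the depth is handled by the averages of the functional, a weight
    above [2^Q] by the estimate on the leaves. *)
Lemma tree_gam Q L H x u0 : (0 < Q)%N -> (8 * Q + 40 <= L)%N -> tree Q L H x u0 ->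
  forall f w, type_Ialpha W f w -> (0 < w)%N -> (w + 2 <= Q)%N \/ w = ws \/ (2 ^ Q <= w)%N ->
  `|pairing f x| <= gam Q w + 2 ^- L.
Proof.
case: Q => // Q _ QL tr f w fI w0 wcase.
have [LH xw x1] := tree_basic leafP tr.
have bg : bigL Q.+1 L by rewrite /bigL; lia.
have xb := tree_bnd hs leafP tr bg.
have q0 : 0 <= 2 ^- Q.+1 :> R by rewrite invr_ge0 exprn_ge0.
have p0 : 0 <= (3 / 4) ^+ w :> R by rewrite exprn_ge0 ?divr_ge0.
have L0 : 0 <= 2 ^- L :> R by rewrite invr_ge0 exprn_ge0.
have Wf : W f := type_I_W (k := true) fI.
case: wcase => [wQ|[->|Qw]]; last first.
- apply: le_trans (tree_ris hs leafP C0 ris tr fI) _; rewrite lerD2r.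
  apply: (@le_trans _ _ (2 ^- Q.+1 * ((C + 1) * (w%:R ^+ 2 * 2 ^- w)))).
    have -> : 2 ^- Q.+1 * ((C + 1) * (w%:R ^+ 2 * 2 ^- w)) =
      (2 ^- Q.+1 * w%:R) * ((C + 1) * w%:R) * 2 ^- w by rewrite expr2; ring.
    rewrite ler_wpM2r ?invr_ge0 ?exprn_ge0 //.
    have w1 : 1 <= w%:R :> R by rewrite ler1n.
    have h1 : 1 <= 2 ^- Q.+1 * w%:R :> R.
      by rewrite ler_pdivlMl ?exprn_gt0 // mulr1 -natrX ler_nat.
    have h2 : C + w%:R <= (C + 1) * w%:R by rewrite mulrDl mul1r lerD2r ler_peMr.
    apply: le_trans h2 _; rewrite ler_peMl // mulr_ge0 ?addr_ge0 //.
  rewrite /gam ler_wpM2l //; apply: (@le_trans _ _ ((C + 1) * (4 * (3 / 4) ^+ w))).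
    by rewrite ler_wpM2l ?addr_ge0 // sqr_half_le.
  apply: ler_wpDr; first by case: ifP.
  rewrite mulrA ler_wpM2r //; lra.
- apply: le_trans (xb f Wf) _; rewrite /gam eqxx.
  apply: ler_wpDr => //; rewrite mulrC ler_wpM2l // lerDr mulr_ge0 //.
    by rewrite addr_ge0 // mulr_ge0.
have xh i : x i != 0 -> (L < i)%N by move=> /xw /andP[].
apply: le_trans (type_I_split (k := true) fI (within_c00 xw) xh xb (T := 2 * 2 ^- Q.+1) _) _.
  move=> u ok uA iu; apply: le_trans (tree_alpha_sum wQ QL tr ok uA) _.
  have h1 : 8 * 2 ^- (Q.+1 - w - 2) * isum u <= 2 ^- Q.+1.
    have e : 2 ^- (Q.+1 - w - 2) = 2 ^+ (w + 2) * 2 ^- Q.+1 :> R.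
      have -> : 2 ^+ Q.+1 = 2 ^+ (w + 2) * 2 ^+ (Q.+1 - w - 2) :> R.
        by rewrite -exprD; congr (_ ^+ _); lia.
      by field; rewrite !expf_neq0.
    have e2 : 8 * 2 ^+ (w + 2) * isum u <= 1.
      apply: (@le_trans _ _ (8 * 2 ^+ (w + 2) * 2 ^- L)).
        by rewrite ler_wpM2l // mulr_ge0 ?exprn_ge0.
      rewrite ler_pdivrMr ?exprn_gt0 // mul1r -[8]/(8%:R) -natrX -natrM -natrX ler_nat.
      by rewrite -[8%N]/(2 ^ 3)%N -expnD leq_exp2l //; lia.
    rewrite e (_ : 8 * _ * _ = 2 ^- Q.+1 * (8 * 2 ^+ (w + 2) * isum u)); last by ring.
    by rewrite -[leRHS]mulr1 ler_wpM2l.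
  have h2 : 2 ^+ (2 * w + 6) * rho R L <= 2 ^- Q.+1.
    rewrite -[leRHS]mul1r ler_pdivlMr ?exprn_gt0 // mulrAC -exprD.
    apply: (@le_trans _ _ (2 ^+ (3 * Q.+1 + 6) * rho R L)).
      rewrite ler_wpM2r ?rho_ge0 // ler_eXn2l ?ltr1n //; lia.
    apply: le_trans (exp_big1 QL) _; rewrite invf_le1 ?ltr0n ?ler1n //; lia.
  by apply: le_trans (lerD h1 h2) _; rewrite -mulr2n mulr_natl.
rewrite /gam; apply: ler_wpDr => //.
have -> : 2 ^- w * (8 * 2 ^- Q.+1 + 2 * 2 ^- Q.+1) = 2 ^- Q.+1 * (10 * 2 ^- w) :> R by ring.
rewrite ler_wpM2l //; apply: ler_wpDr; first by case: ifP.
apply: (@le_trans _ _ (10 * (3 / 4) ^+ w)); first by rewrite ler_wpM2l // pow34.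
rewrite ler_wpM2r // addrC; apply: ler_wpDr; rewrite ?mulr_ge0 // ler_nat //.
Qed.

(** The weight sets of the terms of a beta-average are disjoint, so that the weight
    [ws] occurs in at most one term; the gap hypothesis says that no other weight
    is comparable with the depth of the tree. *)
Lemma tree_beta_sum m Q L H x u0 u : (4 * m <= Q)%N -> (12 <= Q)%N -> (8 * Q + 40 <= L)%N ->
  (forall w, wt w -> (2 * w <= Q)%N \/ w = ws \/ (2 ^ Q <= w)%N) ->
  tree Q L H x u0 -> items_ok false W u -> Adm m u ->
  \sum_(a <- u) `|pairing a.1 x| <=
    (16 * C + 64) * 2 ^- (Q - m - 2) * isum u + 2 ^+ (2 * m + 6) * rho R L.
Proof.
move=> mQ Q12 QL gap tr ok uA.
have eQ : (Q = (Q - m - 2 + m).+2)%N by lia.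
apply: (@tree_items_sum _ _ _ _ _ leafP false (Q - m - 2)%N (Q - 2)%N (8 * Q + 40)%N (16 * C + 64) _ _ m (Q - m - 2)%N L H x u0) => //.
- by rewrite addr_ge0 // mulr_ge0.
- move=> P L' H' x' u' /andP[Pm PM] LL /treeS[N [Ls [Hs [xs [us [nd trs -> _ _]]]]]] a n ka.
  have N0 := node_N0 nd; have N0' : 0 < N%:R :> R by rewrite ltr0n.
  have tb i (iN : (i < N)%N) := tree_basic leafP (trs i iN).
  have LL' i : (i < N)%N -> (8 * P.+1 + 40 <= Ls i)%N.
    by move=> iN; have := node_L nd iN; have := ltn_expl L' (ltnSn 1); lia.
  have ca : c00 a by have [/W_c00] := ka.
  rewrite pairingZr // normrM gtr0_norm ?invr_gt0 //.
  apply: (@le_trans _ _ (N%:R^-1 * (2 + N%:R * (2 ^- P.+1 * (16 * C + 64) / n%:R)))).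
    rewrite ler_wpM2l ?invr_ge0 ?ler0n //; apply: (node_beta nd _ _ _ (@gam_ge0 P.+1) _ ka).
    + by lia.
    + by move=> i iN; have [] := tb i iN.
    + by move=> i iN; have [] := tb i iN.
    + move=> i iN f w fI ww; apply: (tree_gam _ (LL' i iN) (trs i iN) fI) => //.
        by have := wt_gt9 hL ww; lia.
      case: (gap w ww) => [h|[h|h]]; [left; lia|by right; left|right; right].
      by apply: leq_trans h; rewrite leq_exp2l //; lia.
    + by move=> S uS _; exact: gam_sum.
  rewrite mulrDr mulrA mulVf ?lt0r_neq0 // mul1r [leLHS]addrC; apply: lerD.
    rewrite ler_wpM2r ?invr_ge0 ?ler0n // mulrC ler_wpM2l //.
      by rewrite addr_ge0 // mulr_ge0.
    by rewrite exprS invfM ler_piMl ?invr_ge0 ?exprn_ge0 // invf_le1 // ler1n.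
  rewrite mulrC; apply: (@le_trans _ _ (2 * 2 ^- L')); last by rewrite ler_wpM2r ?invr_ge0 ?exprn_ge0 // ler_nat.
  rewrite ler_wpM2l //.
  by have [h _ _ _] := nd; rewrite lef_pV2 ?posrE ?exprn_gt0 // -natrX ler_nat.
- lia.
- lia.
- by rewrite -eQ.
Qed.

End RISLeaves.

End BetaTrees.

(** * Sums of vectors living on windows *)

Section CZero.
Variables (R : realType) (s : nat -> R -> R) (hs : dense_in_sphere s).
Variables (l : nat -> nat) (L1 L2 L3 : set nat) (hL : coding_weights R l L1 L2 L3).
Variables (sigma : seq (nat -> R) -> nat) (hsigma : coding_function L2 sigma).
Local Notation W := (norming_set s L1 sigma).
Local Notation kavg := (kavg s L1 sigma).
Local Notation items_ok := (items_ok s L1 sigma).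
Local Notation bnd := (bnd s L1 sigma).
Local Notation wt := (wt l).
Local Notation item := (item R).

(** The functionals of type I are described by lists of averages which stay
    within any class that contains the averages used and that is closed under
    restriction and negation. *)
Lemma type_I_items_in k (G P : set (nat -> R)) f n : G `<=` W -> G `<=` P ->
  (forall (g : nat -> R) E, nat_interval E -> P g -> P (g \_ E)) ->
  (forall g : nat -> R, P g -> P (- g)) -> type_I (kavg k G) f n ->
  exists u, [/\ items_ok k W u, Adm n u, (0 < n)%N, f = 2 ^- n *: \sum_(a <- u) a.1
    & forall a, a \in u -> P a.1].
Proof.
move=> GW GP Pr PN [g [E [/(weighted_items (fun x h => Wc00 (GW x h)))[u [h uA u0 n0 gE]] [nE fE]]]].
have uP a : a \in u -> P a.1 by move=> au; apply: GP; have [/kavg_in] := h.1 a au.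
have {}h := items_mono GW h.
have [h' le] := items_restr nE h.
pose p (a : item) := a.1 \_ E != 0; pose F (a : item) : item := (a.1 \_ E, a.2).
have uA' : Adm n [seq F a | a <- u & p a] by exact: Adm_map_filter.
have gr : g \_ E = 2 ^- n *: \sum_(a <- [seq F a | a <- u & p a]) a.1.
  rewrite gE restrZ restr_sum big_map big_filter; congr (_ *: _).
  rewrite [RHS]big_mkcond; apply: eq_bigr => a _.
  by case: ifP => // /negbT; rewrite negbK => /eqP.
have uP' a : a \in [seq F a | a <- u & p a] -> P a.1.
  by move=> /mapP[b]; rewrite mem_filter => /andP[_ bu] ->; apply: Pr => //; exact: uP.
case: fE => ->; first by exists [seq F a | a <- u & p a].
have [h2 m2] := items_sign (fun=> true) h'; move: h2 m2 => /= h2 m2.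
exists [seq ((- a.1, a.2) : item) | a <- [seq F a | a <- u & p a]]; split=> //.
- rewrite -[X in map _ X]filter_predT; apply: Adm_map_filter uA'.
  by move=> a au _; rewrite m2.
- by rewrite gr big_map /= sumrN scalerN.
- by move=> a /mapP[b bu ->]; apply: PN; exact: uP'.
Qed.

(** The weights along a special sequence are distinct. *)
Lemma special_geo G d (f g : nat -> nat -> R) w (F : pred 'I_d) (r : R) a :
  G `<=` W -> special L1 sigma G d f g w -> 0 <= r -> r < 1 ->
  (forall t, F t -> (a <= w t)%N) ->
  \sum_(t | F t) r ^+ w t <= r ^+ a / (1 - r).
Proof.
move=> GW /(special_mono GW) sp r0 r1 aw.
have -> : \sum_(t | F t) r ^+ w t =
    \sum_(v <- [seq w (t : 'I_d) | t <- enum F]) r ^+ v.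
  by rewrite big_map big_enum.
apply: uniq_sum_geo => //.
  rewrite map_inj_in_uniq ?enum_uniq // => q t _ _ e1; apply: ord_inj.
  exact: (special_weight_inj hL hsigma sp (ltn_ord q) (ltn_ord t) e1).
by move=> v /mapP[t]; rewrite mem_enum => Ft ->; exact: aw.
Qed.

Variables (z : nat -> nat -> R) (j n : nat -> nat) (delta : nat -> R) (C1 C2 : R).
Hypothesis jS : forall r, (j r < j r.+1)%N.
Hypothesis zj : forall r i, z r i != 0 -> (j r < i)%N && (2 * (i + r) <= j r.+1)%N.
Hypothesis zb : forall r, bnd (z r) C1.
Hypothesis zris : forall r k f m, type_I (kavg k W) f m -> (m < j r)%N ->
  `|pairing f (z r)| <= C1 * 2 ^- m.
Hypothesis delta0 : forall r, 0 <= delta r.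
Hypothesis deltaj : forall r, (j r)%:R * delta r <= 2 ^- r.
Hypothesis zflat : forall r f w, type_Ialpha W f w -> wt w ->
  (j r <= w < j r.+1)%N -> w != n r ->
  `|pairing f (z r)| <= C1 * (3 / 4) ^+ w + delta r.

Lemma j_mono p q : (p < q)%N -> (j p.+1 <= j q)%N.
Proof. by elim: q => // q IH; rewrite ltnS leq_eqVlt => /orP[/eqP->//|/IH h]; apply: leq_trans h (ltnW (jS _)). Qed.

Lemma cz r : c00 (z r).
Proof.
apply: (@c00_of_trunc _ (j r.+1).+1) => [|i ir].
  by apply/eqP; apply: contrapT => /negP /zj.
by apply/eqP; apply: contrapT => /negP /zj; lia.
Qed.

Lemma C1_ge0 : 0 <= C1. Proof. exact: bnd_ge0 (zb 0%N). Qed.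

Lemma win_sum A m (K : R) : 0 <= K -> uniq A ->
  \sum_(q <- A) (if (j q <= m < j q.+1)%N then K else 0) <= K.
Proof.
move=> K0 uA; have [[q qA qm]|no] := pselect (exists2 q, q \in A & (j q <= m < j q.+1)%N).
  rewrite (bigD1_seq q) //= qm big1 ?addr0 // => p pq; case: ifP => // pm.
  case: (ltngtP p q) => [/j_mono|/j_mono|e]; [lia|lia|by rewrite e eqxx in pq].
rewrite big_seq big1 // => q qA; case: ifP => // qm; by case: no; exists q.
Qed.

Lemma tiny_pow r m h : (2 * (h + r) <= m)%N -> h%:R * 2 ^- m <= 2 ^- r * (3 / 4) ^+ m :> R.
Proof.
move=> hm; have e : (3 / 4) ^+ m = (3 / 2) ^+ m * 2 ^- m :> R.
  by rewrite -exprVn -exprMn; congr (_ ^+ _); field.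
rewrite e mulrA ler_wpM2r ?invr_ge0 ?exprn_ge0 // [leRHS]mulrC ler_pdivlMr ?exprn_gt0 //.
apply: (@le_trans _ _ ((9 / 4) ^+ (h + r))).
  apply: (@le_trans _ _ (2 ^+ (h + r))).
    by rewrite exprD ler_wpM2r ?exprn_ge0 // -natrX ler_nat ltnW // ltn_expl.
  by apply: lerXn2r; rewrite ?nnegrE //; lra.
have -> : 9 / 4 = (3 / 2) ^+ 2 :> R by field.
by rewrite -exprM ler_eXn2l //; lra.
Qed.

(** The weight is so large compared with the support of [z r] that the sum of the
    coordinates suffices. *)
Lemma ztiny r k f m : type_I (kavg k W) f m -> (j r.+1 <= m)%N ->
  `|pairing f (z r)| <= C1 * (2 ^- r * (3 / 4) ^+ m).
Proof.
move=> fI rm; pose h := (m./2 - r)%N.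
have [zr0|zr0] := eqVneq (z r) 0.
  rewrite zr0 pairing0r normr0 mulr_ge0 ?C1_ge0 // mulr_ge0 ?invr_ge0 ?exprn_ge0 //; lra.
have [i0 /zj i0r] := supp_neq0 zr0.
have c20 : 0 <= 2 ^- m :> R by rewrite invr_ge0 exprn_ge0.
apply: le_trans (pairing_l1 (h := h) c20 (type_I_coord hs fI) C1_ge0 (bnd_coord (cz r) (zb r)) _) _.
  by move=> i /zj ir; rewrite /h; lia.
rewrite mulrCA ler_wpM2l ?C1_ge0 // mulrC; apply: tiny_pow; rewrite /h; lia.
Qed.

Variables (B : seq nat) (N J0 : nat).
Hypothesis N0 : (0 < N)%N.
Hypothesis BN : (size B <= N)%N.
Hypothesis BJ : forall q, q \in B -> (J0 <= j q)%N /\ (N <= j q)%N.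
Hypothesis Bn : forall q, q \in B -> n q = 0%N \/ (N <= n q)%N.
Hypothesis zidx : forall q k m u, q \in B -> (2 ^ m <= N)%N -> items_ok k W u ->
  Adm m u -> isum u <= 2 ^- J0 -> \sum_(a <- u) `|pairing a.1 (z q)| <= C1 / N%:R.

Definition comb (A : seq nat) (a : nat -> R) : nat -> R := \sum_(q <- A) a q *: z q.

Lemma comb_c00 A a : c00 (comb A a).
Proof. by apply: c00_sum => q _; apply: c00Z; exact: cz. Qed.

Lemma pairing_comb f A a : c00 f -> pairing f (comb A a) = \sum_(q <- A) a q * pairing f (z q).
Proof. by move=> cf; rewrite pairing_sumr //; apply: eq_bigr => q _; rewrite pairingZr. Qed.

Lemma pairing_comb_le f A a : c00 f -> (forall q, `|a q| <= 1) ->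
  `|pairing f (comb A a)| <= \sum_(q <- A) `|pairing f (z q)|.
Proof.
move=> cf a1; rewrite pairing_comb //; apply: le_trans (ler_norm_sum _ _ _) _.
by apply: ler_sum => q _; rewrite normrM ler_piMl.
Qed.

Lemma geo2_sum A : uniq A -> \sum_(q <- A) 2 ^- q <= 2 :> R.
Proof.
move=> uA; under eq_bigr do rewrite -exprVn.
apply: le_trans (@uniq_sum_geo R A 2^-1 0 uA _ _ _) _ => //; first by lra.
by rewrite expr0 (_ : 1 / _ = 2) //; field.
Qed.

Lemma size_le A : uniq A -> {subset A <= B} -> ((size A)%:R <= N%:R :> R).
Proof. by move=> uA AB; rewrite ler_nat; exact: leq_trans (uniq_leq_size uA AB) BN. Qed.

(** At most one vector lies on the window of the weight. *)
Lemma type_I_windows k f m A : type_I (kavg k W) f m -> uniq A ->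
  \sum_(q <- A) `|pairing f (z q)| <=
    (size A)%:R * (C1 * 2 ^- m) + 2 * C1 * (3 / 4) ^+ m + C1.
Proof.
move=> fI uA; have Wf := type_I_W fI; have c0 := C1_ge0.
have p34 : 0 <= (3 / 4) ^+ m :> R by rewrite exprn_ge0 // divr_ge0.
pose T q : R := C1 * 2 ^- m + (C1 * (3 / 4) ^+ m * 2 ^- q + (if (j q <= m < j q.+1)%N then C1 else 0)).
apply: (@le_trans _ _ (\sum_(q <- A) T q)).
  apply: ler_sum => q _; rewrite /T.
  have h1 : 0 <= C1 * 2 ^- m by rewrite mulr_ge0 ?invr_ge0 ?exprn_ge0.
  have h2 : 0 <= C1 * (3 / 4) ^+ m * 2 ^- q by rewrite !mulr_ge0 ?invr_ge0 ?exprn_ge0.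
  case: (ltnP m (j q)) => mq.
    by apply: le_trans (zris fI mq) _; rewrite lerDl addr_ge0.
  case: (ltnP m (j q.+1)) => mq'.
    by apply: le_trans (zb _ Wf) _; rewrite addrA lerDr addr_ge0.
  apply: le_trans (ztiny fI mq') _; rewrite addr0; apply: ler_wpDl => //.
  by rewrite -mulrA ler_wpM2l // mulrC.
rewrite /T !big_split /= -!mulr_sumr big_const_seq count_predT iter_addr_0.
have := win_sum m c0 uA.
have := ler_wpM2l (mulr_ge0 c0 p34) (geo2_sum uA).
have -> : C1 * (2 ^- m *+ size A) = (size A)%:R * (C1 * 2 ^- m).
  by rewrite mulr_natl mulrnAr.
lra.
Qed.

Lemma type_I_large k f m A a : type_I (kavg k W) f m -> (N < 2 ^ m)%N ->
  uniq A -> {subset A <= B} -> (forall q, `|a q| <= 1) ->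
  `|pairing f (comb A a)| <= 4 * C1.
Proof.
move=> fI Nm uA AB a1; have cf := W_c00 (type_I_W fI); have c0 := C1_ge0.
apply: le_trans (pairing_comb_le _ cf a1) _; apply: le_trans (type_I_windows fI uA) _.
have : (size A)%:R * (C1 * 2 ^- m) <= C1.
  rewrite mulrCA ler_piMr // ler_pdivrMr ?exprn_gt0 // mul1r.
  by apply: le_trans (size_le uA AB) _; rewrite -natrX ler_nat ltnW.
have : 2 * C1 * (3 / 4) ^+ m <= 2 * C1.
  by rewrite ler_piMr ?mulr_ge0 // exprn_ile1 // ?divr_ge0 //; lra.
lra.
Qed.

Variable C : R.
Hypothesis C1C : 34 * C1 + 2 * C2 + 5 <= C.
Hypothesis C20 : 0 <= C2.

(** The property proved by induction over [W]; stability under restriction is built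
    into it. *)
Definition good (f : nat -> R) : Prop := forall E A a, nat_interval E -> uniq A ->
  {subset A <= B} -> (forall q, `|a q| <= 1) -> `|pairing (f \_ E) (comb A a)| <= C.

Lemma good_restr f E : nat_interval E -> good f -> good (f \_ E).
Proof. by move=> nE h E' A a nE'; rewrite restr_restr; apply: h; exact: interval_setI. Qed.

Lemma goodN f : good f -> good (- f).
Proof.
move=> h E A a nE uA AB a1; rewrite restrN pairingNl ?normrN; first exact: h.
exact: comb_c00.
Qed.

Local Notation G := [set f | W f /\ good f].

Lemma GW : G `<=` W. Proof. by move=> f []. Qed.

(** The first average meeting the vectors is bounded by induction; the others are so
    large that their sum over all the vectors is negligible. *)
Lemma type_I_small k f m A a : type_I (kavg k G) f m -> (2 ^ m <= N)%N ->
  uniq A -> {subset A <= B} -> (forall q, `|a q| <= 1) ->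
  `|pairing f (comb A a)| <= 2 ^- m * (C + C1).
Proof.
move=> fI mN uA AB a1; have c0 := C1_ge0.
have [u [ok uAd m0 -> uP]] := type_I_items_in GW (fun x h => h.2) good_restr goodN fI.
have cc := comb_c00 A a; have C0 : 0 <= C by have := C1C; have := C20; lra.
rewrite pairingZl // normrM ger0_norm ?invr_ge0 ?exprn_ge0 //.
rewrite ler_wpM2l ?invr_ge0 ?exprn_ge0 // pairing_suml //.
apply: le_trans (ler_norm_sum _ _ _) _.
have [u0 [u' [e o1 iu]]] := first_touch J0 ok.
have -> : \sum_(b <- u) `|pairing b.1 (comb A a)| =
    \sum_(b <- [seq b <- u | (J0 < maxsupp b.1)%N]) `|pairing b.1 (comb A a)|.
  rewrite big_filter [RHS]big_mkcond big_seq [RHS]big_seq; apply: eq_bigr => b bu.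
  case: ltnP => // hb; have cb := items_c00 (@Wc00 _ _ _ _) ok bu.
  rewrite pairing_comb // big_seq big1 ?normr0 // => q qA; rewrite pairing_eq0 ?mulr0 // => i.
  have [->|xi] := eqVneq (z q i) 0; first by right.
  left; apply: contrapT => /eqP bi.
  by move: (maxsupp_ge cb bi) (BJ (AB q qA)).1 (zj xi) hb; clear; lia.
have sub b : b \in u0 ++ u' -> b \in u.
  by rewrite -e mem_filter => /andP[].
rewrite e big_cat /=; apply: lerD.
  case: u0 o1 e sub => [|b [|]] //= _ _ sub; first by rewrite big_nil.
  rewrite big_cons big_nil addr0 -(restr_setT b.1).
  by apply: (uP b (sub b (mem_head _ _))) => //; exact: interval_setT.
have pe := items_filter (fun b : item => (J0 < maxsupp b.1)%N) ok; rewrite e in pe.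
have pu' : pairwise (@irel R) u' by have := pe.2; rewrite pairwise_cat => /and3P[].
have okt : items_ok k W u' by apply: items_sub pe => // b bu; rewrite mem_cat bu orbT.
have uAd' : Adm m u'.
  have := Adm_filter (fun b : item => (J0 < maxsupp b.1)%N) uAd; rewrite e => h.
  suff -> : u' = [seq b <- u0 ++ u' | b \in u'] by exact: Adm_filter.
  have uq : uniq (u0 ++ u').
    apply: (@pairwise_uniq _ (@irel R)) pe.2 => b; apply/negbTE/negP => /and3P[_ _]; by rewrite ltnn.
  rewrite filter_cat (_ : [seq b <- u0 | b \in u'] = [::]) ?cat0s.
    by apply/esym/all_filterP/allP.
  apply/eqP; rewrite -(negbK (_ == _)) -has_filter; apply/hasPn => b bo.
  by move: uq; rewrite cat_uniq => /and3P[_ /hasPn H _]; apply/negP => /H /negP; apply.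
apply: (@le_trans _ _ (\sum_(b <- u') \sum_(q <- A) `|pairing b.1 (z q)|)).
  rewrite big_seq [leRHS]big_seq; apply: ler_sum => b bu.
  by apply: pairing_comb_le => //; exact: items_c00 (@Wc00 _ _ _ _) okt bu.
rewrite exchange_big /=; apply: (@le_trans _ _ (\sum_(q <- A) C1 / N%:R)).
  by rewrite big_seq [leRHS]big_seq; apply: ler_sum => q qA; apply: zidx (AB q qA) mN okt uAd' iu.
rewrite big_const_seq count_predT iter_addr_0 -[leLHS]mulr_natl mulrCA ler_piMr //.
by rewrite ler_pdivrMr ?ltr0n // mul1r; exact: size_le.
Qed.

Hypothesis exc : forall d f g w (F : {set 'I_d}) lam e E A a,
  special_data L1 sigma W f g w F -> II_ok s F lam e -> nat_interval E ->
  uniq A -> {subset A <= B} -> (forall q, `|a q| <= 1) ->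
  `|\sum_(t in F) \sum_(q <- A | w t == n q) a q *
     (ratr (lam t) * (pairing (f t \_ E) (z q) + e * pairing (g t \_ E) (z q)))| <= C2.

Lemma type_I_restr_in k (P : set (nat -> R)) (f : nat -> R) m E : nat_interval E ->
  type_I (kavg k P) f m -> type_I (kavg k P) (f \_ E) m.
Proof.
move=> nE [g [E' [wg sr]]]; exists g, (E' `&` E); split=> //.
exact: signed_restr_patch.
Qed.

(** The small weights are distinct and exceed [9], so they contribute at most half of
    the constant [C].  A large weight sees little of the vectors out of its window, and
    the flatness hypothesis controls its window, except for the weight [n q]. *)
Lemma type_II_tail d f g w (F : {set 'I_d}) lam e E A a :
  special_data L1 sigma G f g w F -> II_ok s F lam e -> nat_interval E ->
  uniq A -> {subset A <= B} -> (forall q, `|a q| <= 1) ->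
  (forall q, q \in A -> (#|F| <= j q)%N) ->
  `|pairing (II_sum F lam e f g \_ E) (comb A a)| <= C2 + 14 * C1 + 2 + 2^-1 * (C + C1).
Proof.
move=> sdG ok nE uA AB a1 FA; have c0 := C1_ge0.
have sd := special_data_mono GW sdG; have [sp [q0 q0F [q0m Fq0]]] := sd.
have [spG _] := sdG; have [spG1 _ _ _ _] := spG; have [sp1 _ _ _ _] := sp.
have cc := comb_c00 A a; have C0 : 0 <= C by have := C1C; have := C20; lra.
have wtw (t : 'I_d) : wt (w t) by exact: (special_weight_wt hL hsigma sp (ltn_ord t)).
have e1 := II_norm_e ok.
have cf (t : 'I_d) : c00 (f t \_ E) /\ c00 (g t \_ E).
  by have [/W_c00 h1 /W_c00 h2 _ _] := sp1 t (ltn_ord t); split; exact: c00_patch.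
pose phi t x : R := ratr (lam t) * (pairing (f t \_ E) x + e * pairing (g t \_ E) x).
have phiE (t : 'I_d) : phi t (comb A a) = \sum_(q <- A) a q * phi t (z q).
  have [h1 h2] := cf t; rewrite /phi !pairing_comb // mulr_sumr -big_split /= mulr_sumr.
  by apply: eq_bigr => q _; ring.
rewrite pairing_patch II_sum_pairing; last exact: c00_patch.
rewrite (eq_bigr (fun t : 'I_d => phi t (comb A a))); last first.
  by move=> t _; rewrite /phi !pairing_patch.
pose small (t : 'I_d) := (2 ^ w t <= N)%N.
rewrite (bigID small) /= mulrDr.
set S1 := \sum_(t in F | small t) _; set S2 := \sum_(t in F | ~~ small t) _.
(* small weights: the induction hypothesis applies to the averages *)
have h1 : `|2^-1 * S1| <= 2^-1 * (C + C1).
  rewrite normrM gtr0_norm // ler_wpM2l // /S1; apply: le_trans (ler_norm_sum _ _ _) _.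
  apply: (@le_trans _ _ (\sum_(t in F | small t) (2 * (C + C1)) * 2^-1 ^+ w t)).
    apply: ler_sum => t /andP[tF st]; have [_ _ fI gI] := spG1 t (ltn_ord t).
    rewrite (_ : 2 * _ * _ = 2 * (2 ^- w t * (C + C1))); last by rewrite exprVn; ring.
    apply: (II_term_le hs ok tF).
      exact: type_I_small (type_I_restr_in (k := true) nE fI) st uA AB a1.
    exact: type_I_small (type_I_restr_in (k := true) nE gI) st uA AB a1.
  have r0 : 0 <= 2^-1 :> R by lra.
  have r1 : 2^-1 < 1 :> R by lra.
  have := @special_geo G d f g w (fun t => (t \in F) && small t) 2^-1 2 GW spG r0 r1.
  have -> : 2^-1 ^+ 2 / (1 - 2^-1) = 2^-1 :> R by field.
  move=> /(_ _) X; rewrite -mulr_sumr.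
  apply: le_trans (_ : 2 * (C + C1) * 2^-1 <= _); last by rewrite mulrAC divff ?mul1r.
  rewrite ler_wpM2l ?mulr_ge0 ?addr_ge0 //; apply: X => t _.
  by have := wt_gt9 hL (wtw t); lia.
pose ex t q := w t == n q.
have S2E : S2 = \sum_(t in F) \sum_(q <- A | ex t q) a q * phi t (z q) +
    \sum_(t in F | ~~ small t) \sum_(q <- A | ~~ ex t q) a q * phi t (z q).
  have -> : \sum_(t in F) \sum_(q <- A | ex t q) a q * phi t (z q) =
    \sum_(t in F | ~~ small t) \sum_(q <- A | ex t q) a q * phi t (z q).
    rewrite big_mkcondr; apply: eq_bigr => t _; case: ifP => // /negbT; rewrite negbK => st.
    rewrite big_seq_cond big_pred0 // => q; apply/negP => /andP[qA /eqP exq].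
    have := wt_gt9 hL (wtw t); have := ltn_expl (w t) (ltnSn 1); rewrite /small in st.
    by case: (Bn (AB q qA)); move: exq st; clear; lia.
  by rewrite -big_split /=; apply: eq_bigr => t _; rewrite phiE (bigID (ex t)).
have h2 := exc sd ok nE uA AB a1.
rewrite S2E mulrDr; set S3 := \sum_(t in F) _ in h2 *; set S4 := \sum_(t in F | _) _.
suff h3 : `|2^-1 * S4| <= 14 * C1 + 2.
  apply: le_trans (ler_normD _ _) _; rewrite addrC; apply: lerD => //.
  apply: le_trans (ler_normD _ _) _; rewrite -addrA; apply: lerD => //.
  by rewrite normrM gtr0_norm //; apply: le_trans h2; rewrite ler_piMl //; lra.
(* large weights: each vector is estimated separately *)
pose wnd (t : 'I_d) q := (j q <= w t < j q.+1)%N.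
pose T (t : 'I_d) q : R := C1 * 2 ^- w t + (C1 * (3 / 4) ^+ w t * 2 ^- q +
  ((if wnd t q then C1 * (3 / 4) ^+ w t else 0) + delta q)).
have p34 m : 0 <= (3 / 4) ^+ m :> R by rewrite exprn_ge0 // divr_ge0.
have p2 m : 0 <= 2 ^- m :> R by rewrite invr_ge0 exprn_ge0.
have T0 t q : 0 <= T t q.
  by rewrite /T !addr_ge0 ?mulr_ge0 //; case: ifP => // _; rewrite mulr_ge0.
have bT (t : 'I_d) q h : type_Ialpha W h (w t) -> ~~ ex t q -> `|pairing h (z q)| <= T t q.
  move=> hI nex; rewrite /T.
  case: (ltnP (w t) (j q)) => wq.
    apply: le_trans (zris (k := true) hI wq) _; rewrite lerDl !addr_ge0 ?mulr_ge0 //.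
    by case: ifP => // _; rewrite mulr_ge0.
  case: (ltnP (w t) (j q.+1)) => wq'.
    rewrite /wnd wq wq' /=; apply: le_trans (zflat hI (wtw t) _ nex) _; first by rewrite wq.
    by rewrite addrA lerDr addr_ge0 ?mulr_ge0.
  apply: le_trans (ztiny (k := true) hI wq') _.
  rewrite [2 ^- q * _]mulrC mulrA addrCA lerDl !addr_ge0 ?mulr_ge0 //.
  by case: ifP => // _; rewrite mulr_ge0.
have h4 : `|2^-1 * S4| <= \sum_(t in F | ~~ small t) \sum_(q <- A) T t q.
  rewrite normrM gtr0_norm // ler_pdivrMl // mulr_sumr; apply: le_trans (ler_norm_sum _ _ _) _.
  apply: ler_sum => t /andP[tF _]; apply: le_trans (ler_norm_sum _ _ _) _.
  rewrite mulr_sumr [leRHS](bigID (ex t)) /=; apply: ler_wpDl.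
    by apply: sumr_ge0 => q _; rewrite mulr_ge0.
  apply: ler_sum => q nex; rewrite normrM; have [_ _ fI gI] := sp1 t (ltn_ord t).
  apply: le_trans (_ : `|phi t (z q)| <= _); first by rewrite ler_piMl.
  apply: (II_term_le hs ok tF); apply: bT => //.
    exact: (type_I_restr (k := true) nE).
  exact: (type_I_restr (k := true) nE).
apply: le_trans h4 _.
pose big (t : 'I_d) := (t \in F) && ~~ small t.
have g34 : \sum_(t | big t) (3 / 4) ^+ w t <= 4 :> R.
  have := @special_geo W d f g w big (3 / 4) 0 (fun _ h => h) sp.
  rewrite expr0 (_ : 1 / (1 - 3 / 4) = 4); last by field.
  by apply; [lra|lra|].
have g2 : N%:R * (\sum_(t | big t) 2 ^- w t) <= 2 :> R.
  under eq_bigr do rewrite -exprVn.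
  have [e0 Na amin] : exists2 e0, (N < 2 ^ e0)%N & forall b, (N < 2 ^ b)%N -> (e0 <= b)%N.
    have ex0 : exists m, (N < 2 ^ m)%N by exists N; exact: ltn_expl.
    by case: (ex_minnP ex0) => a0 ? ?; exists a0.
  have r0 : 0 <= 2^-1 :> R by lra.
  have r1 : 2^-1 < 1 :> R by lra.
  have := @special_geo W d f g w big 2^-1 e0 (fun _ h => h) sp r0 r1.
  move=> /(_ _)/le_trans h; rewrite -ler_pdivlMl ?ltr0n //; apply: h.
    by move=> t /andP[_]; rewrite /small -ltnNge => /amin.
  rewrite exprVn ler_pdivlMl ?ltr0n // mulrA ler_pdivrMr ?subr_gt0 // ler_pdivrMr ?exprn_gt0 //.
  rewrite (_ : 2 * (1 - 2^-1) = 1); last by field.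
  by rewrite mul1r -natrX ler_nat ltnW.
have -> : \sum_(t in F | ~~ small t) \sum_(q <- A) T t q =
  \sum_(t | big t) \sum_(q <- A) T t q by [].
rewrite /T; under eq_bigr do rewrite !big_split /=.
rewrite !big_split /=.
have b1 : \sum_(t | big t) \sum_(q <- A) C1 * 2 ^- w t <= 2 * C1.
  apply: (@le_trans _ _ (C1 * (N%:R * (\sum_(t | big t) 2 ^- w t)))); last first.
    by rewrite [leRHS]mulrC ler_wpM2l.
  rewrite mulrA mulr_sumr; apply: ler_sum => t _.
  rewrite big_const_seq count_predT iter_addr_0 -[leLHS]mulr_natl mulrA ler_wpM2r // mulrC.
  by rewrite ler_wpM2l // size_le.
have b2 : \sum_(t | big t) \sum_(q <- A) C1 * (3 / 4) ^+ w t * 2 ^- q <= 8 * C1.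
  apply: (@le_trans _ _ ((2 * C1) * \sum_(t | big t) (3 / 4) ^+ w t)); last first.
    by have := ler_wpM2l c0 g34; lra.
  rewrite mulr_sumr; apply: ler_sum => t _; rewrite -mulr_sumr [2 * C1 * _]mulrAC [leRHS]mulrC.
  rewrite mulrA mulrC [leRHS]mulrC mulrC [leRHS]mulrC; apply: le_trans (_ : C1 * (3 / 4) ^+ w t * 2 <= _).
    by rewrite ler_wpM2l ?mulr_ge0 // geo2_sum.
  by rewrite le_eqVlt; apply/orP; left; apply/eqP; ring.
have b3 : \sum_(t | big t) \sum_(q <- A) (if wnd t q then C1 * (3 / 4) ^+ w t else 0) <= 4 * C1.
  apply: (@le_trans _ _ (C1 * \sum_(t | big t) (3 / 4) ^+ w t)); last first.
    by rewrite [leRHS]mulrC ler_wpM2l.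
  by rewrite mulr_sumr; apply: ler_sum => t _; apply: win_sum => //; rewrite mulr_ge0.
have b4 : \sum_(t | big t) \sum_(q <- A) delta q <= 2.
  apply: (@le_trans _ _ (\sum_(t in F) \sum_(q <- A) delta q)).
    rewrite [leRHS](bigID (fun t => ~~ small t)) /= lerDl.
    by apply: sumr_ge0 => t _; apply: sumr_ge0 => q _.
  rewrite sumr_const -[leLHS]mulr_natl mulr_sumr; apply: le_trans (geo2_sum uA).
  rewrite big_seq [leRHS]big_seq; apply: ler_sum => q qA; apply: le_trans (deltaj q).
  by rewrite ler_wpM2r // ler_nat FA.
by lra.
Qed.

(** A functional of type II starting after position [ms - 1] misses the vectors before
    it; after the first vector that it meets, its number of terms is small compared
    with the window. *)
Lemma type_II_good d f g w (F : {set 'I_d}) lam e :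
  special_data L1 sigma G f g w F -> II_ok s F lam e -> good (II_sum F lam e f g).
Proof.
move=> sdG ok E A a nE uA AB a1; have c0 := C1_ge0.
have sd := special_data_mono GW sdG; have [sp [q0 q0F [q0m Fq0]]] := sd.
set ms := minsupp (f q0).
have [sp1 sp2 _ _ _] := sp.
have Wh := W_II sd ok; have WhE := W_restr nE Wh; have chE := W_c00 WhE.
have ms0 : (0 < ms)%N.
  have /succvP[f0 _ _] := sp2 q0 (ltn_ord q0); have [Wf _ _ _] := sp1 q0 (ltn_ord q0).
  exact: minsupp_gt0 (W_c00 Wf) f0.
pose A' := [seq q <- A | (ms <= j q)%N].
have split : comb A a = \sum_(q <- A | ~~ (ms <= j q)%N) a q *: z q + comb A' a.
  by rewrite /comb big_filter [LHS](bigID (fun q => (ms <= j q)%N)) /= addrC.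
rewrite split pairingDr //; apply: le_trans (ler_normD _ _) _.
apply: (@le_trans _ _ (C1 + (C2 + 14 * C1 + 2 + 2^-1 * (C + C1)))); last first.
  by have := C1C; have := C20; lra.
apply: lerD.
  rewrite pairing_sumr //; apply: le_trans (ler_norm_sum _ _ _) _.
  apply: le_trans (_ : \sum_(q <- A) (if (j q <= ms.-1 < j q.+1)%N then C1 else 0) <= _); last exact: win_sum.
  rewrite big_mkcond /=; apply: ler_sum => q _; case: (leqP ms (j q)) => msq /=.
    by case: ifP.
  rewrite pairingZr // normrM; case: (ltnP (j q.+1) ms) => qms.
    rewrite pairing_eq0 ?normr0 ?mulr0; first by case: ifP.
    move=> i; have [->|zi] := eqVneq (z q i) 0; first by right.
    left; rewrite restrE; case: ifP => // _; apply: contrapT => /eqP /(II_start sp q0m) h.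
    by have := zj zi; rewrite /ms in qms; lia.
  rewrite ifT; last by lia.
  by apply: le_trans (zb q WhE); rewrite ler_piMl.
apply: (type_II_tail sdG ok nE) => //; first by rewrite /A' filter_uniq.
  by move=> q; rewrite mem_filter => /andP[_ /AB].
move=> q; rewrite mem_filter => /andP[h _]; apply: leq_trans h; rewrite /ms; lia.
Qed.

(** Sums over index sets of size [N] of vectors living on successive windows
    are bounded independently of [N]. *)
Theorem comb_bound f a : W f -> uniq B -> (forall q, `|a q| <= 1) ->
  `|pairing f (comb B a)| <= C.
Proof.
move=> Wf uB a1; have c0 := C1_ge0.
have C0 : 0 <= C by have := C1C; have := C20; lra.
suff gf : good f by rewrite -(restr_setT f); apply: gf => //; exact: interval_setT.
move: f Wf; apply: W_ind.
- move=> m m0 E A b nE uA AB b1.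
  have Wu := W_restr nE (@W_unit _ s L1 sigma m m0); have cu := W_c00 Wu.
  apply: le_trans (pairing_comb_le _ cu b1) _.
  apply: (@le_trans _ _ (\sum_(q <- A) (if (j q <= m.-1 < j q.+1)%N then C1 else 0))).
    apply: ler_sum => q _; case: ifP => h; first exact: zb.
    rewrite pairing_eq0 ?normr0 // => i.
    have [->|zi] := eqVneq (z q i) 0; [by right|left].
    rewrite restrE /unit_vec; case: ifP => // _; case: eqP => // im.
    by have := zj zi; rewrite im; move: h; lia.
  apply: le_trans (win_sum _ c0 uA) _; have := C1C; have := C20; lra.
- by move=> f _; exact: goodN.
- by move=> f E nE _; exact: good_restr.
- move=> d c f cf c1 E A b nE uA AB b1.
  have cc := comb_c00 A b.
  rewrite restr_sum pairing_suml //; apply: le_trans (ler_norm_sum _ _ _) _.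
  apply: (@le_trans _ _ (\sum_(i < d) ratr (c i) * C)).
    apply: ler_sum => i _; have [c0i Wfi gi] := cf i (ltn_ord i).
    rewrite restrZ pairingZl // normrM ger0_norm ?ler0q //.
    by rewrite ler_wpM2l ?ler0q //; exact: gi.
  by rewrite -mulr_suml -rmorph_sum c1 rmorph1 mul1r.
- move=> k f m fw E A b nE uA AB b1.
  have fI : type_I (kavg k G) f m.
    by exists f, setT; split=> //; split; [exact: interval_setT|left; rewrite restr_setT].
  have fI' := type_I_restr_in nE fI.
  case: (leqP (2 ^ m) N) => mN.
    apply: le_trans (type_I_small fI' mN uA AB b1) _.
    have m0 : (0 < m)%N by have [] := fw.
    apply: (@le_trans _ _ (2^-1 * (C + C1))).
      rewrite ler_wpM2r ?addr_ge0 // -[m]prednK // exprS invfM ler_piMr ?invr_ge0 //.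
      by rewrite invf_le1 ?exprn_gt0 // exprn_ege1 // ler1n.
    have := C1C; have := C20; lra.
  have fW : type_I (kavg k W) (f \_ E) m.
    by apply: type_I_mono fI' => x y; apply: kavg_mono; exact: GW.
  apply: le_trans (type_I_large fW mN uA AB b1) _; have := C1C; have := C20; lra.
- by move=> d f g w F lam e; exact: type_II_good.
Qed.

End CZero.

(** * Sequences of index zero *)

Section BlockSequences.
Variable R : realType.
Implicit Types x : nat -> nat -> R.

Lemma block_seq_intro x : (forall q, c00 (x q)) -> (forall q, x q != 0) ->
  (forall q i i', x q i != 0 -> x q.+1 i' != 0 -> (i < i')%N) -> block_seq x.
Proof.
move=> cx x0 xx q; split=> //; apply/succvP; split=> //.
by apply: (xx q); [exact: maxsuppP|exact: minsuppP].
Qed.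

Lemma block_seq_lt x : block_seq x -> forall p q i i', (p < q)%N ->
  x p i != 0 -> x q i' != 0 -> (i < i')%N.
Proof.
move=> bx; have c q : c00 (x q) by have [] := bx q.
have lt q : (maxsupp (x q) < minsupp (x q.+1))%N by have [_ /succvP[]] := bx q.
have nz q : x q != 0 by have [_ /succvP[]] := bx q.
have mono p q : (p < q)%N -> (maxsupp (x p) < minsupp (x q))%N.
  elim: q => // q IH; rewrite ltnS leq_eqVlt => /orP[/eqP->//|/IH h].
  by have := lt q; have := minsupp_maxsupp (c q) (nz q); lia.
move=> p q i i' pq xi xi'; have := mono p q pq.
by have := maxsupp_ge (c p) xi; have := minsupp_le xi'; lia.
Qed.

Lemma block_seq_ge x : block_seq x -> forall q i, x q i != 0 -> (q < i)%N.
Proof.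
move=> bx; elim=> [|q IH] i xi.
  by rewrite lt0n; apply/eqP => i0; move: xi; rewrite i0; have [[-> _] _] := bx 0%N; rewrite eqxx.
have [_ /succvP[q0 _ _]] := bx q; have [i' xi'] := supp_neq0 q0.
by have := IH i' xi'; have := block_seq_lt bx (ltnSn q) xi' xi; lia.
Qed.

Lemma block_seq_sub x (p : nat -> nat) : block_seq x ->
  (forall q, (p q < p q.+1)%N) -> block_seq (x \o p).
Proof.
move=> bx pp; apply: block_seq_intro => /= [q|q|q i i'].
- by have [] := bx (p q).
- by have [_ /succvP[]] := bx (p q).
- exact: block_seq_lt.
Qed.

End BlockSequences.

Section IndexZero.
Variables (R : realType) (s : nat -> R -> R) (hs : dense_in_sphere s).
Variables (l : nat -> nat) (L1 L2 L3 : set nat) (hL : coding_weights R l L1 L2 L3).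
Variables (sigma : seq (nat -> R) -> nat) (hsigma : coding_function L2 sigma).
Local Notation W := (norming_set s L1 sigma).
Local Notation kavg := (kavg s L1 sigma).
Local Notation items_ok := (items_ok s L1 sigma).
Local Notation bnd := (bnd s L1 sigma).
Local Notation wt := (wt l).
Local Notation item := (item R).
Implicit Types (x : nat -> nat -> R) (u : seq item).

(** Admissible families of averages of large size do not see the tail of [x]:
    the index of [x] for averages of kind [k] is zero. *)
Definition IZ (k : bool) x : Prop := forall m (eps : R), 0 < eps ->
  exists tau K, 0 < tau /\ forall q u, (K <= q)%N -> items_ok k W u -> Adm m u ->
    isum u <= tau -> \sum_(a <- u) `|pairing a.1 (x q)| <= eps.

(** Functionals whose weight is one of the [l k] see on the tail only what is summable
    over the weights. *)
Definition flat x : Prop := exists C : R, forall eta : R, 0 < eta ->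
  exists K, forall q f w, (K <= q)%N -> type_Ialpha W f w -> wt w ->
    `|pairing f (x q)| <= C * (3 / 4) ^+ w + eta.

(** The sums of [N] consecutive vectors are bounded independently of [N], provided
    that they start far enough. *)
Definition runs_bounded x : Prop := exists C, forall N, exists M, forall J, (M <= J)%N ->
  bnd (\sum_(i < N) x (J + i)%N) C.

Lemma IZ_sub k x (p : nat -> nat) : (forall q, (q <= p q)%N) -> IZ k x -> IZ k (x \o p).
Proof.
move=> pq h m eps e0; have [tau [K [t0 hK]]] := h m eps e0.
exists tau, K; split=> // q u Kq; apply: hK; exact: leq_trans Kq (pq q).
Qed.

Lemma exp2V_small (tau : R) : 0 < tau -> exists K, forall q, (K <= q)%N -> 2 ^- q <= tau.
Proof.
move=> t0; pose K := Num.bound tau^-1; exists K => q Kq.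
rewrite -[leRHS]invrK lef_pV2 ?posrE ?exprn_gt0 ?invr_gt0 //.
apply: le_trans (ltW (archi_boundP _)) _; first by rewrite invr_ge0 ltW.
by rewrite -natrX ler_nat; apply: leq_trans Kq (ltnW (ltn_expl _ _)).
Qed.

(** One choice of the threshold serves all levels below a given one. *)
Lemma IZ_unif k x M (eps : R) : 0 < eps -> IZ k x ->
  exists tau K, 0 < tau /\ forall m q u, (m < M)%N -> (K <= q)%N -> items_ok k W u -> Adm m u ->
    isum u <= tau -> \sum_(a <- u) `|pairing a.1 (x q)| <= eps.
Proof.
move=> e0 h; elim: M => [|M [tau [K [t0 hK]]]]; first by exists 1, 0%N.
have [tau' [K' [t0' hK']]] := h M eps e0.
exists (Num.min tau tau'), (maxn K K'); split; first by rewrite lt_min t0.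
move=> m q u; rewrite geq_max le_min => mM /andP[Kq K'q] ok ua /andP[ut ut'].
move: mM; rewrite ltnS leq_eqVlt => /orP[/eqP mM|mM]; last exact: (hK m q u mM Kq ok ua ut).
by apply: (hK' q u K'q ok _ ut'); rewrite -mM.
Qed.

(** Sequences of index zero satisfy the estimates of rapidly increasing sequences. *)
Lemma IZ_ris k x C M : block_seq x -> (forall q, bnd (x q) C) -> IZ k x ->
  exists K, forall q f m, (K <= q)%N -> type_I (kavg k W) f m -> (m < M)%N ->
    `|pairing f (x q)| <= (C + 1) * 2 ^- m.
Proof.
move=> bx xC h; have [tau [K [t0 hK]]] := IZ_unif M ltr01 h.
have [K' hK'] := exp2V_small t0.
exists (maxn K K') => q f m; rewrite geq_max => /andP[Kq K'q] fI mM; rewrite mulrC.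
have [cx _] := bx q.
apply: (type_I_split fI cx (block_seq_ge bx (q := q)) (xC q)) => u ok uA iu.
by apply: (hK m q) => //; exact: le_trans iu (hK' _ K'q).
Qed.

(** The window of a weight [m] is the index [r] with [j r <= m < j r.+1].  The
    vectors after it are too far, and the vectors before it too short, for a
    functional of weight [m] to see more than about [2^-m]. *)
Definition windows x (j : nat -> nat) C : Prop :=
  [/\ forall r, (j r < j r.+1)%N,
      forall r i, x r i != 0 -> (j r < i)%N && (2 * (i + r) <= j r.+1)%N &
      forall r k f m, type_I (kavg k W) f m -> (m < j r)%N ->
        `|pairing f (x r)| <= C * 2 ^- m].

(** Each window is chosen after the support of the previous vector, and each vector
    after its window. *)
Lemma sparse x C (Q : nat -> nat -> nat -> Prop) : block_seq x -> (forall q, bnd (x q) C) ->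
  IZ true x -> IZ false x -> (forall j r, exists K, forall q, (K <= q)%N -> Q j r q) ->
  exists p j, [/\ forall q, (p q < p q.+1)%N, windows (x \o p) j (C + 1) &
    forall r, Q (j r) r (p r)].
Proof.
move=> bx xC h1 h2 hQ.
have hp (t : nat * nat * nat) : exists q, [/\ (t.2 <= q)%N, Q t.1.1 t.1.2 q,
    (t.1.1 <= q)%N & forall k f m, type_I (kavg k W) f m -> (m < t.1.1)%N ->
      `|pairing f (x q)| <= (C + 1) * 2 ^- m].
  have [K1 H1] := IZ_ris t.1.1 bx xC h1; have [K2 H2] := IZ_ris t.1.1 bx xC h2.
  have [K3 H3] := hQ t.1.1 t.1.2.
  exists (maxn (maxn K1 K2) (maxn K3 (maxn t.1.1 t.2))); split.
  - by rewrite !leq_max leqnn !orbT.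
  - by apply: H3; rewrite !leq_max leqnn !orbT.
  - by rewrite !leq_max leqnn !orbT.
  - by case=> f m; [apply: H1|apply: H2]; rewrite !leq_max leqnn ?orbT.
have [pick hpick] := choice hp.
pose st := fix st r : nat * nat := if r is r'.+1 then
    let t := st r' in let jj := (t.1 + 2 * (maxsupp (x t.2) + r')).+1 in (jj, pick (jj, r'.+1, t.2.+1))
  else (0%N, pick (0%N, 0%N, 0%N)).
have hst r : exists2 b, (st r).2 = pick ((st r).1, r, b) & forall r', r = r'.+1 -> (b = (st r').2.+1)%N.
  by case: r => [|r]; [exists 0%N|exists (st r).2.+1 => // r' [->]].
exists (fun r => (st r).2), (fun r => (st r).1); split.
- move=> r; have [b -> /(_ r erefl) e] := hst r.+1.
  by have [h _ _ _] := hpick ((st r.+1).1, r.+1, b); rewrite /= e in h *.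
- split.
  + by move=> r /=; lia.
  + move=> r i /= xi; have [b e _] := hst r.
    have [_ _ h _] := hpick ((st r).1, r, b); rewrite -e /= in h.
    have := block_seq_ge bx xi; have [cx _] := bx (st r).2; have := maxsupp_ge cx xi.
    by move=> /= ? ?; apply/andP; split; lia.
  + move=> r k f m fI mr; have [b e _] := hst r.
    by have [_ _ _ h] := hpick ((st r).1, r, b); rewrite /= e; apply: h fI mr.
- by move=> r; have [b e _] := hst r; have [_ h _ _] := hpick ((st r).1, r, b); rewrite e.
Qed.

Lemma incr_ge (p : nat -> nat) : (forall q, (p q < p q.+1)%N) -> forall q, (q <= p q)%N.
Proof. by move=> pp; elim=> // q IH; apply: leq_ltn_trans IH (pp q). Qed.

(** No exceptional weight occurs here: [0] is not the weight of a term of a special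
    sequence. *)
Theorem flat_runs_bounded x C : block_seq x -> (forall q, bnd (x q) C) ->
  IZ true x -> IZ false x -> flat x ->
  exists2 p : nat -> nat, (forall q, (p q < p q.+1)%N) & runs_bounded (x \o p).
Proof.
move=> bx xC h1 h2 [C' hf].
pose Q (j r q : nat) := forall f w, type_Ialpha W f w -> wt w ->
  `|pairing f (x q)| <= C' * (3 / 4) ^+ w + 2 ^- r / j.+1%:R.
have hQ j r : exists K, forall q, (K <= q)%N -> Q j r q.
  have [|K hK] := hf (2 ^- r / j.+1%:R); first by rewrite divr_gt0 ?invr_gt0 ?exprn_gt0.
  by exists K => q Kq f w; exact: hK.
have [p [j [pp [jS zj zris] Qp]]] := sparse bx xC h1 h2 hQ.
have C0 : 0 <= C := bnd_ge0 (xC 0%N).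
have pq := incr_ge pp; have jq := incr_ge jS.
pose C1 := C + 1 + `|C'|; exists p => //; exists (34 * C1 + 2 * 0 + 5) => N.
have C'0 : 0 <= `|C'| by [].
have C10 : 0 < C1 by rewrite /C1; lra.
case: N => [|N]; first by exists 0%N => J _ f Wf; rewrite big_ord0 pairing0r normr0; lra.
have e0 : 0 < C1 / N.+1%:R by rewrite divr_gt0.
have [t1 [K1 [t10 H1]]] := IZ_unif N.+1 e0 h1; have [t2 [K2 [t20 H2]]] := IZ_unif N.+1 e0 h2.
have [K3 H3] := exp2V_small t10; have [K4 H4] := exp2V_small t20.
exists (maxn (maxn K1 K2) (maxn K3 (maxn K4 N.+1))) => J MJ f Wf.
move: MJ; rewrite !geq_max => /andP[/andP[JK1 JK2] /and3P[JK3 JK4 JN]].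
have := @comb_bound R s hs l L1 L2 L3 hL sigma hsigma (x \o p) j (fun=> 0%N)
  (fun r => 2 ^- r / (j r).+1%:R) C1 0 jS zj _ _ _ _ _ (iota J N.+1) N.+1 (j J) _ _ _ _ _
  (34 * C1 + 2 * 0 + 5) _ _ _ f (fun=> 1) Wf (iota_uniq _ _) _.
rewrite /comb; have -> : \sum_(q <- iota J N.+1) 1 *: (x \o p) q = \sum_(i < N.+1) (x \o p) (J + i)%N.
  have -> : iota J N.+1 = index_iota J (N.+1 + J) by rewrite /index_iota addnK.
  rewrite -{1}[J]add0n big_addn addnK big_mkord.
  by apply: eq_bigr => i _; rewrite scale1r addnC.
apply=> //.
- by move=> r g Wg; apply: le_trans (xC _ g Wg) _; rewrite /C1; lra.
- move=> r k g m gI mr; apply: le_trans (zris r k g m gI mr) _.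
  by rewrite ler_wpM2r ?invr_ge0 ?exprn_ge0 // /C1 lerDl.
- move=> r; rewrite mulrA ler_pdivrMr // mulrC ler_wpM2l ?invr_ge0 ?exprn_ge0 //.
  by rewrite ler_nat.
- move=> r g w gI ww _ _; apply: le_trans (Qp r g w gI ww) _; rewrite lerD2r.
  rewrite ler_wpM2r ?exprn_ge0 ?divr_ge0 // /C1; have := ler_norm C'; lra.
- by rewrite size_iota.
- move=> q; rewrite mem_iota => /andP[Jq _]; split.
    move: Jq; rewrite leq_eqVlt => /orP[/eqP->//|/(j_mono jS) h]; exact: ltnW (leq_trans (jS J) h).
  by apply: leq_trans JN (leq_trans Jq (jq q)).
- by move=> q _; left.
- move=> q k m u; rewrite mem_iota => /andP[Jq _] mN ok uA iu.
  have mN' : (m < N.+1)%N by apply: leq_trans (ltn_expl m (ltnSn 1)) mN.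
  have qp : (J <= p q)%N by apply: leq_trans Jq (pq q).
  case: k ok => ok.
    apply: (H1 m (p q) u) => //; first by lia.
    by apply: le_trans iu (H3 _ _); apply: leq_trans JK3 (jq J).
  apply: (H2 m (p q) u) => //; first by lia.
  by apply: le_trans iu (H4 _ _); apply: leq_trans JK4 (jq J).
- move=> d g h w F lam e E A a [sp _] _ _ _ _ _; rewrite big1 ?normr0 // => t _.
  rewrite big_pred0 // => q; apply/negP => /eqP e1.
  by have := wt_gt9 hL (special_weight_wt hL hsigma sp (ltn_ord t)); rewrite e1.
- by move=> _; rewrite normr1.
Qed.

End IndexZero.

(** * Sequences of iterated averages *)

Section TreeSequences.
Variables (R : realType) (s : nat -> R -> R) (hs : dense_in_sphere s).
Variables (l : nat -> nat) (L1 L2 L3 : set nat) (hL : coding_weights R l L1 L2 L3).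
Variables (sigma : seq (nat -> R) -> nat) (hsigma : coding_function L2 sigma).
Local Notation W := (norming_set s L1 sigma).
Local Notation kavg := (kavg s L1 sigma).
Local Notation items_ok := (items_ok s L1 sigma).
Local Notation bnd := (bnd s L1 sigma).
Local Notation wt := (wt l).
Local Notation item := (item R).
Local Notation IZ := (IZ s L1 sigma).
Variable Sp : (nat -> R) -> Prop.
Hypothesis SpP : forall (c : R) x y, Sp x -> Sp y -> Sp (c *: x + y).

(** The averages of [u] live on the interval [(L, H]], have sizes between [L] and [2^H],
    and their values on [y] add up to at least [eps]. *)
Definition normed k (eps : R) (L H : nat) (y : nat -> R) (u : seq item) : Prop :=
  [/\ items_ok k W u, u != [::],
     forall a, a \in u -> [&& (L < minsupp a.1)%N, (maxsupp a.1 <= H)%N,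
        (L < a.2)%N & (a.2 <= 2 ^ H)%N] & eps <= \sum_(a <- u) pairing a.1 y].

(** Leaves made of vectors normed by a list of averages of large size. *)
Definition leafD (Ev : nat -> (nat -> R) -> Prop) k m eps L H y (u : seq item) : Prop :=
  [/\ (L < H)%N, inside L H y, bnd y 1, Sp y /\ Ev L y & Adm m u /\ normed k eps L H y u].

Lemma isum_mem (u : seq item) a : a \in u -> a.2%:R^-1 <= isum u.
Proof.
move=> au; rewrite /isum (big_rem a) //= lerDl.
by apply: sumr_ge0 => b _; rewrite invr_ge0 ler0n.
Qed.

(** If averages of large size keep seeing [x], arbitrarily far vectors of [x]
    are normed by lists of averages which live on the same interval. *)
Lemma NZ_leaf k (x : nat -> nat -> R) Ev : block_seq x -> (forall q, bnd (x q) 1) ->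
  (forall q, Sp (x q)) -> (forall L, exists K, forall q, (K <= q)%N -> Ev L (x q)) ->
  ~ IZ k x ->
  exists m eps, 0 < eps /\ forall L, exists H y u, leafD Ev k m eps L H y u.
Proof.
move=> bx x1 xS evx nz; apply: contrapT => no; apply: nz => m eps e0.
have [L0 noL] : exists L0, ~ exists H y u, leafD Ev k m eps L0 H y u.
  apply: contrapT => h; apply: no; exists m, eps; split=> // L.
  by apply: contrapT => h'; apply: h; exists L.
have [K hK] := evx L0.
exists (L0.+1%:R^-1), (maxn L0 K); split=> [|q u]; first by rewrite invr_gt0.
rewrite geq_max => /andP[Lq Kq] ok uA iu; rewrite leNgt; apply/negP => big.
have [cx _] := bx q; set y := x q in big cx *.
apply: noL; pose M := maxsupp y; pose E := [set i | (L0 < i)%N && (i <= M)%N].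
have nE : nat_interval E by move=> i i' i''; rewrite /E /=; lia.
have yE : y \_ E = y.
  apply/funext => i; rewrite restrE; case: asboolP => // nEi.
  apply/esym/eqP; apply: contrapT => /negP yi; apply: nEi; rewrite /E /=.
  have := block_seq_ge bx yi; have := maxsupp_ge cx yi; rewrite -/M; lia.
have [ok1 m1] := items_restr nE ok.
set p := (fun a : item => a.1 \_ E != 0) in ok1 m1.
set F := (fun a : item => (a.1 \_ E, a.2) : item) in ok1 m1.
set u1 := [seq F a | a <- u & p a] in ok1.
have [ok2 m2] := items_sign (fun a : item => pairing a.1 y < 0) ok1.
set F2 := (fun a : item => _) in ok2 m2; set u2 := [seq F2 a | a <- u1] in ok2.
have sum2 : \sum_(a <- u2) pairing a.1 y = \sum_(a <- u) `|pairing a.1 y|.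
  rewrite /u2 /u1 !big_map big_filter [LHS]big_mkcond; apply: eq_bigr => a _ /=.
  have eq1 : pairing (a.1 \_ E) y = pairing a.1 y by rewrite pairing_patch yE.
  case: ifP => [_|/negbT]; last first.
    by rewrite /p negbK => /eqP e1; rewrite -eq1 e1 pairing0l normr0.
  case: ltP => h; rewrite ?pairingNl // eq1 in h *; first by rewrite ltr0_norm.
  by rewrite ger0_norm.
pose H := (8 * M + \sum_(a <- u) a.2 + L0).+1.
have leH a : a \in u -> (a.2 <= H)%N.
  move=> au; rewrite (_ : H = a.2 + (8 * M + \sum_(b <- rem a u) b.2 + L0).+1)%N ?leq_addr //.
  by rewrite /H (big_rem a) //=; lia.
exists H, y, u2; split.
- by rewrite /H; lia.
- move=> i yi; have := block_seq_ge bx yi; have := maxsupp_ge cx yi; rewrite -/M /H.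
  by move=> ? ?; apply/andP; split; lia.
- exact: x1.
- by split; [exact: xS|exact: hK].
split.
  rewrite /u2 -[X in map _ X]filter_predT; apply: Adm_map_filter => [a au _|].
    by rewrite m2.
  exact: Adm_map_filter.
split=> //; last by rewrite sum2 ltW.
  by apply: contraTneq big => e2; rewrite -sum2 e2 big_nil -leNgt ltW.
move=> a au2; have c2 : c00 a.1 := items_c00 (@Wc00 _ _ _ _) ok2 au2.
have a0 : a.1 != 0 by have [] := ok2.1 a au2.
have [b bu [aE sE]] : exists2 b, b \in u & (forall i, a.1 i != 0 -> E i) /\ a.2 = b.2.
  move: au2 => /mapP[b1 /mapP[b]]; rewrite mem_filter => /andP[_ bu] -> ->; exists b => //.
  split=> // i; rewrite /F2 /=; case: ifP => _; rewrite ?vecN ?oppr_eq0 restrE;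
  by case: asboolP => //; rewrite eqxx.
have b20 : (0 < b.2)%N by have [/kavg_size_gt0] := ok.1 b bu.
have := aE _ (minsuppP a0); have := aE _ (maxsuppP c2 a0); rewrite /E /= => /andP[_ h1] /andP[h2 _].
rewrite h2 sE /=; apply/and3P; split.
- by rewrite /H; lia.
- have := le_trans (isum_mem bu) iu; rewrite lef_pV2 ?posrE ?ltr0n // ler_nat //.
- by apply: leq_trans (leH b bu) (ltnW (ltn_expl _ _)).
Qed.

Variable leaf : nat -> nat -> (nat -> R) -> seq item -> Prop.
Hypothesis leafP : leaf_basic s L1 sigma leaf.
Local Notation tree := (tree leaf).

Lemma tree_seq (Qf : nat -> nat) : (forall L, exists H y u, leaf L H y u) ->
  exists Lf Hf X U, forall q, [/\ tree (Qf q) (Lf q) (Hf q) (X q) (U q),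
    (8 * Qf q + 40 <= Lf q)%N & (Hf q <= Lf q.+1)%N].
Proof.
move=> sup.
have ex (t : nat * nat) : exists v : nat * (nat -> R) * seq item, tree t.1 t.2 v.1.1 v.1.2 v.2.
  by have [H [x [u tr]]] := tree_exists leafP sup t.1 t.2; exists (H, x, u).
have [T hT] := choice ex.
pose Lf := fix Lf q : nat := if q is q'.+1 then ((T (Qf q', Lf q')).1.1 + 8 * Qf q + 40)%N
  else (8 * Qf q + 40)%N.
exists Lf, (fun q => (T (Qf q, Lf q)).1.1), (fun q => (T (Qf q, Lf q)).1.2),
  (fun q => (T (Qf q, Lf q)).2) => q; split.
- exact: hT (Qf q, Lf q).
- by case: q => [|q] /=; lia.
- by rewrite /=; lia.
Qed.

(** The factor compensates for the depth: iterated averages of depth [P] have norm of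
    order [2^-P]. *)
Definition scaled P (x : nat -> R) : nat -> R := (2 ^+ P / 8) *: x.

Lemma scale_gt0 P : 0 < 2 ^+ P / 8 :> R.
Proof. by rewrite divr_gt0 ?exprn_gt0. Qed.

Lemma scaled_inside P L H x : inside L H x -> inside L H (scaled P x).
Proof. by move=> xi i; rewrite /scaled vecZ mulf_eq0 negb_or => /andP[_]; exact: xi. Qed.

Lemma scaled_bnd P L H x u0 : (0 < P)%N -> (8 * P + 40 <= L)%N -> tree P L H x u0 ->
  bnd (scaled P x) 1.
Proof.
case: P => // P _ QL tr f Wf; rewrite /scaled pairingZr; last exact: W_c00 Wf.
have bg : bigL P.+1 L by rewrite /bigL; lia.
rewrite normrM gtr0_norm ?scale_gt0 //.
apply: le_trans (ler_wpM2l _ (tree_bnd hs leafP tr bg Wf)) _; first exact: ltW (scale_gt0 _).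
by rewrite mulrACA [8^-1 * _]mulrC mulrACA divff ?mul1r ?mulfV ?expf_neq0.
Qed.

(** Rescaling turns the gain [2^-P] of the tree into smallness in terms of the sizes
    of the averages. *)
Lemma scaled_sum P L x m (u : seq item) (K : R) kk : (8 * P + 40 <= L)%N ->
  items_ok kk W u -> 0 <= K -> (m + 2 <= P)%N ->
  \sum_(a <- u) `|pairing a.1 x| <=
    K * 2 ^- (P - m - 2) * isum u + 2 ^+ (2 * m + 6) * rho R L ->
  \sum_(a <- u) `|pairing a.1 (scaled P x)| <= K * 2 ^+ m * isum u + L%:R^-1.
Proof.
move=> QL ok K0 mQ h.
have -> : \sum_(a <- u) `|pairing a.1 (scaled P x)| =
    2 ^+ P / 8 * \sum_(a <- u) `|pairing a.1 x|.
  rewrite mulr_sumr big_seq [RHS]big_seq; apply: eq_bigr => a au.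
  rewrite /scaled pairingZr; last exact: items_c00 (@Wc00 _ _ _ _) ok au.
  by rewrite normrM gtr0_norm ?scale_gt0.
apply: le_trans (ler_wpM2l (ltW (scale_gt0 P)) h) _; rewrite mulrDr.
have q0 n : 2 ^+ n != 0 :> R by rewrite expf_neq0.
apply: lerD.
  have -> : 2 ^+ P = 2 ^+ (P - m - 2) * (2 ^+ m * 4) :> R.
    by rewrite (_ : 4 = 2 ^+ 2) -?exprD; [congr (_ ^+ _); lia|rewrite expr2; lra].
  have -> : 2 ^+ (P - m - 2) * (2 ^+ m * 4) / 8 * (K * 2 ^- (P - m - 2) * isum u) =
    2^-1 * (K * 2 ^+ m * isum u) by field.
  rewrite ler_piMl ?invf_le1 ?ler1n // mulr_ge0 ?isum_ge0 // mulr_ge0 ?exprn_ge0 //.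
apply: le_trans (@exp_big1 R _ _ QL).
rewrite mulrA ler_wpM2r ?rho_ge0 // mulrAC -exprD ler_pdivrMr //.
apply: (@le_trans _ _ (2 ^+ (3 * P + 6))); first by rewrite ler_eXn2l ?ltr1n //; lia.
by rewrite ler_peMr ?exprn_ge0 // ler1n.
Qed.

Lemma scaled_flat (C : R) P L H x u0 ws f w : 0 <= C ->
  (forall L H y u, leaf L H y u -> forall f w, type_Ialpha W f w ->
    (w < L)%N -> `|pairing f y| <= C * 2 ^- w) ->
  (0 < P)%N -> (8 * P + 40 <= L)%N -> tree P L H x u0 -> type_Ialpha W f w ->
  (0 < w)%N -> w != ws -> (w + 2 <= P)%N \/ w = ws \/ (2 ^ P <= w)%N ->
  `|pairing f (scaled P x)| <= (4 * C + 14) * (3 / 4) ^+ w + 2 ^+ P * 2 ^- L.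
Proof.
move=> C0 ris P0 QL tr fI w0 nws wc.
have cf := W_c00 (type_I_W (k := true) fI).
have := tree_gam hs leafP C0 ris P0 QL tr fI w0 wc.
move=> /(ler_wpM2l (ltW (scale_gt0 P))) h.
rewrite /scaled pairingZr // normrM gtr0_norm ?scale_gt0 //; apply: le_trans h _.
have p34 : 0 <= (3 / 4) ^+ w :> R by rewrite exprn_ge0 // divr_ge0.
rewrite mulrDr; apply: lerD.
  rewrite /gam (negbTE nws).
  rewrite addr0; rewrite (_ : 2 ^+ P / 8 * _ = 8^-1 * ((4 * C + 14) * (3 / 4) ^+ w)).
    by rewrite ler_piMl ?mulr_ge0 ?addr_ge0 ?mulr_ge0 // invf_le1 // ler1n.
  by field; rewrite expf_neq0.
by rewrite ler_wpM2r ?invr_ge0 ?exprn_ge0 // ler_piMr ?exprn_ge0 // invf_le1 // ler1n.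
Qed.

Variables (k : bool) (m0 : nat) (eps : R).
Hypothesis eps0 : 0 < eps.
Hypothesis leafN : forall L H y u, leaf L H y u -> Adm m0 u /\ normed k eps L H y u.
Hypothesis leafS : forall L H y u, leaf L H y u -> Sp y.
Variable Qf : nat -> nat.
Hypothesis QfP : forall q, (q < Qf q)%N.
Variables (Lf Hf : nat -> nat) (X : nat -> nat -> R) (U : nat -> seq item).
Hypothesis trP : forall q, [/\ tree (Qf q) (Lf q) (Hf q) (X q) (U q),
    (8 * Qf q + 40 <= Lf q)%N & (Hf q <= Lf q.+1)%N].

Definition tvec q : nat -> R := scaled (Qf q) (X q).

Lemma X_inside q : inside (Lf q) (Hf q) (X q).
Proof. by have [tr _ _] := trP q; have [] := tree_basic leafP tr. Qed.

Lemma tvec_inside q : inside (Lf q) (Hf q) (tvec q).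
Proof. exact: scaled_inside (@X_inside q). Qed.

Lemma tvec_c00 q : c00 (tvec q).
Proof. exact: within_c00 (@tvec_inside q). Qed.

Lemma tvec_bnd q : bnd (tvec q) 1.
Proof.
have [tr QL _] := trP q; apply: scaled_bnd QL tr; exact: leq_ltn_trans (QfP q).
Qed.

Lemma tvec_normed q : exists2 f, W f & eps * 2 ^- m0 / 8 <= pairing f (tvec q).
Proof.
have [tr _ _] := trP q.
have [uA [ok u0 _ su]] := tree_items leafP leafN tr.
have Q0 : (0 < Qf q)%N by apply: leq_ltn_trans (QfP q).
exists (2 ^- (Qf q + m0) *: \sum_(a <- U q) a.1).
  by apply: weighted_W ok _ uA; rewrite addn_gt0 Q0.
rewrite pairingZl; last exact: tvec_c00.
rewrite pairing_suml; last exact: tvec_c00.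
apply: (@le_trans _ _ (2 ^- (Qf q + m0) * (2 ^+ Qf q / 8 * eps))).
  by rewrite le_eqVlt; apply/orP; left; apply/eqP; rewrite exprD; field; rewrite !expf_neq0.
rewrite ler_wpM2l ?invr_ge0 ?exprn_ge0 //.
apply: le_trans (ler_wpM2l (ltW (scale_gt0 (Qf q))) su) _; rewrite mulr_sumr big_seq [leRHS]big_seq.
apply: ler_sum => a au; rewrite /tvec /scaled pairingZr //; exact: items_c00 (@Wc00 _ _ _ _) ok au.
Qed.

Lemma tvec_neq0 q : tvec q != 0.
Proof.
have [f Wf] := tvec_normed q; apply: contraTneq => ->; rewrite pairing0r -ltNge.
by rewrite !mulr_gt0 // invr_gt0 exprn_gt0.
Qed.

Lemma tvec_block : block_seq tvec.
Proof.
apply: block_seq_intro; [exact: tvec_c00|exact: tvec_neq0|].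
move=> q i i' /tvec_inside h /tvec_inside h'; have [_ _ HL] := trP q; lia.
Qed.

Lemma tvec_span q : Sp (tvec q).
Proof.
have [tr _ _] := trP q; have XS := tree_span SpP leafS tr.
have S0 : Sp 0 by have := SpP (-1) XS XS; rewrite scaleN1r addNr.
by have := SpP (2 ^+ Qf q / 8) XS S0; rewrite addr0.
Qed.

Lemma Lf_ge q : (q <= Lf q)%N.
Proof. by have [_ QL _] := trP q; have := QfP q; lia. Qed.

Lemma IZ_intro kk (x : nat -> nat -> R) : (forall m, exists K C, 0 < C /\ forall q u, (K <= q)%N ->
    items_ok kk W u -> Adm m u ->
    \sum_(a <- u) `|pairing a.1 (x q)| <= C * isum u + (Lf q)%:R^-1) -> IZ kk x.
Proof.
move=> h m e e0; have [K [C [C0 hK]]] := h m.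
pose K' := Num.bound (2 / e).
exists (e / (2 * C)), (maxn K K'.+1); split; first by rewrite divr_gt0 ?mulr_gt0.
move=> q u; rewrite geq_max => /andP[Kq K'q] ok uA iu.
apply: le_trans (hK q u Kq ok uA) _.
have h1 : C * isum u <= e / 2.
  apply: le_trans (ler_wpM2l (ltW C0) iu) _.
  by rewrite le_eqVlt; apply/orP; left; apply/eqP; field; rewrite lt0r_neq0.
have h2 : (Lf q)%:R^-1 <= e / 2.
  rewrite -[leRHS]invrK lef_pV2 ?posrE ?invr_gt0 ?divr_gt0 ?ltr0n //; last first.
    by have := Lf_ge q; lia.
  rewrite invf_div; apply: le_trans (ltW (archi_boundP _)) _; first by rewrite divr_ge0 ?ltW.
  by rewrite ler_nat -/K'; have := Lf_ge q; lia.
lra.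
Qed.

Lemma tvec_IZ_alpha : IZ true tvec.
Proof.
apply: IZ_intro => m; exists (m + 2)%N, (8 * 2 ^+ m); split; first by rewrite mulr_gt0 ?exprn_gt0.
move=> q u mq ok uA; have [tr QL _] := trP q.
have mQ : (m + 2 <= Qf q)%N by have := QfP q; lia.
exact: (scaled_sum QL ok _ mQ (tree_alpha_sum hs leafP mQ QL tr ok uA)).
Qed.

Variable C : R.
Hypothesis C0 : 0 <= C.
Hypothesis ris : forall L H y u, leaf L H y u -> forall f w, type_Ialpha W f w ->
  (w < L)%N -> `|pairing f y| <= C * 2 ^- w.
Hypothesis gap : forall q w, wt w -> (2 * w <= Qf q)%N \/ w = 0%N \/ (2 ^ Qf q <= w)%N.

Lemma tvec_IZ_beta : IZ false tvec.
Proof.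
apply: IZ_intro => m; exists (4 * m + 12)%N, ((16 * C + 64) * 2 ^+ m); split.
  by rewrite mulr_gt0 ?exprn_gt0 // ltr_wpDl // mulr_ge0.
move=> q u mq ok uA; have [tr QL _] := trP q; have qQ := QfP q.
have mQ : (m + 2 <= Qf q)%N by lia.
apply: (scaled_sum QL ok _ mQ); first by rewrite addr_ge0 // mulr_ge0.
by apply: (tree_beta_sum hs hL hsigma leafP C0 ris _ _ QL (@gap q) tr ok uA); lia.
Qed.

Lemma tvec_flat : flat s l L1 sigma tvec.
Proof.
exists (4 * C + 14) => eta e0; have [K hK] := exp2V_small e0.
exists (maxn K 1) => q f w; rewrite geq_max => /andP[Kq q1] fI ww.
have [tr QL _] := trP q; have w9 := wt_gt9 hL ww.
have wc : (w + 2 <= Qf q)%N \/ w = 0%N \/ (2 ^ Qf q <= w)%N.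
  by case: (gap q ww) => [h|[h|h]]; [left; lia|right; left|right; right].
apply: le_trans (scaled_flat C0 ris _ QL tr fI _ _ wc) _.
- by have := QfP q; lia.
- by lia.
- by rewrite -lt0n; lia.
rewrite lerD2l.
apply: le_trans (hK _ Kq); rewrite ler_pdivrMr ?exprn_gt0 //.
rewrite ler_pdivlMl ?exprn_gt0 // -exprD.
by rewrite ler_eXn2l ?ltr1n //; have := QfP q; lia.
Qed.

End TreeSequences.

(** * Sequences with bounded runs in every block subspace *)

Section Nice.
Variables (R : realType) (s : nat -> R -> R) (hs : dense_in_sphere s).
Variables (l : nat -> nat) (L1 L2 L3 : set nat) (hL : coding_weights R l L1 L2 L3).
Variables (sigma : seq (nat -> R) -> nat) (hsigma : coding_function L2 sigma).
Local Notation W := (norming_set s L1 sigma).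
Local Notation kavg := (kavg s L1 sigma).
Local Notation items_ok := (items_ok s L1 sigma).
Local Notation bnd := (bnd s L1 sigma).
Local Notation wt := (wt l).
Local Notation item := (item R).
Local Notation IZ := (IZ s L1 sigma).
Local Notation flat := (flat s l L1 sigma).
Local Notation runs_bounded := (runs_bounded s L1 sigma).
Local Notation Wnorm := (W_norm s L1 sigma).
Implicit Types (x v : nat -> nat -> R) (y : nat -> R).

Lemma c00_bnd y : c00 y -> exists C, bnd y C.
Proof.
move=> cy; have [K yK] := c00_trunc cy; exists (\sum_(i < K) `|y i|) => f Wf.
rewrite (pairing_trunc _ yK); apply: le_trans (ler_norm_sum _ _ _) _.
by apply: ler_sum => i _; rewrite normrM ler_piMl // (W_coord hs Wf).
Qed.

Lemma Wnorm_has_sup y : c00 y -> has_sup [set pairing f y | f in W].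
Proof.
move=> cy; split; first by exists (pairing 0 y), 0 => //; exact: W0.
have [C yC] := c00_bnd cy; exists C => _ [f Wf <-].
exact: le_trans (ler_norm _) (yC f Wf).
Qed.

Lemma Wnorm_bnd y : c00 y -> bnd y (Wnorm y).
Proof.
move=> cy f Wf; have [_ ub] := Wnorm_has_sup cy.
have h g : W g -> pairing g y <= Wnorm y by move=> Wg; apply: (ub_le_sup ub); exists g.
by rewrite ler_norml h // andbT lerNl -pairingNl //; apply: h; exact: WN.
Qed.

Lemma Wnorm_le y C : bnd y C -> Wnorm y <= C.
Proof.
move=> yC; apply: ge_sup; first by exists (pairing 0 y), 0 => //; exact: W0.
by move=> _ [f Wf <-]; exact: le_trans (ler_norm _) (yC f Wf).
Qed.

Lemma Wnorm_gt0 y : c00 y -> y != 0 -> 0 < Wnorm y.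
Proof.
move=> cy /supp_neq0[i yi]; apply: lt_le_trans (bnd_coord cy (Wnorm_bnd cy) i).
by rewrite normr_gt0.
Qed.

Lemma Wnorm_half y : c00 y -> y != 0 -> exists2 f, W f & Wnorm y / 2 < pairing f y.
Proof.
move=> cy y0; have h := Wnorm_gt0 cy y0.
have h2 : 0 < Wnorm y / 2 by rewrite divr_gt0.
have [_ [f Wf <-] hf] := sup_adherent h2 (Wnorm_has_sup cy).
exists f => //; apply: le_lt_trans hf; rewrite -/(Wnorm y); lra.
Qed.

Lemma bndZ y (c C : R) : c00 y -> 0 <= c -> bnd y C -> bnd (c *: y) (c * C).
Proof.
move=> cy c0 yC f Wf; rewrite pairingZr; last exact: W_c00 Wf.
by rewrite normrM ger0_norm // ler_wpM2l // yC.
Qed.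

Lemma normalize y : c00 y -> y != 0 -> bnd ((Wnorm y)^-1 *: y) 1 /\
  exists2 f, W f & 2^-1 <= pairing f ((Wnorm y)^-1 *: y).
Proof.
move=> cy y0; have h := Wnorm_gt0 cy y0; split.
  have := bndZ cy (_ : 0 <= (Wnorm y)^-1) (Wnorm_bnd cy).
  by rewrite mulVf ?lt0r_neq0 // invr_ge0 ltW //; apply.
have [f Wf hf] := Wnorm_half cy y0; exists f => //.
rewrite pairingZr; last exact: W_c00 Wf.
by rewrite ler_pdivlMl // ltW.
Qed.

Variable Sp : (nat -> R) -> Prop.
Hypothesis SpP : forall (c : R) y y', Sp y -> Sp y' -> Sp (c *: y + y').

Lemma Sp_0 y : Sp y -> Sp 0.
Proof. by move=> Sy; have := SpP (-1) Sy Sy; rewrite scaleN1r addNr. Qed.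

Lemma Sp_Z c y : Sp y -> Sp (c *: y).
Proof. by move=> Sy; have := SpP c Sy (Sp_0 Sy); rewrite addr0. Qed.

Lemma Sp_D y y' : Sp y -> Sp y' -> Sp (y + y').
Proof. by move=> Sy Sy'; have := SpP 1 Sy Sy'; rewrite scale1r. Qed.

Lemma Sp_sum x : (forall q, Sp (x q)) -> forall N J, Sp (\sum_(i < N) x (J + i)%N).
Proof.
move=> xS; elim=> [|N IH] J; first by rewrite big_ord0; exact: Sp_0 (xS 0%N).
by rewrite big_ord_recr /=; apply: Sp_D.
Qed.

Definition lower x : Prop := exists2 eps : R, 0 < eps &
  forall q, exists2 f, W f & eps <= pairing f (x q).

Definition normalized_blocks x : Prop :=
  [/\ block_seq x, forall q, Sp (x q), forall q, bnd (x q) 1 & lower x].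

(** Sequences in [Sp] on which the construction of special sequences can be based. *)
Definition nice x : Prop := [/\ normalized_blocks x, IZ true x & runs_bounded x].

Definition ris_seq x : Prop := exists2 C : R, 0 <= C & forall L, exists K, forall q, (K <= q)%N ->
  forall f w, type_Ialpha W f w -> (w < L)%N -> `|pairing f (x q)| <= C * 2 ^- w.

Lemma normalized_blocks_sub x (p : nat -> nat) : (forall q, (p q < p q.+1)%N) -> normalized_blocks x -> normalized_blocks (x \o p).
Proof.
move=> pp [bx xS x1 [e e0 xe]]; split=> /=.
- exact: block_seq_sub.
- by move=> q; exact: xS.
- by move=> q; exact: x1.
- by exists e => // q; exact: xe.
Qed.

Lemma nice_flat x : normalized_blocks x -> IZ true x -> IZ false x -> flat x -> exists v, nice v.
Proof.
move=> sx h1 h2 h3; have [bx _ x1 _] := sx.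
have [p pp rb] := flat_runs_bounded hs hL hsigma bx x1 h1 h2 h3.
exists (x \o p); split=> //; first exact: normalized_blocks_sub.
exact: IZ_sub (incr_ge pp) h1.
Qed.

Lemma leafD_basic Ev k m eps : leaf_basic s L1 sigma (leafD s L1 sigma Sp Ev k m eps).
Proof. by move=> L H y u []. Qed.

Lemma l_gt q : (q < l q)%N.
Proof.
have [[l9 lS] _ _ _ _] := hL; elim: q => [|q IH]; first by apply: leq_trans l9.
have := lS q; have := ltn_expl (2 * l q) (ltnSn 1); lia.
Qed.

(** If large alpha-averages keep norming the sequence, iterated averages of it are
    still normed, with a loss depending only on the order of the family, and their
    index is zero. *)
Lemma alpha_stage x : normalized_blocks x -> exists2 v, normalized_blocks v & IZ true v.
Proof.
move=> sx; have [bx xS x1 _] := sx.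
have [iz|nz] := pselect (IZ true x); first by exists x.
have [m [eps [e0 sup]]] := NZ_leaf (Ev := fun _ _ => True) bx x1 xS
  (fun L => ex_intro _ 0%N (fun _ _ => I)) nz.
pose leaf := leafD s L1 sigma Sp (fun _ _ => True) true m eps.
have leafP : leaf_basic s L1 sigma leaf by exact: leafD_basic.
have leafN L H y u : leaf L H y u -> Adm m u /\ normed s L1 sigma true eps L H y u by case.
have leafS L H y u : leaf L H y u -> Sp y by case=> _ _ _ [].
have [Lf [Hf [X [U trP]]]] := tree_seq leafP S sup.
have QfP q : (q < q.+1)%N by [].
exists (tvec S X).
  split.
  - exact: (tvec_block leafP e0 leafN QfP trP).
  - exact: (tvec_span SpP leafS trP).
  - exact: (tvec_bnd hs leafP QfP trP).
  - exists (eps * 2 ^- m / 8); first by rewrite !mulr_gt0 // invr_gt0 exprn_gt0.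
    exact: (tvec_normed leafP leafN QfP trP).
exact: (tvec_IZ_alpha hs leafP e0 QfP trP).
Qed.

(** The leaves now satisfy upper estimates for type I_alpha functionals, so that the
    iterated averages have index zero for both kinds of averages and are flat. *)
Lemma ris_stage k x : normalized_blocks x -> ris_seq x -> ~ IZ k x -> exists v, nice v.
Proof.
move=> sx [C C0 xris] nz; have [bx xS x1 _] := sx.
pose Ev L (y : nat -> R) := forall f w, type_Ialpha W f w -> (w < L)%N ->
  `|pairing f y| <= C * 2 ^- w.
have [m [eps [e0 sup]]] := NZ_leaf (Ev := Ev) bx x1 xS xris nz.
pose leaf := leafD s L1 sigma Sp Ev k m eps.
have leafP : leaf_basic s L1 sigma leaf by exact: leafD_basic.
have leafN L H y u : leaf L H y u -> Adm m u /\ normed s L1 sigma k eps L H y u by case.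
have leafS L H y u : leaf L H y u -> Sp y by case=> _ _ _ [].
have ris L H y u : leaf L H y u -> forall f w, type_Ialpha W f w ->
  (w < L)%N -> `|pairing f y| <= C * 2 ^- w by case=> _ _ _ [_ h] _; exact: h.
(* since [2^(2 l_q) < l_(q+1)], no weight is comparable with this depth *)
pose Qf q := (2 * l q)%N.
have [Lf [Hf [X [U trP]]]] := tree_seq leafP Qf sup.
have QfP q : (q < Qf q)%N by have := l_gt q; rewrite /Qf; lia.
have gap q w : wt w -> (2 * w <= Qf q)%N \/ w = 0%N \/ (2 ^ Qf q <= w)%N.
  move=> [i _ <-]; rewrite /Qf; case: (ltnP q i) => qi.
    by right; right; apply: ltnW; exact: l_mono hL _ _ qi.
  left; move: qi; rewrite leq_eqVlt => /orP[/eqP->//|/(l_mono hL) h].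
  have := ltn_expl (2 * l i) (ltnSn 1); lia.
apply: (@nice_flat (tvec Qf X)).
- split.
  - exact: (tvec_block leafP e0 leafN QfP trP).
  - exact: (tvec_span SpP leafS trP).
  - exact: (tvec_bnd hs leafP QfP trP).
  - exists (eps * 2 ^- m / 8); first by rewrite !mulr_gt0 // invr_gt0 exprn_gt0.
    exact: (tvec_normed leafP leafN QfP trP).
- exact: (tvec_IZ_alpha hs leafP e0 QfP trP).
- exact: (tvec_IZ_beta hs hL hsigma leafP e0 QfP trP C0 ris gap).
- exact: (tvec_flat hs hL leafP e0 QfP trP C0 ris gap).
Qed.

Section Runs.
Variables (x : nat -> nat -> R) (j : nat -> nat).
Hypothesis sx : normalized_blocks x.
Hypothesis xwin : windows s L1 sigma x j 2.
Hypothesis xiz : IZ true x.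
Hypothesis nrb : ~ runs_bounded x.

(** A normalized run; what a functional of large weight sees of it tends to zero with
    the norm of the run before normalization. *)
Definition long_run (p M : nat) y : Prop :=
  [/\ c00 y /\ Sp y, forall i, y i != 0 -> (M < i)%N, bnd y 1 /\
      exists2 f, W f & 2^-1 <= pairing f y,
      forall f w, type_Ialpha W f w -> (w < p)%N -> `|pairing f y| <= 2 * 2 ^- w &
      forall f w, type_Ialpha W f w -> `|pairing f y| <= 6 * (3 / 4) ^+ w + 2 / p.+1%:R].

Lemma long_run_exists p M : exists y, long_run p M y.
Proof.
have [bx xS x1 _] := sx; have [jS zj zris] := xwin.
have [N hN] : exists N, forall M', exists2 J, (M' <= J)%N &
    ~ bnd (\sum_(i < N) x (J + i)%N) p.+1%:R.
  apply: contrapT => no; apply: nrb; exists p.+1%:R => N; apply: contrapT => no2.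
  apply: no; exists N => M'; apply: contrapT => no3; apply: no2; exists M' => J MJ.
  by apply: contrapT => no4; apply: no3; exists J.
have N0 : (0 < N)%N.
  rewrite lt0n; apply/eqP => Ne; have [J _] := hN 0%N; apply=> f Wf.
  by rewrite Ne big_ord0 pairing0r normr0.
pose m1 := maxn (2 * N) p.
have eN : 0 < N%:R^-1 :> R by rewrite invr_gt0 ltr0n.
have [tau [K [t0 hK]]] := IZ_unif m1 eN xiz; have [K' hK'] := exp2V_small t0.
have [J] := hN (maxn M (maxn K K')); rewrite !geq_max => /and3P[MJ KJ KJ'] nb.
set y := \sum_(i < N) x (J + i)%N in nb.
have cx q : c00 (x q) by have [] := bx q.
have cy : c00 y by apply: c00_sum => i _.
have rho1 : p.+1%:R < Wnorm y.
  rewrite ltNge; apply/negP => h; apply: nb => f Wf.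
  exact: le_trans (Wnorm_bnd cy Wf) h.
have rho0 : 0 < Wnorm y by apply: lt_trans rho1; rewrite ltr0n.
have y0 : y != 0.
  apply: contraTneq rho1 => ->; rewrite -leNgt; apply: le_trans (ler0n _ _); apply: Wnorm_le.
  by move=> f _; rewrite pairing0r normr0.
have [v1 vl] := normalize cy y0; set v := (Wnorm y)^-1 *: y in v1 vl *.
have cv : c00 v by exact: c00Z.
have vJ i : v i != 0 -> (J < i)%N.
  rewrite /v vecZ mulf_eq0 negb_or => /andP[_]; rewrite /y vec_sum => h.
  have [r hr] : exists r : 'I_N, x (J + r)%N i != 0.
    apply: contrapT => no; move/eqP: h; apply; apply: big1 => r _.
    by apply/eqP; apply: contrapT => /negP hr; apply: no; exists r.
  by apply: leq_trans (block_seq_ge bx hr); rewrite ltnS leq_addr.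
have vle f : W f -> `|pairing f v| <= (Wnorm y)^-1 * \sum_(q <- iota J N) `|pairing f (x q)|.
  move=> Wf; have cf := W_c00 Wf; rewrite /v pairingZr // normrM gtr0_norm ?invr_gt0 //.
  rewrite ler_wpM2l ?invr_ge0 ?(ltW rho0) // /y pairing_sumr //.
  apply: le_trans (ler_norm_sum _ _ _) _.
  have -> : iota J N = index_iota J (N + J) by rewrite /index_iota addnK.
  rewrite -{2}[J]add0n big_addn addnK big_mkord.
  by apply: ler_sum => i _; rewrite addnC.
have rinv : (Wnorm y)^-1 <= p.+1%:R^-1 by rewrite lef_pV2 ?posrE ?ltr0n // ltW.
have rinv1 : (Wnorm y)^-1 <= 1 by apply: le_trans rinv _; rewrite invf_le1 ?ltr0n ?ler1n.
have ris f w : type_Ialpha W f w -> (w < m1)%N -> `|pairing f v| <= 2 * 2 ^- w.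
  move=> fI wm; rewrite mulrC.
  apply: le_trans (type_I_split (k := true) fI cv vJ v1 (T := 1) _) _; last first.
    by rewrite ler_wpM2l ?invr_ge0 ?exprn_ge0.
  move=> u ok uA iu; apply: (@le_trans _ _ (\sum_(b <- u) \sum_(q <- iota J N) `|pairing b.1 (x q)|)).
    rewrite big_seq [leRHS]big_seq; apply: ler_sum => b bu.
    have Wb : W b.1 by have [/kavg_in] := ok.1 b bu.
    by apply: le_trans (vle _ Wb) _; rewrite ler_piMl // sumr_ge0.
  rewrite exchange_big /=; apply: (@le_trans _ _ (\sum_(q <- iota J N) N%:R^-1)); last first.
    by rewrite big_const_seq count_predT iter_addr_0 size_iota -[leLHS]mulr_natl divff // lt0r_neq0 // ltr0n.
  rewrite big_seq [leRHS]big_seq; apply: ler_sum => q; rewrite mem_iota => /andP[Jq _].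
  apply: (hK w q u wm _ ok uA); first exact: leq_trans KJ Jq.
  exact: le_trans iu (hK' J KJ').
exists v; split=> //.
- by split=> //; apply: Sp_Z; exact: Sp_sum.
- by move=> i /vJ; apply: leq_ltn_trans.
- by move=> f w fI wp; apply: ris => //; rewrite /m1 leq_max wp orbT.
move=> f w fI; have p34 : 0 <= (3 / 4) ^+ w :> R by rewrite exprn_ge0 // divr_ge0.
have pp : 0 <= 2 / p.+1%:R :> R by rewrite divr_ge0.
case: (ltnP w m1) => wm.
  apply: le_trans (ris f w fI wm) _; move: (pow34 R w) p34 pp; set a0 := 2 ^- w; set b0 := _ ^+ w; set c0 := 2 / _; lra.
apply: le_trans (vle _ (type_I_W (k := true) fI)) _.
have zb r : bnd (x r) 2 by move=> g Wg; apply: le_trans (x1 r g Wg) _; rewrite ler1n.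
have h := type_I_windows hs jS zj zb zris (k := true) fI (iota_uniq J N).
apply: le_trans (ler_wpM2l _ h) _; first by rewrite invr_ge0 ltW.
rewrite size_iota mulrDr; apply: lerD; last by rewrite mulrC ler_wpM2l.
have t := @tiny_pow R 0 w N; rewrite addn0 expr0 invr1 mul1r in t.
have {}t : N%:R * 2 ^- w <= (3 / 4) ^+ w :> R by apply: t; move: wm; rewrite /m1 geq_max => /andP[].
have sum0 : 0 <= N%:R * (2 * 2 ^- w) + 2 * 2 * (3 / 4) ^+ w :> R.
  by rewrite addr_ge0 ?mulr_ge0 ?invr_ge0 ?exprn_ge0 // divr_ge0.
apply: le_trans (ler_piMl sum0 rinv1) _; lra.
Qed.

(** When runs are unbounded, normalizing longer and longer ones makes the coefficients
    tend to zero, and the sequence obtained is flat. *)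
Lemma run_stage : exists u, [/\ normalized_blocks u, ris_seq u & flat u].
Proof.
have [G hG] := choice (fun t : nat * nat => long_run_exists t.1 t.2).
pose u := fix u p : nat -> R := G (p, if p is p'.+1 then maxsupp (u p') else 0%N).
have hu p : exists2 M, long_run p M (u p) & forall p', p = p'.+1 -> M = maxsupp (u p').
  by case: p => [|p]; [exists 0%N; [exact: hG (0%N, 0%N)|]
    |exists (maxsupp (u p)); [exact: hG (p.+1, maxsupp (u p))|move=> p' [->]]].
exists u; split.
- split.
  + apply: block_seq_intro => [q|q|q i i' ui].
    * by have [M [[h _] _ _ _ _] _] := hu q.
    * have [M [_ _ [_ [f _ h]] _ _] _] := hu q; apply: contraTneq h => ->.
      by rewrite pairing0r -ltNge invr_gt0.
    * have [M [_ h _ _ _] /(_ q erefl) e] := hu q.+1; move=> /h; rewrite e.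
      by apply: leq_ltn_trans; apply: maxsupp_ge ui; have [? [[cq _] _ _ _ _] _] := hu q.
  + by move=> q; have [M [[_ h] _ _ _ _] _] := hu q.
  + by move=> q; have [M [_ _ [h _] _ _] _] := hu q.
  + by exists 2^-1 => [|q]; [rewrite invr_gt0|have [M [_ _ [_ h] _ _] _] := hu q].
- exists 2 => // L; exists L => q Lq f w fI wL.
  have [M [_ _ _ h _] _] := hu q; apply: h fI _; exact: leq_trans wL Lq.
- exists 6 => eta e0; pose K := Num.bound (2 / eta); exists K => q f w Kq fI _.
  have [M [_ _ _ _ h] _] := hu q; apply: le_trans (h f w fI) _; rewrite lerD2l.
  rewrite ler_pdivrMr // -ler_pdivrMl // mulrC; apply: le_trans (ltW (archi_boundP _)) _.
    by rewrite divr_ge0 // ltW.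
  by rewrite ler_nat; exact: leqW Kq.
Qed.

End Runs.

(** After [alpha_stage], either the sequence has index zero for both kinds of averages
    and bounded runs, or normalized long runs or iterated averages of it do. *)
Theorem nice_exists x : normalized_blocks x -> exists v, nice v.
Proof.
move=> /alpha_stage[{}x sx xa]; have [bx xS x1 _] := sx.
have xris : ris_seq x.
  exists (1 + 1) => [|L]; first by rewrite addr_ge0.
  have [K hK] := IZ_ris L bx x1 xa; exists K => q Kq f w fI; exact: hK Kq fI.
have [xb|] := pselect (IZ false x); last exact: ris_stage sx xris.
have [p [j [pp win _]]] := sparse (Q := fun _ _ _ => True) bx x1 xa xb
  (fun _ _ => ex_intro _ 0%N (fun _ _ => I)).
have sx' := normalized_blocks_sub pp sx.
have xa' := IZ_sub (incr_ge pp) xa.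
have [rb|nrb] := pselect (runs_bounded (x \o p)); first by exists (x \o p).
have [u [su uris uf]] := run_stage sx' win xa' nrb.
have [ua|] := pselect (IZ true u); last exact: ris_stage su uris.
have [ub|] := pselect (IZ false u); last exact: ris_stage su uris.
exact: nice_flat su ua ub uf.
Qed.

End Nice.

(** * Vectors normed by functionals of prescribed weight *)

Section Exact.
Variables (R : realType) (s : nat -> R -> R) (hs : dense_in_sphere s).
Variables (l : nat -> nat) (L1 L2 L3 : set nat) (hL : coding_weights R l L1 L2 L3).
Variables (sigma : seq (nat -> R) -> nat) (hsigma : coding_function L2 sigma).
Local Notation W := (norming_set s L1 sigma).
Local Notation kavg := (kavg s L1 sigma).
Local Notation items_ok := (items_ok s L1 sigma).
Local Notation bnd := (bnd s L1 sigma).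
Local Notation wt := (wt l).
Local Notation item := (item R).
Variable Sp : (nat -> R) -> Prop.
Hypothesis SpP : forall (c : R) y y', Sp y -> Sp y' -> Sp (c *: y + y').
Local Notation nice := (nice s L1 sigma Sp).

Lemma maxsupp_eq (y : nat -> R) H : c00 y -> y H != 0 -> (forall i, y i != 0 -> (i <= H)%N) ->
  maxsupp y = H.
Proof.
move=> cy yH h; apply/eqP; rewrite eqn_leq (maxsupp_ge cy yH) andbT; apply: h.
by apply: maxsuppP => //; apply: contraNneq yH => ->.
Qed.

(** Leaves normed by a single average that ends exactly at [H]. *)
Definition leafE (e : R) L H y (u : seq item) : Prop :=
  [/\ (L < H)%N, inside L H y, bnd y 1,
      Sp y /\ forall f w, type_Ialpha W f w -> (w < L)%N -> `|pairing f y| <= 2 * 2 ^- w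
    & [/\ Adm 1 u, normed s L1 sigma true e L H y u & exists2 a, a \in u & maxsupp a.1 = H]].

(** A long run of the sequence is normed by a single average of the functionals
    norming its terms; a unit functional far to the right is added so as to
    prescribe where the average ends. *)
Lemma leafE_exists v : nice v -> exists2 e, 0 < e & forall L, exists H y u, leafE e L H y u.
Proof.
move=> [[bv vS v1 [eps eps0 vl]] iz [C' rb]].
pose C := `|C'| + 1; have C0 : 0 < C by rewrite ltr_wpDl.
have hf q : exists f, W f /\ eps <= pairing f (v q) by have [f] := vl q; exists f.
have [ff hff] := choice hf.
exists (eps / (2 * C)) => [|L]; first by rewrite divr_gt0 ?mulr_gt0.
pose N := L.+1; have eN : 0 < N%:R^-1 :> R by rewrite invr_gt0 ltr0n.
have [tau [K [t0 hK]]] := IZ_unif L eN iz; have [K' hK'] := exp2V_small t0.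
have [M hM] := rb N.
pose J := maxn (maxn L K) (maxn K' M).
have [JL JK JK' JM] : [/\ (L <= J)%N, (K <= J)%N, (K' <= J)%N & (M <= J)%N].
  by rewrite /J !leq_max !leqnn !orbT.
have cv q : c00 (v q) by have [] := bv q.
have nv q : v q != 0 by have [_ /succvP[]] := bv q.
pose y0 := \sum_(i < N) v (J + i)%N; pose y := C^-1 *: y0.
have cy0 : c00 y0 by apply: c00_sum.
have cy : c00 y by exact: c00Z.
have y1 : bnd y 1.
  have h : bnd y0 C by move=> f Wf; apply: le_trans (hM J JM f Wf) _; rewrite /C; have := ler_norm C'; lra.
  have Ci : 0 <= C^-1 by rewrite invr_ge0 ltW.
  by have := bndZ cy0 Ci h; rewrite mulVf ?lt0r_neq0.
pose E q := [set i | (minsupp (v q) <= i)%N && (i <= maxsupp (v q))%N].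
have nE q : nat_interval (E q) by move=> i i' i''; rewrite /E /=; lia.
pose g q := ff q \_ (E q).
have Wg q : W (g q) by apply: (W_restr (nE q)); have [] := hff q.
have gE q i : g q i != 0 -> E q i by rewrite /g restrE; case: asboolP => //; rewrite eqxx.
have vE q i : v q i != 0 -> E q i by move=> vi; rewrite /E /= minsupp_le ?maxsupp_ge.
have EE q r i i' : (q < r)%N -> E q i -> E r i' -> (i < i')%N.
  move=> qr /andP[_ h1] /andP[h2 _].
  have := block_seq_lt bv qr (maxsuppP (cv q) (nv q)) (minsuppP (nv r)); lia.
have gv q r : q != r -> pairing (g q) (v r) = 0.
  move=> qr; apply: pairing_eq0 => i; have [->|gi] := eqVneq (g q i) 0; first by left.
  have [->|vi] := eqVneq (v r i) 0; [by right|].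
  have Eq := gE _ _ gi; have Er := vE _ _ vi.
  by case: (ltngtP q r) qr => // [/EE /(_ Eq Er)|/EE /(_ Er Eq)]; rewrite ltnn.
have gvv q : eps <= pairing (g q) (v q).
  rewrite /g pairing_patch (_ : v q \_ (E q) = v q); first by have [] := hff q.
  apply/funext => i; rewrite restrE; case: asboolP => // nEi.
  by apply/esym/eqP; apply: contrapT => /negP /vE.
have g0 q : g q != 0 by apply: contraTneq (gvv q) => ->; rewrite pairing0l -ltNge.
pose hm := maxsupp (v (J + N)%N); pose H := (8 * hm + L + 10)%N.
have Eh q i : (q < J + N)%N -> E q i -> (i < hm)%N.
  move=> qN Ei; exact: EE qN Ei (vE _ _ (maxsuppP (cv _) (nv _))).
have EJ q i : (J <= q)%N -> E q i -> (L < i)%N.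
  move=> Jq /andP[h _]; have := block_seq_ge bv (minsuppP (nv q)); lia.
pose fam i := if (i < N)%N then g (J + i)%N else unit_vec R H.
have H0 : (0 < H)%N by rewrite /H addnC.
have Wfam i : W (fam i) by rewrite /fam; case: ifP => _ //; exact: W_unit.
have famE i t : (i < N)%N -> fam i t != 0 -> E (J + i)%N t by rewrite /fam => ->; exact: gE.
pose sz := N.+1; pose alp := sz%:R^-1 *: \sum_(i < sz) fam i.
have Wa : W alp by apply: W_mean.
have ca := W_c00 Wa.
have fam0 i : fam i != 0.
  rewrite /fam; case: ifP => // _; apply/eqP => /(congr1 (fun f => f H)).
  by rewrite /unit_vec eqxx => /eqP; rewrite oner_eq0.
have supfam i t : (i < sz)%N -> fam i t != 0 -> (L < t)%N && (t <= H)%N.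
  move=> iN; case: (ltnP i N) => iN'.
    move=> /(famE _ _ iN') h; have := EJ _ _ (leq_addr i J) h; have := Eh (J + i)%N t; rewrite ltn_add2l iN' => /(_ isT h).
    by rewrite /H => ? ->; lia.
  rewrite /fam ltnNge iN' /= /unit_vec; case: (t =P H) => [->|]; rewrite ?eqxx // => _.
  by rewrite leqnn /H; lia.
have blk : block_upto sz fam.
  move=> q qs; apply/succvP; split=> //; rewrite ltnS in qs.
  have e1 := famE q _ qs (maxsuppP (W_c00 (Wfam q)) (fam0 q)).
  case: (ltnP q.+1 N) => q1.
    by apply: EE e1 (famE q.+1 _ q1 (minsuppP (fam0 _))); rewrite addnS.
  have : fam q.+1 (minsupp (fam q.+1)) != 0 by exact: minsuppP.
  rewrite {1}/fam ltnNge q1 /= /unit_vec; case: (minsupp _ =P H) => [-> _|]; last by rewrite eqxx.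
  by have := Eh (J + q)%N _ _ e1; rewrite ltn_add2l qs => /(_ isT); rewrite /H; lia.
have avg : alpha_average W alp sz.
  by split=> //; exists sz, fam; split=> //; rewrite /sz /= leqnn.
have supa t : alp t != 0 -> (L < t)%N && (t <= H)%N.
  rewrite /alp vecZ mulf_eq0 negb_or => /andP[_]; rewrite vec_sum => h.
  apply: contrapT => no; move/eqP: h; apply; apply: big1 => i _; apply/eqP; apply: contrapT => /negP.
  by move=> /(supfam i t (ltn_ord i)).
have aH : alp H != 0.
  rewrite /alp vecZ vec_sum big_ord_recr /= big1 ?add0r.
    by rewrite /fam ltnn /unit_vec eqxx mulr1 invr_eq0 pnatr_eq0.
  move=> i _; apply/eqP; apply: contrapT => /negP /(famE _ _ (ltn_ord i)) h.
  by have := Eh (J + i)%N H; rewrite ltn_add2l ltn_ord => /(_ isT h); rewrite /H; lia.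
have maxa : maxsupp alp = H by apply: maxsupp_eq => // i /supa /andP[].
have a0 : alp != 0 by apply: contraNneq aH => ->.
have mina : (L < minsupp alp)%N by have /supa /andP[] := minsuppP a0.
have insy : inside L H y.
  move=> i; rewrite /y vecZ mulf_eq0 negb_or => /andP[_]; rewrite /y0 vec_sum => h.
  have [r hr] : exists r : 'I_N, v (J + r)%N i != 0.
    apply: contrapT => no; move/eqP: h; apply; apply: big1 => r _.
    by apply/eqP; apply: contrapT => /negP hr; apply: no; exists r.
  have Er := vE _ _ hr; rewrite (EJ _ _ (leq_addr r J) Er).
  by have := Eh (J + r)%N i; rewrite ltn_add2l ltn_ord => /(_ isT Er); rewrite /H; lia.
have ay : eps / (2 * C) <= pairing alp y.
  rewrite /alp pairingZl // pairing_suml // big_ord_recr /= {2}/fam ltnn pairing_unit.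
  have -> : y H = 0.
    by apply/eqP; apply: contrapT => /negP /insy; rewrite /H; lia.
  rewrite addr0; apply: (@le_trans _ _ (sz%:R^-1 * \sum_(i < N) (C^-1 * eps))).
    rewrite sumr_const card_ord -[_ *+ N]mulr_natl.
    have -> : eps / (2 * C) = C^-1 * eps * 2^-1 by field; rewrite lt0r_neq0.
    have -> : sz%:R^-1 * (N%:R * (C^-1 * eps)) = C^-1 * eps * (N%:R / sz%:R).
      by rewrite mulrCA mulrA mulrC [_ / _]mulrC.
    rewrite ler_wpM2l ?mulr_ge0 ?invr_ge0 ?(ltW C0) ?(ltW eps0) //.
    by rewrite ler_pdivlMr ?ltr0n // ler_pdivrMl // -natrM ler_nat /sz /N; lia.
  rewrite ler_wpM2l ?invr_ge0 ?ler0n //; apply: ler_sum => i _.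
  rewrite /y /fam ltn_ord pairingZr; last exact: W_c00 (Wg _).
  rewrite ler_wpM2l ?invr_ge0 ?(ltW C0) // /y0 pairing_sumr; last exact: W_c00 (Wg _).
  rewrite (bigD1 i) //= big1 ?addr0 // => r ri; apply: gv.
  by rewrite eqn_add2l eq_sym; apply: contra ri => /eqP e1; apply/eqP/ord_inj.
have ris f w : type_Ialpha W f w -> (w < L)%N -> `|pairing f y| <= 2 * 2 ^- w.
  move=> fI wL; rewrite mulrC.
  have yJ i : y i != 0 -> (J < i)%N.
    rewrite /y vecZ mulf_eq0 negb_or => /andP[_]; rewrite /y0 vec_sum => h.
    have [r hr] : exists r : 'I_N, v (J + r)%N i != 0.
      apply: contrapT => no; move/eqP: h; apply; apply: big1 => r _.
      by apply/eqP; apply: contrapT => /negP hr; apply: no; exists r.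
    by apply: leq_trans (block_seq_ge bv hr); rewrite ltnS leq_addr.
  apply: le_trans (type_I_split (k := true) fI cy yJ y1 (T := 1) _) _; last first.
    by rewrite ler_wpM2l ?invr_ge0 ?exprn_ge0.
  move=> u ok uA iu.
  apply: (@le_trans _ _ (\sum_(b <- u) \sum_(i < N) `|pairing b.1 (v (J + i)%N)|)).
    rewrite big_seq [leRHS]big_seq; apply: ler_sum => b bu.
    have cb : c00 b.1 := items_c00 (@Wc00 _ _ _ _) ok bu.
    rewrite /y pairingZr // normrM gtr0_norm ?invr_gt0 //.
    apply: le_trans (_ : `|pairing b.1 y0| <= _).
      by rewrite ler_piMl // invf_le1 // /C lerDr.
    by rewrite /y0 pairing_sumr //; exact: ler_norm_sum.
  rewrite exchange_big /=; apply: (@le_trans _ _ (\sum_(i < N) N%:R^-1)); last first.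
    by rewrite sumr_const card_ord -[leLHS]mulr_natl divff // lt0r_neq0 // ltr0n.
  apply: ler_sum => i _; apply: (hK w _ u wL _ ok uA).
    by apply: leq_trans JK _; exact: leq_addr.
  exact: le_trans iu (hK' J JK').
have okit : items_ok true W [:: (alp, sz)].
  by split=> // b; rewrite inE => /eqP->; split.
exists H, y, [:: (alp, sz)]; split=> //.
- by rewrite /H; lia.
- split=> //; rewrite /y; apply: (Sp_Z SpP); exact: (Sp_sum SpP vS).
split.
- apply: (@Adm_up _ 0) => // b; rewrite inE => /eqP->; exact: leq_ltn_trans mina.
- split=> //; last by rewrite big_seq1.
  move=> b; rewrite inE => /eqP-> /=; rewrite mina maxa leqnn /sz /N /=.
  by rewrite (leq_trans _ (ltnW (ltn_expl H (ltnSn 1)))) ?ltnSn // /H; lia.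
- by exists (alp, sz) => //; rewrite mem_head.
Qed.

(** A vector and a functional of type I with weight [n] which norms it, the
    functional ending exactly at [H]. *)
Definition exact_pair (C : R) n L H (x f : nat -> R) : Prop :=
  [/\ Sp x /\ inside L H x, bnd x C,
     [/\ type_Ialpha W f n, pairing f x = 1, forall i, f i != 0 -> (L < i <= H)%N, f != 0
       & maxsupp f = H],
     forall kk m u, (4 * m + 12 <= n)%N -> items_ok kk W u -> Adm m u ->
       \sum_(a <- u) `|pairing a.1 x| <= C * (2 ^+ m * isum u) + C / L%:R
   & forall g w, type_Ialpha W g w -> wt w -> w != n ->
       `|pairing g x| <= C * (3 / 4) ^+ w + C * (2 ^+ n * 2 ^- L)].

(** The depth of the tree is [n - 1], the leaves being normed by a single average;
    dividing by the value of the norming functional makes the pairing equal to [1]. *)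
Lemma exact_exists v : nice v -> exists2 C, 1 <= C & forall n L, wt n -> (14 <= n)%N ->
  (8 * n + 40 <= L)%N -> exists H x f, exact_pair C n L H x f.
Proof.
move=> /leafE_exists[e e0 sup]; pose leaf := leafE e.
have leafP : leaf_basic s L1 sigma leaf by move=> L H y u [].
have leafN L H y u : leaf L H y u -> Adm 1 u /\ normed s L1 sigma true e L H y u.
  by move=> [_ _ _ _ []].
have leafS L H y u : leaf L H y u -> Sp y by case=> _ _ _ [].
have leafM L H y u : leaf L H y u -> exists2 a, a \in u & maxsupp a.1 = H.
  by move=> [_ _ _ _ []].
have ris L H y u : leaf L H y u -> forall f w, type_Ialpha W f w ->
    (w < L)%N -> `|pairing f y| <= 2 * 2 ^- w by case=> _ _ _ [].
have C20 : 0 <= 2 :> R by [].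
exists (1 + 16 / e * 100); first by rewrite lerDl mulr_ge0 ?divr_ge0 ?(ltW e0).
set C := 1 + _ => n L wn n14 nL; case: n wn n14 nL => // P wn n14 nL.
have [H [X [U tr]]] := tree_exists leafP sup P L.
have [LH Xi X1] := tree_basic leafP tr.
have [UA [ok U0 Ub Ue]] := tree_items leafP leafN tr.
have P0 : (0 < P)%N by lia.
have PL : (8 * P + 40 <= L)%N by lia.
have cX : c00 X := within_c00 Xi.
pose f := 2 ^- P.+1 *: \sum_(a <- U) a.1.
have UA' : Adm P.+1 U by move: UA; rewrite addn1.
have fI : type_Ialpha W f P.+1.
  exists f, setT; split; last by split; [exact: interval_setT|left; rewrite restr_setT].
  exact: (items_weighted (k := true) (@Wc00 _ _ _ _) ok (ltn0Sn P) U0 UA').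
have Wf : W f := type_I_W (k := true) fI.
pose c := pairing f X.
have ce : 2 ^- P.+1 * e <= c.
  by rewrite /c pairingZl // pairing_suml // ler_wpM2l // invr_ge0 exprn_ge0.
have c0 : 0 < c by apply: lt_le_trans ce; rewrite mulr_gt0 ?invr_gt0 ?exprn_gt0.
pose mu := c^-1 * 8 / 2 ^+ P; have mu0 : 0 < mu by rewrite divr_gt0 ?mulr_gt0 ?invr_gt0 ?exprn_gt0.
have muC : mu * 100 <= C.
  apply: ler_wpDl => //; rewrite ler_wpM2r //.
  apply: (@le_trans _ _ ((2 ^- P.+1 * e)^-1 * 8 / 2 ^+ P)); last first.
    rewrite le_eqVlt; apply/orP; left; apply/eqP; rewrite exprS; field.
    by rewrite expf_neq0 // lt0r_neq0.
  rewrite /mu ler_wpM2r ?invr_ge0 ?exprn_ge0 // ler_wpM2r // lef_pV2 ?posrE //.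
  by rewrite mulr_gt0 ?invr_gt0 ?exprn_gt0.
pose x := mu *: scaled P X.
have xE : x = c^-1 *: X.
  rewrite /x /scaled scalerA; congr (_ *: _); rewrite /mu; field.
  by rewrite expf_neq0 // lt0r_neq0.
have C0 : 0 < C by apply: lt_le_trans muC; rewrite mulr_gt0.
have cs : c00 (scaled P X) by exact: c00Z.
have gap w : wt w -> (2 * w <= P)%N \/ w = P.+1 \/ (2 ^ P <= w)%N.
  move=> ww; case: (ltngtP w P.+1) => wP; last by right; left.
    by left; move: (wt_gap hL ww wn wP) (ltn_expl (2 * w) (ltnSn 1)); clear; lia.
  right; right; apply: leq_trans (ltnW (wt_gap hL wn ww wP)); rewrite leq_exp2l //; clear; lia.
exists H, x, f; split.
- split; first by rewrite xE; apply: (Sp_Z SpP); exact: tree_span SpP leafS _ _ _ _ _ tr.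
  by move=> i; rewrite xE vecZ mulf_eq0 negb_or => /andP[_]; exact: Xi.
- move=> g Wg; apply: le_trans (bndZ cs (ltW mu0) (scaled_bnd hs leafP P0 PL tr) Wg) _.
  by apply: le_trans muC; rewrite ler_wpM2l ?(ltW mu0) // ler1n.
- have supf i : f i != 0 -> (L < i <= H)%N.
    rewrite /f vecZ mulf_eq0 negb_or => /andP[_]; rewrite vec_sum => h.
    apply: contrapT => no; move/eqP: h; apply; rewrite big_seq big1 // => a aU.
    apply/eqP; apply: contrapT => /negP ai; apply: no.
    have /and4P[h1 h2 _ _] := Ub a aU; have m1 := minsupp_le ai.
    have m2 := maxsupp_ge (items_c00 (@Wc00 _ _ _ _) ok aU) ai.
    by rewrite (leq_trans h1 m1) (leq_trans m2 h2).
  have [a aU aH] := tree_last leafM tr.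
  have ca := items_c00 (@Wc00 _ _ _ _) ok aU; have a0 : a.1 != 0 by have [] := ok.1 a aU.
  have fH : f H != 0.
    rewrite /f vecZ mulf_neq0 ?invr_neq0 ?expf_neq0 // vec_sum (big_rem a) //= big_seq big1.
      by rewrite addr0 -aH; exact: maxsuppP.
    move=> b; have uq : uniq U.
      apply: (@pairwise_uniq _ (@irel R)) ok.2 => b'; apply/negbTE/negP => /and3P[_ _]; by rewrite ltnn.
    rewrite mem_rem_uniq // inE => /andP[ba bU]; apply/eqP; apply: contrapT => /negP bH.
    have cb := items_c00 (@Wc00 _ _ _ _) ok bU; have b0 : b.1 != 0 by have [] := ok.1 b bU.
    have mb : maxsupp b.1 = H.
      apply: maxsupp_eq => // i /(maxsupp_ge cb) h; have /and4P[_ h2 _ _] := Ub b bU.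
      exact: leq_trans h h2.
    have : irel a b \/ irel b a.
      have := ok.2; move: aU bU ba; clear; elim: U => // d U IH.
      rewrite !inE /= => /orP[/eqP->|aU] /orP[/eqP->|bU]; rewrite ?eqxx // => ba /andP[/allP hd pw].
      - by left; apply: hd.
      - by right; apply: hd.
      - exact: IH.
    case=> /and3P[h1 _ _].
      by have := leq_trans h1 (minsupp_maxsupp cb b0); rewrite aH mb ltnn.
    by have := leq_trans h1 (minsupp_maxsupp ca a0); rewrite aH mb ltnn.
  split=> //.
  + by rewrite xE pairingZr ?mulVf ?lt0r_neq0 //; exact: W_c00 Wf.
  + by apply: contraNneq fH => ->.
  + by apply: maxsupp_eq (W_c00 Wf) fH _ => i /supf /andP[].
- move=> kk m u mn oku uA.
  have hh : \sum_(a <- u) `|pairing a.1 (scaled P X)| <= 96 * 2 ^+ m * isum u + L%:R^-1.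
    have mP : (m + 2 <= P)%N by clear -mn; lia.
    have [m4 P12] : (4 * m <= P)%N /\ (12 <= P)%N by clear -mn n14; split; lia.
    case: kk oku => oku.
      apply: le_trans (scaled_sum PL oku _ mP (tree_alpha_sum hs leafP mP PL tr oku uA)) _ => //.
      rewrite lerD2r ler_wpM2r ?isum_ge0 // ler_wpM2r ?exprn_ge0 // ler_nat //.
    have h : 0 <= 16 * 2 + 64 :> R by rewrite addr_ge0 // mulr_ge0.
    have t := tree_beta_sum hs hL hsigma leafP C20 ris m4 P12 PL gap tr oku uA.
    apply: le_trans (scaled_sum PL oku h mP t) _.
    by rewrite lerD2r ler_wpM2r ?isum_ge0 // ler_wpM2r ?exprn_ge0 // -natrM -natrD ler_nat.
  have -> : \sum_(a <- u) `|pairing a.1 x| = mu * \sum_(a <- u) `|pairing a.1 (scaled P X)|.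
    rewrite mulr_sumr big_seq [RHS]big_seq; apply: eq_bigr => a au.
    by rewrite /x pairingZr ?(normrM, gtr0_norm mu0) //; exact: items_c00 (@Wc00 _ _ _ _) oku au.
  apply: le_trans (ler_wpM2l (ltW mu0) hh) _; rewrite mulrDr; apply: lerD.
    rewrite -[96 * _ * _]mulrA [leLHS]mulrA ler_wpM2r ?mulr_ge0 ?isum_ge0 ?exprn_ge0 //.
    by apply: le_trans muC; rewrite ler_wpM2l ?(ltW mu0) // ler_nat.
  rewrite ler_wpM2r ?invr_ge0 ?ler0n //; apply: le_trans muC.
  by rewrite ler_peMr ?(ltW mu0) // ler1n.
- move=> g w gI ww nw; have w9 := wt_gt9 hL ww.
  have wc : (w + 2 <= P)%N \/ w = P.+1 \/ (2 ^ P <= w)%N.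
    by case: (gap w ww) => [h|[h|h]]; [left; clear -h w9; lia|right; left|right; right].
  have t := scaled_flat hs leafP C20 ris P0 PL tr gI _ nw wc.
  have cg := W_c00 (type_I_W (k := true) gI).
  rewrite /x pairingZr // normrM gtr0_norm //.
  apply: le_trans (ler_wpM2l (ltW mu0) (t _)) _; first exact: leq_trans w9.
  rewrite mulrDr mulrA; apply: lerD.
    rewrite ler_wpM2r ?exprn_ge0 ?divr_ge0 //; apply: le_trans muC.
    by rewrite ler_wpM2l ?(ltW mu0) // -natrM -natrD ler_nat.
  apply: ler_pM; rewrite ?mulr_ge0 ?exprn_ge0 ?invr_ge0 ?(ltW mu0) //.
  exact: ltW c0.
    by apply: le_trans muC; rewrite ler_peMr ?(ltW mu0) // ler1n.
  by rewrite ler_wpM2r ?invr_ge0 ?exprn_ge0 // ler_eXn2l ?ltr1n.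
Qed.

End Exact.

(** * A subsequence of the Pelczynski basis equivalent to the basis of c_0 *)

Section Bumps.
Variables (R : realType) (s : nat -> R -> R) (hs : dense_in_sphere s).

(** The maximum [1] is attained where [t^(2^n) = 1/2]; the differences telescope. *)
Definition bump n (t : R) : R := 4 * (t ^+ (2 ^ n) - t ^+ (2 ^ n.+1)).

Lemma bumpE n t : bump n t = 4 * (t ^+ (2 ^ n) * (1 - t ^+ (2 ^ n))).
Proof. by rewrite /bump expnS mulnC exprM expr2; ring. Qed.

Lemma bump_bounds n t : `[0, 1]%classic t -> 0 <= bump n t <= 1.
Proof.
rewrite /= in_itv /= => /andP[t0 t1]; rewrite bumpE.
have u0 : 0 <= t ^+ (2 ^ n) by rewrite exprn_ge0.
have u1 : t ^+ (2 ^ n) <= 1 by rewrite exprn_ile1.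
move: u0 u1; set u := t ^+ _ => u0 u1; rewrite !mulr_ge0 ?subr_ge0 //=.
by have := sqr_ge0 (2 * u - 1); rewrite expr2; nra.
Qed.

Lemma bump_sum (n : nat) t : `[0, 1]%classic t -> \sum_(i < n) bump i t <= 4.
Proof.
move=> t01; have := t01; rewrite /= in_itv /= => /andP[t0 t1].
have -> : \sum_(i < n) bump i t = 4 * (t - t ^+ (2 ^ n)).
  elim: n => [|n IH]; first by rewrite big_ord0 expn0 expr1 subrr mulr0.
  by rewrite big_ord_recr /= IH /bump; ring.
have : 0 <= t ^+ (2 ^ n) by rewrite exprn_ge0.
by lra.
Qed.

Lemma bump_sum_seq (B : seq nat) t : `[0, 1]%classic t -> uniq B -> \sum_(i <- B) bump i t <= 4.
Proof.
move=> t01 uB; pose M := (\max_(w <- B) w).+1.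
have BM w : w \in B -> (w < M)%N by move=> wB; rewrite ltnS; apply: leq_bigmax_seq.
apply: le_trans (bump_sum M t01).
have -> : \sum_(i <- B) bump i t = \sum_(i < M | (i : nat) \in B) bump i t.
  rewrite -(big_mkord (fun i => i \in B) (fun i => bump i t)) -big_filter; apply: perm_big.
  apply: uniq_perm => //; first by rewrite filter_uniq // iota_uniq.
  move=> w; rewrite mem_filter mem_index_iota; case wB: (w \in B) => //=.
  by rewrite BM.
rewrite [leRHS](bigID (fun i : 'I_M => (i : nat) \in B)) /= lerDl.
by apply: sumr_ge0 => i _; have /andP[] := bump_bounds i t01.
Qed.

Definition peak n : R := iter n Num.sqrt 2^-1.

Lemma peak_ge0 n : 0 <= peak n.
Proof. by case: n => [|n]; rewrite /peak /= ?invr_ge0 // sqrtr_ge0. Qed.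

Lemma peak_exp n : peak n ^+ (2 ^ n) = 2^-1.
Proof.
elim: n => [|n IH]; first by rewrite expn0 expr1.
by rewrite expnS exprM -IH /peak /= sqr_sqrtr // -/(peak n) peak_ge0.
Qed.

Lemma peak_le1 n : peak n <= 1.
Proof.
rewrite leNgt; apply/negP => h; have := exprn_ege1 (2 ^ n) (ltW h); rewrite peak_exp; lra.
Qed.

Lemma peak_in n : `[0, 1]%classic (peak n).
Proof. by rewrite /= in_itv /= peak_ge0 peak_le1. Qed.

Lemma bump_peak n : bump n (peak n) = 1.
Proof. by rewrite bumpE peak_exp; field. Qed.

(** Away from its own peak a bump is well below [1] at the other peaks, so the
    bumps are uniformly separated. *)
Lemma bump_off n m : n != m -> bump m (peak n) <= 7 / 8.
Proof.
move=> nm; rewrite bumpE; have p0 := peak_ge0 n; have p1 := peak_le1 n.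
have u0 : 0 <= peak n ^+ (2 ^ m) by rewrite exprn_ge0.
have u1 : peak n ^+ (2 ^ m) <= 1 by rewrite exprn_ile1.
case: (ltngtP n m) nm => // lt _.
  have : peak n ^+ (2 ^ m) <= 1 / 4.
    have -> : 1 / 4 = 2^-1 ^+ 2 :> R by rewrite expr2; field.
    rewrite -(subnKC (ltnW lt)) expnD exprM peak_exp; apply: ler_wiXn2l; [lra|lra|].
    by rewrite -{1}(expn1 2) leq_exp2l // subn_gt0.
  move: u0 u1; set u := _ ^+ _ => u0 u1 u4.
  have : 0 <= (1 / 4 - u) * (3 / 4 - u) by rewrite mulr_ge0 // subr_ge0 //; lra.
  by rewrite mulrBl !mulrBr; nra.
have : 1 / 2 <= (peak n ^+ (2 ^ m)) ^+ 2.
  have -> : 1 / 2 = (peak n ^+ (2 ^ m)) ^+ (2 ^ (n - m)) :> R.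
    by rewrite -exprM -expnD subnKC ?(ltnW lt) // peak_exp mul1r.
  by apply: ler_wiXn2l => //; rewrite -{1}(expn1 2) leq_exp2l // subn_gt0.
move: u0 u1; set u := _ ^+ _ => u0 u1 h.
have u7 : 7 / 10 <= u.
  by rewrite leNgt; apply/negP => u7; move: h; rewrite expr2; nra.
have : 0 <= (u - 7 / 10) * (u + 7 / 10 - 1) by rewrite mulr_ge0 //; lra.
by rewrite mulrDr mulrBr mulrDr; nra.
Qed.

Lemma bump_continuous n : continuous (bump n).
Proof.
move=> t; apply: cvgM; first exact: cvg_cst.
by apply: cvgB; apply: exprn_continuous.
Qed.

Lemma bump_norm n : sup_norm `[0, 1] (bump n) = 1.
Proof.
have b1 t : `[0, 1]%classic t -> `|bump n t| <= 1.
  by move=> /(bump_bounds n)/andP[h1 h2]; rewrite ger0_norm.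
apply/eqP; rewrite eq_le (sup_norm_le (peak_in n) b1) /=.
by apply: le_trans (sup_norm_ub (peak_in n) b1); rewrite bump_peak normr1.
Qed.

Lemma bump_approx n : exists k, forall t, `[0, 1]%classic t ->
  `|bump n t - s k t| <= 2 ^- (n + 5).
Proof.
have e0 : 0 < 2 ^- (n + 5) :> R by rewrite invr_gt0 exprn_gt0.
have [k hk] := hs.2 (bump n) (continuous_subspaceT (@bump_continuous n)) (bump_norm n) _ e0.
exists k => t t01; apply: le_trans (ltW hk).
apply: (@sup_norm_ub _ _ (bump n \- s k) 2 t t01) => u u01.
apply: le_trans (ler_normB _ _) _; have := sphere_le1 hs k u01.
by have /andP[h1 h2] := bump_bounds n u01; rewrite (ger0_norm h1); lra.
Qed.

Lemma inj_unbounded (k : nat -> nat) : injective k -> forall K M, exists n, (M <= n)%N && (K <= k n)%N.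
Proof.
move=> ik K M; apply: contrapT => no.
have small n : (M <= n)%N -> (k n < K)%N.
  by move=> Mn; rewrite ltnNge; apply/negP => h; apply: no; exists n; rewrite Mn.
have u : uniq [seq k n | n <- iota M K.+1] by rewrite map_inj_uniq ?iota_uniq.
have sub : {subset [seq k n | n <- iota M K.+1] <= iota 0 K}.
  by move=> i /mapP[n]; rewrite mem_iota => /andP[Mn _] ->; rewrite mem_iota add0n small.
by have := uniq_leq_size u sub; rewrite size_map !size_iota ltnn.
Qed.

(** The Pelczynski basis has a subsequence equivalent to the unit vector basis
    of [c_0]. *)
Lemma c0_subsequence : exists kap : nat -> nat,
  (forall n m, (n < m)%N -> (kap n < kap m)%N) /\
  forall (e : nat -> R) (B : seq nat) t, `[0, 1]%classic t -> uniq B ->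
     (forall n, `|e n| <= 1) -> `|\sum_(n <- B) e n * s (kap n) t| <= 5.
Proof.
have [k hk] := choice bump_approx.
(* the approximations are closer than the separation of the bumps *)
have e32 n : 2 ^- (n + 5) <= 1 / 32 :> R.
  by rewrite mul1r lef_pV2 ?posrE ?exprn_gt0 // -natrX ler_nat -[32%N]/(2 ^ 5)%N leq_exp2l // leq_addl.
have ik : injective k.
  move=> n m e; apply/eqP; apply: contraT => nm.
  have h1 := hk n _ (peak_in n); have h2 := hk m _ (peak_in n); rewrite -e in h2.
  have h3 := bump_off nm; rewrite bump_peak in h1.
  have := e32 n; have := e32 m; move: h1 h2; rewrite !ler_norml => /andP[_ h1] /andP[h2 _].
  by lra.
have ex (t : nat * nat) : exists n, (t.1 <= n)%N && (t.2 <= k n)%N by exact: inj_unbounded.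
have [P hP] := choice ex.
pose p := fix p i : nat := if i is i'.+1 then P ((p i').+1, (k (p i')).+1) else 0%N.
have pS i : (p i < p i.+1)%N /\ (k (p i) < k (p i.+1))%N.
  by have /andP[] := hP ((p i).+1, (k (p i)).+1).
have mono (g : nat -> nat) : (forall i, (g i < g i.+1)%N) -> forall n m, (n < m)%N -> (g n < g m)%N.
  by move=> gS n m; exact: (homo_ltn (@ltn_trans) gS).
exists (k \o p); split; first by apply: (mono (k \o p)) => i; have [] := pS i.
have pm := mono p (fun i => (pS i).1).
have pn n : (n <= p n)%N by elim: n => // n IH; apply: leq_ltn_trans IH (pS n).1.
move=> e B t t01 uB e1.
apply: (@le_trans _ _ (\sum_(n <- B) (bump (p n) t + (1 / 32) * 2 ^- n))).
  apply: le_trans (ler_norm_sum _ _ _) _; apply: ler_sum => n _.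
  rewrite normrM; apply: le_trans (_ : `|s (k (p n)) t| <= _); first by rewrite ler_piMl.
  have h := hk (p n) t t01; have /andP[b0 b1] := bump_bounds (p n) t01.
  have e2 : 2 ^- (p n + 5) <= 1 / 32 * 2 ^- n :> R.
    have -> : 1 / 32 * 2 ^- n = 2 ^- (n + 5) :> R.
      by rewrite exprD invfM mulrC mul1r; congr (_ * _^-1); rewrite -natrX.
    by rewrite lef_pV2 ?posrE ?exprn_gt0 // ler_eXn2l ?ltr1n // leq_add2r.
  rewrite -[s _ t](subKr (bump (p n) t)); apply: le_trans (ler_normB _ _) _.
  by rewrite (ger0_norm b0) lerD2l; apply: le_trans e2.
rewrite big_split /= -[X in _ + X]mulr_sumr.
have h1 : \sum_(n <- B) bump (p n) t <= 4.
  rewrite -(big_map p xpredT (fun n => bump n t)); apply: bump_sum_seq => //.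
  rewrite map_inj_uniq // => n m e2; case: (ltngtP n m) => // /pm; rewrite e2 ltnn //.
have h2 : \sum_(n <- B) 2 ^- n <= 2 :> R.
  have -> : \sum_(n <- B) 2 ^- n = \sum_(n <- B) 2^-1 ^+ n :> R.
    by apply: eq_bigr => n _; rewrite exprVn.
  have r0 : 0 <= 2^-1 :> R by lra.
  have r1 : 2^-1 < 1 :> R by lra.
  have := @uniq_sum_geo R B 2^-1 0 uB r0 r1; rewrite expr0 => /(_ (fun _ _ => isT)).
  by have -> : 1 / (1 - 2^-1) = 2 :> R by field.
lra.
Qed.

End Bumps.

(** * The special sequence *)

Section SpecialSequence.
Variables (R : realType) (s : nat -> R -> R) (hs : dense_in_sphere s).
Variables (l : nat -> nat) (L1 L2 L3 : set nat) (hL : coding_weights R l L1 L2 L3).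
Variables (sigma : seq (nat -> R) -> nat) (hsigma : coding_function L2 sigma).
Local Notation W := (norming_set s L1 sigma).
Local Notation wt := (wt l).
Variables (Sp : (nat -> R) -> Prop) (C : R) (M0 : nat).
Local Notation exact_pair := (exact_pair s l L1 sigma Sp C).
Hypothesis supply : forall n L, wt n -> (14 <= n)%N ->
  (8 * n + 40 <= L)%N -> exists H x f, exact_pair n L H x f.

(** For the last functional [g], the coding exceeds the support of [g] by the factor
    [2^(1/|g|)], which is at least [4]. *)
Lemma coding_gt (u : seq (nat -> R)) : rational_blocks u ->
  (forall i, `|last (0%R : nat -> R) u i| <= 2^-1) ->
  (4 * maxsupp (last (0%R : nat -> R) u) < sigma u)%N.
Proof.
move=> ru g2; have [_ _ h] := hsigma; have := h u ru.
have [u0 ur _] := ru; set g := last (0%R : nat -> R) u in g2 *.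
have [cg g0] : c00 g /\ g != 0.
  rewrite /g -nth_last; have [|h1 h2 _] := ur (size u).-1; first by rewrite prednK.
  by split=> //; exact: supp_nonempty h2.
have [i gi] := supp_neq0 g0.
have ub : has_ubound [set `|g t| | t in [set: nat]] by exists 2^-1 => _ [t _ <-].
have N0 : 0 < sup_norm setT g.
  by apply: (@lt_le_trans _ _ `|g i|); [rewrite normr_gt0|apply: (ub_le_sup ub); exists i].
have N2 : sup_norm setT g <= 2^-1.
  by apply: ge_sup => [|_ [t _ <-] //]; exists `|g i|; exists i.
have e4 : 4 <= 2 `^ (sup_norm setT g)^-1.
  have -> : 4 = 2 `^ 2%:R :> R by rewrite powR_mulrn // -natrX.
  by apply: ler_powR; [rewrite ler1n|rewrite -[leLHS]invrK lef_pV2 ?posrE ?invr_gt0].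
move=> lt; rewrite -(ltr_nat R) natrM; apply: le_lt_trans lt.
by rewrite ler_wpM2r.
Qed.

Lemma L1_large N0 : exists2 n, L1 n & (N0 <= n)%N.
Proof.
have [_ _ _ _ [i1 _ _]] := hL; apply: contrapT => no; apply: i1.
apply: (sub_finite_set (B := `I_N0)); last exact: finite_II.
by move=> n L1n /=; rewrite ltnNge; apply/negP => h; apply: no; exists n.
Qed.

(** The distance to be left before the next vector of the special sequence. *)
Definition gap q n := (8 * n + 40 + M0 + 2 ^ q + 8 * q)%N.

(** The weight of each pair is the code of the previous pairs.  The norming functionals
    end beyond eight times the supports of the vectors, so the next weight is large
    compared with everything chosen before. *)
Theorem special_exists N0 : (14 <= N0)%N ->
  exists (n Lx Hx Ly Hy : nat -> nat) (x y f g : nat -> nat -> R),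
  [/\ forall q, exact_pair (n q) (Lx q) (Hx q) (x q) (f q) /\
                exact_pair (n q) (Ly q) (Hy q) (y q) (g q),
      forall q, [/\ (gap q (n q) <= Lx q)%N, (Lx q < Hx q <= Ly q)%N,
                    (Ly q < Hy q)%N & (Hy q <= Lx q.+1)%N],
      forall q, [/\ wt (n q), (N0 <= n q)%N & (4 * Hy q < n q.+1)%N]
    & forall d, special L1 sigma W d.+1 f g n].
Proof.
move=> N14; have [n0 L1n0 Nn0] := L1_large N0.
have ex (t : nat * nat) : exists v : nat * (nat -> R) * (nat -> R),
    wt t.1 -> (14 <= t.1)%N -> (8 * t.1 + 40 <= t.2)%N -> exact_pair t.1 t.2 v.1.1 v.1.2 v.2.
  have [[h1 [h2 h3]]|no] := pselect (wt t.1 /\ (14 <= t.1)%N /\ (8 * t.1 + 40 <= t.2)%N).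
    by have [H [x [f h]]] := supply h1 h2 h3; exists (H, x, f).
  by exists (0%N, 0, 0) => h1 h2 h3; case: no.
have [pick hpick] := choice ex.
pose lx q (t : seq (nat -> R) * nat * nat) := (t.2 + gap q t.1.2)%N.
pose px q t := pick (t.1.2, lx q t).
pose ly q t := ((px q t).1.1 + lx q t)%N.
pose py q t := pick (t.1.2, ly q t).
pose nxt q t : seq (nat -> R) * nat * nat :=
  let h := t.1.1 ++ [:: (px q t).2; (py q t).2] in (h, sigma h, (py q t).1.1).
pose st := fix st q := if q is q'.+1 then nxt q' (st q') else ([::], n0, 0%N).
pose n q := (st q).1.2.
pose Lx q := lx q (st q); pose Hx q := (px q (st q)).1.1.
pose x q := (px q (st q)).1.2; pose f q := (px q (st q)).2.
pose Ly q := ly q (st q); pose Hy q := (py q (st q)).1.1.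
pose y q := (py q (st q)).1.2; pose g q := (py q (st q)).2.
have hist q : (st q).1.1 = pairs f g q.
  by elim: q => // q IH; rewrite pairsS -IH.
have nS q : n q.+1 = sigma (pairs f g q.+1).
  by rewrite /n pairsS -hist.
have exq q : wt (n q) -> (14 <= n q)%N ->
    exact_pair (n q) (Lx q) (Hx q) (x q) (f q) /\ exact_pair (n q) (Ly q) (Hy q) (y q) (g q).
  move=> h1 h2; split; apply: (hpick (_, _)) => //=; rewrite -/(n q) /Lx /Ly /ly /lx /gap -/(n q); lia.
have lts q : exact_pair (n q) (Lx q) (Hx q) (x q) (f q) -> (Lx q < Hx q)%N.
  by move=> [_ _ [_ _ h f0 _] _ _]; have /h := minsuppP f0; lia.
have lts' q : exact_pair (n q) (Ly q) (Hy q) (y q) (g q) -> (Ly q < Hy q)%N.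
  by move=> [_ _ [_ _ h f0 _] _ _]; have /h := minsuppP f0; lia.
have LxS q : (Hy q <= Lx q.+1)%N by rewrite /Lx /lx /= leq_addr.
have HxLy q : (Hx q <= Ly q)%N by rewrite /Ly /ly leq_addr.
have spec d : (forall q, (q <= d)%N -> wt (n q) /\ (14 <= n q)%N) -> special L1 sigma W d.+1 f g n.
  move=> hd; have E q : (q <= d)%N -> _ := fun h => exq q (hd q h).1 (hd q h).2.
  have ms L H (h : nat -> R) : h != 0 -> (forall i, h i != 0 -> (L < i <= H)%N) -> (L < minsupp h)%N.
    by move=> h0 hh; have /hh/andP[] := minsuppP h0.
  split.
  - move=> q qd; have [[_ _ [fI _ _ _ _] _ _] [_ _ [gI _ _ _ _] _ _]] := E q qd.
    by split=> //; [exact: (type_I_W (k := true) fI)|exact: (type_I_W (k := true) gI)].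
  - move=> q qd; have [[_ _ [_ _ fs f0 fH] _ _] [_ _ [_ _ gs g0 _] _ _]] := E q qd.
    apply/succvP; split=> //; rewrite fH; apply: leq_ltn_trans (HxLy q) _; exact: ms g0 gs.
  - move=> q qd; have [_ [_ _ [_ _ gs g0 gH] _ _]] := E q (ltnW qd).
    have [[_ _ [_ _ fs f0 _] _ _] _] := E q.+1 qd.
    apply/succvP; split=> //; rewrite gH; apply: leq_ltn_trans (LxS q) _; exact: ms f0 fs.
  - by [].
  - by case=> // q _; rewrite nS.
have wn q : [/\ wt (n q), (N0 <= n q)%N & (0 < q)%N -> (4 * Hy q.-1 < n q)%N].
  elim/ltn_ind: q => -[|q] IH.
    by split=> //; exact: L1_wt hL _ L1n0.
  have sp : special L1 sigma W q.+1 f g n.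
    by apply: spec => i iq; have [h1 h2 _] := IH i iq; split=> //; exact: leq_trans h2.
  have ra : rational_blocks (pairs f g q.+1) by apply: (special_rational sp); rewrite /= leqnn.
  have [h1 h2 _] := IH q (ltnSn q).
  have [_ [_ _ [gI _ _ g0 gH] _ _]] := exq q h1 (leq_trans N14 h2).
  have la : last (0%R : nat -> R) (pairs f g q.+1) = g q by rewrite pairsS last_cat.
  have big : (4 * Hy q < n q.+1)%N.
    rewrite nS -gH -la; apply: coding_gt => // i; rewrite la.
    apply: le_trans (type_I_coord (k := true) hs gI i) _.
    have n0' : (0 < n q)%N by lia.
    by rewrite lef_pV2 ?posrE ?exprn_gt0 // -[leLHS]expr1 ler_eXn2l ?ltr1n.
  split=> //; first by rewrite nS; apply: (L2_wt hL); have [hh _ _] := hsigma; exact: hh.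
  have h14 := leq_trans N14 h2; apply: leq_trans h2 _; apply: leq_trans (ltnW big).
  have := lts' q (exq q h1 h14).2; rewrite /Ly /ly /lx /gap -/(n q); lia.
have w14 q : wt (n q) /\ (14 <= n q)%N.
  by have [h1 h2 _] := wn q; split=> //; exact: leq_trans h2.
have EX q := exq q (w14 q).1 (w14 q).2.
exists n, Lx, Hx, Ly, Hy, x, y, f, g; split.
- exact: EX.
- move=> q; have [e1 e2] := EX q; rewrite HxLy (lts q e1) (lts' q e2) LxS; split=> //.
  by rewrite /Lx /lx leq_addl.
- move=> q; have [h1 h2 _] := wn q; have [_ _ h3] := wn q.+1; split=> //; exact: h3.
- by move=> d; apply: spec => q _.
Qed.

End SpecialSequence.

(** * Combinations of the differences x - y *)

Section Differences.
Variables (R : realType) (s : nat -> R -> R) (hs : dense_in_sphere s).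
Variables (l : nat -> nat) (L1 L2 L3 : set nat) (hL : coding_weights R l L1 L2 L3).
Variables (sigma : seq (nat -> R) -> nat) (hsigma : coding_function L2 sigma).
Local Notation W := (norming_set s L1 sigma).
Local Notation kavg := (kavg s L1 sigma).
Local Notation items_ok := (items_ok s L1 sigma).
Local Notation bnd := (bnd s L1 sigma).
Local Notation wt := (wt l).
Local Notation item := (item R).
Variables (Sp : (nat -> R) -> Prop) (C : R) (M0 : nat).
Local Notation exact_pair := (exact_pair s l L1 sigma Sp C).
Hypothesis C1le : 1 <= C.
Hypothesis CM0 : 2 * C <= 2 ^+ M0.
Variables (n Lx Hx Ly Hy : nat -> nat) (x y f g : nat -> nat -> R).
Hypothesis xf : forall q, exact_pair (n q) (Lx q) (Hx q) (x q) (f q) /\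
                          exact_pair (n q) (Ly q) (Hy q) (y q) (g q).
Hypothesis LH : forall q, [/\ (gap M0 q (n q) <= Lx q)%N, (Lx q < Hx q <= Ly q)%N,
                    (Ly q < Hy q)%N & (Hy q <= Lx q.+1)%N].
Hypothesis wn : forall q, [/\ wt (n q), (14 <= n q)%N & (4 * Hy q < n q.+1)%N].
Hypothesis sp : forall d, special L1 sigma W d.+1 f g n.

Definition z q : nat -> R := x q - y q.
(** The beginning of the window of the [q]-th difference, a fixed fraction of its weight
    [n q]; the weight itself lies in the window. *)
Definition win q := ((n q - 16) %/ 4)%N.

Let C0 : 0 < C. Proof. exact: lt_le_trans C1le. Qed.

Lemma x_c00 q : c00 (x q).
Proof. by have [[[_ h] _ _ _ _] _] := xf q; exact: within_c00 h. Qed.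

Lemma y_c00 q : c00 (y q).
Proof. by have [_ [[_ h] _ _ _ _]] := xf q; exact: within_c00 h. Qed.

Lemma z_c00 q : c00 (z q).
Proof. by apply: c00B; [exact: x_c00|exact: y_c00]. Qed.

Lemma z_inside q i : z q i != 0 -> (Lx q < i)%N && (8 * i <= Hy q)%N.
Proof.
have [[[_ hx] _ _ _ _] [[_ hy] _ _ _ _]] := xf q; have [_ /andP[h1 h2] h3 _] := LH q.
rewrite /z vecD vecN => zi; have [xi|xi] := eqVneq (x q i) 0.
  have /hy : y q i != 0 by move: zi; rewrite xi add0r oppr_eq0.
  lia.
by have := hx i xi; lia.
Qed.

Lemma win_S q : (Hy q <= win q.+1 + 4)%N.
Proof. by have [_ _ h] := wn q; rewrite /win; lia. Qed.

Lemma win_facts q : [/\ (4 * win q + 12 <= n q)%N, (win q < Lx q)%N & (n q < win q.+1)%N].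
Proof.
have [_ n14 _] := wn q; have [h1 /andP[h2 h3] h4 _] := LH q; have := win_S q.
by rewrite /gap in h1; rewrite /win in h1 *; split; lia.
Qed.

Lemma win_pow q : (2 ^ q <= win q.+1)%N.
Proof.
have [h1 /andP[h2 h3] h4 _] := LH q; have := win_S q; rewrite /gap in h1; lia.
Qed.

Lemma win_lt r : (win r < win r.+1)%N.
Proof. by have [h1 h2 h3] := win_facts r; lia. Qed.

Lemma z_win r i : z r i != 0 -> (win r < i)%N && (2 * (i + r) <= win r.+1)%N.
Proof.
move=> /z_inside /andP[h1 h2]; have [_ h3 _] := win_facts r; have := win_S r.
have [h4 /andP[h5 h6] h7 _] := LH r; rewrite /gap in h4; move=> ?; apply/andP; split; lia.
Qed.

Lemma x_bnd q : bnd (x q) C. Proof. by have [[]] := xf q. Qed.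
Lemma y_bnd q : bnd (y q) C. Proof. by have [_ []] := xf q. Qed.

Lemma z_bnd2 q : bnd (z q) (2 * C).
Proof.
move=> h Wh; rewrite /z pairingBr; last exact: W_c00 Wh.
apply: le_trans (ler_normB _ _) _; rewrite mulr_natl mulr2n.
by apply: lerD; [exact: x_bnd|exact: y_bnd].
Qed.

Lemma z_bnd q : bnd (z q) (6 * C).
Proof. move=> h Wh; apply: le_trans (z_bnd2 q Wh) _; have := C0; lra. Qed.

Lemma z_sum q kk m (u : seq item) : (4 * m + 12 <= n q)%N -> items_ok kk W u -> Adm m u ->
  \sum_(a <- u) `|pairing a.1 (z q)| <= 2 * (C * (2 ^+ m * isum u) + C / (Lx q)%:R).
Proof.
move=> mn ok uA; have [[_ _ _ hx _] [_ _ _ hy _]] := xf q; have [h1 /andP[h2 h3] _ _] := LH q.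
have c0 := C0.
have hx' := hx kk m u mn ok uA; have hy' := hy kk m u mn ok uA.
have LL : C / (Ly q)%:R <= C / (Lx q)%:R.
  rewrite ler_wpM2l ?(ltW c0) // lef_pV2 ?posrE ?ltr0n ?ler_nat //; rewrite /gap in h1; lia.
apply: (@le_trans _ _ (\sum_(a <- u) (`|pairing a.1 (x q)| + `|pairing a.1 (y q)|))).
  rewrite big_seq [leRHS]big_seq; apply: ler_sum => a au.
  by rewrite /z pairingBr ?ler_normB //; exact: items_c00 (@Wc00 _ _ _ _) ok au.
rewrite big_split /=; apply: le_trans (lerD hx' hy') _; rewrite [leRHS]mulr_natl mulr2n.
by rewrite lerD2l lerD2l.
Qed.

Lemma z_ris r k h m : type_I (kavg k W) h m -> (m < win r)%N ->
  `|pairing h (z r)| <= 6 * C * 2 ^- m.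
Proof.
move=> hI mr; have [h1 h2 _] := win_facts r; have c0 := C0.
have zl i : z r i != 0 -> (win r < i)%N by move=> /z_win /andP[].
rewrite mulrC; apply: le_trans (type_I_split hI (z_c00 r) zl (z_bnd2 r) (T := 4 * C) _) _; last first.
  by rewrite ler_wpM2l ?invr_ge0 ?exprn_ge0 //; lra.
move=> u ok uA iu; have mn : (4 * m + 12 <= n r)%N by lia.
apply: le_trans (z_sum mn ok uA) _.
have e1 : 2 ^+ m * isum u <= 1.
  apply: le_trans (ler_wpM2l _ iu) _; first by rewrite exprn_ge0.
  by rewrite ler_pdivrMr ?exprn_gt0 // mul1r ler_eXn2l ?ltr1n // ltnW.
have e2 : C / (Lx r)%:R <= C.
  by rewrite ler_piMr ?(ltW c0) // invf_le1 ?ler1n ?ltr0n; lia.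
have := ler_wpM2l (ltW c0) e1; lra.
Qed.

(** The error term in the estimate [z_flat]. *)
Definition dlt q : R := 2 * C * (2 ^+ n q * 2 ^- Lx q).

Lemma dlt_ge0 q : 0 <= dlt q.
Proof. by rewrite /dlt !mulr_ge0 ?invr_ge0 ?exprn_ge0 ?(ltW C0). Qed.

Lemma dlt_win q : (win q)%:R * dlt q <= 2 ^- q.
Proof.
have [h1 _ _] := win_facts q; have [h2 _ _ _] := LH q; have c0 := C0.
have wq : (win q)%:R <= 2 ^+ n q :> R.
  by rewrite -natrX ler_nat; apply: leq_trans (ltnW (ltn_expl (n q) (ltnSn 1))); lia.
apply: (@le_trans _ _ (2 ^+ n q * (2 ^+ M0 * (2 ^+ n q * 2 ^- Lx q)))).
  apply: ler_pM => //; first by exact: dlt_ge0.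
  by rewrite /dlt ler_wpM2r // mulr_ge0 ?invr_ge0 ?exprn_ge0.
rewrite !mulrA ler_pdivrMr ?exprn_gt0 // ler_pdivlMl ?exprn_gt0 // -!exprD.
by rewrite ler_eXn2l ?ltr1n //; rewrite /gap in h2; have := ltn_expl q (ltnSn 1); lia.
Qed.

Lemma z_flat r h w : type_Ialpha W h w -> wt w -> (win r <= w < win r.+1)%N -> w != n r ->
  `|pairing h (z r)| <= 6 * C * (3 / 4) ^+ w + dlt r.
Proof.
move=> hI ww _ nw; have [[_ _ _ _ hx] [_ _ _ _ hy]] := xf r; have [_ /andP[h2 h3] _ _] := LH r.
have c0 := C0.
rewrite /z pairingBr; last exact: W_c00 (type_I_W (k := true) hI).
apply: le_trans (ler_normB _ _) _; apply: le_trans (lerD (hx h w hI ww nw) (hy h w hI ww nw)) _.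
have LL : C * (2 ^+ n r * 2 ^- Ly r) <= C * (2 ^+ n r * 2 ^- Lx r).
  rewrite ler_wpM2l ?(ltW c0) // ler_wpM2l ?exprn_ge0 // lef_pV2 ?posrE ?exprn_gt0 //.
  by rewrite ler_eXn2l ?ltr1n //; lia.
have p34 : 0 <= C * (3 / 4) ^+ w by rewrite mulr_ge0 ?(ltW c0) // exprn_ge0 // divr_ge0.
rewrite /dlt; move: LL p34; set A1 := C * (_ * _); set A2 := C * (_ * _); set A3 := C * _.
have -> : 2 * C * (2 ^+ n r / 2 ^+ Lx r) = 2 * A2 by rewrite /A2; ring.
have -> : 6 * C * (3 / 4) ^+ w = 6 * A3 by rewrite /A3; ring.
lra.
Qed.

Variable kap : nat -> nat.
Hypothesis kapP : forall i j, (i < j)%N -> (kap i < kap j)%N.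
Hypothesis kaps : forall (e : nat -> R) (B : seq nat) t, `[0, 1]%classic t -> uniq B ->
     (forall i, `|e i| <= 1) -> `|\sum_(i <- B) e i * s (kap i) t| <= 5.

(** The interval occupied by the [q]-th pair. *)
Definition block q i := (Lx q < i <= Hy q)%N.

Lemma block_mono p q i i' : (p < q)%N -> block p i -> block q i' -> (i < i')%N.
Proof.
have h p' q' : (p' < q')%N -> (Hy p' <= Lx q')%N.
  elim: q' => // q' IH; rewrite ltnS leq_eqVlt => /orP[/eqP->|/IH h].
    by have [_ _ _] := LH q'.
  by have [_ /andP[? ?] ? ?] := LH q'; lia.
by move=> /h; rewrite /block; lia.
Qed.

(** Each functional norms its own vector and vanishes on the other one. *)
Lemma fg_z q : pairing (f q) (z q) = 1 /\ pairing (g q) (z q) = -1.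
Proof.
have [[[_ hx] _ [_ fx fs _ _] _ _] [[_ hy] _ [_ gy gs _ _] _ _]] := xf q.
have [_ /andP[h2 h3] h4 _] := LH q.
have [sp1 _ _ _ _] := sp q; have [/W_c00 cf /W_c00 cg _ _] := sp1 q (ltnSn q).
rewrite /z !pairingBr // fx gy; split.
  rewrite (_ : pairing (f q) (y q) = 0) ?subr0 //; apply: pairing_eq0 => i.
  have [->|fi] := eqVneq (f q i) 0; [by left|right]; apply: contrapT => /eqP yi.
  by have := fs i fi; have := hy i yi; lia.
rewrite (_ : pairing (g q) (x q) = 0) ?sub0r //; apply: pairing_eq0 => i.
have [->|gi] := eqVneq (g q i) 0; [by left|right]; apply: contrapT => /eqP xi.
by have := gs i gi; have := hx i xi; lia.
Qed.

Lemma fg_block q i : f q i != 0 \/ g q i != 0 -> block q i.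
Proof.
have [[_ _ [_ _ fs _ _] _ _] [_ _ [_ _ gs _ _] _ _]] := xf q.
by have [_ /andP[h2 h3] h4 _] := LH q; rewrite /block => -[/fs|/gs]; lia.
Qed.

(** By injectivity of the coding. *)
Lemma weight_match d f' g' w (t : 'I_d) q : special L1 sigma W d f' g' w -> w t = n q ->
  t = q :> nat /\ forall i, (i < q)%N -> f' i = f i /\ g' i = g i.
Proof.
move=> sp' e; have [e1 h] := special_weight_eq hL hsigma sp' (sp q) (ltn_ord t) (ltnSn q) e.
by split=> // i iq; apply: h; rewrite e1.
Qed.

(** A special functional that shares a weight with the sequence agrees with it
    up to the last common weight.  The terms before it see the difference
    [x - y] through functionals equal to [1] on [x] and on [y]: the sums cancel,
    while the differences are controlled by the coefficients. *)
Lemma exceptional d f' g' w (F : {set 'I_d}) lam e E A a Bn :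
  special_data L1 sigma W f' g' w F -> II_ok s F lam e -> nat_interval E -> uniq A ->
  uniq Bn -> {subset A <= [seq kap i | i <- Bn]} -> (forall q, `|a q| <= 1) ->
  `|\sum_(t in F) \sum_(q <- A | w t == n q) a q *
     (ratr (lam t) * (pairing (f' t \_ E) (z q) + e * pairing (g' t \_ E) (z q)))|
   <= 36 * C + 10.
Proof.
move=> [sp' _] ok nE uA uB AB a1; have c0 := C0.
pose V (t : 'I_d) : R := a t * (ratr (lam t) *
   (pairing (f' t \_ E) (z t) + e * pairing (g' t \_ E) (z t))).
pose P (t : 'I_d) := (t \in F) && (((t : nat) \in A) && (w t == n t)).
rewrite (_ : \sum_(t in F) _ = \sum_(t | P t) V t); last first.
  rewrite /P big_mkcondr; apply: eq_bigr => t tF; rewrite big_mkcond.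
  have zero (q : nat) : q != t -> (if w t == n q then a q * (ratr (lam t) *
      (pairing (f' t \_ E) (z q) + e * pairing (g' t \_ E) (z q))) else 0) = 0.
    move=> qt; case: (w t =P n q) => // wtq; have [tq _] := weight_match sp' wtq.
    by rewrite tq eqxx in qt.
  case tA: ((t : nat) \in A) => /=.
    by rewrite (bigD1_seq (t : nat)) //= big1 ?addr0 // => q qt; exact: zero.
  rewrite big_seq big1 // => q qA; apply: zero; by apply: contraFneq tA => <-.
have [sp1 _ _ _ _] := sp'.
have VC (t : 'I_d) : P t -> `|V t| <= 12 * C.
  move=> /andP[tF _]; rewrite /V normrM.
  have [Wf Wg _ _] := sp1 t (ltn_ord t).
  have h := II_term_le hs ok tF (z_bnd t (W_restr nE Wf)) (z_bnd t (W_restr nE Wg)).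
  have := ler_pM (normr_ge0 _) (normr_ge0 _) (a1 t) h; rewrite mul1r; lra.
have C12 : 0 <= 12 * C by rewrite mulr_ge0 // ltW.
(* The last common weight and the at most two terms cut by an end of [E] are
   bounded one by one; the other terms are kept or killed entirely by [E]. *)
pose final (t : 'I_d) := [forall t', P t' ==> (t' <= t)%N].
pose lb (t : 'I_d) := `[< exists i i', [/\ (i < i')%N, block t i, block t i', ~ E i & E i'] >].
pose rb (t : 'I_d) := `[< exists i i', [/\ (i < i')%N, block t i, block t i', E i & ~ E i'] >].
rewrite (bigID final) /= (bigID lb (fun t => P t && ~~ final t)) /=.
rewrite (bigID rb (fun t => P t && ~~ final t && ~~ lb t)) /=.
have s1 : `|\sum_(t | P t && final t) V t| <= 12 * C.
  apply: sum_one_nonzero => // [t /andP[/VC]//|t t' /andP[Pt /forallP h] /andP[Pt' /forallP h'] _ _].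
  have := h t'; have := h' t; rewrite Pt Pt' /= => i1 i2; apply: ord_inj; lia.
have s2 : `|\sum_(t | P t && ~~ final t && lb t) V t| <= 12 * C.
  have uni (t t' : 'I_d) : (t < t')%N -> lb t -> lb t' -> False.
    move=> tt' /asboolP[i [i' [_ _ b1 _ e1]]] /asboolP[k [k' [kk b2 b3 e2 e3]]].
    by apply: e2; apply: (nE i' k k') => //; rewrite (ltnW kk) (ltnW (block_mono tt' b1 b2)).
  apply: sum_one_nonzero => // [t /andP[/andP[/VC]]//|t t' /andP[_ h] /andP[_ h'] _ _].
  by apply: ord_inj; case: (ltngtP t t') => // tt; [case: (uni t t' tt h h')|case: (uni t' t tt h' h)].
have s3 : `|\sum_(t | P t && ~~ final t && ~~ lb t && rb t) V t| <= 12 * C.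
  have uni (t t' : 'I_d) : (t < t')%N -> rb t -> rb t' -> False.
    move=> tt' /asboolP[i [i' [ii b1 b2 e1 e2]]] /asboolP[k [k' [_ b3 _ e3 _]]].
    by apply: e2; apply: (nE i i' k) => //; rewrite (ltnW ii) (ltnW (block_mono tt' b2 b3)).
  apply: sum_one_nonzero => // [t /andP[/andP[/andP[/VC]]]//|t t' /andP[_ h] /andP[_ h'] _ _].
  by apply: ord_inj; case: (ltngtP t t') => // tt; [case: (uni t t' tt h h')|case: (uni t' t tt h' h)].
have Vrest (t : 'I_d) : P t -> ~~ final t -> ~~ lb t -> ~~ rb t -> `|V t| <= (1 - e) * `|ratr (lam t)|.
  move=> Pt nf nlb nrb.
  have [t' Pt' tt'] : exists2 t' : 'I_d, P t' & (t < t')%N.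
    apply: contrapT => no; move/negP: nf; apply; apply/forallP => t'; apply/implyP => Pt'.
    by rewrite leqNgt; apply/negP => h; apply: no; exists t'.
  have /andP[_ /andP[_ /eqP wt']] := Pt'.
  have [_ eqs] := weight_match sp' wt'.
  have [ft gt] := eqs t tt'; rewrite /V ft gt.
  have e1 : 0 <= 1 - e by case: ok => [[_ ->]|[_ ->]]; lra.
  have [[i bi Ei]|none] := pselect (exists2 i, block t i & E i); last first.
    have z0 (h : nat -> R) : (forall i, h i != 0 -> block t i) -> pairing (h \_ E) (z t) = 0.
      move=> hb; apply: pairing_eq0 => i; left; rewrite restrE; case: asboolP => // Ei.
      by apply/eqP; apply: contrapT => /negP /hb bi; apply: none; exists i.
    rewrite !z0 => [||i hi]; first by rewrite mulr0 addr0 !mulr0 normr0 mulr_ge0.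
      by move=> i hi; apply: fg_block; right.
    by apply: fg_block; left.
  have all i' : block t i' -> E i'.
    move=> bi'; apply: contrapT => nE'; case: (ltngtP i i') => ii.
    - by move/negP: nrb; apply; apply/asboolP; exists i, i'.
    - by move/negP: nlb; apply; apply/asboolP; exists i', i.
    - by apply: nE'; rewrite -ii.
  have id (h : nat -> R) : (forall i, h i != 0 -> block t i) -> h \_ E = h.
    move=> hb; apply/funext => i'; rewrite restrE; case: asboolP => // nEi.
    by apply/esym/eqP; apply: contrapT => /negP /hb /all.
  rewrite !id => [||i' hi]; last first.
  - by apply: fg_block; left.
  - by move=> i' hi; apply: fg_block; right.
  have [-> ->] := fg_z t; rewrite mulrN1 !normrM [`|1 - e|]ger0_norm //.
  by rewrite [leRHS]mulrC ler_piMl ?mulr_ge0.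
have s4 : `|\sum_(t | P t && ~~ final t && ~~ lb t && ~~ rb t) V t| <= 10.
  apply: le_trans (ler_norm_sum _ _ _) _.
  apply: (@le_trans _ _ (\sum_(t in F | has (fun i => kap i == t :> nat) Bn) (1 - e) * `|ratr (lam t)|)).
    have e1 : 0 <= 1 - e by case: ok => [[_ ->]|[_ ->]]; lra.
    rewrite [leRHS](bigID (fun t => P t && ~~ final t && ~~ lb t && ~~ rb t)) /=; apply: ler_wpDr.
      by apply: sumr_ge0 => t _; rewrite mulr_ge0.
    rewrite [leRHS](eq_bigl (fun t => P t && ~~ final t && ~~ lb t && ~~ rb t)).
      by apply: ler_sum => t /andP[/andP[/andP[h1 h2] h3] h4]; exact: Vrest.
    move=> t; apply/andb_idl => /andP[/andP[/andP[/andP[tF /andP[tA _]] _] _] _].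
    by rewrite tF /=; have /mapP[i iB ->] := AB _ tA; apply/hasP; exists i.
  rewrite -mulr_sumr; case: ok => [[_ ->]|[co ->]]; first by rewrite subrr mul0r.
  have := dual_sum_le hs kapP (ltr0n R 5) kaps uB co.
  by rewrite opprK; lra.
apply: le_trans (ler_normD _ _) _.
apply: le_trans (lerD s1 (le_trans (ler_normD _ _) (lerD s2 (le_trans (ler_normD _ _) (lerD s3 s4))))) _.
lra.
Qed.

Definition C3 : R := 34 * (6 * C) + 2 * (36 * C + 10) + 5.

(** The only weight not covered by flatness is the weight of the pair itself, and
    [exceptional] takes care of it. *)
Theorem z_comb N Bn h a : uniq Bn -> (size Bn <= N)%N -> (4 <= N)%N ->
  (forall i, i \in Bn -> (N <= win (kap i))%N) -> W h -> (forall q, `|a q| <= 1) ->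
  `|pairing h (\sum_(i <- Bn) a (kap i) *: z (kap i))| <= C3.
Proof.
move=> uB BN N4 BJ Wh a1; have c0 := C0.
have kinj : injective kap.
  by move=> i i' e; case: (ltngtP i i') => // /kapP; rewrite e ltnn.
have -> : \sum_(i <- Bn) a (kap i) *: z (kap i) = comb z [seq kap i | i <- Bn] a.
  by rewrite /comb big_map.
have N0 : (0 < N)%N by lia.
apply: (@comb_bound R s hs l L1 L2 L3 hL sigma hsigma z win n dlt (6 * C) (36 * C + 10)
  win_lt z_win z_bnd z_ris dlt_ge0 dlt_win z_flat [seq kap i | i <- Bn] N N) => //.
- by rewrite size_map.
- by move=> q /mapP[i iB ->]; split; exact: BJ.
- move=> q /mapP[i iB ->]; right; have := BJ i iB; have [h1 _ _] := win_facts (kap i); lia.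
- move=> q k m u /mapP[i iB ->] mN ok uA iu.
  have jN := BJ i iB; have [h1 h2 h3] := win_facts (kap i).
  have mm : (4 * m + 12 <= n (kap i))%N by have := ltn_expl m (ltnSn 1); lia.
  apply: le_trans (z_sum mm ok uA) _.
  have NV : 0 <= N%:R^-1 :> R by rewrite invr_ge0 ler0n.
  have e1 : 2 ^+ m * isum u <= N%:R^-1.
    apply: (@le_trans _ _ (N%:R * 2 ^- N)).
      by apply: ler_pM; rewrite ?exprn_ge0 ?isum_ge0 // -natrX ler_nat.
    rewrite ler_pdivrMr ?exprn_gt0 // ler_pdivlMl ?ltr0n // -natrX -natrM ler_nat.
    exact: sqr_le_exp.
  have e2 : (Lx (kap i))%:R^-1 <= N%:R^-1 :> R.
    by rewrite lef_pV2 ?posrE ?ltr0n ?ler_nat //; lia.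
  have := ler_wpM2l (ltW c0) e1; have := ler_wpM2l (ltW c0) e2.
  have := mulr_ge0 (ltW c0) NV; lra.
- by have := c0; lra.
- by move=> d f' g' w F lam e E A b sd ok nE uA AB b1; exact: exceptional sd ok nE uA uB AB b1.
- by rewrite map_inj_uniq.
Qed.

End Differences.

(** * The operator of square zero *)

Section OrdSums.
Variable V : nmodType.

Lemma sum_ord_seq d (S : seq nat) (G : nat -> V) : uniq S -> (forall q, q \in S -> (q < d)%N) ->
  \sum_(q < d | (q : nat) \in S) G q = \sum_(q <- S) G q.
Proof.
move=> uS Sd; rewrite -(big_mkord (fun q => q \in S) G) -big_filter; apply: perm_big.
apply: uniq_perm => //; first by rewrite filter_uniq // iota_uniq.
move=> w; rewrite mem_filter mem_index_iota; case wS: (w \in S) => //=; exact: Sd.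
Qed.

End OrdSums.

Section Operator.
Variables (R : realType) (s : nat -> R -> R) (hs : dense_in_sphere s).
Variables (l : nat -> nat) (L1 L2 L3 : set nat) (hL : coding_weights R l L1 L2 L3).
Variables (sigma : seq (nat -> R) -> nat) (hsigma : coding_function L2 sigma).
Local Notation W := (norming_set s L1 sigma).
Local Notation kavg := (kavg s L1 sigma).
Local Notation items_ok := (items_ok s L1 sigma).
Local Notation bnd := (bnd s L1 sigma).
Local Notation wt := (wt l).
Local Notation item := (item R).
Variables (Sp : (nat -> R) -> Prop) (C : R) (M0 : nat).
Local Notation exact_pair := (exact_pair s l L1 sigma Sp C).
Hypothesis C1le : 1 <= C.
Hypothesis CM0 : 2 * C <= 2 ^+ M0.
Variables (n Lx Hx Ly Hy : nat -> nat) (x y f g : nat -> nat -> R).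
Hypothesis xf : forall q, exact_pair (n q) (Lx q) (Hx q) (x q) (f q) /\
                          exact_pair (n q) (Ly q) (Hy q) (y q) (g q).
Hypothesis LH : forall q, [/\ (gap M0 q (n q) <= Lx q)%N, (Lx q < Hx q <= Ly q)%N,
                    (Ly q < Hy q)%N & (Hy q <= Lx q.+1)%N].
Hypothesis wn : forall q, [/\ wt (n q), (14 <= n q)%N & (4 * Hy q < n q.+1)%N].
Hypothesis sp : forall d, special L1 sigma W d.+1 f g n.

Local Notation z := (z x y).
Local Notation win := (win n).
Variable kap : nat -> nat.
Hypothesis kapP : forall i j, (i < j)%N -> (kap i < kap j)%N.
Hypothesis kaps : forall (e : nat -> R) (B : seq nat) t, `[0, 1]%classic t -> uniq B ->
     (forall i, `|e i| <= 1) -> `|\sum_(i <- B) e i * s (kap i) t| <= 5.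

Let C0 : 0 < C. Proof. exact: lt_le_trans C1le. Qed.

Lemma kap_ge i : (i <= kap i)%N.
Proof. by elim: i => // i IH; apply: leq_ltn_trans IH (kapP (ltnSn i)). Qed.

Lemma kap_inj : injective kap.
Proof. by move=> i i' e; case: (ltngtP i i') => // /kapP; rewrite e ltnn. Qed.

Definition phi q (v : nat -> R) : R := pairing (f q + g q) v.

Lemma fg_W q : W (f q) /\ W (g q).
Proof. by have [sp1 _ _ _ _] := sp q; have [] := sp1 q (ltnSn q). Qed.

Lemma fg_c00 q : c00 (f q + g q).
Proof. by have [/W_c00 h1 /W_c00 h2] := fg_W q; exact: c00D. Qed.

Lemma phi_le q v t : c00 v -> bnd v t -> `|phi q v| <= 2 * t.
Proof.
move=> cv vt; have [h1 h2] := fg_W q; rewrite /phi pairingDl //.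
by apply: le_trans (ler_normD _ _) _; rewrite mulr_natl mulr2n; apply: lerD; exact: vt.
Qed.

Lemma fg_supp q i : (f q + g q) i != 0 -> block Lx Hy q i.
Proof.
move=> h; apply: (fg_block C1le CM0 xf LH); have [fi|] := eqVneq (f q i) 0; last by left.
by right; move: h; rewrite vecD fi add0r.
Qed.

Lemma Lx_pow q : (2 ^ q <= Lx q)%N.
Proof. by have [h _ _ _] := LH q; rewrite /gap in h; lia. Qed.

Lemma phi_small q v : (forall i, v i != 0 -> (i <= q)%N) -> phi q v = 0.
Proof.
move=> vq; apply: pairing_eq0 => i; have [->|h] := eqVneq ((f q + g q) i) 0; first by left.
right; apply/eqP; apply: contrapT => /negP /vq; have := fg_supp h; rewrite /block.
by have := Lx_pow q; have := ltn_expl q (ltnSn 1); lia.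
Qed.

(** The functionals of type II_+ bound the sum of the coefficients over any set
    of indices which is small with respect to its first element. *)
Lemma phi_sum v t (D : seq nat) m : c00 v -> bnd v t -> uniq D ->
  (forall i, i \in D -> (m <= i)%N) -> (2 * size D <= 2 ^ m)%N ->
  `|\sum_(i <- D) phi (kap i) v| <= 2 * t.
Proof.
move=> cv vt uD Dm Dsz; have t0 := bnd_ge0 vt.
case: (D =P [::]) => [->|/eqP D0]; first by rewrite big_nil normr0 mulr_ge0.
pose S := [seq kap i | i <- D].
have uS : uniq S by rewrite map_inj_uniq //; exact: kap_inj.
pose d := (\max_(q <- S) q)%N.
have Sd q : q \in S -> (q < d.+1)%N by move=> qS; rewrite ltnS; apply: leq_bigmax_seq.
pose F := [set q : 'I_d.+1 | (q : nat) \in S]%SET.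
have FS (G : nat -> R) : \sum_(q in F) G q = \sum_(i <- D) G (kap i).
  rewrite -(big_map kap xpredT G) -/S -(sum_ord_seq G uS Sd).
  by apply: eq_bigl => q; rewrite inE.
have cF : #|F| = size D.
  rewrite -sum1_card (eq_bigl (fun q : 'I_d.+1 => (q : nat) \in S)); last by move=> q; rewrite inE.
  by rewrite (sum_ord_seq (fun=> 1%N) uS Sd) sum1_size size_map.
have [q1 q1F] : exists q1, q1 \in F.
  case: D D0 @S uS @d Sd @F {Dm Dsz uD FS cF} => // i D _ S uS d Sd F.
  have kS : kap i \in S by rewrite mem_head.
  by exists (Ordinal (Sd _ kS)); rewrite inE.
pose q0 := [arg min_(q < q1 in F) (q : nat)].
have [q0F q0m] : q0 \in F /\ forall q, q \in F -> (q0 <= q)%N.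
  by rewrite /q0; case: arg_minnP => // q qF hq; split.
have sd : special_data L1 sigma W f g n F.
  split; first exact: sp.
  exists q0 => //; split=> //; rewrite cF; apply: leq_trans Dsz _.
  have [i iD e] : exists2 i, i \in D & (q0 : nat) = kap i by move: q0F; rewrite inE => /mapP[i iD e]; exists i.
  apply: (@leq_trans (2 ^ q0)).
    by rewrite leq_exp2l // e; apply: leq_trans (Dm i iD) (kap_ge i).
  apply: leq_trans (Lx_pow q0) _.
  have [[_ _ [_ _ fs f0 _] _ _] _] := xf q0.
  by have /fs/andP[h _] := minsuppP f0; exact: ltnW.
have WF : W (IIplus_sum F f g).
  by rewrite IIplus_sumE; apply: W_II sd _; left.
have := vt _ WF; rewrite /IIplus_sum pairingZl // pairing_suml //.
rewrite (FS (fun q => pairing (f q + g q) v)) normrM gtr0_norm // => h.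
by rewrite -ler_pdivrMl.
Qed.

(** The signs of the coefficients split the index set into two parts. *)
Lemma phi_abs_sum v t (D : seq nat) m : c00 v -> bnd v t -> uniq D ->
  (forall i, i \in D -> (m <= i)%N) -> (2 * size D <= 2 ^ m)%N ->
  \sum_(i <- D) `|phi (kap i) v| <= 4 * t.
Proof.
move=> cv vt uD Dm Dsz; pose p i := 0 <= phi (kap i) v.
have part (r : pred nat) : `|\sum_(i <- [seq i <- D | r i]) phi (kap i) v| <= 2 * t.
  apply: (phi_sum (m := m)) => //; first by rewrite filter_uniq.
    by move=> i; rewrite mem_filter => /andP[_]; exact: Dm.
  by apply: leq_trans Dsz; rewrite leq_mul2l size_filter count_size orbT.
rewrite (bigID p) /= -big_filter -[X in _ + X]big_filter.
have h1 := part p; have h2 := part (fun i => ~~ p i).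
have e1 : \sum_(i <- [seq i <- D | p i]) `|phi (kap i) v| = \sum_(i <- [seq i <- D | p i]) phi (kap i) v.
  by rewrite !big_filter; apply: eq_bigr => i pi; rewrite ger0_norm.
have e2 : \sum_(i <- [seq i <- D | ~~ p i]) `|phi (kap i) v| = - \sum_(i <- [seq i <- D | ~~ p i]) phi (kap i) v.
  by rewrite -sumrN !big_filter; apply: eq_bigr => i; rewrite -ltNge => pi; rewrite ltr0_norm.
rewrite e1 e2; move: h1 h2; rewrite !ler_norml => /andP[_ h1] /andP[h2 _]; lra.
Qed.

(** The operator [v |-> sum_i (f_q + g_q)(v) (x_q - y_q)] for [q = kap i]; only finitely
    many terms are nonzero. *)
Definition S0 (v : nat -> R) : nat -> R := \sum_(i < (maxsupp v).+1) phi (kap i) v *: z (kap i).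

Lemma S0E v N : c00 v -> (forall i, v i != 0 -> (i < N)%N) ->
  S0 v = \sum_(i < N) phi (kap i) v *: z (kap i).
Proof.
move=> cv vN.
have stb M M' : (M <= M')%N -> (forall i, v i != 0 -> (i < M)%N) ->
    \sum_(i < M) phi (kap i) v *: z (kap i) = \sum_(i < M') phi (kap i) v *: z (kap i).
  move=> MM vM; rewrite -(subnKC MM) big_split_ord /= [X in _ + X]big1 ?addr0 // => i _.
  rewrite phi_small ?scale0r // => i' /vM h; apply: leq_trans (kap_ge _).
  by apply: leq_trans (ltnW h) _; rewrite leq_addr.
have vm i : v i != 0 -> (i < (maxsupp v).+1)%N by move=> /(maxsupp_ge cv).
transitivity (\sum_(i < N + (maxsupp v).+1) phi (kap i) v *: z (kap i)).
  exact: stb (leq_addl _ _) vm.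
exact/esym/(stb _ _ (leq_addr _ _) vN).
Qed.

Lemma S0_c00 v : c00 v -> c00 (S0 v).
Proof. by move=> cv; apply: c00_sum => i _; apply: c00Z; exact: (z_c00 xf). Qed.

Lemma S0_linear a v w : c00 v -> c00 w -> S0 (a *: v + w) = a *: S0 v + S0 w.
Proof.
move=> cv cw; pose N := (maxsupp v + maxsupp w).+1.
have hv i : v i != 0 -> (i < N)%N by move=> /(maxsupp_ge cv) ?; rewrite /N; lia.
have hw i : w i != 0 -> (i < N)%N by move=> /(maxsupp_ge cw) ?; rewrite /N; lia.
have hvw i : (a *: v + w) i != 0 -> (i < N)%N.
  rewrite vecD vecZ; have [vi|/hv//] := eqVneq (v i) 0.
  by rewrite vi mulr0 add0r => /hw.
rewrite (S0E cv hv) (S0E cw hw) (S0E _ hvw); last by apply: c00D => //; exact: c00Z.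
rewrite scaler_sumr -big_split /=; apply: eq_bigr => i _.
rewrite /phi pairingDr ?pairingZr; try exact: fg_c00.
by rewrite scalerDl scalerA.
Qed.

(** The value [1] on [x q] cancels with the value [1] on [y q]. *)
Lemma phi_z q r : phi q (z r) = 0.
Proof.
have [cf cg] : c00 (f q) /\ c00 (g q) by have [/W_c00 ? /W_c00 ?] := fg_W q.
have [<-|qr] := eqVneq q r.
  have [h1 h2] := fg_z C1le CM0 xf LH sp q; rewrite /phi pairingDl; last exact: (z_c00 xf).
  by rewrite h1 h2 addrN.
apply: pairing_eq0 => i; have [->|fi] := eqVneq ((f q + g q) i) 0; first by left.
have [->|zi] := eqVneq (z r i) 0; [by right|].
have b1 := fg_supp fi; have b2 : block Lx Hy r i by have := z_inside C1le CM0 xf LH zi; rewrite /block; lia.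
by case: (ltngtP q r) qr => // [/(block_mono C1le CM0 LH)/(_ b1 b2)|/(block_mono C1le CM0 LH)/(_ b2 b1)]; rewrite ltnn.
Qed.

Lemma S0_S0 v : c00 v -> S0 (S0 v) = 0.
Proof.
move=> cv; rewrite {1}/S0 big1 // => i _; rewrite /phi {1}/S0 pairing_sumr; last exact: fg_c00.
rewrite big1 ?scale0r // => j _; rewrite pairingZr; last exact: fg_c00.
by have := phi_z (kap i) (kap j); rewrite /phi => ->; rewrite mulr0.
Qed.

Lemma S0_x i : S0 (x (kap i)) = z (kap i).
Proof.
have cx := x_c00 xf (kap i); set q := kap i in cx *.
have xb j : x q j != 0 -> block Lx Hy q j.
  have [[[_ hx] _ _ _ _] _] := xf q; move=> /hx; rewrite /block.
  by have [_ /andP[? ?] ? _] := LH q; lia.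
pose N := (maxsupp (x q) + i).+1.
have hN j : x q j != 0 -> (j < N)%N by move=> /(maxsupp_ge cx) ?; rewrite /N; lia.
have iN : (i < N)%N by rewrite /N; lia.
rewrite (S0E cx hN) (bigD1 (Ordinal iN)) //= big1 ?addr0.
  suff -> : phi q (x q) = 1 by rewrite scale1r.
  rewrite /phi pairingDl //; have [[[_ hx] _ [_ -> _ _ _] _ _] [_ _ [_ _ gs _ _] _ _]] := xf q.
  rewrite pairing_eq0 ?addr0 // => j; have [->|gj] := eqVneq (g q j) 0; first by left.
  right; apply: contrapT => /eqP /hx h; have := gs j gj.
  by have [_ /andP[? ?] ? _] := LH q; lia.
move=> j ji; rewrite /phi pairing_eq0 ?scale0r // => t.
have [->|fi] := eqVneq ((f (kap j) + g (kap j)) t) 0; first by left.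
have [->|xt] := eqVneq (x q t) 0; [by right|].
have b1 := fg_supp fi; have b2 := xb t xt.
have neq : (j : nat) != i by apply: contra ji => /eqP e; apply/eqP/ord_inj.
case: (ltngtP j i) neq => // /kapP; rewrite -/q.
  by move=> /(block_mono C1le CM0 LH)/(_ b1 b2); rewrite ltnn.
by move=> /(block_mono C1le CM0 LH)/(_ b2 b1); rewrite ltnn.
Qed.

Definition C4 : R := 192 * C + 4 * (C3 C).

(** The coefficients are split according to their size relative to the norm of
    [v].  At each level there are few large coefficients far out, and their
    contribution is that of a combination of few differences; the remaining
    coefficients decrease geometrically. *)
Theorem S0_bound v t h : c00 v -> bnd v t -> W h -> `|pairing h (S0 v)| <= C4 * t.
Proof.
move=> cv vt Wh; have t0 := bnd_ge0 vt; have c0 := C0; have ch := W_c00 Wh.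
pose a i := phi (kap i) v; have a2 i : `|a i| <= 2 * t by exact: phi_le.
have C3p : 0 <= C3 C by rewrite /C3; lra.
have hl i : exists k, (a i = 0 /\ k = i) \/ (a i != 0 /\ 2 ^- k * t < `|a i| <= 2 * 2 ^- k * t).
  have [a0|a0] := eqVneq (a i) 0; first by exists i; left.
  have an : 0 < `|a i| by rewrite normr_gt0.
  have tp : 0 < t by have := a2 i; lra.
  have [K hK] := exp2V_small (divr_gt0 an (mulr_gt0 (ltr0n R 2) tp)).
  have ex : exists k, 2 ^- k * t < `|a i|.
    exists K; apply: le_lt_trans (ler_wpM2r t0 (hK K (leqnn K))) _.
    by rewrite invfM mulrA mulfVK ?lt0r_neq0 // ltr_pdivrMr // ltr_pMr // ltr1n.
  have [k hk kmin] := ex_minnP ex; exists k; right; split=> //; rewrite hk /=.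
  case: k hk kmin => [|k] hk kmin; first by rewrite expr0 invr1 mulr1.
  rewrite exprS invfM mulrA mulfV ?mul1r ?pnatr_eq0 // leNgt; apply/negP => /kmin; by rewrite ltnn.
(* [lv i] is the level of [a i]; a vanishing coefficient is counted as small *)
have [lv hlv] := choice hl.
pose N := (maxsupp v).+1; pose sm i := (i < lv i + 4)%N.
rewrite /S0 -/N pairing_sumr //.
rewrite (eq_bigr (fun i : 'I_N => a i * pairing h (z (kap i)))); last by move=> i _; rewrite pairingZr.
rewrite (bigID (fun i : 'I_N => sm i)) /=; apply: le_trans (ler_normD _ _) _.
have hz i : `|pairing h (z i)| <= 6 * C by exact: (z_bnd C1le xf).
(* coefficients which are small compared with their index *)
have p1 : `|\sum_(i < N | sm i) a i * pairing h (z (kap i))| <= 192 * C * t.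
  apply: le_trans (ler_norm_sum _ _ _) _.
  apply: (@le_trans _ _ (\sum_(i < N | sm i) (96 * C * t) * 2 ^- i)).
    apply: ler_sum => i smi; rewrite normrM.
    have ai : `|a i| <= 16 * t * 2 ^- i.
      case: (hlv i) => [[-> _]|[_ /andP[_ h2]]].
        by rewrite normr0 !mulr_ge0 ?invr_ge0 ?exprn_ge0.
      apply: le_trans h2 _; have : 2 ^- lv i <= 8 * 2 ^- i :> R.
        rewrite ler_pdivlMr ?exprn_gt0 // ler_pdivrMl ?exprn_gt0 //.
        have -> : 8 = 2 ^+ 3 :> R by rewrite -natrX.
        by rewrite mulrC -exprD ler_eXn2l ?ltr1n //; rewrite /sm in smi; lia.
      by move=> /(ler_wpM2l t0); lra.
    apply: le_trans (ler_pM _ _ ai (hz (kap i))) _ => //.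
    by rewrite le_eqVlt; apply/orP; left; apply/eqP; ring.
  rewrite -mulr_sumr (_ : 192 * C * t = 96 * C * t * 2); last by ring.
  rewrite ler_wpM2l ?mulr_ge0 ?(ltW c0) //.
  apply: le_trans (_ : \sum_(i <- iota 0 N) 2 ^- i <= _); last exact/geo2_sum/iota_uniq.
  have -> : iota 0 N = index_iota 0 N by rewrite /index_iota subn0.
  rewrite big_mkord [leRHS](bigID (fun i : 'I_N => sm i)) /= lerDl.
  by apply: sumr_ge0 => i _; rewrite invr_ge0 exprn_ge0.
(* coefficients of level [k], of index at least [k + 4] *)
have p2 : `|\sum_(i < N | ~~ sm i) a i * pairing h (z (kap i))| <= 4 * (C3 C) * t.
  pose D k := [seq i <- iota 0 N | ~~ sm i && (lv i == k)].
  have lvN (i : 'I_N) : ~~ sm i -> (lv i < N)%N.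
    by rewrite /sm -leqNgt => hh; apply: leq_ltn_trans (ltn_ord i); lia.
  have -> : \sum_(i < N | ~~ sm i) a i * pairing h (z (kap i)) =
      \sum_(k < N) \sum_(i <- D k) a i * pairing h (z (kap i)).
    transitivity (\sum_(i < N | ~~ sm i) \sum_(k < N | lv i == k) a i * pairing h (z (kap i))).
      by apply: eq_bigr => i smi; rewrite (big_pred1 (Ordinal (lvN i smi))) //.
    rewrite (exchange_big_dep xpredT) //=; apply: eq_bigr => k _; rewrite /D big_filter.
    have -> : iota 0 N = index_iota 0 N by rewrite /index_iota subn0.
    by rewrite big_mkord.
  apply: le_trans (ler_norm_sum _ _ _) _.
  apply: (@le_trans _ _ (\sum_(k < N) (2 * (C3 C) * t) * 2 ^- k)); last first.
    rewrite -mulr_sumr (_ : 4 * (C3 C) * t = 2 * (C3 C) * t * 2); last by ring.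
    rewrite ler_wpM2l ?mulr_ge0 //.
    apply: le_trans (_ : \sum_(i <- iota 0 N) 2 ^- i <= _); last exact/geo2_sum/iota_uniq.
    have -> : iota 0 N = index_iota 0 N by rewrite /index_iota subn0.
    by rewrite big_mkord.
  apply: ler_sum => -[k /= _] _.
  have Dk i : i \in D k -> [/\ (k + 4 <= i)%N, 2 ^- k * t < `|a i| & `|a i| <= 2 * 2 ^- k * t].
    rewrite mem_filter /sm -leqNgt => /andP[/andP[h1 /eqP h2] _]; rewrite -h2; split=> //.
      by case: (hlv i) => [[_ e]|[_ /andP[]//]]; rewrite e in h1; lia.
    by case: (hlv i) => [[_ e]|[_ /andP[]//]]; rewrite e in h1; lia.
  have uD : uniq (D k) by rewrite filter_uniq // iota_uniq.
  (* otherwise [2^(k+2) + 1] of them would violate the bound by type II_+ *)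
  have szD : (size (D k) <= 2 ^ (k + 2))%N.
    rewrite leqNgt; apply/negP => big.
    pose D' := take (2 ^ (k + 2)).+1 (D k).
    have sz' : size D' = (2 ^ (k + 2)).+1 by rewrite /D' size_takel.
    have sub i : i \in D' -> i \in D k by exact: mem_take.
    have := phi_abs_sum (m := k + 4) cv vt (take_uniq _ uD : uniq D') (fun i iD => let: And3 h1 _ _ := Dk i (sub i iD) in h1).
    have pw : (2 ^ (k + 4) = 4 * 2 ^ (k + 2))%N by rewrite addnS addnS !expnS; lia.
    rewrite sz' => /(_ _); have -> : (2 * (2 ^ (k + 2)).+1 <= 2 ^ (k + 4))%N.
      by rewrite pw; have := expn_gt0 2 (k + 2); lia.
    move=> /(_ isT) h4.
    have low : \sum_(i <- D') 2 ^- k * t <= \sum_(i <- D') `|phi (kap i) v|.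
      by rewrite big_seq [leRHS]big_seq; apply: ler_sum => i /sub /Dk[_ /ltW].
    have i0 : nth 0%N D' 0 \in D k by apply: sub; rewrite mem_nth // sz'.
    have tp : 0 < t.
      have [_ h1 _] := Dk _ i0; have := a2 (nth 0%N D' 0).
      have : 0 <= 2 ^- k * t by rewrite mulr_ge0 ?invr_ge0 ?exprn_ge0.
      by lra.
    move: low; rewrite big_const_seq count_predT iter_addr_0 sz' -[leLHS]mulr_natl => low.
    have := le_trans low h4; rewrite mulrA ler_pM2r // ler_pdivrMr ?exprn_gt0 //.
    have -> : 4 * 2 ^+ k = (2 ^ (k + 2))%:R :> R by rewrite natrX exprD expr2; ring.
    by rewrite ler_nat ltnn.
  have [Dk0|/negP Dk0] := pselect (D k == [::]).
    by rewrite (eqP Dk0) big_nil normr0 !mulr_ge0 ?invr_ge0 ?exprn_ge0.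
  have tk : 0 < 2 * 2 ^- k * t.
    case: (D k) Dk0 Dk => // i D' _ /(_ i (mem_head _ _))[_ h1 h2].
    by apply: lt_le_trans h2; apply: le_lt_trans h1; rewrite mulr_ge0 ?invr_ge0 ?exprn_ge0.
  pose b q : R := if q \in [seq kap i | i <- D k] then phi q v / (2 * 2 ^- k * t) else 0.
  have b1 q : `|b q| <= 1.
    rewrite /b; case: ifP => [/mapP[i iD ->]|_]; last by rewrite normr0.
    rewrite normrM normfV [`|_ * t|]gtr0_norm // ler_pdivrMr // mul1r.
    by have [] := Dk i iD.
  have bz := z_comb hs hL hsigma C1le CM0 xf LH wn sp kapP kaps (N := 2 ^ (k + 2)) uD szD _ _ Wh b1.
  have -> : \sum_(i <- D k) a i * pairing h (z (kap i)) =
     2 * 2 ^- k * t * pairing h (\sum_(i <- D k) b (kap i) *: z (kap i)).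
    rewrite pairing_sumr // mulr_sumr big_seq [RHS]big_seq; apply: eq_bigr => i iD.
    rewrite pairingZr // /b map_f // mulrA; congr (_ * _).
    by rewrite mulrC divfK // lt0r_neq0.
  rewrite normrM (gtr0_norm tk).
  have -> : 2 * (C3 C) * t * 2 ^- k = 2 * 2 ^- k * t * (C3 C) by ring.
  rewrite ler_wpM2l ?(ltW tk) //; apply: bz.
    by rewrite -[4%N]/(2 ^ 2)%N leq_exp2l // leq_addl.
  move=> i iD; have [ik _ _] := Dk i iD; have ki := kap_ge i.
  case: (kap i) ki => [|q] ki; first by clear -ik ki; lia.
  apply: leq_trans (win_pow C1le CM0 LH wn q); rewrite leq_exp2l //; clear -ik ki; lia.
rewrite /C4 mulrDl; exact: lerD.
Qed.

End Operator.

(** * Extension to the completion and conclusion *)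

Section Extension.
Variables (R : realType) (X : completeNormedModType R) (iota : (nat -> R) -> X).
Hypothesis iota_lin : forall (a : R) x y, c00 x -> c00 y ->
    iota (a *: x + y) = a *: iota x + iota y.
Hypothesis iota_dense : closure (iota @` @c00 R) = [set: X].
Variables (S0 : (nat -> R) -> nat -> R) (K : R).
Hypothesis K0 : 0 <= K.
Hypothesis S0c : forall v, c00 v -> c00 (S0 v).
Hypothesis S0lin : forall a v w, c00 v -> c00 w -> S0 (a *: v + w) = a *: S0 v + S0 w.
Hypothesis S0b : forall v, c00 v -> `|iota (S0 v)| <= K * `|iota v|.
Hypothesis S0S0 : forall v, c00 v -> S0 (S0 v) = 0.

Lemma iota0 : iota 0 = 0.
Proof.
have := iota_lin 1 (@c00_0 R) (@c00_0 R); rewrite !scale1r addr0 => h.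
by apply: (addrI (iota 0)); rewrite -h addr0.
Qed.

Lemma iotaB x y : c00 x -> c00 y -> iota (x - y) = iota x - iota y.
Proof.
by move=> cx cy; rewrite addrC -scaleN1r iota_lin // scaleN1r addrC.
Qed.

Lemma iota_sum (x : nat -> nat -> R) (a : nat -> R) N : (forall i, c00 (x i)) ->
  iota (\sum_(i < N) a i *: x i) = \sum_(i < N) a i *: iota (x i).
Proof.
move=> cx; elim: N => [|N IH]; first by rewrite !big_ord0 iota0.
rewrite !big_ord_recr /= addrC iota_lin ?IH 1?addrC //.
by apply: c00_sum => i _; exact: c00Z.
Qed.

Lemma dense_approx (v : X) e : 0 < e -> exists2 x, c00 x & `|v - iota x| < e.
Proof.
move=> e0; have : closure (iota @` @c00 R) v by rewrite iota_dense.
move=> /(_ (ball v e) (nbhsx_ballx v e e0))[_ [[x cx <-]]].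
by rewrite -ball_normE /= => h; exists x.
Qed.

(** The closure of the graph of [S0], which is the graph of its extension. *)
Definition rel (v w : X) : Prop := forall e, 0 < e ->
  exists x, [/\ c00 x, `|v - iota x| < e & `|w - iota (S0 x)| < e].

Lemma rel_iota x : c00 x -> rel (iota x) (iota (S0 x)).
Proof. by move=> cx e e0; exists x; rewrite !subrr !normr0. Qed.

Lemma rel_lin a v w v' w' : rel v w -> rel v' w' -> rel (a *: v + v') (a *: w + w').
Proof.
move=> h h' e e0; pose e' := e / (`|a| + 1) / 2.
have a1 : 0 < `|a| + 1 by rewrite ltr_wpDl.
have e'0 : 0 < e' by rewrite !divr_gt0.
have [x [cx x1 x2]] := h e' e'0; have [y [cy y1 y2]] := h' e' e'0.
have est (p q p' q' : X) : `|p - q| < e' -> `|p' - q'| < e' -> `|a *: p + p' - (a *: q + q')| < e.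
  move=> hp hq; rewrite opprD addrACA -scalerBr; apply: le_lt_trans (ler_normD _ _) _.
  rewrite normrZ; apply: (@lt_le_trans _ _ (`|a| * e' + e')).
    by apply: ler_ltD => //; rewrite ler_wpM2l // ltW.
  have -> : `|a| * e' + e' = e / 2 by rewrite /e'; field; rewrite lt0r_neq0.
  by rewrite ler_pdivrMr // ler_peMr ?(ltW e0) // ler1n.
exists (a *: x + y); split; first by apply: c00D => //; exact: c00Z.
  by rewrite iota_lin //; exact: est.
by rewrite S0lin // iota_lin; [exact: est|exact: S0c|exact: S0c].
Qed.

Lemma rel_bound v w : rel v w -> `|w| <= K * `|v|.
Proof.
move=> h; apply/ler_addgt0Pr => e e0; pose e' := e / (K + 1).
have K1 : 0 < K + 1 by rewrite ltr_wpDl.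
have e'0 : 0 < e' by rewrite divr_gt0.
have [x [cx x1 x2]] := h e' e'0.
have h1 : `|w| <= e' + `|iota (S0 x)|.
  rewrite -{1}[w](subrK (iota (S0 x))); apply: le_trans (ler_normD _ _) _.
  by rewrite lerD2r ltW.
have h2 : `|iota x| <= `|v| + e'.
  rewrite -{1}[iota x](subKr v); apply: le_trans (ler_normB _ _) _.
  by rewrite lerD2l ltW.
have h3 := ler_wpM2l K0 h2; have h4 := S0b cx.
have -> : e = e' * (K + 1) by rewrite /e' divfK // lt0r_neq0.
lra.
Qed.

(** The images of approximations of [v] form a Cauchy sequence. *)
Lemma rel_total v : exists w, rel v w.
Proof.
have hx n : exists x, c00 x /\ `|v - iota x| < 2 ^- n.
  by have [|x cx hx] := @dense_approx v (2 ^- n); [rewrite invr_gt0 exprn_gt0|exists x].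
have [x hx'] := choice hx; pose u n := iota (S0 (x n)).
have cx n : c00 (x n) by have [] := hx' n.
have near0 n m : (n <= m)%N -> `|u n - u m| <= K * (2 * 2 ^- n).
  move=> nm; rewrite /u -iotaB; try exact: S0c.
  have -> : S0 (x n) - S0 (x m) = S0 (x n - x m).
    by rewrite [x n - x m]addrC -[- x m]scaleN1r S0lin // scaleN1r addrC.
  apply: le_trans (S0b _) _; first exact: c00B.
  rewrite ler_wpM2l // iotaB //.
  have -> : iota (x n) - iota (x m) = (v - iota (x m)) - (v - iota (x n)).
    by rewrite opprB [RHS]addrC addrA subrK.
  apply: le_trans (ler_normB _ _) _; rewrite mulr_natl mulr2n; apply: lerD.
    have [_ h] := hx' m; apply: le_trans (ltW h) _.
    by rewrite lef_pV2 ?posrE ?exprn_gt0 // ler_eXn2l ?ltr1n.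
  by have [_ h] := hx' n; exact: ltW.
have small e : 0 < e -> exists n, K * (2 * 2 ^- n) < e /\ 2 ^- n < e.
  move=> e0; have e1 : 0 < e / (2 * K + 2) by rewrite divr_gt0 // ltr_wpDl // mulr_ge0.
  have [n hn] := exp2V_small e1; exists n; have := hn n (leqnn n).
  rewrite ler_pdivlMr; last by rewrite ltr_wpDl // mulr_ge0.
  have p0 : 0 < 2 ^- n :> R by rewrite invr_gt0 exprn_gt0.
  have := mulr_ge0 K0 (ltW p0); rewrite mulrDr => ? ?; split; lra.
have cu : cvg (u @ \oo).
  apply: cauchy_cvg; apply: cauchy_exP => e e0; have [n [hn _]] := small e e0.
  exists (u n); exists n => // m /= nm; rewrite -ball_normE /=.
  exact: le_lt_trans (near0 n m nm) hn.
exists (lim (u @ \oo)) => e e0; have e2 : 0 < e / 2 by rewrite divr_gt0.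
have [n [hn hn2]] := small _ e2; exists (x n); split=> //.
  by have [_ h] := hx' n; apply: lt_trans h _; apply: lt_trans hn2 _; rewrite ltr_pdivrMr // ltr_pMr // ltr1n.
have : \forall m \near \oo, `|lim (u @ \oo) - u m| < e / 2.
  by have /cvgrPdist_lt := cu; apply.
move=> [M _ hM]; have hmax := hM (maxn M n) (leq_maxl _ _).
rewrite -(subrK (u (maxn M n)) (lim (u @ \oo))) -addrA.
apply: le_lt_trans (ler_normD _ _) _; rewrite [ltRHS]splitr; apply: ltrD => //.
rewrite -normrN opprB; apply: le_lt_trans hn; apply: near0; exact: leq_maxr.
Qed.

(** A bounded operator on the finitely supported vectors extends to the
    completion; when its square vanishes, the identity minus the extension is an
    isomorphism. *)
Theorem extension : exists T : {linear X -> X}, isomorphism T /\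
  forall x, c00 x -> T (iota x) = iota (x - S0 x).
Proof.
have [S hS] := choice rel_total.
have uniq_rel v w w' : rel v w -> rel v w' -> w = w'.
  move=> h h'; have := rel_bound (rel_lin (-1) h h'); rewrite !scaleN1r addNr normr0 mulr0.
  by rewrite normr_le0 addrC subr_eq0 => /eqP.
have SE x : c00 x -> S (iota x) = iota (S0 x).
  by move=> cx; apply: uniq_rel (hS _) (rel_iota cx).
have Slin a u v : S (a *: u + v) = a *: S u + S v.
  exact: uniq_rel (hS _) (rel_lin a (hS u) (hS v)).
have Sb v : `|S v| <= K * `|v| by exact: rel_bound.
have S0' : S 0 = 0.
  by apply/eqP; rewrite -normr_le0; have := Sb 0; rewrite normr0 mulr0.
have SZ a u : S (a *: u) = a *: S u by have := Slin a u 0; rewrite !addr0 S0' addr0.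
have SD u v : S (u + v) = S u + S v by have := Slin 1 u v; rewrite !scale1r.
have SN u : S (- u) = - S u by rewrite -scaleN1r SZ scaleN1r.
have SS v : S (S v) = 0.
  apply/eqP; rewrite -normr_le0; apply/ler_addgt0Pr => e e0; rewrite add0r.
  have d0 : 0 < e / (K * K + 1) by rewrite divr_gt0 // ltr_wpDl // mulr_ge0.
  have [x cx hx] := dense_approx v d0.
  have -> : S (S v) = S (S (v - iota x)).
    by rewrite SD SN !SD !SN (SE x cx) (SE _ (S0c cx)) S0S0 // iota0 subr0.
  apply: le_trans (Sb _) _; apply: le_trans (ler_wpM2l K0 (Sb _)) _.
  move: (ltW hx); rewrite ler_pdivlMr; last by rewrite ltr_wpDl // mulr_ge0.
  by rewrite mulrA mulrDr mulr1 [`|_| * _]mulrC; apply: le_trans; rewrite lerDl.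
have lip (F : X -> X) M : 0 <= M -> (forall u v, `|F u - F v| <= M * `|u - v|) -> continuous F.
  move=> M0 hF u; apply/cvgrPdist_lt => e e0; have M1 : 0 < M + 1 by rewrite ltr_wpDl.
  apply/nbhs_ballP; exists (e / (M + 1)) => /=; first by rewrite divr_gt0.
  move=> v; rewrite -ball_normE /= => h; apply: le_lt_trans (hF u v) _.
  move: h; rewrite ltr_pdivlMr // mulrC; apply: le_lt_trans.
  by rewrite ler_wpM2r // lerDl.
pose t (u : X) := u - S u.
have tlin : linear t.
  by move=> a u v; rewrite /t Slin opprD addrACA -scalerBr.
pose T : {linear X -> X} := HB.pack t (GRing.isLinear.Build _ _ _ _ t tlin).
have K1 : 0 <= 1 + K by rewrite addr_ge0.
exists T; split; last by move=> x cx; rewrite /= /t SE // iotaB //; exact: S0c.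
split.
  apply: (lip _ (1 + K)) => // u v /=.
  have -> : t u - t v = (u - v) - S (u - v).
    by rewrite /t SD SN !opprD !opprK addrACA.
  apply: le_trans (ler_normB _ _) _; rewrite mulrDl mul1r lerD2l; exact: Sb.
exists (fun u => u + S u); split.
- by move=> u /=; rewrite /t SD SN SS subr0 subrK.
- by move=> u /=; rewrite /t SD SS addr0 addrK.
- apply: (lip _ (1 + K)) => // u v; rewrite opprD addrACA -SN -SD.
  apply: le_trans (ler_normD _ _) _; rewrite mulrDl mul1r lerD2l; exact: Sb.
Qed.

End Extension.

Section Assembly.
Variables (R : realType) (s : nat -> R -> R) (hs : dense_in_sphere s).
Variables (l : nat -> nat) (L1 L2 L3 : set nat) (hL : coding_weights R l L1 L2 L3).
Variables (sigma : seq (nat -> R) -> nat) (hsigma : coding_function L2 sigma).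
Local Notation W := (norming_set s L1 sigma).
Local Notation bnd := (bnd s L1 sigma).
Variable Sp : (nat -> R) -> Prop.
Hypothesis SpP : forall (c : R) y y', Sp y -> Sp y' -> Sp (c *: y + y').

(** The sequence [xs] lists the vectors [x_q] and [y_q] alternately, for [q = kap i]. *)
Theorem operator_exists v : nice s L1 sigma Sp v ->
  exists (xs : nat -> nat -> R) (S0 : (nat -> R) -> nat -> R) (C K : R),
  [/\ block_seq xs /\ forall n, Sp (xs n),
      0 <= K /\ forall n, bnd (xs n) C /\ exists2 f, W f & pairing f (xs n) = 1,
      [/\ forall v, c00 v -> c00 (S0 v),
         forall a v w, c00 v -> c00 w -> S0 (a *: v + w) = a *: S0 v + S0 w
       & forall v, c00 v -> S0 (S0 v) = 0],
      forall v t f, c00 v -> bnd v t -> W f -> `|pairing f (S0 v)| <= K * t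
    & forall n, S0 (xs n.*2) = xs n.*2 - xs n.*2.+1].
Proof.
move=> /(exact_exists hs hL hsigma SpP)[C C1 sup].
have [M0 CM] : exists M0, 2 * C <= 2 ^+ M0.
  exists (Num.bound (2 * C)); apply: le_trans (ltW (archi_boundP _)) _.
    by rewrite mulr_ge0 //; lra.
  by rewrite -natrX ler_nat ltnW // ltn_expl.
have [n [Lx [Hx [Ly [Hy [x [y [f [g [xf LH wn sp]]]]]]]]]] :=
  special_exists hs hL hsigma M0 sup (leqnn 14).
have [kap [kapP kaps]] := c0_subsequence hs.
pose xs i := if odd i then y (kap i./2) else x (kap i./2).
exists xs, (S0 x y f g kap), C, (C4 C).
have xc := x_c00 xf; have yc := y_c00 xf.
have xone q : W (f q) /\ pairing (f q) (x q) = 1.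
  by have [[_ _ [/(type_I_W (k := true))h e _ _ _] _ _] _] := xf q.
have yone q : W (g q) /\ pairing (g q) (y q) = 1.
  by have [_ [_ _ [/(type_I_W (k := true))h e _ _ _] _ _]] := xf q.
have nz (h w : nat -> R) : pairing h w = 1 -> w != 0.
  by move=> e; apply/eqP => w0; move: e; rewrite w0 pairing0r => /eqP; rewrite eq_sym oner_eq0.
have xin q i : x q i != 0 -> block Lx Hy q i /\ (i < Hx q)%N.
  have [[[_ hx] _ _ _ _] _] := xf q; move=> /hx; rewrite /block.
  by have [_ /andP[? ?] ? _] := LH q; split; lia.
have yin q i : y q i != 0 -> block Lx Hy q i /\ (Ly q < i)%N.
  have [_ [[_ hy] _ _ _ _]] := xf q; move=> /hy; rewrite /block.
  by have [_ /andP[? ?] ? _] := LH q; split; lia.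
split.
- split.
    apply: block_seq_intro.
    + by move=> q; rewrite /xs; case: ifP => _.
    + by move=> q; rewrite /xs; case: ifP => _; [apply: nz (yone _).2|apply: nz (xone _).2].
    + move=> q i i'; rewrite /xs /= uphalf_half; case: (odd q) => /=.
        by rewrite add1n => /yin[b1 _] /xin[b2 _]; apply: (block_mono C1 CM LH (kapP _ _ _) b1 b2).
      rewrite add0n => /xin[_ h1] /yin[_ h2].
      by have [_ /andP[_ h3] _ _] := LH (kap q./2); lia.
  move=> q; rewrite /xs; have [[[h _] _ _ _ _] [[h' _] _ _ _ _]] := xf (kap q./2).
  by case: ifP.
- split; first by rewrite /C4 /C3; lra.
  move=> q; rewrite /xs; case: ifP => _.
    split; first exact: y_bnd xf _.
    by have [h e] := yone (kap q./2); exists (g (kap q./2)).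
  split; first exact: x_bnd xf _.
  by have [h e] := xone (kap q./2); exists (f (kap q./2)).
- split.
  + by move=> w; exact: (S0_c00 xf).
  + by move=> a w w'; exact: (S0_linear C1 CM xf LH sp kapP).
  + by move=> w; exact: (S0_S0 C1 CM xf LH sp).
- by move=> w t h cw wt Wh; exact: (S0_bound hs hL hsigma C1 CM xf LH wn sp kapP kaps cw wt Wh).
- move=> q; rewrite /xs /= odd_double doubleK uphalf_double.
  exact: (S0_x C1 CM xf LH kapP).
Qed.

End Assembly.

Theorem mainTheorem2 (R : realType)
    (s : nat -> R -> R) (hs : dense_in_sphere s)
    (l : nat -> nat) (L1 L2 L3 : set nat) (hL : coding_weights R l L1 L2 L3)
    (sigma : seq (nat -> R) -> nat) (hsigma : coding_function L2 sigma)
    (X : completeNormedModType R) (iota : (nat -> R) -> X)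
    (hX : is_completion s L1 sigma iota)
    (Y : set X) (hY : block_subspace iota Y) :
  exists x : nat -> nat -> R,
    [/\ block_seq x,
        forall n, Y (iota (x n)),
        seminormalized (fun n => iota (x n))
      & exists T : {linear X -> X},
          isomorphism T /\
          forall n, T (iota (x n.*2)) = iota (x n.*2.+1)].
Proof.
have [il inorm idense] := hX; have [y by_ YE] := hY.
have cy q : c00 (y q) by have [] := by_ q.
have y0 q : y q != 0 by have [_ /succvP[]] := by_ q.
pose Sp v := exists N (a : nat -> R), (forall i, (N <= i)%N -> a i = 0) /\
  v = \sum_(i < N) a i *: y i.
have pad N M (a : nat -> R) : (N <= M)%N -> (forall i, (N <= i)%N -> a i = 0) ->
    \sum_(i < N) a i *: y i = \sum_(i < M) a i *: y i.
  move=> NM a0; rewrite -(subnKC NM) big_split_ord /= [X in _ + X]big1 ?addr0 // => i _.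
  by rewrite a0 ?scale0r // leq_addr.
have SpP (c : R) v w : Sp v -> Sp w -> Sp (c *: v + w).
  move=> [N [a [a0 ->]]] [M [b [b0 ->]]]; exists (maxn N M), (fun i => c * a i + b i); split.
    by move=> i; rewrite geq_max => /andP[/a0 -> /b0 ->]; rewrite mulr0 addr0.
  rewrite (pad N (maxn N M) a (leq_maxl _ _) a0) (pad M (maxn N M) b (leq_maxr _ _) b0).
  rewrite scaler_sumr -big_split /=; apply: eq_bigr => i _.
  by rewrite scalerDl scalerA.
have Spy q : Sp (y q).
  exists q.+1, (fun i => (i == q)%:R); split=> [i qi|]; first by rewrite gtn_eqF.
  rewrite big_ord_recr /= eqxx scale1r big1 ?add0r // => i _.
  by rewrite ltn_eqF // scale0r.
pose x0 q := (W_norm s L1 sigma (y q))^-1 *: y q.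
have sn : normalized_blocks s L1 sigma Sp x0.
  have hn q := normalize hs L1 sigma (cy q) (y0 q).
  split.
  - apply: block_seq_intro => [q|q|q i i'].
    + exact: c00Z.
    + have [_ [f _ h]] := hn q; apply: contraTneq h; rewrite -/(x0 q) => ->.
      by rewrite pairing0r -ltNge invr_gt0.
    + rewrite /x0 !vecZ !mulf_eq0 !negb_or => /andP[_ h] /andP[_ h'].
      exact: (block_seq_lt by_ (ltnSn q) h h').
  - by move=> q; apply: (Sp_Z SpP).
  - by move=> q; have [] := hn q.
  - by exists 2^-1 => [|q]; [rewrite invr_gt0|have [] := hn q].
have [v nv] := nice_exists hs hL hsigma SpP sn.
have [xs [S0 [C [K [[bx xS] [K0 xb] [S0c S0l S0S] S0b S0x]]]]] :=
  operator_exists hs hL hsigma SpP nv.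
have cx q : c00 (xs q) by have [] := bx q.
exists xs; split=> //.
- move=> q; have [N [a [_ e]]] := xS q; rewrite YE; apply: subset_closure.
  by exists N, a; rewrite e (iota_sum il).
- exists 1, C; split=> // q; rewrite inorm //; have [h [f Wf e]] := xb q.
  rewrite (Wnorm_le h) andbT; apply: le_trans (Wnorm_bnd hs (cx q) Wf).
  by rewrite e normr1.
have S0n w : c00 w -> `|iota (S0 w)| <= K * `|iota w|.
  move=> cw; rewrite !inorm //; last exact: S0c.
  by apply: Wnorm_le => f Wf; apply: S0b => //; exact: (Wnorm_bnd hs cw).
have [T [iT TE]] := extension il idense K0 S0c S0l S0n S0S.
exists T; split=> // q; rewrite TE // S0x; congr (iota _).
by rewrite opprB addrC subrK.
Qed.
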